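(* Let $d\ge 1$ and let $(R,B,L)$ be a Hadamard triple on $\mathbb{R}^d$. Then the self-affine measure $\mu(R,B)$ is a spectral measure.
   Context: Hadamard triple: $R\in M_d(\mathbb{Z})$ is an expansive matrix (all eigenvalues have modulus $>1$), $B,L\subset\mathbb{Z}^d$ are finite sets with $\#B=\#L=:N$, and the matrix $\frac{1}{\sqrt N}\left[e^{2\pi i\langle R^{-1}b,\ell\rangle}\right]_{\ell\in L,b\in B}$ is unitary. Self-affine measure: for $b\in B$ let $\tau_b(x)=R^{-1}(x+b)$, $x\in\mathbb{R}^d$. Then $\mu(R,B)$ is the unique Borel probability measure $\mu$ on $\mathbb{R}^d$ with $\mu(E)=\frac1N\sum_{b\in B}\mu(\tau_b^{-1}(E))$ for all Borel sets $E$. A Borel probability measure $\mu$ on $\mathbb{R}^d$ is a spectral measure if there is a countable set $\Lambda\subset\mathbb{R}^d$ (a spectrum of $\mu$) such that $\{e^{2\pi i\langle\lambda,x\rangle}:\lambda\in\Lambda\}$ is an orthonormal basis of $L^2(\mu)$. *)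

(* Defs.v *)
From mathcomp Require Import all_boot all_order all_algebra.
From mathcomp Require Import finmap.
From mathcomp Require Import spectral.
From mathcomp Require Import complex.
From mathcomp Require Import all_classical all_reals all_analysis.

Set Implicit Arguments.
Unset Strict Implicit.
Unset Printing Implicit Defensive.

Import Order.TTheory GRing.Theory Num.Theory.
Import numFieldTopology.Exports numFieldNormedType.Exports.
Import ComplexField.Normc.

Local Open Scope classical_set_scope.
Local Open Scope ring_scope.
Local Open Scope complex_scope.

Definition Rd (R : realType) (d : nat) :
    measurableType (sigma_display (@open 'cV[R]_d)) :=
  g_sigma_algebraType (@open 'cV[R]_d).

Definition dotv (R : realType) (d : nat) (x y : 'cV[R]_d) : R :=
  \sum_(i < d) x i ord0 * y i ord0.

(* e^{2 pi i t} *)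
Definition e2pii (R : realType) (t : R) : R[i] :=
  cos (2 * pi * t) +i* sin (2 * pi * t).

Definition zmx (S : pzRingType) (m n : nat) (A : 'M[int]_(m, n)) : 'M[S]_(m, n) :=
  map_mx intr A.

Definition expansive (R : realType) (d : nat) (A : 'M[int]_d) : Prop :=
  forall z : R[i], eigenvalue (zmx R[i] A) z -> 1 < `|z|.

(* The finite sets [B] and [L] are enumerated in order to index the matrix;
   unitarity does not depend on the enumerations. *)
Definition hadamard_mx (R : realType) (d : nat) (A : 'M[int]_d)
    (B L : {fset 'cV[int]_d}) : 'M[R[i]]_(#|` L|, #|` B|) :=
  \matrix_(l, b) ((Num.sqrt (#|` B|%:R : R))^-1%:C *
    e2pii (dotv (invmx (zmx R A) *m zmx R (nth 0 (enum_fset B) b))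
                (zmx R (nth 0 (enum_fset L) l)))).

Definition hadamard_triple (R : realType) (d : nat) (A : 'M[int]_d)
    (B L : {fset 'cV[int]_d}) : Prop :=
  [/\ expansive R A, #|` B| = #|` L| & hadamard_mx R A B L \is unitarymx].

Definition tau (R : realType) (d : nat) (A : 'M[int]_d) (b : 'cV[int]_d)
  (x : 'cV[R]_d) : 'cV[R]_d := invmx (zmx R A) *m (x + zmx R b).

(* The measure mu(A, B) is the unique Borel probability measure with this
   property when [A] is expansive and [B] is nonempty. *)
Definition self_affine_measure (R : realType) (d : nat) (A : 'M[int]_d)
    (B : {fset 'cV[int]_d}) (mu : probability (Rd R d) R) : Prop :=
  forall E : set (Rd R d), measurable E ->
    mu E = ((#|` B|%:R : R)^-1%:E * \sum_(b <- B) mu (tau A b @^-1` E))%E.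

Definition cintegral (dT : measure_display) (T : measurableType dT)
    (R : realType) (mu : {measure set T -> \bar R}) (f : T -> R[i]) : R[i] :=
  (\int[mu]_x complex.Re (f x)) +i* (\int[mu]_x complex.Im (f x)).

Definition l2norm (dT : measure_display) (T : measurableType dT)
    (R : realType) (mu : {measure set T -> \bar R}) (f : T -> R[i]) : \bar R :=
  'N[mu]_(2%:E) [EFin \o (@normc R \o f)].

Definition square_integrable (dT : measure_display) (T : measurableType dT)
    (R : realType) (mu : {measure set T -> \bar R}) (f : T -> R[i]) : Prop :=
  [/\ measurable_fun setT (fun x => complex.Re (f x)),
      measurable_fun setT (fun x => complex.Im (f x)) &
      (l2norm mu f < +oo)%E].

Definition inner_product (dT : measure_display) (T : measurableType dT)
    (R : realType) (mu : {measure set T -> \bar R}) (f g : T -> R[i]) : R[i] :=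
  cintegral mu (fun x => f x * (g x)^*).

(* Functions are not quotiented by a.e. equality: the inner product and the
   norm do not see the difference. The last clause is density of the span. *)
Definition orthonormal_basis (dT : measure_display) (T : measurableType dT)
    (R : realType) (mu : {measure set T -> \bar R})
    (I : choiceType) (D : set I) (e : I -> T -> R[i]) : Prop :=
  [/\ forall i, D i -> square_integrable mu (e i),
      forall i j, D i -> D j -> inner_product mu (e i) (e j) = (i == j)%:R &
      forall f, square_integrable mu f -> forall eps : R, 0 < eps ->
        exists (F : {fset I}) (c : I -> R[i]),
          [set` F] `<=` D /\
          (l2norm mu (fun x => f x - \sum_(i <- F) c i * e i x)%R < eps%:E)%E].

Definition is_spectrum (R : realType) (d : nat) (mu : probability (Rd R d) R)
    (Lam : set 'cV[R]_d) : Prop :=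
  countable Lam /\
  orthonormal_basis mu Lam
    (fun (lam : 'cV[R]_d) (x : Rd R d) => e2pii (dotv lam x)).

Definition spectral_measure (R : realType) (d : nat)
    (mu : probability (Rd R d) R) : Prop :=
  exists Lam : set 'cV[R]_d, is_spectrum mu Lam.

(* Main.v *)
(* Write S = R^T and let q(x) be the product over n >= 1 of |m_B(S^-n x)|^2, where m_B
   is the mean of e^{2 pi i <b, .>} over B; this is the squared modulus of the Fourier
   transform of mu.  It suffices to find a countable Lam such that Parseval's identity,
   with the weight q, holds along Lam for functions of finitely many digits.

   If q is equi-positive (for some eps > 0 every x has an integer translate with
   q >= eps), Lam is grown level by level from L, each new frequency being corrected by
   an integer vector that keeps q bounded below along it.  Equi-positivity is tested with
   a transfer operator acting on Fourier coefficients: either all the mass is absorbed by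
   the zero frequency, and a Fejer-type kernel gives equi-positivity, or some nonzero
   frequency survives for ever.  Such frequencies generate an R-invariant group G != 0
   into which every digit can be carried: for a in G and b in B some b' in B has
   b' - b - a in RG.

   In the second case take G of minimal rank for some power of R.  In an adapted basis R
   is block triangular, the projection of B is part of a Hadamard triple of smaller
   dimension, and the fibres are complete residue systems of the other block.  The
   integer frequencies tile for the fibre system: otherwise a nonconstant harmonic
   trigonometric polynomial exists, and the irreducible components of a minimal invariant
   Zariski closed subset of its extremal set produce a carrying group of smaller rank.
   Induction on the dimension then gives Lam as a product.

   Finally, averages over words are quadratures for mu, so Parseval's identity makes every
   bounded Lipschitz function an L^2(mu)-limit of trigonometric sums over Lam, and such
   functions are dense. *)
Require Import Defs.
From mathcomp Require Import all_boot all_order all_algebra.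
From mathcomp Require Import finmap.
From mathcomp Require fingroup perm.
From mathcomp Require Import spectral complex ring lra zify.
From mathcomp Require Import all_classical all_reals all_analysis measurable_realfun.

Set Implicit Arguments.
Unset Strict Implicit.
Unset Printing Implicit Defensive.

Import Order.TTheory GRing.Theory Num.Theory.
Import numFieldTopology.Exports numFieldNormedType.Exports.

Local Open Scope ring_scope.
Local Open Scope complex_scope.

(** The obstacle is completeness. Orthogonality of the exponentials grown from [L] is immediate from
    unitarity, but mass can escape where q is small on a whole coset of Z^d, since integer
    corrections are then powerless. The measure stays out of the combinatorics. Before the
    quadrature there are only finite sums over words, q is an infimum of finite products, and
    Parseval's identity is split into Bessel's inequality for finite sets and near equality for one
    of them, so that no infinite sum occurs. Powers of R cannot be avoided, since R^T merely
    permutes the components of the minimal invariant set; they do no harm, since a set Lam that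
    works for a power and its block digits works for R itself. As the fibre system may produce a
    group for a further power, minimality of the rank is taken over all powers at once. Neither 0 in
    B nor a generating property of B is assumed. Instead, the lattice spanned by differences inside
    the fibres, saturated under division by the block, receives a basis P of its own, and the fibre
    system is read in that basis. This makes the fibre digits generate, which excludes a new group
    of full rank. *)

Ltac mxring := apply/matrixP => ? ?; rewrite !mxE; ring.

(** * Exponentials and integer vectors *)

Section SquaredModulus.
Variable R : realType.
Implicit Types (z w : R[i]) (t s : R).

(** Squared moduli replace moduli throughout, which keeps the estimates polynomial in the real and
    imaginary parts. *)
Definition sqn z : R := complex.Re z ^+ 2 + complex.Im z ^+ 2.

Lemma sqn_ge0 z : 0 <= sqn z.
Proof. by rewrite addr_ge0 ?sqr_ge0. Qed.

Definition cr t : R[i] := t%:C.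

Definition cj z : R[i] := z^*.

Lemma cr_inj : injective cr.
Proof. exact: complexI. Qed.

Lemma crM t s : cr (t * s) = cr t * cr s.
Proof. exact: rmorphM. Qed.

Lemma crD t s : cr (t + s) = cr t + cr s.
Proof. exact: rmorphD. Qed.

Lemma crB t s : cr (t - s) = cr t - cr s.
Proof. exact: rmorphB. Qed.

Lemma cr_nat n : cr n%:R = n%:R.
Proof. exact: rmorph_nat. Qed.

Lemma crX t n : cr (t ^+ n) = cr t ^+ n.
Proof. exact: rmorphXn. Qed.

Lemma cr0 : cr 0 = 0. Proof. by []. Qed.

Lemma cr1 : cr 1 = 1. Proof. by []. Qed.

Lemma cr_sum (I : Type) (r : seq I) (P : pred I) (F : I -> R) :
  cr (\sum_(i <- r | P i) F i) = \sum_(i <- r | P i) cr (F i).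
Proof. exact: rmorph_sum. Qed.

Lemma cj_cr t : cj (cr t) = cr t.
Proof. by apply/eqP; rewrite eq_complex /= oppr0 !eqxx. Qed.

Lemma cj1 : cj 1 = 1. Proof. exact: cj_cr. Qed.

Lemma cjM z w : cj (z * w) = cj z * cj w.
Proof. exact: rmorphM. Qed.

Lemma cjK : involutive cj.
Proof. exact: conjcK. Qed.

Lemma cj_sum (I : Type) (r : seq I) (P : pred I) (F : I -> R[i]) :
  cj (\sum_(i <- r | P i) F i) = \sum_(i <- r | P i) cj (F i).
Proof. exact: rmorph_sum. Qed.

Lemma sqnE z : cr (sqn z) = z * cj z.
Proof.
case: z => a b; apply/eqP; rewrite eq_complex /= /sqn /=.
by apply/andP; split; apply/eqP; ring.
Qed.

Lemma sqnM z w : sqn (z * w) = sqn z * sqn w.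
Proof. case: z => a b; case: w => c d; rewrite /sqn /=; ring. Qed.

Lemma sqn0 : sqn 0 = 0. Proof. by rewrite /sqn /= expr0n addr0. Qed.

Lemma sqn1 : sqn 1 = 1. Proof. by rewrite /sqn /= expr0n addr0 expr1n. Qed.

Lemma sqn_eq0 z : sqn z = 0 -> z = 0.
Proof.
case: z => a b; rewrite /sqn /= => /eqP.
rewrite paddr_eq0 ?sqr_ge0// !sqrf_eq0 => /andP[/eqP -> /eqP ->].
by [].
Qed.

Lemma sqn_cj z : sqn (cj z) = sqn z.
Proof. by case: z => a b; rewrite /sqn /= sqrrN. Qed.

Lemma sqnN z : sqn (- z) = sqn z.
Proof. by case: z => a b; rewrite /sqn /= !sqrrN. Qed.

Lemma sqn_real t : sqn (cr t) = t ^+ 2.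
Proof. by rewrite /sqn /= expr0n addr0. Qed.

Lemma ReD z w : complex.Re (z + w) = complex.Re z + complex.Re w.
Proof. by case: z; case: w. Qed.

Lemma ImD z w : complex.Im (z + w) = complex.Im z + complex.Im w.
Proof. by case: z; case: w. Qed.

Lemma Re_sum (I : Type) (r : seq I) (P : pred I) (F : I -> R[i]) :
  complex.Re (\sum_(i <- r | P i) F i) = \sum_(i <- r | P i) complex.Re (F i).
Proof. by apply: (big_morph _ ReD). Qed.

Lemma Im_sum (I : Type) (r : seq I) (P : pred I) (F : I -> R[i]) :
  complex.Im (\sum_(i <- r | P i) F i) = \sum_(i <- r | P i) complex.Im (F i).
Proof. by apply: (big_morph _ ImD). Qed.

Lemma ReZ t z : complex.Re (cr t * z) = t * complex.Re z.
Proof. by case: z => a b /=; rewrite mul0r subr0. Qed.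

Lemma ImZ t z : complex.Im (cr t * z) = t * complex.Im z.
Proof. by case: z => a b /=; rewrite mul0r addr0. Qed.

Lemma Re_sqr_le z : complex.Re z ^+ 2 <= sqn z.
Proof. by rewrite lerDl sqr_ge0. Qed.

(* A weighted form of the triangle inequality that avoids square roots. *)
Lemma sqn_sub_lb (eta : R) z w : 0 < eta -> eta < 1 ->
  (1 - eta) * sqn w - eta^-1 * sqn (z - w) <= sqn z.
Proof.
case: z => a b; case: w => c d eta0 eta1; rewrite /sqn /=.
have key (x y : R) : (1 - eta) * y ^+ 2 - eta^-1 * (x - y) ^+ 2 <= x ^+ 2.
  rewrite -subr_ge0.
  have -> : x ^+ 2 - ((1 - eta) * y ^+ 2 - eta^-1 * (x - y) ^+ 2) =
     eta^-1 * (x - y + eta * y) ^+ 2 + (x - y) ^+ 2.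
    by field; rewrite gt_eqF.
  by rewrite addr_ge0 ?sqr_ge0// mulr_ge0 ?sqr_ge0// invr_ge0 ltW.
have h1 := key a c; have h2 := key b d; lra.
Qed.

Lemma sqn_le_norms z w : sqn (z + w) <= 2 * (sqn z + sqn w).
Proof.
case: z => a b; case: w => c d; rewrite /sqn /=.
have := sqr_ge0 (a - c); have := sqr_ge0 (b - d); rewrite !expr2; lra.
Qed.

Local Notation e := (@e2pii R).

Lemma e2piiD t s : e (t + s) = e t * e s.
Proof.
rewrite /e2pii mulrDr cosD sinD; apply/eqP; rewrite eq_complex /= eqxx/=.
by apply/eqP; ring.
Qed.

Lemma e2pii0 : e 0 = 1.
Proof. by rewrite /e2pii mulr0 cos0 sin0. Qed.

Lemma e2piiN t : e (- t) = cj (e t).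
Proof. by rewrite /e2pii mulrN cosN sinN. Qed.

Lemma sqn_e t : sqn (e t) = 1.
Proof. by rewrite /sqn /= cos2Dsin2. Qed.

Lemma e2pii_mulJ t s : e t * cj (e s) = e (t - s).
Proof. by rewrite e2piiD e2piiN. Qed.

Lemma e2pii1 : e 1 = 1.
Proof.
by rewrite /e2pii mulr1 mulr_natl cos2pi sin2pi.
Qed.

Lemma e2pii_nat (n : nat) : e n%:R = 1.
Proof.
elim: n => [|n IH]; first by rewrite e2pii0.
by rewrite -natr1 e2piiD IH e2pii1 mulr1.
Qed.

Lemma e2pii_int (n : int) : e n%:~R = 1.
Proof.
case: n => n; first by rewrite -[n%:~R]/(n%:R) e2pii_nat.
by rewrite NegzE mulrNz e2piiN -[(n.+1)%:~R]/(n.+1%:R) e2pii_nat cj1.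
Qed.

Lemma near_int t : exists n : int, `|t - n%:~R| <= 2^-1.
Proof.
exists (Num.floor (t + 2^-1)).
have /andP[h1 h2] := floor_itv (t + 2^-1).
by move: h1 h2; rewrite ler_norml intrD; lra.
Qed.

(* cos decreases on [0, pi], so cos(2 pi t) is close to 1 only near integers *)
Lemma cos_near t (eta : R) : 0 < eta -> eta <= 2^-1 ->
  cos (2 * pi * eta) < cos (2 * pi * t) ->
  exists n : int, `|t - n%:~R| < eta.
Proof.
move=> eta0 eta1; have [n hn] := near_int t.
have -> : cos (2 * pi * t) = cos (2 * pi * `|t - n%:~R|).
  have -> : cos (2 * pi * t) = complex.Re (e t) by [].
  have -> : e t = e (t - n%:~R) by rewrite e2piiD e2piiN e2pii_int cj1 mulr1.
  rewrite /e2pii/=; case: (leP 0 (t - n%:~R)) => h; first by rewrite ger0_norm.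
  by rewrite ltr0_norm // mulrN cosN.
move=> h; exists n; have pi0 := pi_gt0 R.
have hr (x : R) : 0 <= x -> x <= 2^-1 -> (2 * pi * x) \in `[0, pi]%R.
  move=> x0 x1; rewrite in_itv /=; apply/andP; split.
    by rewrite !mulr_ge0 // pi_ge0.
  have : x * pi <= 2^-1 * pi by rewrite ler_pM2r.
  lra.
move: h; rewrite ltr_cos ?hr ?normr_ge0 // ?(ltW eta0) //.
by rewrite ltr_pM2l // mulr_gt0.
Qed.

(** If [t] had positive distance to its nearest integer [n], then [cos_near] with that distance as
    [eta] would give an integer strictly closer to [t]. The two integers differ by less than 1,
    hence coincide, which is absurd. *)
Lemma e2pii_eq1 t : e t = 1 -> exists n : int, t = n%:~R.
Proof.
move=> h; have [n hn] := near_int t; exists n.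
have [/eqP|h0] := eqVneq (t - n%:~R) 0; first by rewrite subr_eq0 => /eqP.
have p0 : 0 < `|t - n%:~R| by rewrite normr_gt0.
have : cos (2 * pi * `|t - n%:~R|) < cos (2 * pi * t).
  have -> : cos (2 * pi * t) = 1 by rewrite -[LHS]/(complex.Re (e t)) h.
  have pi0 := pi_gt0 R.
  rewrite -[X in _ < X](@cos0 R) ltr_cos.
  - by rewrite !mulr_gt0.
  - by rewrite in_itv /= lexx pi_ge0.
  - rewrite in_itv /=; apply/andP; split; first by rewrite !mulr_ge0 ?pi_ge0.
    have : `|t - n%:~R| * pi <= 2^-1 * pi by rewrite ler_pM2r.
    lra.
move=> /(cos_near p0 hn)[m hm].
have : `|n%:~R - m%:~R : R| < 1.
  have := ler_normD (t - m%:~R) (- (t - n%:~R)).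
  rewrite normrN (_ : t - m%:~R + - (t - n%:~R) = n%:~R - m%:~R); last by ring.
  by move: hm hn; set x := `|_|; set y := `|_|; set w := `|_|; lra.
rewrite -intrB -intr_norm ltrz1 => h1.
have : (n - m = 0)%R by move: h1; case: (n - m) => [[|k]|k].
by move/eqP; rewrite subr_eq0 => /eqP nm; move: hm; rewrite -nm ltxx.
Qed.

Lemma cos_2pi_lt1 (eta : R) : 0 < eta -> eta <= 2^-1 -> cos (2 * pi * eta) < 1.
Proof.
move=> eta0 eta1; rewrite lt_neqAle cos_le1 andbT; apply/negP => /eqP h.
have [m hm] : exists m : int, eta = m%:~R.
  apply: e2pii_eq1; apply/eqP; rewrite eq_complex /= h eqxx /=.
  have := cos2Dsin2 (2 * pi * eta); rewrite h expr1n => /eqP; rewrite eq_sym addrC -subr_eq subrr eq_sym.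
  by rewrite sqrf_eq0.
move: eta0 eta1; rewrite hm ltr0z => m0 hm1.
have : (1%:~R : R) <= m%:~R by rewrite ler_int.
rewrite -[1%:~R]/(1 : R) => h1; have := le_trans h1 hm1; lra.
Qed.

End SquaredModulus.

(** * Lipschitz bounds for the exponential *)

Section Lipschitz.
Variable R : realType.
Local Notation e := (@e2pii R).

Lemma sin_le_norm (x : R) : `|sin x| <= `|x|.
Proof.
wlog x0 : x / 0 <= x => [H|].
  case: (leP 0 x) => [/H //|h].
  by have := H (- x); rewrite sinN !normrN; apply; lra.
rewrite (ger0_norm x0).
have [x1|x1] := leP 1 x; first exact: le_trans (sin_max x) x1.
have s0 : 0 <= sin x.
  apply: sin_ge0_pi; have := pi_ge2 R; lra.
rewrite ger0_norm //; move: x0; rewrite le_eqVlt => /predU1P[<-|x0].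
  by rewrite sin0.
have [|c _] := @MVT R sin cos 0 x x0 (fun z _ => is_derive_sin z).
  by apply: continuous_subspaceT => z; exact: continuous_sin.
rewrite sin0 !subr0 => ->.
by rewrite -[leRHS]mul1r ler_wpM2r ?(ltW x0) // cos_le1.
Qed.

Lemma e2pii_dist (t : R) : sqn (1 - e t) = 4 * sin (pi * t) ^+ 2.
Proof.
have -> : e t = (e (t / 2)) ^+ 2.
  by rewrite expr2 -e2piiD; congr (e _); field.
rewrite /e2pii /sqn /= (_ : 2 * pi * (t / 2) = pi * t); last by field.
have := cos2Dsin2 (pi * t); set c := cos _; set s := sin _ => h.
have hc : c ^+ 2 = 1 - s ^+ 2 by rewrite -h addrK.
have -> : (1 - (c * c - s * s)) ^+ 2 + (0 - (c * s + s * c)) ^+ 2 =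
  (1 - c ^+ 2 + s ^+ 2) ^+ 2 + 4 * c ^+ 2 * s ^+ 2 by ring.
rewrite hc; ring.
Qed.

Lemma sqn_1Be_le (t : R) : sqn (1 - e t) <= (2 * pi * t) ^+ 2.
Proof.
rewrite e2pii_dist -[leRHS]ger0_norm ?sqr_ge0//.
have h := sin_le_norm (pi * t).
have : `|sin (pi * t)| ^+ 2 <= `|pi * t| ^+ 2 by rewrite lerXn2r // nnegrE.
rewrite -!normrX !ger0_norm ?sqr_ge0 // => h2.
have -> : (2 * pi * t) ^+ 2 = 4 * (pi * t) ^+ 2 by ring.
lra.
Qed.

(** From sin^2 <= |sin|. A bound linear in the argument adds up to a geometric series along the
    orbit of a contraction. *)
Lemma Re_e_ge (t : R) : 1 - 2 * pi * `|t| <= complex.Re (e t).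
Proof.
have h := cos2Dsin2 (pi * t).
have -> : complex.Re (e t) = 1 - 2 * sin (pi * t) ^+ 2.
  have -> : e t = (e (t / 2)) ^+ 2.
    by rewrite expr2 -e2piiD; congr (e _); field.
  rewrite /e2pii /= (_ : 2 * pi * (t / 2) = pi * t); last by field.
  by move: h; rewrite !expr2; lra.
have h1 : `|sin (pi * t)| <= 1 by exact: sin_max.
have h2 := sin_le_norm (pi * t).
have h3 : sin (pi * t) ^+ 2 <= pi * `|t|.
  rewrite -real_normK ?num_real // expr2.
  rewrite normrM (ger0_norm (pi_ge0 R)) in h2.
  apply: le_trans h2.
  by rewrite -[leRHS]mul1r ler_wpM2r.
lra.
Qed.

End Lipschitz.

(** * Dot products, integer vectors and the l^1 norm *)

Section Dot.
Variable R : realType.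
Implicit Types d : nat.

Lemma dotvDl d (x y z : 'cV[R]_d) : dotv (x + y) z = dotv x z + dotv y z.
Proof. by rewrite /dotv -big_split; apply: eq_bigr => i _; rewrite mxE mulrDl. Qed.

Lemma dotvC d (x y : 'cV[R]_d) : dotv x y = dotv y x.
Proof. by apply: eq_bigr => i _; rewrite mulrC. Qed.

Lemma dotvDr d (x y z : 'cV[R]_d) : dotv z (x + y) = dotv z x + dotv z y.
Proof. by rewrite dotvC dotvDl !(dotvC z). Qed.

Lemma dotvNl d (x y : 'cV[R]_d) : dotv (- x) y = - dotv x y.
Proof. by rewrite /dotv -sumrN; apply: eq_bigr => i _; rewrite mxE mulNr. Qed.

Lemma dotvNr d (x y : 'cV[R]_d) : dotv x (- y) = - dotv x y.
Proof. by rewrite dotvC dotvNl dotvC. Qed.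

Lemma dotvBl d (x y z : 'cV[R]_d) : dotv (x - y) z = dotv x z - dotv y z.
Proof. by rewrite dotvDl dotvNl. Qed.

Lemma dotvBr d (x y z : 'cV[R]_d) : dotv z (x - y) = dotv z x - dotv z y.
Proof. by rewrite dotvDr dotvNr. Qed.

Lemma dotv0l d (x : 'cV[R]_d) : dotv 0 x = 0.
Proof. by rewrite /dotv big1 // => i _; rewrite mxE mul0r. Qed.

Lemma dotv0r d (x : 'cV[R]_d) : dotv x 0 = 0.
Proof. by rewrite dotvC dotv0l. Qed.

Lemma dotvZl d a (x y : 'cV[R]_d) : dotv (a *: x) y = a * dotv x y.
Proof. by rewrite /dotv mulr_sumr; apply: eq_bigr => i _; rewrite mxE mulrA. Qed.

Lemma dotvZr d a (x y : 'cV[R]_d) : dotv x (a *: y) = a * dotv x y.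
Proof. by rewrite dotvC dotvZl dotvC. Qed.

Lemma dotvE d (x y : 'cV[R]_d) : dotv x y = (x^T *m y) ord0 ord0.
Proof. by rewrite mxE; apply: eq_bigr => i _; rewrite mxE. Qed.

Lemma dotv_mulr d1 d2 (M : 'M[R]_(d1, d2)) x y :
  dotv x (M *m y) = dotv (M^T *m x) y.
Proof. by rewrite !dotvE trmx_mul trmxK mulmxA. Qed.

Lemma dotv_mull d1 d2 (M : 'M[R]_(d1, d2)) x y :
  dotv (M *m x) y = dotv x (M^T *m y).
Proof. by rewrite dotvC dotv_mulr dotvC. Qed.

Lemma dotv_col d1 d2 (x1 y1 : 'cV[R]_d1) (x2 y2 : 'cV[R]_d2) :
  dotv (col_mx x1 x2) (col_mx y1 y2) = dotv x1 y1 + dotv x2 y2.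
Proof.
rewrite /dotv big_split_ord /=; congr (_ + _); apply: eq_bigr => i _.
  by rewrite !col_mxEu.
by rewrite !col_mxEd.
Qed.

Lemma zmxD m n (x y : 'M[int]_(m, n)) : zmx R (x + y) = zmx R x + zmx R y.
Proof. exact: map_mxD. Qed.

Lemma zmxN m n (x : 'M[int]_(m, n)) : zmx R (- x) = - zmx R x.
Proof. exact: map_mxN. Qed.

Lemma zmxB m n (x y : 'M[int]_(m, n)) : zmx R (x - y) = zmx R x - zmx R y.
Proof. exact: map_mxB. Qed.

Lemma zmx0 m n : zmx R (0 : 'M[int]_(m, n)) = 0.
Proof. exact: map_mx0. Qed.

Lemma zmxM m n p (x : 'M[int]_(m, n)) (y : 'M[int]_(n, p)) :
  zmx R (x *m y) = zmx R x *m zmx R y.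
Proof. exact: map_mxM. Qed.

Lemma zmxT m n (x : 'M[int]_(m, n)) : zmx R (x^T) = (zmx R x)^T.
Proof. by apply/matrixP => i j; rewrite !mxE. Qed.

Lemma zmx1 n : zmx R (1%:M : 'M[int]_n) = 1%:M.
Proof. exact: map_mx1. Qed.

Lemma zmxZ m n a (x : 'M[int]_(m, n)) : zmx R (a *: x) = a%:~R *: zmx R x.
Proof. by apply/matrixP => i j; rewrite !mxE intrM. Qed.

Lemma zmx_inj m n : injective (@zmx R m n).
Proof.
move=> x y /matrixP h; apply/matrixP => i j.
by have := h i j; rewrite !mxE => /eqP; rewrite eqr_int => /eqP.
Qed.

Lemma zmxX d (A : 'M[int]_d) n : zmx R (A ^+ n) = zmx R A ^+ n.
Proof.
elim: n => [|n IH]; first by rewrite !expr0; exact: zmx1.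
by rewrite !exprS -[_ * _]/(_ *m _) zmxM IH.
Qed.

Lemma zmx_col d1 d2 (x : 'cV[int]_d1) (y : 'cV[int]_d2) :
  zmx R (col_mx x y) = col_mx (zmx R x) (zmx R y).
Proof. exact: map_col_mx. Qed.

Definition isint (t : R) := exists n : int, t = n%:~R.

Lemma isint_int (n : int) : isint n%:~R. Proof. by exists n. Qed.

Lemma isint0 : isint 0. Proof. by exists 0. Qed.

Lemma isintD s t : isint s -> isint t -> isint (s + t).
Proof. by move=> [m ->] [n ->]; exists (m + n); rewrite intrD. Qed.

Lemma isintN t : isint t -> isint (- t).
Proof. by move=> [m ->]; exists (- m); rewrite mulrNz. Qed.

Lemma isintB s t : isint s -> isint t -> isint (s - t).
Proof. by move=> hs ht; apply/isintD/isintN. Qed.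

Lemma isint_e t : isint t -> e2pii t = 1.
Proof. by move=> [n ->]; exact: e2pii_int. Qed.

Lemma isint_sum (I : Type) (r : seq I) (F : I -> R) :
  (forall i, isint (F i)) -> isint (\sum_(i <- r) F i).
Proof. by move=> h; elim/big_rec: _ => [|i x _]; [exact: isint0|apply: isintD]. Qed.

Lemma dotv_int d (x y : 'cV[int]_d) : isint (dotv (zmx R x) (zmx R y)).
Proof. by apply: isint_sum => i; rewrite !mxE; exists (x i ord0 * y i ord0); rewrite intrM. Qed.

Definition isintv d (x : 'cV[R]_d) := exists k : 'cV[int]_d, x = zmx R k.

Lemma isintvP d (x : 'cV[R]_d) : (forall i, isint (x i ord0)) -> isintv x.
Proof.
move=> /choice[f hf]; exists (\col_i f i); apply/matrixP => i j.
by rewrite !mxE (ord1 j) hf.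
Qed.

Lemma isintv_dot d (x : 'cV[R]_d) :
  (forall a : 'cV[int]_d, isint (dotv (zmx R a) x)) -> isintv x.
Proof.
move=> h; apply: isintvP => i; have := h (delta_mx i ord0).
rewrite /dotv (bigD1 i) //= !mxE !eqxx /= mul1r big1 ?addr0 // => j ji.
by rewrite !mxE (negPf ji) mul0r.
Qed.

Definition nrm1 d (x : 'cV[R]_d) : R := \sum_i `|x i ord0|.

Lemma nrm1_ge0 d (x : 'cV[R]_d) : 0 <= nrm1 x.
Proof. exact: sumr_ge0. Qed.

Lemma nrm1N d (x : 'cV[R]_d) : nrm1 (- x) = nrm1 x.
Proof. by apply: eq_bigr => i _; rewrite mxE normrN. Qed.

Lemma nrm1D d (x y : 'cV[R]_d) : nrm1 (x + y) <= nrm1 x + nrm1 y.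
Proof. by rewrite /nrm1 -big_split ler_sum //= => i _; rewrite mxE ler_normD. Qed.

Lemma nrm1_entry d (x : 'cV[R]_d) i : `|x i ord0| <= nrm1 x.
Proof. by rewrite /nrm1 (bigD1 i) //= lerDl sumr_ge0. Qed.

Lemma dotv_le d (x y : 'cV[R]_d) : `|dotv x y| <= nrm1 x * nrm1 y.
Proof.
rewrite /dotv (le_trans (ler_norm_sum _ _ _)) // /nrm1 mulr_suml ler_sum // => i _.
by rewrite normrM ler_wpM2l // nrm1_entry.
Qed.

Lemma nrm1_mul d1 d2 (M : 'M[R]_(d1, d2)) c x :
  (forall i j, `|M i j| <= c) -> nrm1 (M *m x) <= d1%:R * c * nrm1 x.
Proof.
move=> h; rewrite /nrm1.
have -> : d1%:R * c * nrm1 x = \sum_(i < d1) (c * nrm1 x).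
  by rewrite sumr_const card_ord -[RHS]mulr_natl mulrA.
apply: ler_sum => i _; rewrite mxE (le_trans (ler_norm_sum _ _ _)) //.
rewrite /nrm1 mulr_sumr ler_sum // => j _.
by rewrite normrM ler_wpM2r.
Qed.

End Dot.

Lemma sum_const_seq (R : pzRingType) (I : Type) (s : seq I) (a : R) :
  \sum_(i <- s) a = (size s)%:R * a.
Proof. by rewrite big_const_seq count_predT iter_addr_0 mulr_natl. Qed.

Lemma pow_small (R : realType) (rho eps : R) : 0 <= rho -> rho < 1 -> 0 < eps ->
  exists n0, forall n, (n0 <= n)%N -> rho ^+ n <= eps.
Proof.
move=> rho0 rho1 eps0.
have rn : `|rho| < 1 by rewrite ger0_norm.
have /cvgrPdist_le /(_ _ eps0)[n0 _ h] := cvg_expr rn.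
exists n0 => n hn; have /= := h n hn.
by rewrite sub0r normrN ger0_norm // exprn_ge0.
Qed.

Section MatrixPowers.
Variables (S : pzRingType) (d : nat) (T : 'M[S]_d).
Implicit Types x : 'cV[S]_d.

Lemma mulTX n x : T ^+ n.+1 *m x = T ^+ n *m (T *m x).
Proof. by rewrite exprSr -[_ * _]/(_ *m _) mulmxA. Qed.

Lemma mulTXl n x : T ^+ n.+1 *m x = T *m (T ^+ n *m x).
Proof. by rewrite exprS -[_ * _]/(_ *m _) mulmxA. Qed.

Lemma mulTX0 x : T ^+ 0 *m x = x.
Proof. by rewrite expr0 mul1mx. Qed.

Lemma mulTXD m n x : T ^+ (m + n) *m x = T ^+ m *m (T ^+ n *m x).
Proof. by rewrite exprD -[_ * _]/(_ *m _) mulmxA. Qed.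

End MatrixPowers.

Lemma trmxX (S : comPzRingType) (d : nat) (T : 'M[S]_d) n : (T ^+ n)^T = T^T ^+ n.
Proof.
elim: n => [|n IH]; first by rewrite !expr0 -[1]/(1%:M) trmx1.
by rewrite exprS -[_ * _]/(_ *m _) trmx_mul IH exprSr.
Qed.

(** * Infinite products and words *)

Section InfiniteProduct.
Variables (R : realType) (d : nat) (T : 'M[R]_d) (u : 'cV[R]_d -> R).

Fixpoint qn n x : R := if n is m.+1 then u (T *m x) * qn m (T *m x) else 1.

(** Partial products of factors in [0, 1] decrease, so the infimum is the infinite product and no
    convergence argument is required. *)
Definition q x : R := inf (range (qn ^~ x)).

Hypothesis u01 : forall y, 0 <= u y <= 1.

Lemma qn01 n x : 0 <= qn n x <= 1.
Proof.
elim: n x => [|n IH] x /=; first by rewrite ler01 lexx.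
have /andP[h1 h2] := IH (T *m x); have /andP[h3 h4] := u01 (T *m x).
by rewrite mulr_ge0 //= mulr_ile1.
Qed.

Lemma qnD m n x : qn (m + n) x = qn m x * qn n (T ^+ m *m x).
Proof.
elim: m x => [|m IH] x; first by rewrite mul1r mulTX0.
by rewrite addSn /= IH mulrA mulTX.
Qed.

Lemma qn_le m n x : (m <= n)%N -> qn n x <= qn m x.
Proof.
move=> /subnKC <-; rewrite qnD.
have /andP[h1 h2] := qn01 m x.
have /andP[_ h3] := qn01 (n - m) (T ^+ m *m x).
by rewrite -[leRHS]mulr1 ler_wpM2l.
Qed.

Lemma q_le_qn n x : q x <= qn n x.
Proof.
apply: ge_inf; last by exists n.
by exists 0 => _ [m _ <-]; have /andP[] := qn01 m x.
Qed.

Lemma q_lb x a : (forall n, a <= qn n x) -> a <= q x.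
Proof.
move=> h; apply: lb_le_inf; first by exists (qn 0 x); exists 0%N.
by move=> _ [n _ <-].
Qed.

Lemma q_ge0 x : 0 <= q x.
Proof. by apply: q_lb => n; have /andP[] := qn01 n x. Qed.

Lemma q_le1 x : q x <= 1.
Proof. exact: (q_le_qn 0). Qed.

Lemma q_step x : q x = u (T *m x) * q (T *m x).
Proof.
have /andP[u0 u1] := u01 (T *m x).
apply/eqP; rewrite eq_le; apply/andP; split; last first.
  apply: q_lb => n; apply: le_trans (qn_le x (leqnSn n)).
  by rewrite /= ler_wpM2l // q_le_qn.
(* The first factor is divided out below, so the case where it is 0 is settled separately: the
   product already vanishes at stage 1. *)
rewrite le_eqVlt in u0; have [/eqP v0|v0] := orP u0.
  by rewrite -v0 mul0r (le_trans (q_le_qn 1 x)) //= -v0 mul0r.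
rewrite -ler_pdivrMl //; apply: q_lb => n.
by rewrite ler_pdivrMl // (q_le_qn n.+1).
Qed.

Lemma q_iter n x : q x = qn n x * q (T ^+ n *m x).
Proof.
elim: n x => [|n IH] x; first by rewrite mul1r mulTX0.
by rewrite q_step IH mulrA mulTX.
Qed.

Lemma q_mono n x : q x <= q (T ^+ n *m x).
Proof.
rewrite (q_iter n); have /andP[_ h] := qn01 n x.
by rewrite -[leRHS]mul1r ler_wpM2r // q_ge0.
Qed.

Variables (c K rho : R).
Hypotheses (c0 : 0 <= c) (K0 : 0 <= K) (rho0 : 0 <= rho) (rho1 : rho < 1).
Hypothesis u_lb : forall y, 1 - c * nrm1 y <= u y.
Hypothesis T_contr : forall j x, nrm1 (T ^+ j *m x) <= K * rho ^+ j * nrm1 x.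

(** Weierstrass' inequality: a product of numbers 1 - a_j in [0, 1] is at least 1 minus the sum of
    the a_j. The induction step is (1 - u)(1 - qn) >= 0. *)
Lemma qn_lb n x : 1 - \sum_(j < n) c * nrm1 (T ^+ j.+1 *m x) <= qn n x.
Proof.
elim: n x => [|n IH] x; first by rewrite big_ord0 subr0.
have /andP[h0 h1] := qn01 n (T *m x); have /andP[v0 v1] := u01 (T *m x).
rewrite big_ord_recl /=.
have h := IH (T *m x); have hu := u_lb (T *m x).
under eq_bigr => i _ do rewrite /bump /= add1n mulTX.
rewrite mulTX mulTX0.
have : 0 <= (1 - u (T *m x)) * (1 - qn n (T *m x)) by rewrite mulr_ge0 // subr_ge0.
lra.
Qed.

Lemma geo_sum_le n : \sum_(j < n) rho ^+ j.+1 <= (1 - rho)^-1.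
Proof.
have h1 : 0 < 1 - rho by rewrite subr_gt0.
rewrite -[leRHS]mul1r ler_pdivlMr // mulrBr mulr1.
have -> : \sum_(j < n) rho ^+ j.+1 = rho * \sum_(j < n) rho ^+ j.
  by rewrite mulr_sumr; apply: eq_bigr => i _; rewrite exprS.
set s := \sum_(_ < _) _.
have hs : (1 - rho) * s = 1 - rho ^+ n.
  by rewrite -[in RHS](expr1n R n) subrXX; congr (_ * _); apply: eq_bigr => i _;
    rewrite expr1n mul1r.
have : 0 <= rho ^+ n by rewrite exprn_ge0.
have -> : rho * s - rho * s * rho = rho * (1 - rho ^+ n) by rewrite -hs; ring.
move=> h; have : rho * (1 - rho ^+ n) <= 1 * 1.
  have hn : rho ^+ n <= 1 by rewrite exprn_ile1 // ltW.
  by rewrite ler_pM // ?subr_ge0 ?(ltW rho1) // lerBlDr lerDl.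
by rewrite mulr1.
Qed.

Lemma q_near x : 1 - c * K * (1 - rho)^-1 * nrm1 x <= q x.
Proof.
apply: q_lb => n; apply: le_trans (qn_lb n x); rewrite lerB //.
apply: (@le_trans _ _ (\sum_(j < n) c * K * nrm1 x * rho ^+ j.+1)).
  apply: ler_sum => j _; rewrite -!mulrA ler_wpM2l //.
  by apply: (le_trans (T_contr _ _)); rewrite -mulrA ler_wpM2l // mulrC.
rewrite -mulr_sumr.
have h := geo_sum_le n; have h1 := nrm1_ge0 x.
have -> : c * K * (1 - rho)^-1 * nrm1 x = (c * K * nrm1 x) * (1 - rho)^-1.
  by rewrite mulrAC.
by rewrite ler_wpM2l // !mulr_ge0.
Qed.

End InfiniteProduct.

Section Words.
Variable X : Type.

(** One alphabet per position. Besides words over a fixed [B], this covers the fibre over a word,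
    where each letter prescribes its own alphabet. *)
Fixpoint prodw (Ds : seq (seq X)) : seq (seq X) :=
  if Ds is D :: Es then [seq x :: v | x <- D, v <- prodw Es] else [:: [::]].

Definition words (B : seq X) n := prodw (nseq n B).

Lemma big_prodw_cons (V : nmodType) D Ds (F : seq X -> V) :
  \sum_(w <- prodw (D :: Ds)) F w = \sum_(b <- D) \sum_(w <- prodw Ds) F (b :: w).
Proof. by rewrite big_allpairs_dep. Qed.

Lemma big_prodw_cat (V : nmodType) Ds Es (F : seq X -> V) :
  \sum_(w <- prodw (Ds ++ Es)) F w =
  \sum_(u <- prodw Ds) \sum_(v <- prodw Es) F (u ++ v).
Proof.
elim: Ds F => [|D Ds IH] F; first by rewrite big_seq1.
rewrite cat_cons !big_prodw_cons; apply: eq_bigr => b _.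
by rewrite IH.
Qed.

Lemma big_words0 (V : nmodType) B (F : seq X -> V) :
  \sum_(w <- words B 0) F w = F [::].
Proof. by rewrite big_seq1. Qed.

Lemma big_wordsS (V : nmodType) B n (F : seq X -> V) :
  \sum_(w <- words B n.+1) F w = \sum_(b <- B) \sum_(w <- words B n) F (b :: w).
Proof. exact: big_prodw_cons. Qed.

Lemma big_words_cat (V : nmodType) B m n (F : seq X -> V) :
  \sum_(w <- words B (m + n)) F w =
  \sum_(u <- words B m) \sum_(v <- words B n) F (u ++ v).
Proof. by rewrite /words nseqD big_prodw_cat. Qed.

Lemma big_words_rcons (V : nmodType) B n (F : seq X -> V) :
  \sum_(w <- words B n.+1) F w = \sum_(b <- B) \sum_(w <- words B n) F (rcons w b).
Proof.
rewrite -addn1 big_words_cat exchange_big /= big_allpairs_dep /=.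
by apply: eq_bigr => b _; rewrite big_seq1; apply: eq_bigr => w _; rewrite cats1.
Qed.

Lemma size_words B n : size (words B n) = (size B ^ n)%N.
Proof.
elim: n => [|n IH] //; by rewrite /words /= size_allpairs -/(words B n) IH expnS.
Qed.

End Words.

Lemma prodwP (X : eqType) (Ds : seq (seq X)) w :
  w \in prodw Ds -> size w = size Ds.
Proof.
elim: Ds w => [|D Ds IH] w /=; first by rewrite inE => /eqP ->.
by case/allpairsP => -[x v] /= [_ /IH h ->] /=; rewrite h.
Qed.

Lemma prodw_consP (X : eqType) (D : seq X) (Ds : seq (seq X)) b w :
  (b :: w \in prodw (D :: Ds)) = (b \in D) && (w \in prodw Ds).
Proof.
apply/idP/idP => [/allpairsP[[x v] /= [h1 h2 [-> ->]]]|/andP[h1 h2]].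
  by rewrite h1.
by apply/allpairsP; exists (b, w).
Qed.

Lemma prodw_uniq (X : eqType) (Ds : seq (seq X)) :
  (forall D, D \in Ds -> uniq D) -> uniq (prodw Ds).
Proof.
elim: Ds => [//|D Ds IH] h /=; apply: allpairs_uniq.
- by apply: h; rewrite mem_head.
- by apply: IH => E hE; apply: h; rewrite inE hE orbT.
- by move=> [x v] [y w] _ _ /= [-> ->].
Qed.

Lemma words_size (X : eqType) (B : seq X) n w : w \in words B n -> size w = n.
Proof. by move/prodwP; rewrite size_nseq. Qed.

Lemma words_uniq (X : eqType) (B : seq X) n : uniq B -> uniq (words B n).
Proof. by move=> h; apply: prodw_uniq => D; rewrite mem_nseq => /andP[_ /eqP ->]. Qed.

Section FiniteParseval.
Variable R : realType.

(** Expanding the square, orthogonality of the vectors [phi x] kills the off-diagonal terms. It is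
    Pythagoras for a combination of these vectors, so they need not span. *)
Lemma fin_parseval (X : eqType) (s : seq X) (Q : Type) (r : seq Q)
    (phi : X -> Q -> R[i]) (a : X -> R[i]) (k : R) : uniq s ->
  (forall x y, x \in s -> y \in s ->
    \sum_(z <- r) phi x z * cj (phi y z) = cr (k * (x == y)%:R)) ->
  \sum_(z <- r) sqn (\sum_(x <- s) a x * phi x z) = k * \sum_(x <- s) sqn (a x).
Proof.
move=> us h; apply: cr_inj.
rewrite cr_sum crM cr_sum.
under eq_bigr => z _ do rewrite sqnE cj_sum mulr_suml.
rewrite exchange_big /= mulr_sumr; apply: eq_big_seq => x xs.
under eq_bigr => z _ do rewrite mulr_sumr.
rewrite exchange_big /= (bigD1_seq x) //= [X in _ + X]big1_seq ?addr0; last first.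
  move=> y /andP[yx ys].
  under eq_bigr => z _ do rewrite cjM mulrACA.
  by rewrite -mulr_sumr h // eq_sym (negPf yx) mulr0 mulr0.
under eq_bigr => z _ do rewrite cjM mulrACA.
by rewrite -mulr_sumr h // eqxx mulr1 -sqnE mulrC.
Qed.

End FiniteParseval.

(** * Weighted Parseval identities *)

Section System.
Variables (R : realType) (d : nat).
Local Notation e := (@e2pii R).
Implicit Types (A : 'M[int]_d) (B : seq 'cV[int]_d) (x y : 'cV[R]_d).

Definition Rinv A : 'M[R]_d := invmx (zmx R A).
Definition Tinv A : 'M[R]_d := (Rinv A)^T.

(** The form in which expansiveness is used. Unlike a condition on eigenvalues, it passes easily to
    powers, conjugates and diagonal blocks. *)
Definition contracting A := zmx R A \in unitmx /\
  exists K rho : R, [/\ 0 <= K, 0 <= rho, rho < 1 &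
    forall j i k, `|(Rinv A ^+ j) i k| <= K * rho ^+ j].

Definition mean_e B y : R[i] :=
  cr (size B)%:R^-1 * \sum_(b <- B) e (dotv y (zmx R b)).

(** A single digit set gives the factor of the self-affine measure. Lists of several sets occur for
    the fibres of a block triangular system, which form a random digit system. *)
Definition mean_sqn (DD : seq (seq 'cV[int]_d)) y : R :=
  (size DD)%:R^-1 * \sum_(D <- DD) sqn (mean_e D y).

Fixpoint digit_sum A (w : seq 'cV[int]_d) : 'cV[R]_d :=
  if w is b :: v then Rinv A *m (zmx R b + digit_sum A v) else 0.

(* Fourier coefficient at x of a function c of the first n digits, for the uniform
   measure on words of length n. *)
Definition coef A B n (c : seq 'cV[int]_d -> R[i]) x : R[i] :=
  cr ((size B)%:R ^+ n)^-1 *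
  \sum_(w <- words B n) c w * e (- dotv x (digit_sum A w)).

Definition nrm2 B n (c : seq 'cV[int]_d -> R[i]) : R :=
  ((size B)%:R ^+ n)^-1 * \sum_(w <- words B n) sqn (c w).

(* The squared modulus of the Fourier transform of the self-affine measure. *)
Definition qB A B : 'cV[R]_d -> R := q (Tinv A) (mean_sqn [:: B]).

(* The maps [coef A B n _ lam] weighted by [qB] are the coefficients along the
   exponential e_lam, seen as a function on infinite words over B. *)
Definition parseval A B (Lam : set 'cV[R]_d) :=
  forall n (c : seq 'cV[int]_d -> R[i]),
  (forall F : seq 'cV[R]_d, uniq F -> [set` F] `<=` Lam ->
     \sum_(x <- F) sqn (coef A B n c x) * qB A B (Tinv A ^+ n *m x) <= nrm2 B n c)%classic /\
  (forall eps : R, 0 < eps -> exists F : seq 'cV[R]_d,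
     [/\ uniq F, ([set` F] `<=` Lam)%classic &
     nrm2 B n c - eps <= \sum_(x <- F) sqn (coef A B n c x) * qB A B (Tinv A ^+ n *m x)]).

(** Cauchy-Schwarz against the constant vector, by induction. The new term and the old sum are
    combined with weights n + 1 and (n + 1) / n, for which the defect is a perfect square. *)
Lemma sqn_sum_le (I : Type) (s : seq I) (w : I -> R[i]) :
  sqn (\sum_(i <- s) w i) <= (size s)%:R * \sum_(i <- s) sqn (w i).
Proof.
elim: s => [|i s IH]; first by rewrite !big_nil sqn0 mulr0.
rewrite !big_cons /=; case: s IH => [|j s] IH.
  by rewrite !big_nil !addr0 mul1r.
set n : R := (size (j :: s))%:R; set S := \sum_(k <- j :: s) w k.
set Q := \sum_(k <- j :: s) sqn (w k); rewrite -/n -/S -/Q in IH.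
have n0 : 0 < n by rewrite ltr0n.
rewrite -natr1 -/n; move: (w i) S IH => [a b] [a' b'].
rewrite /sqn /= => IH.
have h (x y : R) : (x + y) ^+ 2 <= (n + 1) * x ^+ 2 + (n + 1) * n^-1 * y ^+ 2.
  rewrite -subr_ge0.
  have -> : (n + 1) * x ^+ 2 + (n + 1) * n^-1 * y ^+ 2 - (x + y) ^+ 2 =
     n^-1 * (n * x - y) ^+ 2 by field; rewrite gt_eqF.
  by rewrite mulr_ge0 ?sqr_ge0 ?invr_ge0 // ltW.
apply: (@le_trans _ _ ((n + 1) * (a ^+ 2 + b ^+ 2) + (n + 1) * n^-1 * (a' ^+ 2 + b' ^+ 2))).
  have := h a a'; have := h b b'; lra.
rewrite [leRHS]mulrDr lerD2l -mulrA ler_wpM2l ?addr_ge0 ?(ltW n0) //.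
by rewrite ler_pdivrMl.
Qed.

Lemma mean_e_01 B y : 0 <= sqn (mean_e B y) <= 1.
Proof.
rewrite sqn_ge0 /= /mean_e.
have [B0|B0] := posnP (size B).
  by rewrite B0 invr0 mul0r sqn0.
have N0 : 0 < (size B)%:R :> R by rewrite ltr0n.
rewrite sqnM sqn_real exprVn ler_pdivrMl ?exprn_gt0 // mulr1.
apply: le_trans (sqn_sum_le _ _) _.
under eq_bigr => b _ do rewrite sqn_e.
by rewrite big_const_seq count_predT iter_addr_0 expr2.
Qed.

Lemma mean_eN B y : cj (mean_e B y) = mean_e B (- y).
Proof.
rewrite /mean_e cjM cj_cr cj_sum; congr (_ * _).
by apply: eq_bigr => b _; rewrite dotvNl e2piiN.
Qed.

Lemma mean_sqn_01 DD y : 0 <= mean_sqn DD y <= 1.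
Proof.
rewrite /mean_sqn; have [B0|B0] := posnP (size DD).
  by rewrite B0 invr0 mul0r lexx ler01.
have N0 : 0 < (size DD)%:R :> R by rewrite ltr0n.
rewrite mulr_ge0 ?invr_ge0 ?(ltW N0) //=; last first.
  by apply: sumr_ge0 => D _; rewrite sqn_ge0.
rewrite ler_pdivrMl // mulr1.
apply: (@le_trans _ _ (\sum_(D <- DD) 1)).
  by apply: ler_sum => D _; have /andP[] := mean_e_01 D y.
by rewrite big_const_seq count_predT iter_addr_0.
Qed.

Lemma mean_sqn1 B y : mean_sqn [:: B] y = sqn (mean_e B y).
Proof. by rewrite /mean_sqn big_seq1 /= invr1 mul1r. Qed.

(** The squared modulus of the sum over [D] is the double sum of Re e(<y, b - b'>), and each term is
    bounded below by [Re_e_ge]. *)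
Lemma mean_sqn_lb DD : (0 < size DD)%N -> (forall D, D \in DD -> (0 < size D)%N) ->
  exists2 c : R, 0 <= c & forall y, 1 - c * nrm1 y <= mean_sqn DD y.
Proof.
move=> DD0 hD.
(* Summing over all pairs is wasteful, but it dominates the contribution of any single pair. *)
pose bd (D : seq 'cV[int]_d) : R := \sum_(b <- D) \sum_(b' <- D) nrm1 (zmx R (b - b')).
have bd0 D : 0 <= bd D.
  by apply: sumr_ge0 => b _; apply: sumr_ge0 => b' _; exact: nrm1_ge0.
exists (2 * pi * \sum_(D <- DD) bd D).
  by rewrite !mulr_ge0 ?pi_ge0 // sumr_ge0.
move=> y.
have key D : D \in DD -> 1 - 2 * pi * bd D * nrm1 y <= sqn (mean_e D y).
  move=> hDD; have s0 := hD _ hDD.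
  have N0 : 0 < (size D)%:R :> R by rewrite ltr0n.
  rewrite /mean_e sqnM sqn_real exprVn [_^-1 * sqn _]mulrC ler_pdivlMr ?exprn_gt0 //.
  have -> : sqn (\sum_(b <- D) e (dotv y (zmx R b))) =
    \sum_(b <- D) \sum_(b' <- D) complex.Re (e (dotv y (zmx R (b - b')))).
    rewrite -[LHS]/(complex.Re (cr (sqn _))) sqnE cj_sum mulr_suml Re_sum.
    apply: eq_bigr => b _; rewrite mulr_sumr Re_sum; apply: eq_bigr => b' _.
    by rewrite e2pii_mulJ zmxB dotvBr.
  have -> : (1 - 2 * pi * bd D * nrm1 y) * (size D)%:R ^+ 2 =
    \sum_(b <- D) \sum_(b' <- D) (1 - 2 * pi * bd D * nrm1 y).
    by rewrite !sum_const_seq mulrA expr2 mulrC.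
  rewrite !big_seq; apply: ler_sum => b hb; rewrite !big_seq; apply: ler_sum => b' hb'.
  apply: le_trans (Re_e_ge _); rewrite lerB // -!mulrA !ler_wpM2l ?pi_ge0 //.
  apply: (le_trans (dotv_le _ _)); rewrite mulrC ler_wpM2r ?nrm1_ge0 //.
  rewrite /bd (big_rem b hb) /= (big_rem b' hb') /= -addrA lerDl addr_ge0 //.
    by apply: sumr_ge0 => ? _; exact: nrm1_ge0.
  by apply: sumr_ge0 => ? _; apply: sumr_ge0 => ? _; exact: nrm1_ge0.
rewrite /mean_sqn [leRHS]mulrC ler_pdivlMr ?ltr0n //.
have -> : (1 - 2 * pi * (\sum_(D <- DD) bd D) * nrm1 y) * (size DD)%:R =
    \sum_(D <- DD) (1 - 2 * pi * (\sum_(D <- DD) bd D) * nrm1 y).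
  by rewrite big_const_seq count_predT iter_addr_0 mulr_natr.
rewrite !big_seq; apply: ler_sum => D hDD; apply: le_trans (key D hDD).
rewrite lerB // ler_wpM2r ?nrm1_ge0 // ler_wpM2l ?mulr_ge0 ?pi_ge0 //.
by rewrite -big_seq (big_rem D hDD) /= lerDl sumr_ge0.
Qed.

Lemma Tinv_contr A : contracting A -> exists K rho : R, [/\ 0 <= K, 0 <= rho, rho < 1 &
  forall j x, nrm1 (Tinv A ^+ j *m x) <= K * rho ^+ j * nrm1 x].
Proof.
move=> [_ [K [rho [K0 rho0 rho1 h]]]]; exists (d%:R * K), rho; split => //.
  by rewrite mulr_ge0.
move=> j x; rewrite -(mulrA d%:R); apply: nrm1_mul => i k.
rewrite /Tinv -trmxX.
by rewrite mxE.
Qed.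

Lemma Rinv_contr A : contracting A -> exists K rho : R, [/\ 0 <= K, 0 <= rho, rho < 1 &
  forall j x, nrm1 (Rinv A ^+ j *m x) <= K * rho ^+ j * nrm1 x].
Proof.
move=> [_ [K [rho [K0 rho0 rho1 h]]]]; exists (d%:R * K), rho; split => //.
  by rewrite mulr_ge0.
by move=> j x; rewrite -(mulrA d%:R); apply: nrm1_mul => i k.
Qed.

Lemma q_family_near A DD : contracting A -> (0 < size DD)%N ->
  (forall D, D \in DD -> (0 < size D)%N) ->
  exists2 c : R, 0 < c & forall x, 1 - c * nrm1 x <= q (Tinv A) (mean_sqn DD) x.
Proof.
move=> cA DD0 hD; have [K [rho [K0 rho0 rho1 hT]]] := Tinv_contr cA.
have [c c0 hc] := mean_sqn_lb DD0 hD.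
exists (c * K * (1 - rho)^-1 + 1).
  by rewrite ltr_wpDl // !mulr_ge0 // invr_ge0 subr_ge0 ltW.
move=> x; apply: le_trans (q_near (mean_sqn_01 DD) c0 K0 rho0 rho1 hc hT x).
by rewrite lerB // ler_wpM2r ?nrm1_ge0 // lerDl.
Qed.

Lemma q_family0 A DD : contracting A -> (0 < size DD)%N ->
  (forall D, D \in DD -> (0 < size D)%N) -> q (Tinv A) (mean_sqn DD) 0 = 1.
Proof.
move=> cA DD0 hD; have [c _ /(_ 0) hc] := q_family_near cA DD0 hD.
apply/eqP; rewrite eq_le q_le1 /=; last exact: mean_sqn_01.
move: hc; rewrite (_ : nrm1 0 = 0) ?mulr0 ?subr0 //.
by rewrite /nrm1 big1 // => i _; rewrite mxE normr0.
Qed.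

(** The orbit tends to 0, where the product is 1. Hence at deep levels weighted sums over a fixed
    finite set of frequencies become unweighted ones. *)
Lemma q_family_lim A DD : contracting A -> (0 < size DD)%N ->
  (forall D, D \in DD -> (0 < size D)%N) -> forall x (eps : R), 0 < eps ->
  exists n0, forall n, (n0 <= n)%N -> 1 - eps <= q (Tinv A) (mean_sqn DD) (Tinv A ^+ n *m x).
Proof.
move=> cA DD0 hD x eps eps0; have [c c0 hc] := q_family_near cA DD0 hD.
have [K [rho [K0 rho0 rho1 hT]]] := Tinv_contr cA.
have C0 : 0 < c * K * nrm1 x + 1 by rewrite ltr_wpDl // !mulr_ge0 ?nrm1_ge0 ?(ltW c0).
have [n0 hn] := pow_small rho0 rho1 (divr_gt0 eps0 C0).
exists n0 => n /hn h; apply: le_trans (hc _); rewrite lerB //.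
have h1 := hT n x; rewrite ler_pdivlMr // in h.
apply: le_trans h; apply: (@le_trans _ _ (c * (K * rho ^+ n * nrm1 x))).
  by rewrite ler_wpM2l // ltW.
have -> : c * (K * rho ^+ n * nrm1 x) = rho ^+ n * (c * K * nrm1 x) by ring.
by rewrite ler_wpM2l ?exprn_ge0 // lerDl.
Qed.

Lemma Rinv_mul A : contracting A -> forall x, Rinv A *m (zmx R A *m x) = x.
Proof. by move=> [uA _] x; rewrite mulmxA mulVmx // mul1mx. Qed.

Lemma mul_Rinv A : contracting A -> forall x, zmx R A *m (Rinv A *m x) = x.
Proof. by move=> [uA _] x; rewrite mulmxA mulmxV // mul1mx. Qed.

Lemma dot_Rinv A x y : dotv x (Rinv A *m y) = dotv (Tinv A *m x) y.
Proof. by rewrite dotv_mulr. Qed.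

Lemma dot_RinvX A n x y : dotv x (Rinv A ^+ n *m y) = dotv (Tinv A ^+ n *m x) y.
Proof.
elim: n x => [|n IH] x; first by rewrite !mulTX0.
by rewrite mulTXl dot_Rinv IH -mulTX.
Qed.

Lemma digit_sum_cat A w v :
  digit_sum A (w ++ v) = digit_sum A w + Rinv A ^+ size w *m digit_sum A v.
Proof.
elim: w => [|b w IH] /=; first by rewrite mulTX0 add0r.
by rewrite IH addrA mulmxDr mulTXl.
Qed.

Lemma digit_sum_rcons A w b :
  digit_sum A (rcons w b) = digit_sum A w + Rinv A ^+ (size w).+1 *m zmx R b.
Proof. by rewrite -cats1 digit_sum_cat /= addr0 mulTX. Qed.

(** The digit sum scaled by the power of [A] that clears its denominators: the radix expansion with
    the most significant digit first. *)
Fixpoint digit_isum A (w : seq 'cV[int]_d) : 'cV[int]_d :=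
  if w is b :: v then A ^+ size v *m b + digit_isum A v else 0.

Lemma digit_isumE A w : contracting A ->
  zmx R (A ^+ size w) *m digit_sum A w = zmx R (digit_isum A w).
Proof.
move=> cA; elim: w => [|b w IH]; first by rewrite mulmx0 zmx0.
rewrite zmxX [size _]/= mulTX /= mul_Rinv // mulmxDr -zmxX IH.
by rewrite zmxD zmxM.
Qed.

Section Coefficients.
Variables (A : 'M[int]_d) (B : seq 'cV[int]_d).
Hypothesis cA : contracting A.
Hypothesis B0 : (0 < size B)%N.

Let N : R := (size B)%:R.
Let N0 : 0 < N. Proof. by rewrite ltr0n. Qed.
Let Nn0 n : 0 < N ^+ n. Proof. by rewrite exprn_gt0. Qed.

Lemma coef_cat n m c x :
  coef A B (n + m) (fun w => c (take n w)) x =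
  coef A B n c x * coef A B m (fun=> 1) (Tinv A ^+ n *m x).
Proof.
rewrite /coef big_words_cat mulrACA -crM -invfM -exprD; congr (_ * _).
rewrite mulr_suml; apply: eq_big_seq => w hw; rewrite mulr_sumr; apply: eq_big_seq => v _.
rewrite mul1r take_size_cat ?(words_size hw) // digit_sum_cat (words_size hw).
by rewrite dotvDr opprD e2piiD dot_RinvX mulrA.
Qed.

(** The Fourier transform of the uniform measure on words of length [m] factors over the letters;
    its squared modulus is the partial product of [qB]. *)
Lemma sqn_coef1 m x : sqn (coef A B m (fun=> 1) x) = qn (Tinv A) (mean_sqn [:: B]) m x.
Proof.
elim: m x => [|m IH] x /=.
  by rewrite /coef expr0 invr1 mul1r big_words0 /= dotv0r oppr0 e2pii0 mulr1 sqn1.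
have -> : coef A B m.+1 (fun=> 1) x =
    cj (mean_e B (Tinv A *m x)) * coef A B m (fun=> 1) (Tinv A *m x).
  rewrite mean_eN /coef /mean_e big_wordsS exprS invfM crM mulrACA.
  congr (_ * _); rewrite mulr_suml; apply: eq_bigr => b _.
  rewrite mulr_sumr; apply: eq_bigr => w _.
  by rewrite !mul1r dot_Rinv dotvDr opprD e2piiD dotvNl.
by rewrite sqnM sqn_cj IH mean_sqn1.
Qed.

(** Viewing [c] as a function of more letters multiplies its coefficient by a partial product, which
    is exactly what the weight loses. The terms of [parseval] thus do not depend on the level at
    which [c] is viewed. *)
Lemma coef_qB n m c x :
  sqn (coef A B n c x) * qB A B (Tinv A ^+ n *m x) =
  sqn (coef A B (n + m) (fun w => c (take n w)) x) * qB A B (Tinv A ^+ (n + m) *m x).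
Proof.
rewrite coef_cat sqnM sqn_coef1 -!mulrA; congr (_ * _).
rewrite /qB (q_iter (Tinv A) (mean_sqn_01 _) m).
by rewrite -mulTXD addnC.
Qed.

Lemma nrm2_take n m c : nrm2 B (n + m) (fun w => c (take n w)) = nrm2 B n c.
Proof.
rewrite /nrm2 big_words_cat exprD -/N invfM -mulrA; congr (_ * _).
rewrite mulr_sumr; apply: eq_big_seq => w hw.
under eq_bigr => v _ do rewrite take_size_cat ?(words_size hw) //.
rewrite big_const_seq count_predT iter_addr_0 size_words -mulr_natl natrX.
by rewrite mulrA mulVf ?mul1r // gt_eqF.
Qed.

Lemma nrm2_ge0 n c : 0 <= nrm2 B n c.
Proof. by rewrite mulr_ge0 ?invr_ge0 ?(ltW (Nn0 n)) // sumr_ge0 // => w _; exact: sqn_ge0. Qed.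

Lemma nrm2_le n c a : (forall w, w \in words B n -> sqn (c w) <= a) -> nrm2 B n c <= a.
Proof.
move=> h; rewrite /nrm2 ler_pdivrMl //.
have -> : N ^+ n * a = \sum_(w <- words B n) a.
  by rewrite big_const_seq count_predT iter_addr_0 size_words -mulr_natl natrX.
by rewrite !big_seq; apply: ler_sum.
Qed.

Lemma qB01 x : 0 <= qB A B x <= 1.
Proof. by rewrite /qB q_ge0 ?q_le1 //; exact: mean_sqn_01. Qed.

Lemma coef_sub n c c' x : coef A B n (fun w => c w - c' w) x = coef A B n c x - coef A B n c' x.
Proof.
rewrite /coef -mulrBr; congr (_ * _); rewrite -sumrB; apply: eq_bigr => w _.
by rewrite mulrBl.
Qed.

(** Extends near completeness to functions of infinitely many letters. The set [F] found at level
    [m] serves all later levels: the change from level [m] to [m + j] is controlled by Bessel's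
    inequality and absorbed by [sqn_sub_lb]. Finally the weight is bounded by 1. *)
Lemma parseval_limit Lam (c : nat -> seq 'cV[int]_d -> R[i]) m (delta eta : R) :
  parseval A B Lam -> 0 < eta -> eta < 1 ->
  (forall j w, w \in words B (m + j) -> sqn (c (m + j)%N w - c m (take m w)) <= delta) ->
  forall eps : R, 0 < eps -> exists F : seq 'cV[R]_d,
  [/\ uniq F, ([set` F] `<=` Lam)%classic &
   forall j, (1 - eta) * (nrm2 B m (c m) - eps) - eta^-1 * delta <=
     \sum_(x <- F) sqn (coef A B (m + j) (c (m + j)%N) x)].
Proof.
move=> pL eta0 eta1 hd eps eps0; have [F [uF FL hF]] := (pL m (c m)).2 _ eps0.
exists F; split => // j.
have [hB _] := pL (m + j)%N (fun w => c (m + j)%N w - c m (take m w)).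
have {}hB := hB F uF FL; have hB' := nrm2_le (hd j).
apply: (@le_trans _ _ (\sum_(x <- F) ((1 - eta) * (sqn (coef A B m (c m) x) *
    qB A B (Tinv A ^+ m *m x)) - eta^-1 *
   (sqn (coef A B (m + j) (fun w => c (m + j)%N w - c m (take m w)) x) *
     qB A B (Tinv A ^+ (m + j) *m x))))).
  rewrite sumrB -!mulr_sumr lerB // ler_wpM2l ?subr_ge0 ?(ltW eta1) ?invr_ge0 ?(ltW eta0) //.
  exact: le_trans hB hB'.
apply: ler_sum => x _; rewrite (coef_qB _ j) coef_sub.
have /andP[q0 q1] := qB01 (Tinv A ^+ (m + j) *m x).
set z := coef _ _ _ (c (m + j)%N) x; set z' := coef _ _ _ _ x.
apply: (@le_trans _ _ (sqn z * qB A B (Tinv A ^+ (m + j) *m x))); last first.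
  by rewrite -[leRHS]mulr1 ler_wpM2l ?sqn_ge0.
by rewrite !mulrA -mulrBl ler_wpM2r // sqn_sub_lb.
Qed.

Lemma qB_lim (s : seq 'cV[R]_d) (eps : R) : 0 < eps -> exists n0, forall n, (n0 <= n)%N ->
  forall x, x \in s -> 1 - eps <= qB A B (Tinv A ^+ n *m x).
Proof.
move=> eps0; elim: s => [|x s [n1 h1]]; first by exists 0%N.
have [n2 h2] : exists n0, forall n, (n0 <= n)%N -> 1 - eps <= qB A B (Tinv A ^+ n *m x).
  by apply: q_family_lim => // D; rewrite inE => /eqP ->.
exists (maxn n1 n2) => n; rewrite geq_max => /andP[hn1 hn2] y.
by rewrite inE => /orP[/eqP ->|hy]; [exact: h2|exact: h1].
Qed.

End Coefficients.

Definition hadamard A B (L : seq 'cV[int]_d) := [/\ uniq B, (0 < size B)%N, size L = size B &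
  forall b b', b \in B -> b' \in B ->
  \sum_(l <- L) e (dotv (zmx R l) (Rinv A *m zmx R (b - b'))) = cr ((size B)%:R * (b == b')%:R)].

End System.

Lemma cr_ge0_sum (R : realType) (I : eqType) (s t : seq I) (F : I -> R) :
  uniq s -> uniq t -> {subset s <= t} -> (forall i, 0 <= F i) ->
  \sum_(i <- s) F i <= \sum_(i <- t) F i.
Proof.
move=> us ut st F0.
rewrite [leRHS](perm_big (s ++ [seq i <- t | i \notin s])) /=; last first.
  apply: uniq_perm => //.
    rewrite cat_uniq us filter_uniq // andbT; apply/hasPn => i.
    by rewrite mem_filter => /andP[].
  move=> i; rewrite mem_cat mem_filter; case: (boolP (i \in s)) => //= hi.
  by rewrite st.
by rewrite big_cat /= lerDl sumr_ge0.
Qed.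

(** * Spectra from an equi-positive weight *)

Section Tree.
Variables (R : realType) (d : nat).
Local Notation e := (@e2pii R).
Variables (A : 'M[int]_d) (B L : seq 'cV[int]_d).
Hypothesis cA : contracting R A.
Hypothesis hBL : hadamard R A B L.

Let N : R := (size B)%:R.
Let uB : uniq B. Proof. by case: hBL. Qed.
Let B0 : (0 < size B)%N. Proof. by case: hBL. Qed.
Let N0 : 0 < N. Proof. by rewrite ltr0n. Qed.
Let T := Tinv R A.
Let q := qB A B : 'cV[R]_d -> R.

Definition is_basis n (s : seq 'cV[int]_d) := forall c : seq 'cV[int]_d -> R[i],
  \sum_(l <- s) sqn (\sum_(w <- words B n) c w * e (- dotv (zmx R l) (digit_sum R A w))) =
  N ^+ n * \sum_(w <- words B n) sqn (c w).

(** A frequency listed twice, tested against its own character, would contribute twice the whole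
    right side. *)
Lemma is_basis_uniq n s : is_basis n s -> uniq s.
Proof.
move=> hs; apply: count_mem_uniq => x; case: (boolP (x \in s)) => [xs|/count_memPn -> //].
rewrite (permP (perm_to_rem xs)) /= eqxx; apply/eqP; rewrite eqSS.
apply/eqP/count_memPn/negP => xs'.
have := hs (fun w => e (dotv (zmx R x) (digit_sum R A w))).
rewrite (perm_big _ (perm_to_rem xs)) big_cons (perm_big _ (perm_to_rem xs')) big_cons /=.
set z := sqn _; have -> : z = N ^+ n * N ^+ n.
  rewrite /z; under eq_bigr => w _ do rewrite -e2piiD subrr e2pii0.
  rewrite sum_const_seq mulr1 size_words.
  by rewrite -[(_ ^ _)%:R]/((_ ^ _)%:R) -(rmorph_nat (real_complex R)) -/(cr _) sqn_real natrX expr2.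
under [in RHS]eq_bigr => w _ do rewrite sqn_e.
rewrite sum_const_seq mulr1 size_words natrX -/N.
have h0 : 0 < N ^+ n * N ^+ n by rewrite mulr_gt0 // exprn_gt0.
have : 0 <= \sum_(i <- rem x (rem x s)) sqn (\sum_(w <- words B n)
  e (dotv (zmx R x) (digit_sum R A w)) * e (- dotv (zmx R i) (digit_sum R A w))).
  by apply: sumr_ge0 => i _; exact: sqn_ge0.
set S := \sum_(_ <- _) _; move: h0; set y := _ * _ => h0 h1 h2; lra.
Qed.

Lemma zmx_dot_digit_sum (z : 'cV[int]_d) n w : w \in words B n ->
  isint (dotv (zmx R (A^T ^+ n *m z)) (digit_sum R A w)).
Proof.
move=> hw; rewrite zmxM dotv_mull -zmxT.
rewrite trmxX trmxK.
rewrite -(words_size hw) digit_isumE //; exact: dotv_int.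
Qed.

Lemma zmxTX_dot n (z : 'cV[int]_d) x :
  dotv (zmx R (A^T ^+ n *m z)) (Rinv R A ^+ n *m x) = dotv (zmx R z) x.
Proof.
elim: n x z => [|n IH] x z; first by rewrite !mulTX0.
rewrite (mulTX A^T) (mulTX (Rinv R A)) IH zmxM dotv_mull zmxT trmxK.
by rewrite mul_Rinv.
Qed.

(** A multiple of S^n, where S = A^T, is trivial on the first [n] digits, so [l] resolves those and
    [l'] resolves the new one. The term S^(n+1) k is trivial on all n + 1 digits, which is why [k]
    may be chosen freely. *)
Lemma is_basis_step n s (k : 'cV[int]_d -> 'cV[int]_d -> 'cV[int]_d) : is_basis n s ->
  is_basis n.+1 [seq l + A^T ^+ n *m (l' + A^T *m k l l') | l <- s, l' <- L].
Proof.
move=> hs c; rewrite big_allpairs_dep /=.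
have [_ _ sL hL] := hBL.
pose G (l b : 'cV[int]_d) : R[i] := \sum_(w <- words B n) c (rcons w b) *
  e (- dotv (zmx R l) (digit_sum R A w)).
have -> : \sum_(w <- words B n.+1) sqn (c w) =
    \sum_(b <- B) \sum_(w <- words B n) sqn (c (rcons w b)).
  exact: big_words_rcons.
transitivity (\sum_(l <- s) N * \sum_(b <- B) sqn (G l b)); last first.
  rewrite exprS -mulrA -mulr_sumr; congr (_ * _).
  rewrite exchange_big /= mulr_sumr; apply: eq_bigr => b _.
  exact: (hs (fun w => c (rcons w b))).
apply: eq_bigr => l _.
pose a (b : 'cV[int]_d) := G l b * e (- dotv (zmx R l) (Rinv R A ^+ n.+1 *m zmx R b)).
transitivity (N * \sum_(b <- B) sqn (a b)); last first.
  by congr (_ * _); apply: eq_bigr => b _; rewrite /a sqnM sqn_e mulr1.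
rewrite -(@fin_parseval _ _ _ _ L (fun b l' => e (- dotv (zmx R l') (Rinv R A *m zmx R b)))) //.
  apply: eq_bigr => l' _; congr sqn.
  rewrite big_words_rcons; apply: eq_bigr => b _; rewrite /a /G -!mulrA mulr_suml.
  apply: eq_big_seq => w hw; rewrite -mulrA; congr (_ * _).
  rewrite -!e2piiD; set z := l' + _.
  rewrite digit_sum_rcons (words_size hw) zmxD dotvDl !dotvDr.
  have -> : dotv (zmx R (A^T ^+ n *m z)) (Rinv R A ^+ n.+1 *m zmx R b) =
      dotv (zmx R l') (Rinv R A *m zmx R b) + dotv (zmx R (k l l')) (zmx R b).
    by rewrite mulTX zmxTX_dot zmxD dotvDl zmxM dotv_mull zmxT trmxK mul_Rinv.
  have [m1 ->] := zmx_dot_digit_sum z hw.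
  have [m2 ->] := dotv_int R (k l l') b.
  set x := dotv _ _; set y := dotv _ _; set t := dotv _ _.
  rewrite (_ : - _ = - x + (- y - t) - (m1 + m2)%:~R); last by rewrite intrD; ring.
  by rewrite (e2piiD (- x + (- y - t))) (isint_e (isintN (isint_int _ _))) mulr1.
move=> b b' hb hb'; have := congr1 (@cj R) (hL b b' hb hb').
rewrite cj_cr => <-; rewrite cj_sum; apply: eq_bigr => l' _.
rewrite e2pii_mulJ -e2piiN; congr e2pii.
by rewrite zmxB mulmxBr dotvBr; ring.
Qed.

Lemma is_basis0 : is_basis 0 [:: 0].
Proof.
move=> c; rewrite big_seq1 expr0 mul1r !big_words0 /= dotv0r oppr0 e2pii0.
by rewrite mulr1.
Qed.

Variables (k : 'cV[R]_d -> 'cV[int]_d) (eps0 : R).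
Hypothesis eps0_gt0 : 0 < eps0.
Hypothesis hk : forall y, eps0 <= q (y + zmx R (k y)).
Hypothesis hk0 : forall y, eps0 <= q y -> k y = 0.
Hypothesis L0 : 0 \in L.

(** The correction is evaluated at the point y for which T^(m+1) maps the new frequency to y + k(y).
    The weight of that frequency at its own level is therefore at least [eps0]. *)
Fixpoint tree n : seq 'cV[int]_d := if n is m.+1 then
  [seq l + A^T ^+ m *m (l' + A^T *m k (T ^+ m.+1 *m zmx R l + T *m zmx R l')) |
    l <- tree m, l' <- L] else [:: 0].

Lemma tree_basis n : is_basis n (tree n).
Proof.
elim: n => [|n IH]; first exact: is_basis0.
exact: (@is_basis_step n (tree n) (fun l l' => k (T ^+ n.+1 *m zmx R l + T *m zmx R l')) IH).
Qed.

Let u01 := @mean_sqn_01 R d [:: B].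

Lemma TinvX_mul n (z : 'cV[int]_d) : T ^+ n *m zmx R (A^T ^+ n *m z) = zmx R z.
Proof.
elim: n z => [|n IH] z; first by rewrite !mulTX0.
rewrite mulTXl mulTX IH zmxM mulmxA zmxT.
have -> : T *m (zmx R A)^T = 1%:M; last by rewrite mul1mx.
by rewrite /T /Tinv -trmx_mul mulmxV ?trmx1 //; case: cA.
Qed.

Lemma tree_q n l : l \in tree n -> eps0 <= q (T ^+ n *m zmx R l).
Proof.
elim: n l => [|n IH] l.
  rewrite inE => /eqP ->; rewrite zmx0 mulmx0; apply: (le_trans (hk 0)).
  have -> : q 0 = 1 by apply: q_family0 => // D; rewrite inE => /eqP ->.
  by have /andP[_] := qB01 A B (0 + zmx R (k 0)).
case/allpairsP => -[l1 l2] /= [h1 h2 ->].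
set y := T ^+ n.+1 *m zmx R l1 + T *m zmx R l2.
have -> : T ^+ n.+1 *m zmx R (l1 + A^T ^+ n *m (l2 + A^T *m k y)) = y + zmx R (k y).
  rewrite zmxD mulmxDr mulmxDr -mulTX zmxD mulmxDr addrA; congr (_ + _).
    have -> : T ^+ n.+1 *m zmx R (A^T ^+ n *m l2) = T *m zmx R l2 by rewrite mulTXl TinvX_mul.
    by [].
  exact: TinvX_mul.
exact: hk.
Qed.

(** The child of [l] along 0 in [L] is [l] itself: q does not decrease along the orbit, so the
    correction prescribed by [hk0] is 0. *)
Lemma tree_mono m n : (m <= n)%N -> {subset tree m <= tree n}.
Proof.
move=> /subnKC <-; elim: (n - m)%N => [|j IH] l hl; first by rewrite addn0.
rewrite addnS; apply/allpairsP; exists (l, 0); split => //=; first exact: IH.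
rewrite zmx0 mulmx0 addr0 hk0; first by rewrite mulmx0 addr0 mulmx0 addr0.
apply: le_trans (tree_q (IH _ hl)) _; rewrite mulTXl.
have := q_mono T u01 1 (T ^+ (m + j) *m zmx R l); rewrite mulTX mulTX0 /q /qB.
done.
Qed.

Definition tree_set : set 'cV[R]_d := [set x | exists n, x \in map (@zmx R d 1) (tree n)]%classic.

Lemma tree_set_countable : countable tree_set.
Proof.
have : (tree_set `<=` [set zmx R l | l in [set: 'cV[int]_d]])%classic.
  by move=> x [n /mapP[l _ ->]]; exists l.
move/subset_card_le => h; apply: card_le_trans h (card_le_trans (card_image_le _ _) _).
exact: countableP.
Qed.

Lemma tree_set_seq (F : seq 'cV[R]_d) : ([set` F] `<=` tree_set)%classic ->
  exists n, {subset F <= map (@zmx R d 1) (tree n)}.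
Proof.
elim: F => [|x F IH] h; first by exists 0%N.
have [n1 h1] : tree_set x by apply: h; rewrite /= mem_head.
have [n2 h2] : exists n, {subset F <= map (@zmx R d 1) (tree n)}.
  by apply: IH => y /= hy; apply: h => /=; rewrite inE hy orbT.
exists (maxn n1 n2) => y; rewrite inE => /orP[/eqP ->|hy].
  by have /mapP[l hl ->] := h1; apply/map_f/(tree_mono (leq_maxl _ _)).
by have /mapP[l hl ->] := h2 y hy; apply/map_f/(tree_mono (leq_maxr _ _)).
Qed.

Lemma tree_coef n c :
  \sum_(x <- map (@zmx R d 1) (tree n)) sqn (coef A B n c x) = nrm2 B n c.
Proof.
rewrite big_map /coef; under eq_bigr => l _ do rewrite sqnM sqn_real.
rewrite -mulr_sumr (tree_basis n c) /nrm2 mulrA; congr (_ * _).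
by rewrite exprVn expr2 invfM -mulrA mulVf ?mulr1 // expf_eq0 gt_eqF ?andbF.
Qed.

(** At a level high enough to contain a given finite set, the tree is a full basis, which gives
    Bessel's inequality. For completeness, [F] nearly attains the supremum of the weighted sums. The
    rest of a deep level then carries little weighted mass and, its weights being at least [eps0],
    little mass at all. *)
Lemma tree_parseval : parseval A B tree_set.
Proof.
move=> n c; set Tn := Tinv R A.
have utree m : uniq (map (@zmx R d 1) (tree m)).
  by rewrite map_inj_uniq; [exact: is_basis_uniq (tree_basis m)|exact: zmx_inj].
have a0 x : 0 <= sqn (coef A B n c x) * qB A B (Tn ^+ n *m x).
  by have /andP[q0 _] := qB01 A B (Tn ^+ n *m x); rewrite mulr_ge0 ?sqn_ge0.
have bessel F : uniq F -> ([set` F] `<=` tree_set)%classic ->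
     \sum_(x <- F) sqn (coef A B n c x) * qB A B (Tn ^+ n *m x) <= nrm2 B n c.
  move=> uF hF; have [m0 hm0] := tree_set_seq hF; pose m := (n + m0)%N.
  have hm : {subset F <= map (@zmx R d 1) (tree m)}.
    move=> x /hm0 /mapP[l hl ->]; apply/map_f/(tree_mono _ hl); exact: leq_addl.
  apply: (le_trans (cr_ge0_sum uF (utree m) hm a0)).
  rewrite -(nrm2_take B0 _ m0) -tree_coef; apply: ler_sum => x _.
  rewrite (coef_qB A B n m0).
  have /andP[_ q1] := qB01 A B (Tn ^+ (n + m0) *m x).
  by rewrite -[leRHS]mulr1 ler_wpM2l ?sqn_ge0.
split=> // eps eps_gt0.
set nc := nrm2 B n c in bessel *.
have nc0 : 0 <= nc by exact: nrm2_ge0.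
pose S : set R := [set s | exists F : seq 'cV[R]_d, [/\ uniq F, ([set` F] `<=` tree_set)%classic &
   s = \sum_(x <- F) sqn (coef A B n c x) * qB A B (Tn ^+ n *m x)]]%classic.
have hS : has_sup S.
  split; first by exists 0; exists [::]; split => //; rewrite big_nil.
  by exists nc => _ [F [uF FL ->]]; exact: bessel.
(* Chosen so that the two losses, delta nc on [F] and delta / eps0 off [F], add up to at most
   [eps]. *)
pose delta : R := Num.min (2^-1) (eps / (nc + eps0^-1 + 1)).
have D0 : 0 < nc + eps0^-1 + 1.
  by rewrite ltr_wpDl // addr_ge0 // invr_ge0 ltW.
have delta0 : 0 < delta by rewrite lt_min invr_gt0 ltr0n /= divr_gt0.
have [_ [F [uF FL ->]] hF] := sup_adherent delta0 hS.
exists F; split => //.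
set s0 := \sum_(x <- F) _ in hF *.
(* [m1] is a level containing [F]; from [m2] on, the weights on [F] are at least 1 - delta. *)
have [m1 hm1] := tree_set_seq FL; have [m2 hm2] := qB_lim cA B0 F delta0.
pose j := maxn m1 m2; pose m := (n + j)%N.
have hm : {subset F <= map (@zmx R d 1) (tree m)}.
  move=> x /hm1 /mapP[l hl ->]; apply/map_f/(tree_mono _ hl).
  exact: leq_trans (leq_maxl m1 m2) (leq_addl _ _).
pose t x := sqn (coef A B m (fun w => c (take n w)) x).
have t0 x : 0 <= t x by exact: sqn_ge0.
have at_ x : sqn (coef A B n c x) * qB A B (Tn ^+ n *m x) = t x * qB A B (Tn ^+ m *m x).
  by rewrite (coef_qB A B n j).
have h1 : \sum_(x <- map (@zmx R d 1) (tree m)) t x = nc by rewrite tree_coef nrm2_take.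
pose r := [seq x <- map (@zmx R d 1) (tree m) | x \notin F].
have pr : perm_eq (map (@zmx R d 1) (tree m)) (F ++ r).
  apply: uniq_perm => //.
    rewrite cat_uniq uF filter_uniq // andbT; apply/hasPn => i.
    by rewrite mem_filter => /andP[].
  move=> i; rewrite mem_cat mem_filter; case: (boolP (i \in F)) => //= hi.
  by rewrite hm.
rewrite (perm_big _ pr) big_cat /= in h1.
have h2 : \sum_(x <- F) t x <= s0 + delta * nc.
  have : \sum_(x <- F) t x <= nc by rewrite -h1 lerDl sumr_ge0.
  have : (1 - delta) * \sum_(x <- F) t x <= s0.
    rewrite mulr_sumr /s0 !big_seq; apply: ler_sum => x xF; rewrite at_ mulrC ler_wpM2l //.
    apply: hm2 => //; exact: leq_trans (leq_maxr m1 m2) (leq_addl _ _).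
  move=> k1 k2; have : delta * \sum_(x <- F) t x <= delta * nc by rewrite ler_wpM2l // ltW.
  lra.
have h3 : eps0 * \sum_(x <- r) t x <= delta.
  apply: (@le_trans _ _ (\sum_(x <- r) sqn (coef A B n c x) * qB A B (Tn ^+ n *m x))).
    rewrite mulr_sumr !big_seq; apply: ler_sum => x; rewrite mem_filter => /andP[_ /mapP[l hl ->]].
    by rewrite at_ mulrC ler_wpM2l // tree_q.
  have : s0 + \sum_(x <- r) sqn (coef A B n c x) * qB A B (Tn ^+ n *m x) <= sup S.
    rewrite /s0 -big_cat /=; apply: sup_upper_bound => //.
    exists (F ++ r); split => //; first by rewrite -(perm_uniq pr).
    by move=> x /=; rewrite -(perm_mem pr) => hx; exists m.
  move: hF; lra.
have h4 : \sum_(x <- r) t x <= delta * eps0^-1.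
  by rewrite ler_pdivlMr // mulrC.
have h5 : delta * (nc + eps0^-1 + 1) <= eps.
  by rewrite -ler_pdivlMr // ge_min lexx orbT.
rewrite !mulrDr in h5; move: h1 h2 h4 h5 (ltW delta0); lra.
Qed.

End Tree.

(** * The transfer operator of a family of digit sets *)

Section Division.
Variable d : nat.
Implicit Types (A : 'M[int]_d) (g : 'cV[int]_d).

Definition Aimg A g : bool := `[< exists k, g = A *m k >].

(** The default 0 is used outside the image; inside it, injectivity of a contracting [A] makes the
    quotient unique. *)
Definition Adiv A g : 'cV[int]_d := xget 0 [set k | g = A *m k]%classic.

Lemma AimgP A g : reflect (exists k, g = A *m k) (Aimg A g).
Proof. exact: asboolP. Qed.

Lemma AdivE A g : Aimg A g -> g = A *m Adiv A g.
Proof. by move=> /AimgP[k hk]; rewrite /Adiv; case: xgetP => // h; case: (h k). Qed.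

Variable R : realType.

Lemma contr_inj A : contracting R A -> injective (fun k : 'cV[int]_d => A *m k).
Proof.
move=> cA x y /= h; apply: (@zmx_inj R).
by rewrite -(Rinv_mul cA (zmx R x)) -zmxM h zmxM Rinv_mul.
Qed.

Lemma Adiv_mul A k : contracting R A -> Adiv A (A *m k) = k.
Proof.
move=> cA; apply: (contr_inj cA); rewrite /= -AdivE //.
by apply/AimgP; exists k.
Qed.

Lemma Aimg_Rinv A g : contracting R A -> Aimg A g -> Rinv R A *m zmx R g = zmx R (Adiv A g).
Proof. by move=> cA h; rewrite {1}(AdivE h) zmxM Rinv_mul. Qed.

Lemma Aimg_isintv A g : contracting R A -> isintv (Rinv R A *m zmx R g) -> Aimg A g.
Proof.
move=> cA [k hk]; apply/AimgP; exists k; apply: (@zmx_inj R).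
by rewrite zmxM -hk mul_Rinv.
Qed.

End Division.

Section Family.
Variables (R : realType) (d : nat).
Implicit Types (A : 'M[int]_d) (DD : seq (seq 'cV[int]_d)) (D : seq 'cV[int]_d).

Definition nextf A (V : nmodType) (f : 'cV[int]_d -> V) g : V :=
  if Aimg A g then f (Adiv A g) else 0.

(* The transfer operator of the family, read on Fourier coefficients. *)
Definition Pop A DD (f : 'cV[int]_d -> R) (g : 'cV[int]_d) : R :=
  (size DD)%:R^-1 * \sum_(D <- DD) (size D)%:R^-1 *
    \sum_(b <- D) \sum_(b' <- D) nextf A f (g + b - b').

(** All sets have the same size, and the digits within a set are incongruent modulo the image of
    [A]; completeness is a separate hypothesis. *)
Record digit_family A DD (n : nat) : Prop := Family {
  fam_size : (0 < size DD)%N;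
  fam_card : forall D, D \in DD -> size D = n;
  fam_pos : (0 < n)%N;
  fam_uniq : forall D, D \in DD -> uniq D;
  fam_mod : forall D, D \in DD -> forall b b', b \in D -> b' \in D -> Aimg A (b - b') -> b = b'
}.

Section Fixed.
Variables (A : 'M[int]_d) (DD : seq (seq 'cV[int]_d)) (n0 : nat).
Hypothesis cA : contracting R A.
Hypothesis fD : digit_family A DD n0.

Let DD0 : 0 < (size DD)%:R :> R. Proof. by rewrite ltr0n; case: fD. Qed.
Let n00 : 0 < n0%:R :> R. Proof. by rewrite ltr0n; case: fD. Qed.

Lemma fam_sum_const a : (size DD)%:R^-1 * (\sum_(D <- DD) (size D)%:R^-1 * \sum_(b <- D) a) = a :> R.
Proof.
rewrite (eq_big_seq (fun=> a)) => [|D hD].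
  by rewrite sum_const_seq mulrA mulVf ?mul1r // gt_eqF.
by rewrite sum_const_seq mulrA mulVf ?mul1r // (fam_card fD hD) gt_eqF.
Qed.

(** Digits being incongruent, at most one [b'] makes g + b - b' divisible. So [Pop] averages over
    [D] and [b] the value at the unique successor of [g], if there is one: a substochastic
    operator. *)
Lemma next_sum D b g (f : 'cV[int]_d -> R) : D \in DD -> b \in D ->
  (exists2 b', b' \in D & exists k, g + b - b' = A *m k /\
     forall f : 'cV[int]_d -> R, \sum_(b' <- D) nextf A f (g + b - b') = f k) \/
  (forall f : 'cV[int]_d -> R, \sum_(b' <- D) nextf A f (g + b - b') = 0).
Proof.
move=> hD hb.
have [[b' hb' hi]|hn] := pselect (exists2 b', b' \in D & Aimg A (g + b - b')).
  left; exists b' => //; exists (Adiv A (g + b - b')); split; first exact: AdivE.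
  move=> f'; rewrite (bigD1_seq b') ?(fam_uniq fD hD) //= {1}/nextf hi big1_seq ?addr0 //.
  move=> c /andP[cb hc]; rewrite /nextf ifF //; apply/negP => hi'.
  move/eqP: cb; apply; apply: (fam_mod fD hD hc hb'); apply/AimgP.
  exists (Adiv A (g + b - b') - Adiv A (g + b - c)).
  by rewrite mulmxBr -!AdivE //; mxring.
right=> f'; rewrite big1_seq // => b' /andP[_ hb']; rewrite /nextf ifF //.
by apply/negP => hi; apply: hn; exists b'.
Qed.

Lemma Pop_le (G : set 'cV[int]_d) f f' :
  (forall D b b' g k, D \in DD -> b \in D -> b' \in D -> G g -> g + b - b' = A *m k -> G k) ->
  (forall g, G g -> f g <= f' g) -> forall g, G g -> Pop A DD f g <= Pop A DD f' g.
Proof.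
move=> hG hf g Gg; rewrite /Pop ler_wpM2l ?invr_ge0 ?(ltW DD0) //.
rewrite !big_seq; apply: ler_sum => D hD; rewrite ler_wpM2l ?invr_ge0 //.
rewrite !big_seq; apply: ler_sum => b hb; rewrite !big_seq; apply: ler_sum => b' hb'.
rewrite /nextf; case: ifP => // hi; apply: hf; apply: (hG D b b' g) => //.
exact: AdivE.
Qed.

Lemma Pop_scale a f g : Pop A DD (fun x => a * f x) g = a * Pop A DD f g.
Proof.
rewrite /Pop mulrCA; congr (_ * _); rewrite mulr_sumr; apply: eq_bigr => D _.
rewrite mulrCA; congr (_ * _); rewrite mulr_sumr; apply: eq_bigr => b _.
rewrite mulr_sumr; apply: eq_bigr => b' _; rewrite /nextf.
by case: ifP; rewrite ?mulr0.
Qed.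

Lemma Pop0 f : Pop A DD f 0 = f 0.
Proof.
rewrite /Pop -[RHS]fam_sum_const; congr (_ * _); apply: eq_big_seq => D hD.
congr (_ * _); apply: eq_big_seq => b hb.
have [[b' hb' [k [hk ->]]]|h] := next_sum 0 f hD hb.
  have hbb : b = b'.
    by apply: (fam_mod fD hD hb hb'); apply/AimgP; exists k; rewrite -hk add0r.
  congr f; apply: (contr_inj cA); rewrite /= -hk hbb add0r subrr mulmx0.
  by [].
have := h (fun=> 1); rewrite (bigD1_seq b) ?(fam_uniq fD hD) //= add0r subrr.
rewrite {1}/nextf ifT; last by apply/AimgP; exists 0; rewrite mulmx0.
have : 0 <= \sum_(i <- D | i != b) nextf A (fun=> 1 : R) (0 + b - i).
  by apply: sumr_ge0 => i _; rewrite /nextf; case: ifP.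
by move=> h1 h2; exfalso; move: h1; rewrite !add0r => h1; lra.
Qed.

Lemma iterPop0 m f : iter m (Pop A DD) f 0 = f 0.
Proof. by elim: m => [|m IH] //=; rewrite Pop0. Qed.

(* The mass that has not been absorbed by the frequency 0 after m steps from g. *)
Definition alive m (g : 'cV[int]_d) : R := iter m (Pop A DD) (fun x => (x != 0)%:R) g.

Lemma alive0 m : alive m 0 = 0.
Proof. by rewrite /alive iterPop0 eqxx. Qed.

Lemma Pop_ge0 f : (forall g, 0 <= f g) -> forall g, 0 <= Pop A DD f g.
Proof.
move=> hf g; rewrite mulr_ge0 ?invr_ge0 ?(ltW DD0) // sumr_ge0 // => D _.
rewrite mulr_ge0 ?invr_ge0 // sumr_ge0 // => b _; rewrite sumr_ge0 // => b' _.
by rewrite /nextf; case: ifP.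
Qed.

Lemma Pop_le1 f : (forall g, 0 <= f g <= 1) -> forall g, Pop A DD f g <= 1.
Proof.
move=> hf g; rewrite -[leRHS]fam_sum_const /Pop ler_wpM2l ?invr_ge0 ?(ltW DD0) //.
rewrite !big_seq; apply: ler_sum => D hD; rewrite ler_wpM2l ?invr_ge0 //.
rewrite !big_seq; apply: ler_sum => b hb.
have [[b' hb' [k [hk ->]]]|->] := next_sum g f hD hb; last exact: ler01.
by have /andP[] := hf k.
Qed.

Lemma alive01 m g : 0 <= alive m g <= 1.
Proof.
elim: m g => [|m IH] g; first by rewrite /alive /=; case: eqP; rewrite lexx ler01.
by rewrite /alive /= Pop_ge0 ?Pop_le1 // => h; have /andP[] := IH h.
Qed.

Lemma alive_le m n g : (m <= n)%N -> alive n g <= alive m g.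
Proof.
move=> /subnKC <-; elim: (n - m)%N g => [|j IH] g; first by rewrite addn0.
rewrite addnS; apply: le_trans (IH g).
elim: (m + j)%N g => [|i IH'] g.
  have [->|g0] := eqVneq g 0; first by rewrite !alive0.
  by rewrite {2}/alive /= g0; have /andP[] := alive01 1 g.
by apply: (@Pop_le setT) => // h _; exact: IH'.
Qed.

Definition immortal g := forall m, alive m g = 1.

Lemma immortal_neq0 g : immortal g -> g != 0.
Proof. by move=> h; apply/negP => /eqP g0; have := h 0%N; rewrite g0 alive0 => /eqP; rewrite eq_sym oner_eq0. Qed.

(** An average of numbers at most 1 equals 1 only if all of them do. The successor is determined by
    [g] and [b] alone, so it is the same for every number of steps. *)
Lemma immortal_next g D b : immortal g -> D \in DD -> b \in D ->
  exists2 b', b' \in D & exists2 k, g + b - b' = A *m k & immortal k.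
Proof.
move=> hg hD hb.
have key m : \sum_(b' <- D) nextf A (alive m) (g + b - b') = 1.
  have h1 D' b1 : D' \in DD -> b1 \in D' -> \sum_(b' <- D') nextf A (alive m) (g + b1 - b') <= 1.
    move=> hD' hb1; have [[b' _ [k [_ ->]]]|->] := next_sum g (alive m) hD' hb1.
      by have /andP[] := alive01 m k.
    exact: ler01.
  apply/eqP; rewrite eq_le h1 //=; rewrite leNgt; apply/negP => hlt.
  have := hg m.+1; rewrite {1}/alive /= -/(alive m).
  suff: Pop A DD (alive m) g < 1 by move=> h h'; rewrite h' ltxx in h.
  rewrite -[ltRHS]fam_sum_const /Pop ltr_pM2l ?invr_gt0 //.
  rewrite (big_rem D hD) /= [ltRHS](big_rem D hD) /=.
  apply: ltr_leD.
    rewrite ltr_pM2l ?invr_gt0 ?(fam_card fD hD) // (big_rem b hb) /= [ltRHS](big_rem b hb) /=.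
    apply: ltr_leD => //; rewrite !big_seq; apply: ler_sum => b1 hb1.
    by apply: h1 => //; exact: mem_rem hb1.
  rewrite !big_seq; apply: ler_sum => D' /mem_rem hD'; rewrite ler_wpM2l ?invr_ge0 //.
  by rewrite !big_seq; apply: ler_sum => b1 hb1; exact: h1.
have [[b' hb' [k [hk h]]]|h] := next_sum g (alive 0) hD hb.
  by exists b' => //; exists k => // m; rewrite -h.
by have := key 0%N; rewrite h => /eqP; rewrite eq_sym oner_eq0.
Qed.

Lemma int_box_finite (c : R) : exists s : seq 'cV[int]_d, forall g, nrm1 (zmx R g) <= c -> g \in s.
Proof.
have [m hm] : exists m : nat, c <= m%:R.
  by exists (Num.truncn c).+1; rewrite ltW // truncnS_gt.
exists [seq (\col_i ((nat_of_ord (f i))%:Z - m%:Z))%R | f : {ffun 'I_d -> 'I_(m + m).+1}] => g hg.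
have h i : (`|g i ord0| <= m%:Z)%R.
  have : `|(g i ord0)%:~R : R| <= m%:R.
    apply: le_trans (le_trans hg hm); have := nrm1_entry (zmx R g) i.
    by rewrite mxE.
  by rewrite -intr_norm -[m%:R]/(m%:Z%:~R) ler_int.
apply/mapP; exists [ffun i => inord `|(g i ord0 + m%:Z)%R|%N]; first by rewrite mem_enum.
apply/matrixP => i j; rewrite (_ : j = ord0); last exact: ord1.
have := h i; rewrite ler_norml => /andP[h1 h2].
have h3 : 0 <= g i ord0 + m%:Z by rewrite -lerBlDr sub0r.
rewrite !mxE ffunE inordK; first by rewrite gez0_abs // addrK.
rewrite -ltz_nat gez0_abs //; apply: (@le_lt_trans _ _ (m + m)%:Z); last by rewrite ltz_nat.
by rewrite PoszD lerD2r.
Qed.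

(** The usual renorming: a weighted sum of nrm1 (Rinv^j x) over j <= J, with a rate [tau] between
    [rho] and 1, shrinks already in one step. *)
Lemma adapted_norm : exists (tau : R) (N : 'cV[R]_d -> R),
  [/\ 0 <= tau, tau < 1, forall x y, N (x + y) <= N x + N y,
      forall x, nrm1 x <= N x & forall x, N (Rinv R A *m x) <= tau * N x].
Proof.
have [K [rho [K0 rho0 rho1 hK]]] := Rinv_contr cA.
pose tau := (1 + rho) / 2.
have t0 : 0 < tau by rewrite divr_gt0 // ltr_wpDr.
have t1 : tau < 1 by rewrite ltr_pdivrMr //; lra.
have r0 : 0 <= rho / tau by rewrite divr_ge0 // ltW.
have r1 : rho / tau < 1 by rewrite ltr_pdivrMr // mul1r /tau ltr_pdivlMr //; lra.
have K1 : 0 < (K + 1)^-1 by rewrite invr_gt0 ltr_wpDl.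
(* Ensures K rho^(J+1) <= tau^(J+1), so the last term of the shifted sum is absorbed by the first
   term of the old one. *)
have [J hJ] := pow_small r0 r1 K1; have {}hJ := hJ J.+1 (leqnSn J).
exists tau, (fun x => \sum_(j < J.+1) tau ^- j * nrm1 (Rinv R A ^+ j *m x)).
have ti j : 0 <= tau ^- j by rewrite invr_ge0 exprn_ge0 // ltW.
split=> //; first exact: ltW.
- move=> x y; rewrite -big_split; apply: ler_sum => j _ /=.
  by rewrite -mulrDr ler_wpM2l // mulmxDr nrm1D.
- move=> x; rewrite big_ord_recl expr0 invr1 mul1r mulTX0 lerDl sumr_ge0 // => j _.
  by rewrite mulr_ge0 ?nrm1_ge0.
- move=> x; under eq_bigr => j _ do rewrite -mulTX.
  rewrite [X in _ <= tau * X]big_ord_recl [leLHS]big_ord_recr /= expr0 invr1 mul1r mulTX0.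
  rewrite mulrDr [X in _ <= _ + X]mulr_sumr addrC lerD //.
    rewrite ler_pdivrMl ?exprn_gt0 // mulrA -exprSr.
    apply: (le_trans (hK _ _)); rewrite ler_wpM2r ?nrm1_ge0 //.
    move: hJ; rewrite expr_div_n ler_pdivrMr ?exprn_gt0 // => hJ.
    apply: (le_trans (ler_wpM2l K0 hJ)); rewrite mulrA -[leRHS]mul1r.
    rewrite ler_wpM2r ?exprn_ge0 ?(ltW t0) // ler_pdivrMr ?ltr_wpDl // mul1r lerDl.
    exact: ler01.
  apply: ler_sum => j _; rewrite /bump /= add1n [tau ^+ _.+1]exprS invfM !mulrA mulfV ?gt_eqF //.
  by rewrite mul1r.
Qed.

Section Decay.
Variable G : set 'cV[int]_d.
Hypothesis G_next : forall D b b' g k, D \in DD -> b \in D -> b' \in D ->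
  G g -> g + b - b' = A *m k -> G k.

(** A successor is Rinv (g + b - b'), so large balls of the adapted norm are mapped into themselves,
    and they contain finitely many integer vectors. *)
Lemma finite_closed g0 : G g0 -> exists (s : seq 'cV[int]_d), [/\ uniq s, g0 \in s,
  forall g, g \in s -> G g &
  forall D b b' g k, D \in DD -> b \in D -> b' \in D -> g \in s -> g + b - b' = A *m k -> k \in s].
Proof.
move=> Gg0; have [tau [N [tau0 tau1 ND Nge Nc]]] := adapted_norm.
have N_ge0 x : 0 <= N x by apply: le_trans (nrm1_ge0 x) (Nge x).
pose M := \sum_(D <- DD) \sum_(b <- D) \sum_(b' <- D) N (zmx R (b - b')).
have hM D b b' : D \in DD -> b \in D -> b' \in D -> N (zmx R (b - b')) <= M.
  move=> hD hb hb'; rewrite /M (big_rem D hD) /= (big_rem b hb) /= (big_rem b' hb') /=.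
  rewrite -!addrA lerDl !addr_ge0 // sumr_ge0 // => ? _; rewrite ?sumr_ge0 // => ? _.
  by rewrite sumr_ge0.
have h1 : 0 < 1 - tau by rewrite subr_gt0.
(* The second term is the fixed point of c = tau (c + M): beyond it the radius is preserved. *)
pose c := Num.max (N (zmx R g0)) (tau * M / (1 - tau)).
have [s hs] := int_box_finite c.
exists (undup [seq g <- s | (N (zmx R g) <= c) && `[< G g >]]); split.
- exact: undup_uniq.
- rewrite mem_undup mem_filter le_max lexx /=; apply/andP; split; first exact/asboolP.
  by apply: hs; apply: le_trans (Nge _) _; rewrite le_max lexx.
- by move=> g; rewrite mem_undup mem_filter => /andP[/andP[_ /asboolP]].
move=> D b b' g k hD hb hb'; rewrite !mem_undup !mem_filter => /andP[/andP[hg /asboolP Gg] _] hk.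
have Nk : N (zmx R k) <= c.
  have -> : zmx R k = Rinv R A *m (zmx R g + zmx R (b - b')).
    by rewrite -zmxD addrA hk zmxM Rinv_mul.
  apply: (le_trans (Nc _)); apply: (@le_trans _ _ (tau * (c + M))).
    rewrite ler_wpM2l //; apply: (le_trans (ND _ _)); apply: lerD => //.
    exact: (hM D).
  have : tau * M / (1 - tau) <= c by rewrite le_max lexx orbT.
  by rewrite ler_pdivrMr // => h2; rewrite mulrDr; lra.
rewrite Nk /= hs ?andbT; last exact: le_trans (Nge _) Nk.
by apply/asboolP; apply: (G_next hD hb hb' Gg hk).
Qed.

(** On the finite closed set a single time [n1] brings the surviving mass below some th < 1.
    Positivity and homogeneity of the operator then give th^j after j such rounds. *)
Lemma alive_decay : (forall g, G g -> ~ immortal g) ->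
  forall g, G g -> forall eps : R, 0 < eps -> exists n1, forall n, (n1 <= n)%N -> alive n g <= eps.
Proof.
move=> hG g0 Gg0 eps eps0; have [s [us g0s sG hs]] := finite_closed Gg0.
have [n1 [th [th0 th1 hth]]] : exists n1 (th : R), [/\ 0 <= th, th < 1 &
    forall g, g \in s -> alive n1 g <= th].
  have : forall g, g \in s -> G g by [].
  elim: {us g0s sG hs} s => [|g s IH] hsG; first by exists 0%N, 0; split.
  have [|n1 [th [th0 th1 hth]]] := IH; first by move=> h hh; apply: hsG; rewrite inE hh orbT.
  have [n2 hn2] : exists n2, alive n2 g < 1.
    have /existsNP[n2 h] : ~ forall m, alive m g = 1 by apply: hG; apply: hsG; rewrite mem_head.
    by exists n2; rewrite lt_neqAle; have /andP[_ ->] := alive01 n2 g; rewrite andbT; apply/eqP.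
  exists (maxn n1 n2), (Num.max th (alive n2 g)); split.
  - by rewrite le_max th0.
  - by rewrite gt_max th1.
  move=> h; rewrite inE => /orP[/eqP ->|hh]; rewrite le_max.
    by rewrite (alive_le g (leq_maxr n1 n2)) orbT.
  by rewrite (le_trans (alive_le h (leq_maxl n1 n2)) (hth h hh)).
have key j g : g \in s -> alive (j * n1) g <= th ^+ j.
  elim: j g => [|j IH] g hg; first by rewrite expr0; have /andP[] := alive01 0 g.
  have -> : alive (j.+1 * n1) g = iter n1 (Pop A DD) (alive (j * n1)) g by rewrite /alive mulSn iterD.
  apply: (@le_trans _ _ (th ^+ j * alive n1 g)); last first.
    by rewrite exprSr ler_wpM2l ?exprn_ge0 // hth.
  have step m h : h \in s -> iter m (Pop A DD) (alive (j * n1)) h <= th ^+ j * alive m h.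
    elim: m h => [|m IHm] h hh.
      rewrite /alive /=; have [->|h0] := eqVneq h 0; first by rewrite iterPop0 eqxx mulr0.
      by rewrite mulr1; exact: IH.
    rewrite /alive /= -/(alive m) -Pop_scale.
    by apply: (@Pop_le [set x | x \in s]%classic) => // D b b' x k hD hb hb' /= hx; exact: (hs D b b').
  exact: step.
have [j0 hj0] := pow_small th0 th1 eps0.
exists (j0 * n1)%N => n hn; apply: le_trans (alive_le g0 hn) _.
by apply: le_trans (key j0 g0 g0s) (hj0 j0 (leqnn _)).
Qed.

End Decay.

End Fixed.
End Family.

(** * Powers of a digit family and the transfer identity *)

Section PowerFamily.
Variables (R : realType) (d : nat).
Local Notation e := (@e2pii R).
Implicit Types (A : 'M[int]_d) (DD : seq (seq 'cV[int]_d)) (D E : seq 'cV[int]_d).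

Lemma zmx_unitX A n : zmx R A \in unitmx -> zmx R (A ^+ n) \in unitmx.
Proof.
move=> uA; rewrite zmxX; elim: n => [|n IH]; first by rewrite expr0 unitmx1.
by rewrite exprS unitmx_mul uA.
Qed.

Lemma RinvX A n : zmx R A \in unitmx -> Rinv R (A ^+ n) = Rinv R A ^+ n.
Proof.
move=> uA; have h : zmx R (A ^+ n) *m (Rinv R A ^+ n) = 1%:M.
  rewrite zmxX; elim: n => [|n IH]; first by rewrite !expr0 mul1mx.
  rewrite exprSr exprS -[_ * zmx R A]/(_ *m zmx R A) -[Rinv R A * _]/(Rinv R A *m _).
  by rewrite -mulmxA (mulmxA (zmx R A)) mulmxV // mul1mx.
by rewrite -[RHS]mul1mx -(mulVmx (zmx_unitX n uA)) -mulmxA h mulmx1.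
Qed.

Lemma TinvX A n : zmx R A \in unitmx -> Tinv R (A ^+ n) = Tinv R A ^+ n.
Proof. by move=> uA; rewrite /Tinv RinvX // trmxX. Qed.

Lemma contractingX A n : contracting R A -> contracting R (A ^+ n.+1).
Proof.
move=> [uA [K [rho [K0 rho0 rho1 h]]]]; split; first exact: zmx_unitX.
exists K, (rho ^+ n.+1); split => //; first exact: exprn_ge0.
  by rewrite exprn_ilt1.
by move=> j i k; rewrite RinvX // -!exprM mulnC.
Qed.

Fixpoint fam_pow A DD n : seq (seq 'cV[int]_d) := if n is m.+1 then
  [seq [seq b + A *m x | b <- D, x <- E] | D <- DD, E <- fam_pow A DD m] else [:: [:: 0]].

Section Fixed.
Variables (A : 'M[int]_d) (DD : seq (seq 'cV[int]_d)) (n0 : nat).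
Hypothesis cA : contracting R A.
Hypothesis fD : digit_family A DD n0.

Lemma digit_split b b' x x' k D : D \in DD -> b \in D -> b' \in D ->
  (b + A *m x) - (b' + A *m x') = A *m k -> b = b' /\ x - x' = k.
Proof.
move=> hD hb hb' h.
have hbb : b = b'.
  apply: (fam_mod fD hD hb hb'); apply/AimgP; exists (k - (x - x')).
  by rewrite !mulmxBr -h; mxring.
split=> //; apply: (contr_inj cA); rewrite /= -h hbb mulmxBr; mxring.
Qed.

Lemma AXS n (x : 'cV[int]_d) : A ^+ n.+1 *m x = A *m (A ^+ n *m x).
Proof. exact: mulTXl. Qed.

Lemma fam_powP n : digit_family (A ^+ n) (fam_pow A DD n) (n0 ^ n)%N.
Proof.
elim: n => [|n IH].
  split=> // D; rewrite inE => /eqP -> //.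
  by move=> b b'; rewrite !inE => /eqP -> /eqP ->.
split.
- by rewrite size_allpairs muln_gt0 (fam_size fD) (fam_size IH).
- move=> _ /allpairsP[[D E] /= [hD hE ->]].
  by rewrite size_allpairs (fam_card fD hD) (fam_card IH hE) expnS.
- by rewrite expn_gt0 (fam_pos fD).
- move=> _ /allpairsP[[D E] /= [hD hE ->]]; apply: allpairs_uniq.
  + exact: (fam_uniq fD).
  + exact: (fam_uniq IH).
  move=> [b x] [b' x'] /allpairsP[[? ?] /= [h1 h2 [-> ->]]] /allpairsP[[? ?] /= [h3 h4 [-> ->]]] h.
  have [-> /eqP] := @digit_split _ _ _ _ 0 _ hD h1 h3 (etrans (etrans (congr1 (fun z => z - _) h) (subrr _)) (esym (mulmx0 _ A))).
  by rewrite subr_eq0 => /eqP ->.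
- move=> _ /allpairsP[[D E] /= [hD hE ->]] _ _ /allpairsP[[b x] /= [h1 h2 ->]] /allpairsP[[b' x'] /= [h3 h4 ->]].
  move=> /AimgP[k]; rewrite AXS => /(digit_split hD h1 h3)[-> h].
  by rewrite (fam_mod IH hE h2 h4) //; apply/AimgP; exists k.
Qed.

Lemma mean_e_sumset D E (y : 'cV[R]_d) :
  mean_e [seq b + A *m x | b <- D, x <- E] y = mean_e D y * mean_e E ((zmx R A)^T *m y).
Proof.
rewrite /mean_e size_allpairs natrM invfM crM mulrACA; congr (_ * _).
rewrite big_allpairs_dep mulr_suml; apply: eq_bigr => b _; rewrite mulr_sumr.
by apply: eq_bigr => x _; rewrite zmxD zmxM dotvDr e2piiD dotv_mulr.
Qed.

Lemma mean_sqn_powS n (y : 'cV[R]_d) :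
  mean_sqn (fam_pow A DD n.+1) y =
  mean_sqn DD y * mean_sqn (fam_pow A DD n) ((zmx R A)^T *m y).
Proof.
rewrite /mean_sqn size_allpairs natrM invfM mulrACA; congr (_ * _).
rewrite big_allpairs_dep mulr_suml; apply: eq_bigr => D _; rewrite mulr_sumr.
by apply: eq_bigr => E _; rewrite mean_e_sumset sqnM.
Qed.

Lemma AT_Tinv (x : 'cV[R]_d) : (zmx R A)^T *m (Tinv R A *m x) = x.
Proof.
by rewrite mulmxA /Tinv -trmx_mul mulVmx ?trmx1 ?mul1mx //; case: cA.
Qed.

Lemma Tinv_AT (x : 'cV[R]_d) : Tinv R A *m ((zmx R A)^T *m x) = x.
Proof.
by rewrite mulmxA /Tinv -trmx_mul mulmxV ?trmx1 ?mul1mx //; case: cA.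
Qed.

Lemma mean_sqn_pow0 (y : 'cV[R]_d) : mean_sqn (fam_pow A DD 0) y = 1.
Proof. by rewrite mean_sqn1 /mean_e big_seq1 zmx0 dotv0r e2pii0 mulr1 /= invr1 sqn_real expr1n. Qed.

Lemma mean_sqn_pow n (x : 'cV[R]_d) :
  mean_sqn (fam_pow A DD n) (Tinv R A ^+ n *m x) = qn (Tinv R A) (mean_sqn DD) n x.
Proof.
elim: n x => [|n IH] x; first by rewrite mean_sqn_pow0.
have -> : qn (Tinv R A) (mean_sqn DD) n.+1 x =
  qn (Tinv R A) (mean_sqn DD) n x * mean_sqn DD (Tinv R A ^+ n.+1 *m x).
  by rewrite -{1}(addn1 n) qnD /= mulr1 mulTXl.
by rewrite mean_sqn_powS mulrC {1}mulTXl AT_Tinv IH.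
Qed.

Lemma nextf_pow n (V : nmodType) (f : 'cV[int]_d -> V) g b b' x x' :
  nextf (A ^+ n.+1) f (g + (b + A *m x) - (b' + A *m x')) =
  nextf A (fun k => nextf (A ^+ n) f (k + x - x')) (g + b - b').
Proof.
rewrite {2}/nextf; case: ifP => hi; last first.
  rewrite /nextf ifF //; apply/negP => /AimgP[z]; rewrite AXS => h.
  move/negP: hi; apply; apply/AimgP; exists (A ^+ n *m z - x + x').
  by rewrite mulmxDr mulmxBr -h; mxring.
have hk := AdivE hi; set k := Adiv A _ in hk *.
have -> : g + (b + A *m x) - (b' + A *m x') = A *m (k + x - x').
  rewrite mulmxBr mulmxDr -hk; mxring.
rewrite /nextf; have -> : Aimg (A ^+ n.+1) (A *m (k + x - x')) = Aimg (A ^+ n) (k + x - x').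
  apply/AimgP/AimgP => -[z hz]; exists z; last by rewrite hz AXS.
  by apply: (contr_inj cA); rewrite /= hz AXS.
case: ifP => // hi2; congr f.
by rewrite {1}(AdivE hi2) -AXS (Adiv_mul _ (contractingX n cA)).
Qed.

(** Digits of the power are radix expansions, so a division by A^n is n successive divisions by [A].
    Identities for one step thereby cover n steps. *)
Lemma Pop_pow n f g : Pop (R := R) (A ^+ n) (fam_pow A DD n) f g = iter n (Pop A DD) f g.
Proof.
elim: n g => [|n IH] g.
  rewrite /Pop [fam_pow _ _ _]/= big_seq1 [size _]/= invr1 !mul1r !big_seq1 addr0 subr0.
  have hg : Aimg (A ^+ 0) g by apply/AimgP; exists g; rewrite mulTX0.
  rewrite /nextf hg; congr f; have := AdivE hg; rewrite mulTX0 => <- //.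
have -> : iter n.+1 (Pop A DD) f g = Pop A DD (Pop (A ^+ n) (fam_pow A DD n) f) g.
  rewrite /= /Pop; congr (_ * _); apply: eq_bigr => D _; congr (_ * _).
  apply: eq_bigr => b _; apply: eq_bigr => b' _; rewrite /nextf.
  by case: ifP => // _; rewrite -IH.
rewrite {1}/Pop size_allpairs natrM invfM -mulrA {2}/Pop; congr (_ * _).
rewrite big_allpairs_dep mulr_sumr; apply: eq_bigr => D _.
under eq_bigr => E _ do rewrite size_allpairs natrM invfM -mulrA.
rewrite -mulr_sumr mulrCA; congr (_ * _).
under eq_bigr => E _.
  rewrite big_allpairs_dep; under eq_bigr => b _.
    under eq_bigr => x _ do rewrite big_allpairs_dep.
    rewrite exchange_big /=.
    over.
  rewrite mulr_sumr.
  over.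
rewrite exchange_big /= mulr_sumr; apply: eq_bigr => b _.
under eq_bigr => E _ do rewrite mulr_sumr.
rewrite exchange_big /= mulr_sumr; apply: eq_bigr => b' _.
under eq_bigr => E _.
  under eq_bigr => x _ do under eq_bigr => x' _ do rewrite nextf_pow.
  over.
rewrite /= {2}/nextf /nextf; case: ifP => // _.
by rewrite big1 ?mulr0 // => E _; rewrite big1 ?mulr0 // => x _; rewrite big1.
Qed.

Lemma contr_fam_pow n : contracting R (A ^+ n.+1) /\
  digit_family (A ^+ n.+1) (fam_pow A DD n.+1) (n0 ^ n.+1)%N.
Proof. by split; [exact: contractingX|exact: fam_powP]. Qed.

End Fixed.

Section Transfer.
Variables (A : 'M[int]_d) (DD : seq (seq 'cV[int]_d)) (n0 : nat).
Hypothesis cA : contracting R A.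
Hypothesis fD : digit_family A DD n0.
Variable Q : seq 'cV[int]_d.
Hypothesis Q0 : (0 < size Q)%N.

(** The Ruelle operator with weight [mean_sqn], summed over the points T (y + l), sends characters
    to combinations of characters, with coefficients given by [Pop]. The factor [z] gives access to
    real and imaginary parts alike. *)
Lemma transfer_op (z : R[i]) (y : 'cV[R]_d) (g : 'cV[int]_d) :
  (forall D b b', D \in DD -> b \in D -> b' \in D ->
    \sum_(l <- Q) e (dotv (zmx R l) (Rinv R A *m zmx R (g + b - b'))) =
     cr (size Q)%:R * (Aimg A (g + b - b'))%:R) ->
  n0%:R / (size Q)%:R * \sum_(l <- Q) mean_sqn DD (Tinv R A *m (y + zmx R l)) *
     complex.Re (z * e (dotv (zmx R g) (Tinv R A *m (y + zmx R l)))) =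
  Pop A DD (fun k => complex.Re (z * e (dotv (zmx R k) y))) g.
Proof.
move=> hQ; have Q1 : (size Q)%:R != 0 :> R by rewrite pnatr_eq0 -lt0n.
have n1 : n0%:R != 0 :> R by rewrite pnatr_eq0 -lt0n (fam_pos fD).
rewrite /mean_sqn /Pop.
under eq_bigr => l _ do rewrite -mulrA.
rewrite -mulr_sumr mulrCA; congr (_ * _).
under eq_bigr => l _ do rewrite mulr_suml.
rewrite exchange_big /= mulr_sumr; apply: eq_big_seq => D hD.
rewrite (fam_card fD hD) mulrC.
transitivity (complex.Re (\sum_(l <- Q) cr (sqn (mean_e D (Tinv R A *m (y + zmx R l)))) *
    (z * e (dotv (zmx R g) (Tinv R A *m (y + zmx R l))))) * (n0%:R / (size Q)%:R)).
  by rewrite Re_sum; congr (_ * _); apply: eq_bigr => l _; rewrite ReZ.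
have -> : \sum_(l <- Q) cr (sqn (mean_e D (Tinv R A *m (y + zmx R l)))) *
    (z * e (dotv (zmx R g) (Tinv R A *m (y + zmx R l)))) =
    cr (n0%:R ^- 2) * \sum_(b <- D) \sum_(b' <- D) \sum_(l <- Q)
      (z * e (dotv y (Rinv R A *m zmx R (g + b - b')))) *
       e (dotv (zmx R l) (Rinv R A *m zmx R (g + b - b'))).
  rewrite mulr_sumr.
  under [RHS]eq_bigr => b _ do rewrite exchange_big /= mulr_sumr.
  rewrite exchange_big /=; apply: eq_bigr => l _.
  rewrite /mean_e (fam_card fD hD) sqnM sqn_real crM -exprVn -mulrA -mulr_sumr; congr (_ * _).
  rewrite sqnE cj_sum mulr_suml mulr_suml; apply: eq_bigr => b _.
  rewrite mulr_sumr mulr_suml; apply: eq_bigr => b' _.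
  rewrite e2pii_mulJ mulrCA -mulrA; congr (_ * _); rewrite -!e2piiD; congr e2pii.
  rewrite !dot_Rinv -dotvDl -mulmxDr zmxB zmxD dotvBr dotvDr (dotvC (zmx R g)).
  ring.
have -> : \sum_(b <- D) \sum_(b' <- D) \sum_(l <- Q)
      (z * e (dotv y (Rinv R A *m zmx R (g + b - b')))) *
       e (dotv (zmx R l) (Rinv R A *m zmx R (g + b - b'))) =
  cr (size Q)%:R * \sum_(b <- D) \sum_(b' <- D)
     nextf A (fun k => z * e (dotv (zmx R k) y)) (g + b - b').
  rewrite mulr_sumr; apply: eq_big_seq => b hb; rewrite mulr_sumr; apply: eq_big_seq => b' hb'.
  rewrite -mulr_sumr (hQ D) // mulrCA; congr (_ * _); rewrite /nextf; case: ifP => hi; last by rewrite mulr0.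
  by rewrite mulr1 (Aimg_Rinv cA hi) dotvC.
rewrite mulrA -crM ReZ Re_sum mulrC mulrA; congr (_ * _).
  by field; rewrite n1 Q1.
apply: eq_bigr => b _; rewrite Re_sum; apply: eq_bigr => b' _.
by rewrite /nextf; case: ifP.
Qed.

End Transfer.

Section Box.

Lemma geometric_e (t : R) (m : nat) : (0 < m)%N -> isint (m%:R * t) ->
  \sum_(j < m) e (j%:R * t) = (if `[< isint t >] then m%:R else 0).
Proof.
move=> m0 ht; case: asboolP => hi.
  rewrite (eq_bigr (fun=> 1)) ?sumr_const ?card_ord // => j _.
  by rewrite isint_e //; case: hi => n ->; exists (j%:Z * n); rewrite intrM.
have hpow (j : nat) : e (j%:R * t) = e t ^+ j.
  elim: j => [|j IH]; first by rewrite mul0r e2pii0.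
  by rewrite -natr1 mulrDl mul1r e2piiD IH exprSr.
under eq_bigr => j _ do rewrite hpow.
have h1 : e t - 1 != 0.
  by apply/negP; rewrite subr_eq0 => /eqP /e2pii_eq1.
apply/eqP; rewrite -(mulrI_eq0 _ (mulfI h1)) -subrX1 -hpow isint_e //.
by rewrite subrr.
Qed.

Definition box m : seq 'cV[int]_d :=
  [seq \col_i ((f i : nat)%:Z)%R | f : {ffun 'I_d -> 'I_m}].

Lemma size_box m : size (box m) = (m ^ d)%N.
Proof. by rewrite size_map -cardE card_ffun !card_ord. Qed.

Lemma box_sum (x : 'cV[R]_d) m : (0 < m)%N -> (forall i, isint (m%:R * x i ord0)) ->
  \sum_(l <- box m) e (dotv (zmx R l) x) = cr (size (box m))%:R * (`[< isintv x >])%:R.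
Proof.
move=> m0 hx; rewrite size_box big_map big_enum /=.
transitivity (\sum_(f : {ffun 'I_d -> 'I_m}) \prod_i e ((f i)%:R * x i ord0)).
  apply: eq_bigr => f _; rewrite /dotv.
  transitivity (e (\sum_(i < d) (f i)%:R * x i ord0)).
    by congr e2pii; apply: eq_bigr => i _; rewrite !mxE.
  by apply: (big_morph _ (@e2piiD R) (@e2pii0 R)).
rewrite -(bigA_distr_bigA (fun i j => e ((nat_of_ord j)%:R * x i ord0))) /=.
under eq_bigr => i _ do rewrite geometric_e //.
case: asboolP => hi.
  rewrite mulr1 (eq_bigr (fun=> m%:R)); last first.
    by move=> i _; rewrite ifT //; apply/asboolP; case: hi => k ->; rewrite mxE; exists (k i ord0).
  by rewrite prodr_const card_ord natrX /cr rmorphXn rmorph_nat.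
have [i hi'] : exists i, ~ isint (x i ord0).
  by apply/existsNP => h; apply: hi; apply: isintvP.
by rewrite (bigD1 i) //= ifF ?mul0r ?mulr0 //; apply/asboolP.
Qed.

(** By the adjugate, det A times the inverse of [A] is integral, so on a box of side |det A| the
    sums are full geometric sums that detect divisibility. *)
Lemma box_avg (A : 'M[int]_d) : contracting R A ->
  exists2 Q : seq 'cV[int]_d, (0 < size Q)%N & forall g : 'cV[int]_d,
    \sum_(l <- Q) e (dotv (zmx R l) (Rinv R A *m zmx R g)) = cr (size Q)%:R * (Aimg A g)%:R.
Proof.
move=> cA; have [uA _] := cA.
have dA : \det A != 0.
  apply/negP => /eqP h0; move: uA; rewrite unitmxE.
  by rewrite /zmx det_map_mx h0 unitr0.
pose m := `|\det A|%N; have m0 : (0 < m)%N by rewrite absz_gt0.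
exists (box m) => [|h]; first by rewrite size_box expn_gt0 m0.
rewrite box_sum //.
  congr (_ * _%:R); congr nat_of_bool; apply/asboolP/idP => [hi|hi].
    exact: (@Aimg_isintv d R).
  by rewrite (Aimg_Rinv cA hi); exists (Adiv A h).
move=> i; have -> : m%:R * (Rinv R A *m zmx R h) i ord0 =
   (Num.sg (\det A))%:~R * (zmx R (\adj A *m h)) i ord0.
  rewrite /Rinv /invmx uA /zmx det_map_mx -scalemxAl mxE mulrA.
  rewrite -[\adj (map_mx _ _)]map_mx_adj -map_mxM; congr (_ * _).
  rewrite -[m%:R]/(m%:Z%:~R) /m abszE normrEsg intrM mulfK //.
  by rewrite intr_eq0.
by rewrite mxE -intrM; exact: isint_int.
Qed.

End Box.
End PowerFamily.

Section Periodic.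
Variables (R : realType) (d : nat).
Local Notation e := (@e2pii R).
Implicit Types (A : 'M[int]_d) (DD : seq (seq 'cV[int]_d)) (D : seq 'cV[int]_d).

Lemma mean_e_int D (y : 'cV[R]_d) k : mean_e D (y + zmx R k) = mean_e D y.
Proof.
congr (_ * _); apply: eq_bigr => b _.
by rewrite dotvDl e2piiD (isint_e (dotv_int _ _ _)) mulr1.
Qed.

Lemma mean_sqn_int DD (y : 'cV[R]_d) k : mean_sqn DD (y + zmx R k) = mean_sqn DD y.
Proof. by congr (_ * _); apply: eq_bigr => D _; rewrite mean_e_int. Qed.

Variables (A : 'M[int]_d) (DD : seq (seq 'cV[int]_d)) (n0 : nat).
Hypothesis cA : contracting R A.
Hypothesis fD : digit_family A DD n0.

(** The first n factors depend only on integral expressions of the shift T^j S^n k with j <= n. *)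
Lemma qn_int n (x : 'cV[R]_d) (k : 'cV[int]_d) :
  qn (Tinv R A) (mean_sqn DD) n (x + zmx R (A^T ^+ n *m k)) = qn (Tinv R A) (mean_sqn DD) n x.
Proof.
by rewrite -!(mean_sqn_pow DD cA) mulmxDr TinvX_mul // mean_sqn_int.
Qed.

Lemma transfer_iter n (Q : seq 'cV[int]_d) (z : R[i]) (y : 'cV[R]_d) (g : 'cV[int]_d) :
  (0 < size Q)%N ->
  (forall D b b', D \in fam_pow A DD n.+1 -> b \in D -> b' \in D ->
    \sum_(l <- Q) e (dotv (zmx R l) (Rinv R (A ^+ n.+1) *m zmx R (g + b - b'))) =
     cr (size Q)%:R * (Aimg (A ^+ n.+1) (g + b - b'))%:R) ->
  (n0 ^ n.+1)%:R / (size Q)%:R * \sum_(l <- Q) qn (Tinv R A) (mean_sqn DD) n.+1 (y + zmx R l) *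
     complex.Re (z * e (dotv (zmx R g) (Tinv R A ^+ n.+1 *m (y + zmx R l)))) =
  iter n.+1 (Pop A DD) (fun k => complex.Re (z * e (dotv (zmx R k) y))) g.
Proof.
move=> Q0 hQ; rewrite -(Pop_pow DD cA).
have [cAn fDn] := contr_fam_pow cA fD n.
rewrite -(transfer_op cAn fDn Q0 _ _ hQ); congr (_ * _).
apply: eq_bigr => l _; rewrite -(mean_sqn_pow DD cA) TinvX //.
by case: cA.
Qed.

Lemma iterPop_le m (f f' : 'cV[int]_d -> R) :
  (forall g, f g <= f' g) -> forall g, iter m (Pop A DD) f g <= iter m (Pop A DD) f' g.
Proof.
move=> h; elim: m => [|m IH] g //=.
by apply: (Pop_le fD (G := setT)).
Qed.

Lemma iterPop_scale m a (f : 'cV[int]_d -> R) g :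
  iter m (Pop A DD) (fun x => a * f x) g = a * iter m (Pop A DD) f g.
Proof.
elim: m g => [|m IH] g //=.
rewrite -Pop_scale; congr (Pop A DD _ g); apply/funext => x; exact: IH.
Qed.

Lemma alive_uniform (J : eqType) (s : seq J) (g : J -> 'cV[int]_d) (delta : R) :
  (forall g, ~ immortal R A DD g) -> 0 < delta ->
  exists n, forall j, j \in s -> alive R A DD n.+1 (g j) <= delta.
Proof.
move=> hno d0.
suff [n hn] : exists n, forall j, j \in s -> alive R A DD n (g j) <= delta.
  by exists n => j hj; apply: le_trans (alive_le cA fD _ (leqnSn n)) (hn _ hj).
elim: s => [|j s [n IH]]; first by exists 0%N.
have [||n' h] := alive_decay cA fD (G := setT) _ _ (I : setT (g j)) d0; first by [].
  by move=> k _; exact: hno.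
exists (maxn n n') => i; rewrite inE => /orP[/eqP ->|hi]; first by apply: h; rewrite leq_maxr.
by apply: le_trans (IH _ hi); apply: (alive_le cA fD); rewrite leq_maxl.
Qed.

End Periodic.

(** * A kernel of Fejer type *)

Section Cosine.
Variables (R : realType) (d : nat).
Local Notation e := (@e2pii R).

(** With s the square root of [r], one factor s^M pays for M + 1, since s^M (M + 1) is at most the
    geometric sum; the other is left to the induction. *)
Lemma pow_poly_bound n (r : R) : 0 <= r -> r < 1 -> exists C : R, forall M : nat, r ^+ M * (M.+1)%:R ^+ n <= C.
Proof.
elim: n r => [|n IH] r r0 r1.
  by exists 1 => M; rewrite expr0 mulr1 exprn_ile1 // ltW.
pose s := Num.sqrt r; have s0 : 0 <= s by exact: sqrtr_ge0.
have s1 : s < 1 by rewrite -[ltRHS]sqrtr1 ltr_sqrt.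
have [C hC] := IH s s0 s1.
have C0 : 0 <= C by apply: le_trans (hC 0%N); rewrite expr0 mul1r exprn_ge0.
exists (C * (1 - s)^-1) => M.
have -> : r ^+ M * M.+1%:R ^+ n.+1 = (s ^+ M * M.+1%:R ^+ n) * (s ^+ M * M.+1%:R).
  by rewrite exprSr -[r](sqr_sqrtr r0) -/s -exprM mul2n -addnn exprD; ring.
apply: ler_pM => //; try by rewrite mulr_ge0 // exprn_ge0.
have h1 : 0 < 1 - s by rewrite subr_gt0.
rewrite -[leRHS]mul1r ler_pdivlMr //.
apply: (@le_trans _ _ ((\sum_(i < M.+1) s ^+ i) * (1 - s))).
  rewrite ler_wpM2r // ?(ltW h1) //.
  rewrite mulr_natr -[M.+1 in leLHS]card_ord -sumr_const; apply: ler_sum => i _.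
  by rewrite ler_wiXn2l // ?(ltW s1) // -ltnS.
have -> : (\sum_(i < M.+1) s ^+ i) * (1 - s) = 1 - s ^+ M.+1.
  rewrite mulrC -[in RHS](expr1n R M.+1) subrXX; congr (_ * _); apply: eq_bigr => i _.
  by rewrite expr1n mul1r.
by rewrite lerBlDr lerDl exprn_ge0.
Qed.

Lemma pow_poly_small n (r : R) : 0 <= r -> r < 1 -> exists M : nat, r ^+ M * (M.+1)%:R ^+ n <= 4^-1.
Proof.
move=> r0 r1; pose s := Num.sqrt r; have s0 : 0 <= s by exact: sqrtr_ge0.
have s1 : s < 1 by rewrite -[ltRHS]sqrtr1 ltr_sqrt.
have [C hC] := pow_poly_bound n s0 s1.
have C0 : 0 <= C by apply: le_trans (hC 0%N); rewrite expr0 mul1r exprn_ge0.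
have C1 : 0 < (4 * (C + 1))^-1 by rewrite invr_gt0 mulr_gt0 // ltr_wpDl.
have [M hM] := pow_small s0 s1 C1.
exists M; have -> : r ^+ M * M.+1%:R ^+ n = s ^+ M * (s ^+ M * M.+1%:R ^+ n).
  by rewrite -[in LHS](sqr_sqrtr r0) -/s -exprM mul2n -addnn exprD; ring.
apply: (@le_trans _ _ ((4 * (C + 1))^-1 * (C + 1))).
  apply: ler_pM; rewrite ?exprn_ge0 //; first by rewrite mulr_ge0 // exprn_ge0.
    exact: hM.
  by apply: le_trans (hC M) _; rewrite lerDl.
by rewrite invfM -mulrA mulVf ?mulr1 // gt_eqF // ltr_wpDl.
Qed.

Variable M : nat.
Let I : finType := {ffun 'I_d -> 'I_M.+1}.

Definition cosv (f : I) : 'cV[int]_d := \col_i (f i : nat)%:Z.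
Definition cosc (f : I) : R := \prod_i ('C(M, f i)%:R * 2 ^- M).
(** The product over coordinates of ((1 + e(x_i)) / 2)^M, expanded. Its squared modulus is the
    product of cos(pi x_i)^(2M), concentrated at integer points. *)
Definition cosp (x : 'cV[R]_d) : R[i] := \sum_(f : I) cr (cosc f) * e (dotv (zmx R (cosv f)) x).

Lemma cosc_ge0 f : 0 <= cosc f.
Proof. by apply: prodr_ge0 => i _; rewrite mulr_ge0 // invr_ge0 exprn_ge0. Qed.

Lemma cospE x : cosp x = \prod_i (cr 2^-1 * (1 + e (x i ord0))) ^+ M.
Proof.
rewrite /cosp.
transitivity (\sum_(f : I) \prod_i (cr ('C(M, f i)%:R * 2 ^- M) * e (x i ord0) ^+ (f i))).
  apply: eq_bigr => f _; rewrite big_split /=; congr (_ * _).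
    by rewrite /cosc (big_morph _ (@crM R) (@cr1 R)).
  transitivity (e (\sum_(i < d) (f i : nat)%:R * x i ord0)).
    by congr e2pii; apply: eq_bigr => i _; rewrite !mxE.
  rewrite (big_morph _ (@e2piiD R) (@e2pii0 R)); apply: eq_bigr => i _.
  elim: (nat_of_ord (f i)) => [|m IH]; first by rewrite mul0r e2pii0.
  by rewrite -natr1 mulrDl mul1r e2piiD IH exprSr.
rewrite -(bigA_distr_bigA (fun i j => cr ('C(M, nat_of_ord j)%:R * 2 ^- M) * e (x i ord0) ^+ j)) /=.
apply: eq_bigr => i _; rewrite exprMn [in RHS]exprDn mulr_sumr; apply: eq_bigr => j _.
by rewrite expr1n mul1r crM cr_nat -exprVn crX -[e _ ^+ j *+ _]mulr_natr [LHS]mulrC [RHS]mulrC -[RHS]mulrA.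
Qed.

Lemma sum_cosc : \sum_f cosc f = 1.
Proof.
apply: (@cr_inj R); rewrite cr_sum.
transitivity (cosp 0).
  by rewrite /cosp; apply: eq_bigr => f _; rewrite dotv0r e2pii0 mulr1.
rewrite cospE big1 // => i _; rewrite mxE e2pii0 -[1 + 1]/(2%:R : R[i]).
by rewrite -(cr_nat R 2) -crM mulVf ?cr1 ?expr1n // pnatr_eq0.
Qed.

(** The left side bounds from below the constant Fourier coefficient of the kernel. It decays only
    polynomially in M, while the kernel decays exponentially away from the lattice. *)
Lemma sum_cosc2 : ((M.+1)%:R ^+ d)^-1 <= \sum_f cosc f ^+ 2.
Proof.
have := sqn_sum_le (enum I) (fun f => cr (cosc f)).
rewrite !big_enum -cr_sum sum_cosc sqn_real expr1n -cardE card_ffun !card_ord natrX.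
under eq_bigr => f _ do rewrite sqn_real.
by rewrite -ler_pdivrMl ?exprn_gt0 // mulr1.
Qed.

Lemma sqn_half (t : R) : sqn (cr 2^-1 * (1 + e t)) = (1 + cos (2 * pi * t)) / 2.
Proof.
rewrite sqnM sqn_real /sqn /=; have := cos2Dsin2 (2 * pi * t).
set c := cos _; set s := sin _ => h.
have -> : (1 + c) ^+ 2 + (0 + s) ^+ 2 = 1 + 2 * c + (c ^+ 2 + s ^+ 2) by ring.
by rewrite h; field.
Qed.

Lemma sqn_half01 (t : R) : 0 <= sqn (cr 2^-1 * (1 + e t)) <= 1.
Proof.
rewrite sqn_ge0 sqn_half /=; have := cos_le1 (2 * pi * t); lra.
Qed.

Lemma sqnX (z : R[i]) n : sqn (z ^+ n) = sqn z ^+ n.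
Proof. by elim: n => [|n IH]; rewrite ?sqn1 // !exprS sqnM IH. Qed.

Lemma sqn_prod (J : finType) (F : J -> R[i]) : sqn (\prod_i F i) = \prod_i sqn (F i).
Proof. by apply: (big_morph _ (@sqnM R) (@sqn1 R)). Qed.

Lemma sqn_cosp_le1 x : sqn (cosp x) <= 1.
Proof.
rewrite cospE sqn_prod; apply: prodr_ile1 => i _.
by have /andP[h0 h1] := sqn_half01 (x i ord0); rewrite sqnX exprn_ge0 //= exprn_ile1.
Qed.

Lemma sqn_cosp_far x (eta : R) : 0 < eta -> eta <= 2^-1 ->
  (exists k, nrm1 (x - zmx R k) <= d%:R * eta) \/
  sqn (cosp x) <= ((1 + cos (2 * pi * eta)) / 2) ^+ M.
Proof.
move=> e0 e1; case: (pselect (forall i, exists n : int, `|x i ord0 - n%:~R| < eta)) => h.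
  left; have [f hf] := choice h; exists (\col_i f i).
  rewrite /nrm1 mulr_natl -[d in leRHS]card_ord -sumr_const; apply: ler_sum => i _.
  by rewrite !mxE ltW.
right; move/existsNP: h => [i hi].
rewrite cospE sqn_prod (bigD1 i) //= -[leRHS]mulr1; apply: ler_pM.
- exact: sqn_ge0.
- by apply: prodr_ge0 => j _; apply: sqn_ge0.
- rewrite sqnX; apply: lerXn2r; rewrite ?nnegrE ?sqn_ge0 //.
  rewrite [leLHS]sqn_half; suff : cos (2 * pi * x i ord0) <= cos (2 * pi * eta) by lra.
  by rewrite leNgt; apply/negP => /(cos_near e0 e1).
- apply: prodr_ile1 => j _.
  by have /andP[h0 h1] := sqn_half01 (x j ord0); rewrite sqnX exprn_ge0 //= exprn_ile1.
Qed.

Lemma sqn_cosp x : sqn (cosp x) = \sum_(f : I) \sum_(g : I)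
  complex.Re (cr (cosc f * cosc g) * e (dotv (zmx R (cosv f - cosv g)) x)).
Proof.
have -> : sqn (cosp x) = complex.Re (cr (sqn (cosp x))) by [].
rewrite sqnE cj_sum mulr_suml Re_sum; apply: eq_bigr => f _.
rewrite mulr_sumr Re_sum; apply: eq_bigr => g _.
by rewrite cjM cj_cr mulrACA -crM e2pii_mulJ zmxB dotvBl.
Qed.

End Cosine.

Section Equipositive.
Variables (R : realType) (d : nat).
Local Notation e := (@e2pii R).
Variables (A : 'M[int]_d) (B : seq 'cV[int]_d).
Hypothesis cA : contracting R A.
Hypothesis fB : digit_family A [:: B] (size B).
Hypothesis hno : forall g, ~ immortal R A [:: B] g.

Let u01 := @mean_sqn_01 R d [:: B].

(** If q were below [eps] on all of y + Z^d, consider the average [S] of the kernel over the level n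
    + 1 preimages of [y]. From below, almost all mass of nonzero frequencies has left them, so [S]
    is close to at least the constant coefficient. From above, preimages near the lattice have tiny
    weight, and the kernel is tiny at the others. *)
Lemma equi_positive : exists2 eps : R, 0 < eps &
  forall y, exists k : 'cV[int]_d, eps <= qB A B (y + zmx R k).
Proof.
have [c c0 hc] := q_family_near cA (fam_size fB) (fun D hD => eq_ind_r (fun k => (0 < k)%N) (fam_pos fB) (fam_card fB hD)).
(* Points within l^1 distance d eta of 0 then have q at least 1/2. *)
pose eta : R := Num.min 2^-1 (2 * c * (d%:R + 1))^-1.
have d1 : 0 < d%:R + 1 :> R by rewrite ltr_wpDl.
have eta0 : 0 < eta by rewrite lt_min !invr_gt0 !mulr_gt0 // andbT.
have eta1 : eta <= 2^-1 by rewrite ge_min lexx.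
have etac : c * (d%:R * eta) <= 2^-1.
  apply: (@le_trans _ _ (c * ((d%:R + 1) * (2 * c * (d%:R + 1))^-1))); last first.
    rewrite le_eqVlt; apply/orP; left; apply/eqP; field.
    by rewrite !gt_eqF.
  rewrite ler_wpM2l ?(ltW c0) //; apply: ler_pM; rewrite ?(ltW eta0) //; last by rewrite ge_min lexx orbT.
  by rewrite lerDl.
pose r : R := (1 + cos (2 * pi * eta)) / 2.
have r0 : 0 <= r by rewrite divr_ge0 // -lerBlDl sub0r cos_geN1.
have r1 : r < 1.
  rewrite /r ltr_pdivrMr // mul1r; have := cos_2pi_lt1 eta0 eta1; lra.
have [M hM] := pow_poly_small d r0 r1.
pose f0 : R := ((M.+1)%:R ^+ d)^-1.
have f00 : 0 < f0 by rewrite invr_gt0 exprn_gt0.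
pose J : finType := ({ffun 'I_d -> 'I_M.+1} * {ffun 'I_d -> 'I_M.+1})%type.
pose gj (j : J) := cosv j.1 - cosv j.2.
have f02 : 0 < f0 / 2 by rewrite divr_gt0.
have [n hn] := alive_uniform cA fB (enum J) gj hno f02.
have [cAn fBn] := contr_fam_pow cA fB n.
have [Q Q0 hQ] := box_avg cAn.
pose N : R := (size B ^ n.+1)%:R.
have N0 : 0 < N by rewrite ltr0n (fam_pos fBn).
(* With 16 here, 2 N eps = f0 / 8; as r^M <= f0 / 4, the upper bound on [S] falls short of f0 / 2.
   Nothing chosen so far depends on [y]. *)
pose eps := f0 / (16 * N).
have eps0 : 0 < eps by rewrite divr_gt0 // mulr_gt0.
exists eps => // y; apply: contrapT => /forallNP hk.
have hq k : qB A B (y + zmx R k) < eps by rewrite ltNge; apply/negP/hk.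
pose w (l : 'cV[int]_d) : R := qn (Tinv R A) (mean_sqn [:: B]) n.+1 (y + zmx R l).
pose x (l : 'cV[int]_d) : 'cV[R]_d := Tinv R A ^+ n.+1 *m (y + zmx R l).
pose S := N / (size Q)%:R * \sum_(l <- Q) w l * sqn (cosp M (x l)).
have w0 l : 0 <= w l by have /andP[] := qn01 (Tinv R A) u01 n.+1 (y + zmx R l).
have trans z g : N / (size Q)%:R * \sum_(l <- Q) w l * complex.Re (z * e (dotv (zmx R g) (x l))) =
   iter n.+1 (Pop A [:: B]) (fun k => complex.Re (z * e (dotv (zmx R k) y))) g.
  by apply: (transfer_iter cA fB) => // D b b' _ _ _; exact: hQ.
have NQ : 0 < N / (size Q)%:R by rewrite divr_gt0 // ltr0n.
have w1 : N / (size Q)%:R * \sum_(l <- Q) w l = 1.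
  transitivity (N / (size Q)%:R * \sum_(l <- Q) w l * complex.Re (cr 1 * e (dotv (zmx R 0) (x l)))).
    by congr (_ * _); apply: eq_bigr => l _; rewrite zmx0 dotv0l e2pii0 mulr1 /= mulr1.
  by rewrite trans (iterPop0 cA fB) zmx0 dotv0l e2pii0 mulr1.
(* The diagonal pairs have frequency 0, which is fixed. An off-diagonal pair loses at most its
   coefficient times the mass still alive, since the cosine is at least -1 and the contribution
   absorbed at 0 is nonnegative. *)
have lower : f0 / 2 <= S.
  have -> : S = \sum_(f : {ffun 'I_d -> 'I_M.+1}) \sum_(g : {ffun 'I_d -> 'I_M.+1})
      iter n.+1 (Pop A [:: B]) (fun k => complex.Re (cr (cosc R f * cosc R g) *
         e (dotv (zmx R k) y))) (cosv f - cosv g).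
    rewrite /S; under eq_bigr => l _ do rewrite sqn_cosp mulr_sumr.
    rewrite exchange_big mulr_sumr; apply: eq_bigr => f _.
    under eq_bigr => l _ do rewrite mulr_sumr.
    by rewrite exchange_big mulr_sumr; apply: eq_bigr => g _; rewrite trans.
  apply: (@le_trans _ _ (\sum_(f : {ffun 'I_d -> 'I_M.+1}) \sum_(g : {ffun 'I_d -> 'I_M.+1})
     (cosc R f ^+ 2 * (g == f)%:R - cosc R f * cosc R g * (f0 / 2)))).
    under eq_bigr => f _ do rewrite sumrB.
    rewrite sumrB.
    have -> : \sum_(f : {ffun 'I_d -> 'I_M.+1}) \sum_(g : {ffun 'I_d -> 'I_M.+1})
       cosc R f * cosc R g * (f0 / 2) = f0 / 2.
      under eq_bigr => f _ do rewrite -mulr_suml -mulr_sumr sum_cosc mulr1.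
      by rewrite -mulr_suml sum_cosc mul1r.
    have -> : \sum_(f : {ffun 'I_d -> 'I_M.+1}) \sum_(g : {ffun 'I_d -> 'I_M.+1})
       cosc R f ^+ 2 * (g == f)%:R = \sum_(f : {ffun 'I_d -> 'I_M.+1}) cosc R f ^+ 2.
      apply: eq_bigr => f _; rewrite (bigD1 f) //= eqxx mulr1 big1 ?addr0 // => g /negPf ->.
      by rewrite mulr0.
    have := sum_cosc2 R d M; rewrite -/f0; lra.
  apply: ler_sum => f _; apply: ler_sum => g _.
  have cc : 0 <= cosc R f * cosc R g by rewrite mulr_ge0 // cosc_ge0.
  have [->|gf] := eqVneq g f.
    rewrite mulr1 subrr (iterPop0 cA fB) zmx0 dotv0l e2pii0 mulr1 /= -expr2.
    by rewrite gerBl mulr_ge0 ?sqr_ge0 // ltW.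
  rewrite mulr0 sub0r.
  apply: (@le_trans _ _ (iter n.+1 (Pop A [:: B])
      (fun k => - (cosc R f * cosc R g) * (k != 0)%:R) (cosv f - cosv g))).
    rewrite iterPop_scale mulNr lerN2 ler_wpM2l //.
    by have := hn (f, g); apply; rewrite mem_enum.
  apply: (iterPop_le fB) => k; rewrite ReZ.
  case: eqVneq => [->|_]; first by rewrite mulr0 zmx0 dotv0l e2pii0 mulr1.
  by rewrite mulr1 -mulrN1 ler_wpM2l // /e2pii /= cos_geN1.
have upper : S <= 2 * N * eps + r ^+ M.
  have -> : 2 * N * eps + r ^+ M = N / (size Q)%:R * \sum_(l <- Q) (2 * eps + w l * r ^+ M).
    rewrite big_split /= mulrDr; congr (_ + _); last by rewrite -mulr_suml mulrA w1 mul1r.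
    by rewrite sum_const_seq; field; rewrite pnatr_eq0 -lt0n.
  rewrite ler_wpM2l ?(ltW NQ) //; apply: ler_sum => l _.
  have [[k hk1]|hfar] := sqn_cosp_far M (x l) eta0 eta1; last first.
    apply: (@le_trans _ _ (w l * r ^+ M)); first by rewrite ler_wpM2l.
    by rewrite lerDr mulr_ge0 // ltW.
  apply: (@le_trans _ _ (2 * eps)); last by rewrite lerDl mulr_ge0 // exprn_ge0.
  apply: (@le_trans _ _ (w l)).
    by rewrite -[leRHS]mulr1 ler_wpM2l // sqn_cosp_le1.
  (* Translating [y] by l - S^(n+1) k keeps the first n + 1 factors and moves the tail argument next
     to 0, so the assumption on q forces w l <= 2 eps. *)
  have hS : y + zmx R (l - A^T ^+ n.+1 *m k) = y + zmx R l - zmx R (A^T ^+ n.+1 *m k).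
    by rewrite zmxB addrA.
  have := hq (l - A^T ^+ n.+1 *m k); rewrite hS /qB (q_iter (Tinv R A) u01 n.+1).
  rewrite mulmxBr -/(x l) TinvX_mul // -zmxN -mulmxN qn_int // -/(w l) => hlt.
  have := hc (x l - zmx R k); set qq := q _ _ _ in hlt * => hqq.
  have : 2^-1 <= qq.
    apply: le_trans hqq; have : c * nrm1 (x l - zmx R k) <= 2^-1.
      by apply: le_trans etac; rewrite ler_wpM2l // ltW.
    lra.
  move=> hq2; have : w l * 2^-1 <= w l * qq by rewrite ler_wpM2l.
  move: hlt; lra.
have : 2 * N * eps = f0 / 8 by rewrite /eps; field; rewrite gt_eqF.
move: hM; rewrite -ler_pdivlMr ?exprn_gt0 // mulrC -/f0 => h1 h2.
have := le_trans lower upper; rewrite h2; have := f00; move: h1; lra.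
Qed.

End Equipositive.

(** * The Zariski topology of trigonometric polynomials *)

Section Noetherian.
Variable F : comNzRingType.
Implicit Types (S T I J : set F) (s : seq F).

Definition is_subring S := [/\ S 1, forall a b, S a -> S b -> S (a - b) &
  forall a b, S a -> S b -> S (a * b)].

Definition is_ideal S I := [/\ I 0, forall a, I a -> S a, forall a b, I a -> I b -> I (a - b) &
  forall a b, S a -> I b -> I (a * b)].

Definition ideal_gen S (G : set F) : set F :=
  [set a | forall J, is_ideal S J -> (forall b, G b -> J b) -> J a]%classic.

Definition noetherian S := forall I, is_ideal S I ->
  exists s, (forall a, a \in s -> I a) /\ forall a, I a -> ideal_gen S [set` s]%classic a.

(** Subrings are predicates on one ambient ring, because trigonometric polynomials are used as
    functions: [u] may satisfy algebraic relations, and only values p(u) matter. *)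
Definition adjoin S u : set F := [set a | exists2 p : {poly F}, (forall i, S p`_i) & a = p.[u]]%classic.

Lemma subring0 S : is_subring S -> S 0.
Proof. by case=> S1 SB _; rewrite -(subrr 1); exact: SB. Qed.

Lemma subringN S a : is_subring S -> S a -> S (- a).
Proof. by move=> hS Sa; have S0 := subring0 hS; case: hS => _ SB _; rewrite -sub0r; exact: SB. Qed.

Lemma subringD S a b : is_subring S -> S a -> S b -> S (a + b).
Proof. by move=> hS Sa Sb; rewrite -[b]opprK; have := hS; case=> _ SB _; apply: SB => //; exact: subringN. Qed.

Lemma subring_sum S (K : Type) (r : seq K) (P : pred K) (f : K -> F) : is_subring S ->
  (forall i, P i -> S (f i)) -> S (\sum_(i <- r | P i) f i).
Proof.
move=> hS h; elim/big_ind: _ => //; first exact: subring0.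
by move=> x y; apply: subringD.
Qed.

Lemma subring_prod S (K : Type) (r : seq K) (P : pred K) (f : K -> F) : is_subring S ->
  (forall i, P i -> S (f i)) -> S (\prod_(i <- r | P i) f i).
Proof. by move=> [S1 _ SM] h; elim/big_ind: _. Qed.

Lemma subringX S a n : is_subring S -> S a -> S (a ^+ n).
Proof. by move=> [S1 _ SM] Sa; elim: n => [|n IH]; rewrite ?expr0 // exprS; exact: SM. Qed.

Lemma ideal_genP S G : is_subring S -> (forall a, G a -> S a) -> is_ideal S (ideal_gen S G).
Proof.
move=> hS hG; split.
- by move=> J [J0 _ _ _] _.
- move=> a /(_ S); apply=> //; have [S1 SB SM] := hS.
  by split=> //; exact: subring0.
- by move=> a b ha hb J hJ hGJ; have [_ _ JB _] := hJ; apply: JB; [exact: ha|exact: hb].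
- by move=> a b Sa hb J hJ hGJ; have [_ _ _ JM] := hJ; apply: JM => //; exact: hb.
Qed.

Lemma ideal_gen_sub S G a : G a -> ideal_gen S G a.
Proof. by move=> Ga J _; apply. Qed.

Lemma ideal_gen_mono S (G G' : set F) : (forall a, G a -> G' a) ->
  forall a, ideal_gen S G a -> ideal_gen S G' a.
Proof. by move=> h a ha J hJ hG; apply: ha => // b /h; exact: hG. Qed.

Lemma adjoin_subring S u : is_subring S -> is_subring (adjoin S u).
Proof.
move=> hS; have [S1 SB SM] := hS; split.
- exists 1; last by rewrite hornerC.
  by move=> i; rewrite coefC; case: ifP => // _; exact: subring0.
- move=> _ _ [p hp ->] [p' hp' ->]; exists (p - p'); last by rewrite hornerD hornerN.
  by move=> i; rewrite coefB; exact: SB.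
- move=> _ _ [p hp ->] [p' hp' ->]; exists (p * p'); last by rewrite hornerM.
  by move=> i; rewrite coefM; apply: subring_sum => // j _; exact: SM.
Qed.

Lemma adjoin_sub S u a : is_subring S -> S a -> adjoin S u a.
Proof.
move=> hS Sa; exists a%:P; last by rewrite hornerC.
by move=> i; rewrite coefC; case: ifP => // _; exact: subring0.
Qed.

Lemma adjoin_mem S u : is_subring S -> adjoin S u u.
Proof.
move=> hS; exists 'X; last by rewrite hornerX.
by move=> i; rewrite coefX; have [S1 _ _] := hS; case: (i == 1%N) => //; exact: subring0.
Qed.

Lemma min_size (P : set {poly F}) : (exists p, P p) ->
  exists2 p, P p & forall p', P p' -> (size p <= size p')%N.
Proof.
move=> [p0 h0].
have hex : exists n, `[< exists2 p, P p & size p = n >].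
  by exists (size p0); apply/asboolP; exists p0.
case: (ex_minnP hex) => n /asboolP[p Pp pn] hmin; exists p => // p' Pp'.
by rewrite pn; apply: hmin; apply/asboolP; exists p'.
Qed.

(* Hilbert's basis theorem, for the ring of values p(u) instead of the ring of
   polynomials p: minimality of degrees is taken over representatives. *)
Lemma noetherian_adjoin S u : is_subring S -> noetherian S -> noetherian (adjoin S u).
Proof.
move=> hS nS I hI; apply: contrapT => hno.
have hT := adjoin_subring u hS.
have [S1 SB SM] := hS.
have [I0 IT IB IM] := hI.
pose ev (s : seq {poly F}) : seq F := [seq p.[u] | p <- s].
pose T := adjoin S u.
pose ok (p : {poly F}) := (forall i, S p`_i) /\ I p.[u].
pose cand (s : seq {poly F}) (p : {poly F}) := ok p /\ ~ ideal_gen T [set` ev s]%classic p.[u].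
(* Were no generator list sufficient, a representative of least degree could always be found outside
   the ideal generated so far. *)
have hcand (s : seq {poly F}) : exists p, (forall p, p \in s -> ok p) -> cand s p /\ forall p', cand s p' -> (size p <= size p')%N.
  case: (pselect (forall p, p \in s -> ok p)) => hs; last by exists 0 => h; case: hs.
  have [|p hp hmin] := @min_size (cand s); last by exists p.
  apply: contrapT => /forallNP hn; apply: hno; exists (ev s); split.
    by move=> _ /mapP[p /hs [_ hp] ->].
  move=> a Ia; have [p hp pa] := IT a Ia.
  by apply: contrapT => ha; apply: (hn p); split; [split=> //; rewrite -pa|rewrite -pa].
have [nx hnx] := choice hcand.
pose P := fix P n := if n is m.+1 then rcons (P m) (nx (P m)) else [::].
have okP n : forall p, p \in P n -> ok p.
  elim: n => [|n IH] p //=; rewrite mem_rcons inE => /orP[/eqP ->|]; last exact: IH.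
  by have [[]] := hnx _ IH.
have PP m n : (m <= n)%N -> {subset P m <= P n}.
  elim: n => [|n IH]; first by rewrite leqn0 => /eqP ->.
  rewrite leq_eqVlt => /orP[/eqP ->//|hmn] p hp /=.
  by rewrite mem_rcons inE IH ?orbT.
have candn n := hnx _ (@okP n).
pose a n := lead_coef (nx (P n)).
have Sa n : S (a n) by have [[[h _] _] _] := candn n; exact: h.
pose G m : set F := [set x | exists2 i, (i < m)%N & x = a i]%classic.
have GS m x : G m x -> S x by move=> [i _ ->].
pose L : set F := [set x | exists m, ideal_gen S (G m) x]%classic.
have Gmono m n : (m <= n)%N -> forall x, ideal_gen S (G m) x -> ideal_gen S (G n) x.
  by move=> hmn; apply: ideal_gen_mono => x [i hi ->]; exists i => //; exact: leq_trans hmn.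
have idG m : is_ideal S (ideal_gen S (G m)) by apply: ideal_genP => // x /GS.
have hL : is_ideal S L.
  split.
  - by exists 0%N; have [] := idG 0%N.
  - by move=> x [m hm]; have [_ h _ _] := idG m; exact: h.
  - move=> x y [m hm] [n hn]; exists (maxn m n); have [_ _ h _] := idG (maxn m n).
    by apply: h; [apply: Gmono hm; rewrite leq_maxl|apply: Gmono hn; rewrite leq_maxr].
  - by move=> x y Sx [m hm]; exists m; have [_ _ _ h] := idG m; exact: h.
have [s [sL hs]] := nS L hL.
have [m hm] : exists m, forall x, x \in s -> ideal_gen S (G m) x.
  elim: (s) sL => [|x t IH] h; first by exists 0%N.
  have [|m1 h1] := IH; first by move=> y hy; apply: h; rewrite inE hy orbT.
  have [m2 h2] := h x (mem_head _ _).
  exists (maxn m1 m2) => y; rewrite inE => /orP[/eqP ->|/h1].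
    by apply: Gmono h2; rewrite leq_maxr.
  by apply: Gmono; rewrite leq_maxl.
have am : ideal_gen S (G m) (a m).
  apply: (hs (a m)); last by move=> x; exact: hm.
    by exists m.+1; apply: ideal_gen_sub; exists m.
  exact: idG.
have [candm minm] := candn m; have [[pmS pmI] pmn] := candm.
set pm := nx (P m) in candm minm pmS pmI pmn.
have idT : is_ideal T (ideal_gen T [set` ev (P m)]%classic).
  by apply: ideal_genP => // _ /= /mapP[p /okP [hp _] ->]; exists p.
have [T0 TT TB TM] := idT.
have size_le i : (i < m)%N -> (size (nx (P i)) <= size pm)%N.
  move=> hi; have [_ h] := candn i; apply: h; split => // hg; apply: pmn.
  apply: ideal_gen_mono hg => _ /= /mapP[p hp ->]; apply: map_f.
  by apply: PP hp; exact: ltnW.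
have pm0 : pm != 0.
  by apply/negP => /eqP p0; apply: pmn; rewrite p0 horner0.
(* Coefficients in the top degree of [pm] realised by the ideal of the earlier choices. This is an
   ideal of [S]; it contains the earlier leading coefficients, after multiplication by powers of X,
   and hence also that of [pm]. *)
pose W : set F := [set x | exists g : {poly F}, [/\ forall i, S g`_i,
   ideal_gen T [set` ev (P m)]%classic g.[u], (size g <= size pm)%N & g`_(size pm).-1 = x]]%classic.
have hW : is_ideal S W.
  split.
  - exists 0; split; rewrite ?horner0 ?size_poly0 ?coef0 // => i.
    by rewrite coef0; exact: subring0.
  - by move=> _ [g [hg _ _ <-]].
  - move=> _ _ [g [h1 h2 h3 <-]] [g' [h1' h2' h3' <-]]; exists (g - g'); split.
    + by move=> i; rewrite coefB; exact: SB.
    + by rewrite hornerD hornerN; exact: TB.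
    + by rewrite (leq_trans (size_polyD _ _)) // geq_max h3 size_polyN.
    + by rewrite coefB.
  - move=> x _ Sx [g [h1 h2 h3 <-]]; exists (x%:P * g); split.
    + by move=> i; rewrite coefCM; exact: SM.
    + by rewrite hornerM hornerC; apply: TM => //; exact: adjoin_sub.
    + by rewrite mul_polyC (leq_trans (size_scale_leq _ _)).
    + by rewrite coefCM.
have [g [gS gT gsz glead]] : W (a m).
  apply: am => // _ [i hi ->].
  have [[[piS _] pin] _] := candn i; set pi := nx (P i) in piS pin *.
  have pi0 : pi != 0.
    apply/negP => /eqP p0; apply: pin; rewrite p0 horner0.
    by move=> J [].
  have spi : (0 < size pi)%N by rewrite size_poly_gt0.
  have hsz := size_le i hi.
  exists (pi * 'X^(size pm - size pi)); split.
  - by move=> j; rewrite coefMXn; case: ifP => // _; exact: subring0.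
  - rewrite hornerM hornerXn mulrC; apply: TM.
      by apply: subringX; [exact: adjoin_subring|exact: adjoin_mem].
    apply: ideal_gen_sub; apply: map_f; apply: (PP i.+1) => //.
    by rewrite /= mem_rcons mem_head.
  - by rewrite size_mulXn // subnK.
  - rewrite coefMXn; have h : ((size pm).-1 < size pm - size pi)%N = false by apply/negbTE; rewrite -leqNgt; lia.
    rewrite h /a lead_coefE -/pi; congr (_ `_ _); move: hsz spi; rewrite -/pi.
    by set k := size pm; set l := size pi; lia.
have : cand (P m) (pm - g).
  split; first split.
  - by move=> i; rewrite coefB; exact: SB.
  - rewrite hornerD hornerN; apply: IB => //; apply: gT => //.
    by move=> _ /= /mapP[p /okP [_ hp] ->].
  - rewrite hornerD hornerN => hg; apply: pmn; rewrite -[pm.[u]](subrK g.[u]) -[X in _ + X]opprK.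
    have TN := TB _ _ T0 gT; rewrite sub0r in TN; exact: TB hg TN.
(* Subtracting [g] cancels the leading term, so the candidate [pm - g] would have smaller degree. *)
move=> /minm; rewrite leqNgt => /negP; apply.
have hsz : (size (pm - g)%R <= size pm)%N by rewrite (leq_trans (size_polyD _ _)) // geq_max leqnn size_polyN.
rewrite ltn_neqAle hsz andbT; apply/negP => /eqP he.
have : lead_coef (pm - g) = 0.
  by rewrite lead_coefE he coefB glead -lead_coefE subrr.
move/eqP; rewrite lead_coef_eq0 => /eqP h0; move: he; rewrite h0 size_poly0 => /esym/eqP.
by rewrite size_poly_eq0 (negPf pm0).
Qed.

End Noetherian.

(** * Trigonometric polynomials and their zero sets *)

Section Trigonometric.
Variables (R : realType) (r : nat).
Local Notation e := (@e2pii R).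
Local Notation X := 'cV[R]_r.
Local Notation F := (X -> R[i]).
Implicit Types (f : F) (W Y : set X) (g : 'cV[int]_r).

Definition chi g : F := fun x => e (dotv (zmx R g) x).

Definition trig : set F :=
  [set f | exists s : seq (R[i] * 'cV[int]_r), f = fun x => \sum_(p <- s) p.1 * chi p.2 x]%classic.

Lemma chiD g g' x : chi (g + g') x = chi g x * chi g' x.
Proof. by rewrite /chi zmxD dotvDl e2piiD. Qed.

Lemma chi0 x : chi 0 x = 1.
Proof. by rewrite /chi zmx0 dotv0l e2pii0. Qed.

Lemma chi_add g x y : chi g (x + y) = chi g x * chi g y.
Proof. by rewrite /chi dotvDr e2piiD. Qed.

Lemma chi_int g k : chi g (zmx R k) = 1.
Proof. by rewrite /chi isint_e //; exact: dotv_int. Qed.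

Lemma trig_chi z g : trig (fun x => z * chi g x).
Proof. by exists [:: (z, g)]; apply/funext => x; rewrite big_seq1. Qed.

Lemma trig_chi1 g : trig (chi g).
Proof. by have := trig_chi 1 g; congr trig; apply/funext => x; rewrite mul1r. Qed.

Lemma trig_cst z : trig (fun=> z).
Proof. by have := trig_chi z 0; congr trig; apply/funext => x; rewrite chi0 mulr1. Qed.

Lemma trigD f f' : trig f -> trig f' -> trig (fun x => f x + f' x).
Proof. by move=> [s ->] [t ->]; exists (s ++ t); apply/funext => x; rewrite big_cat. Qed.

Lemma trig_sum (I : Type) (s : seq I) (h : I -> F) : (forall i, trig (h i)) ->
  trig (fun x => \sum_(i <- s) h i x).
Proof.
move=> hh; elim: s => [|i s IH].
  by have := trig_cst 0; congr trig; apply/funext => x; rewrite big_nil.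
have := trigD (hh i) IH; congr trig; apply/funext => x; by rewrite big_cons.
Qed.

Lemma trigM f f' : trig f -> trig f' -> trig (fun x => f x * f' x).
Proof.
move=> [s ->] [t ->].
have -> : (fun x => (\sum_(p <- s) p.1 * chi p.2 x) * (\sum_(p <- t) p.1 * chi p.2 x)) =
  fun x => \sum_(p <- s) \sum_(p' <- t) (p.1 * p'.1) * chi (p.2 + p'.2) x.
  apply/funext => x; rewrite mulr_suml; apply: eq_bigr => p _.
  by rewrite mulr_sumr; apply: eq_bigr => p' _; rewrite chiD mulrACA.
by apply: trig_sum => p; apply: trig_sum => p'; exact: trig_chi.
Qed.

Lemma trigZ z f : trig f -> trig (fun x => z * f x).
Proof. by move=> hf; apply: trigM => //; exact: trig_cst. Qed.

Lemma trigB f f' : trig f -> trig f' -> trig (fun x => f x - f' x).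
Proof.
move=> hf hf'; have := trigD hf (trigZ (-1) hf'); congr trig.
by apply/funext => x; rewrite mulN1r.
Qed.

Lemma trig_shift f t : trig f -> trig (fun x => f (x + t)).
Proof.
move=> [s ->]; apply: trig_sum => p.
have := trig_chi (p.1 * chi p.2 t) p.2; congr trig; apply/funext => x.
by rewrite chi_add; ring.
Qed.

Lemma trig_comp f (M : 'M[int]_r) : trig f -> trig (fun x => f (zmx R M *m x)).
Proof.
move=> [s ->]; apply: trig_sum => p.
have := trig_chi p.1 (M^T *m p.2); congr trig; apply/funext => x.
by rewrite /chi dotv_mulr zmxM zmxT.
Qed.

Lemma trig_int f x k : trig f -> f (x + zmx R k) = f x.
Proof. by move=> [s ->]; apply: eq_bigr => p _; rewrite chi_add chi_int mulr1. Qed.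

Lemma trig_subring : is_subring (trig : set F).
Proof.
split; first exact: trig_cst.
- by move=> a b ha hb; exact: trigB.
- by move=> a b ha hb; exact: trigM.
Qed.

Lemma trig_cj f : trig f -> trig (fun x => cj (f x)).
Proof.
move=> [s ->].
have -> : (fun x => cj (\sum_(p <- s) p.1 * chi p.2 x)) = fun x => \sum_(p <- s) cj p.1 * chi (- p.2) x.
  apply/funext => x; rewrite cj_sum; apply: eq_bigr => p _.
  by rewrite cjM /chi zmxN dotvNl e2piiN.
by apply: trig_sum => p; exact: trig_chi.
Qed.

Lemma trig_Re f : trig f -> trig (fun x => cr (complex.Re (f x))).
Proof.
move=> hf; have := trigZ (cr 2^-1) (trigD hf (trig_cj hf)); congr trig; apply/funext => x.
case: (f x) => a b; apply/eqP; rewrite eq_complex /=; by apply/andP; split; apply/eqP; field.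
Qed.

Lemma sum_continuous (Y : topologicalType) (I : Type) (s : seq I) (h : I -> Y -> R) :
  (forall i, continuous (h i)) -> continuous (fun x => \sum_(i <- s) h i x).
Proof.
move=> hc; elim: s => [|i s IH].
  have -> : (fun x => \sum_(i <- [::]) h i x) = fun=> 0 by apply/funext => x; rewrite big_nil.
  exact: cst_continuous.
have -> : (fun x => \sum_(i <- i :: s) h i x) = fun x => h i x + \sum_(i <- s) h i x.
  by apply/funext => x; rewrite big_cons.
by move=> x; apply: continuousD; [exact: hc|exact: IH].
Qed.

Lemma trig_max f : trig f -> exists y, forall x, complex.Re (f x) <= complex.Re (f y).
Proof.
move=> hf; have [s hs] := hf.
(* The extreme value theorem is applied on the unit cube of row vectors, hence the transpose;
   periodicity brings every point into the cube. *)
pose h (v : 'rV[R]_r) : R := complex.Re (f v^T).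
have ch : continuous h.
  have -> : h = fun v : 'rV[R]_r => \sum_(p <- s) (complex.Re p.1 * cos (2 * pi * \sum_i (p.2 i ord0)%:~R * v ord0 i) -
      complex.Im p.1 * sin (2 * pi * \sum_i (p.2 i ord0)%:~R * v ord0 i)).
    apply/funext => v; rewrite /h hs Re_sum; apply: eq_bigr => p _.
    have -> : \sum_i (p.2 i ord0)%:~R * v ord0 i = dotv (zmx R p.2) v^T.
      by apply: eq_bigr => i _; rewrite !mxE.
    by case: p.1.
  apply: sum_continuous => p v.
  have cl : {for v, continuous (fun v : 'rV[R]_r => 2 * pi * \sum_i (p.2 i ord0)%:~R * v ord0 i)}.
    apply: continuousM; first exact: cst_continuous.
    apply: (@sum_continuous _ _ _ (fun i (v : 'rV[R]_r) => (p.2 i ord0)%:~R * v ord0 i)) => i w.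
    apply: continuousM; first exact: cst_continuous.
    exact: coord_continuous.
  apply: (@cvgB _ _ _ (nbhs v)); apply: cvgM; try exact: cvg_cst.
    by apply: (continuous_comp cl); exact: continuous_cos.
  by apply: (continuous_comp cl); exact: continuous_sin.
pose K : set 'rV[R]_r := [set v | forall i, `[0, 1]%classic (v ord0 i)]%classic.
have cK : compact K by apply: (@rV_compact R r (fun=> `[0, 1]%classic)) => i; exact: segment_compact.
have K0 : (K !=set0)%classic by exists 0 => i; rewrite mxE /= in_itv /= lexx ler01.
have [c cK' hc] := EVT_max_rV K0 cK (continuous_subspaceT ch).
exists c^T => x.
pose k : 'cV[int]_r := \col_i Num.floor (x i ord0).
rewrite -(trig_int x (- k) hf).
have := hc (x + zmx R (- k))^T; rewrite /h !trmxK; apply; rewrite inE => i /=.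
rewrite !mxE in_itv /= rmorphN /=; have := floor_itv (x i ord0); rewrite intrD.
move=> /andP[h1 h2]; rewrite subr_ge0 h1 /= lerBlDl; exact: ltW.
Qed.

Definition csts : set F := [set f | exists z, f = fun=> z]%classic.

Lemma csts_subring : is_subring csts.
Proof.
split; first by exists 1.
- by move=> _ _ [z ->] [w ->]; exists (z - w).
- by move=> _ _ [z ->] [w ->]; exists (z * w).
Qed.

Lemma csts_noetherian : noetherian csts.
Proof.
move=> I [I0 IS IB IM].
case: (pselect (exists2 z, z != 0 & I (fun=> z))) => [[z z0 hz]|hn].
  exists [:: (fun=> z)]; split; first by move=> a; rewrite inE => /eqP ->.
  move=> a /IS [w ->] J [_ _ _ JM] /(_ (fun=> z)); rewrite /= inE eqxx => /(_ isT) h.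
  have -> : (fun=> w) = (fun=> w / z) * (fun=> z) :> F.
    by apply/funext => x; rewrite /GRing.mul /= divfK.
  by apply: JM => //; exists (w / z).
exists [::]; split => // a Ia; have [z az] := IS a Ia.
have [z0|z0] := eqVneq z 0; last by case: hn; exists z => //; rewrite -az.
have -> : a = 0 by rewrite az z0.
by move=> J [].
Qed.

(** Trigonometric polynomials arise from the constants by adjoining the characters of plus and minus
    the unit vectors one at a time, so [noetherian_adjoin] applies finitely often. *)
Fixpoint tower (s : seq F) : set F := if s is u :: s' then adjoin (tower s') u else csts.

Lemma tower_subring s : is_subring (tower s).
Proof. by elim: s => [|u s IH]; [exact: csts_subring|exact: adjoin_subring]. Qed.

Lemma tower_noetherian s : noetherian (tower s).
Proof.
elim: s => [|u s IH]; first exact: csts_noetherian.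
by apply: noetherian_adjoin => //; exact: tower_subring.
Qed.

Lemma tower_csts s f : csts f -> tower s f.
Proof. by move=> hf; elim: s => [|u s IH] //; apply: adjoin_sub => //; exact: tower_subring. Qed.

Lemma tower_mem s u : u \in s -> tower s u.
Proof.
elim: s => [|v s IH] //; rewrite inE => /orP[/eqP ->|/IH h].
  by apply: adjoin_mem; exact: tower_subring.
by apply: adjoin_sub => //; exact: tower_subring.
Qed.

Lemma tower_trig s f : (forall u, u \in s -> trig u) -> tower s f -> trig f.
Proof.
elim: s f => [|u s IH] f hs; first by move=> [z ->]; exact: trig_cst.
move=> [p hp ->]; rewrite horner_coef.
apply: subring_sum trig_subring _ => i _.
have [_ _ M] := trig_subring; apply: M.
  by apply: IH (hp i) => v hv; apply: hs; rewrite inE hv orbT.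
by apply: subringX trig_subring _; apply: hs; rewrite mem_head.
Qed.

Definition gens : seq F := [seq chi (\col_j (if j == i.1 then (-1) ^+ (i.2 : bool) else 0)) | i : 'I_r * bool].

Lemma trig_tower f : trig f -> tower gens f.
Proof.
have hT := tower_subring gens; have [T1 _ TM] := hT.
have hchi g : tower gens (chi g).
  have -> : chi g = \prod_i ((chi (\col_j (if j == i then (-1) ^+ (g i ord0 < 0)%R else 0)) : F) ^+ `|g i ord0|%N).
    have hX (u : F) n x : (u ^+ n) x = u x ^+ n.
      by elim: n => [|n IH]; rewrite ?expr0 // !exprS -IH.
    apply/funext => x; rewrite fct_prodE.
    under eq_bigr => i _ do rewrite hX.
    rewrite {1}/chi /dotv (big_morph _ (@e2piiD R) (@e2pii0 R)); apply: eq_bigr => i _.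
    have -> : chi (\col_j (if j == i then (-1) ^+ (g i ord0 < 0)%R else 0)) x =
        e (((-1) ^+ (g i ord0 < 0)%R) * x i ord0).
      rewrite /chi; congr e2pii; rewrite /dotv (bigD1 i) //= big1 => [|j ji].
        by rewrite !mxE eqxx addr0 rmorphXn rmorphN1.
      by rewrite !mxE (negPf ji) mul0r.
    rewrite mxE; set t := x i ord0.
    have -> : (g i ord0)%:~R * t = `|g i ord0|%N%:R * ((-1) ^+ (g i ord0 < 0)%R * t).
      by rewrite {1}[g i ord0]intEsign intrM rmorphXn rmorphN1 -pmulrn -mulrA mulrCA.
    elim: `|g i ord0|%N => [|n IH]; first by rewrite mul0r e2pii0.
    by rewrite -natr1 mulrDl mul1r e2piiD IH exprSr.
  apply: subring_prod => // i _; apply: subringX => //; apply: tower_mem.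
  by apply/mapP; exists (i, (g i ord0 < 0)%R); rewrite ?mem_enum.
move=> [s ->].
have -> : (fun x => \sum_(p <- s) p.1 * chi p.2 x) = \sum_(p <- s) ((fun=> p.1) * chi p.2 : F).
  by apply/funext => x; rewrite fct_sumE.
apply: subring_sum => // p _; apply: TM => //.
by apply: tower_csts; exists p.1.
Qed.

Lemma trig_noetherian : noetherian (trig : set F).
Proof.
have -> : trig = tower gens; last exact: tower_noetherian.
apply/funext => f; apply/propext; split; first exact: trig_tower.
by apply: tower_trig => u /mapP[i _ ->]; exact: trig_chi1.
Qed.

(* Closure for the topology whose closed sets are the zero sets of trigonometric
   polynomials; it is invariant under integer translations, so it lives on the torus. *)
Definition zcl W : set X := [set x | forall f, trig f -> (forall w, W w -> f w = 0) -> f x = 0]%classic.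
Definition zclosed W := forall x, zcl W x -> W x.

Lemma zcl_sub W x : W x -> zcl W x.
Proof. by move=> Wx f _; apply. Qed.

Lemma zcl_closed W : zclosed (zcl W).
Proof. by move=> x h f hf hW; apply: h => // w; apply. Qed.

Lemma zcl_min W Y : zclosed Y -> (forall x, W x -> Y x) -> forall x, zcl W x -> Y x.
Proof. by move=> hY h x hx; apply: hY => f hf hfY; apply: hx => // w /h; exact: hfY. Qed.

Lemma zclosedI W Y : zclosed W -> zclosed Y -> zclosed (fun x => W x /\ Y x).
Proof.
by move=> hW hY x hx; split; [apply: hW|apply: hY] => f hf h; apply: hx => // w [h1 h2]; exact: h.
Qed.

Lemma zclosedU W Y : zclosed W -> zclosed Y -> zclosed (fun x => W x \/ Y x).
Proof.
move=> hW hY x hx; apply: contrapT => /not_orP[nW nY].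
have : ~ zcl W x by move=> /hW.
move=> /existsNP[f /not_implyP[hf /not_implyP[fW fx]]].
have : ~ zcl Y x by move=> /hY.
move=> /existsNP[f' /not_implyP[hf' /not_implyP[fY fx']]].
have /eqP := hx _ (trigM hf hf') (fun w => or_ind (fun h => etrans (congr1 ( *%R^~ _) (fW _ h)) (mul0r _))
   (fun h => etrans (congr1 ( *%R _) (fY _ h)) (mulr0 _))).
by rewrite mulf_eq0 => /orP[/eqP|/eqP].
Qed.

Lemma zclosed_shift W t : zclosed W -> zclosed (fun x => W (x + t)).
Proof.
move=> hW x hx; apply: hW => f hf h; apply: (hx _ (trig_shift t hf)) => w; exact: h.
Qed.

Lemma zclosed_comp W M : zclosed W -> zclosed (fun x => W (zmx R M *m x)).
Proof.
move=> hW x hx; apply: hW => f hf h; apply: (hx _ (trig_comp M hf)) => w; exact: h.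
Qed.

Lemma zclosed_int W x k : zclosed W -> W x -> W (x + zmx R k).
Proof. by move=> hW Wx; apply: hW => f hf h; rewrite trig_int //; exact: h. Qed.

Lemma zclosed_lattice : zclosed [set x | isintv x]%classic.
Proof.
move=> x hx; apply: isintvP => i.
have /(_ _)/= := hx _ (trigB (trig_chi1 (\col_j (j == i)%:Z)) (trig_cst 1)).
have h0 w : isintv w -> chi (\col_j (j == i)%:Z) w - 1 = 0.
  by move=> [k ->]; rewrite chi_int subrr.
move=> /(_ h0).
move=> /eqP; rewrite subr_eq0 => /eqP /e2pii_eq1.
rewrite /dotv (bigD1 i) //= big1 => [|j ji]; rewrite !mxE ?eqxx ?mul1r ?addr0 //.
by rewrite (negPf ji) mul0r.
Qed.

(** A class without a minimal member would contain an infinite strictly decreasing chain. The ideals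
    vanishing on its members increase, their union is finitely generated, so they become constant;
    closed sets are determined by these ideals. *)
Lemma zmin (C : set (set X)) : (exists W, C W) -> (forall W, C W -> zclosed W) ->
  exists2 W, C W & forall Y, C Y -> (forall x, Y x -> W x) -> forall x, W x -> Y x.
Proof.
move=> [W0 C0] hC; apply: contrapT => hno.
have : forall W, exists Y, C W -> [/\ C Y, forall x, Y x -> W x & exists2 x, W x & ~ Y x].
  move=> W; case: (pselect (C W)) => CW; last by exists W.
  apply: contrapT => /forallNP hn; apply: hno; exists W => // Y CY YW x Wx.
  by apply: contrapT => nY; apply: (hn Y) => _; split=> //; exists x.
move=> /choice[g hg].
pose V n := iter n g W0.
have CV n : C (V n) by elim: n => [|n IH] //=; have [] := hg _ IH.
have VS m n x : (m <= n)%N -> V n x -> V m x.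
  elim: n => [|n IH]; first by rewrite leqn0 => /eqP ->.
  rewrite leq_eqVlt => /orP[/eqP -> //|hmn] /= h; apply: IH => //.
  by have [_ h' _] := hg _ (CV n); exact: h'.
pose I n : set F := [set f | trig f /\ forall w, V n w -> f w = 0]%classic.
have idI n : is_ideal trig (I n).
  split.
  - by split=> //; exact: trig_cst.
  - by move=> a [].
  - move=> a b [ha ha'] [hb hb']; split; first by have [_ B _] := trig_subring; exact: B.
    by move=> w hw; rewrite /GRing.add /= /GRing.opp /= ha' // hb' // oppr0 addr0.
  - move=> a b ha [hb hb']; split; first by have [_ _ M] := trig_subring; exact: M.
    by move=> w hw; rewrite /GRing.mul /= hb' // mulr0.
have Imono m n f : (m <= n)%N -> I m f -> I n f.
  by move=> hmn [hf h]; split => // w /(VS _ _ _ hmn); exact: h.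
pose U : set F := [set f | exists n, I n f]%classic.
have idU : is_ideal trig U.
  split.
  - by exists 0%N; have [] := idI 0%N.
  - by move=> a [n []].
  - move=> a b [m hm] [n hn]; exists (maxn m n); have [_ _ h _] := idI (maxn m n).
    by apply: h; [apply: Imono hm; rewrite leq_maxl|apply: Imono hn; rewrite leq_maxr].
  - by move=> a b ha [n hn]; exists n; have [_ _ _ h] := idI n; exact: h.
have [s [sU hs]] := trig_noetherian idU.
have [m hm] : exists m, forall f, f \in s -> I m f.
  elim: (s) sU => [|f t IH] h; first by exists 0%N.
  have [|m1 h1] := IH; first by move=> y hy; apply: h; rewrite inE hy orbT.
  have [m2 h2] := h f (mem_head _ _).
  exists (maxn m1 m2) => y; rewrite inE => /orP[/eqP ->|/h1].
    by apply: Imono h2; rewrite leq_maxr.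
  by apply: Imono; rewrite leq_maxl.
have [CV1 _ [x Vx nVx]] := hg _ (CV m).
apply: nVx; apply: (hC _ CV1) => f hf hf0.
have : I m f by apply: (hs f) => //; exists m.+1.
by move=> [_ h]; exact: h.
Qed.

Definition zirr W := [/\ zclosed W, exists x, W x & forall Y Z, zclosed Y -> zclosed Z ->
  (forall x, W x -> Y x \/ Z x) -> (forall x, W x -> Y x) \/ (forall x, W x -> Z x)].

Lemma zirr_big W (I : Type) (s : seq I) (Y : I -> set X) : zirr W -> (forall i, zclosed (Y i)) ->
  (forall x, W x -> exists2 i, List.In i s & Y i x) -> exists2 i, List.In i s & forall x, W x -> Y i x.
Proof.
move=> [cW [x0 Wx0] irr] cY; elim: s => [|i s IH] h; first by have [] := h x0 Wx0.
pose Z : set X := fun x => exists2 i, List.In i s & Y i x.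
have cZ : zclosed Z.
  rewrite /Z; elim: (s) => [|j t IHt].
    by move=> x hx; have /eqP := hx (fun=> 1) (trig_cst 1) (fun w '(ex_intro2 _ h _) => match h with end); rewrite oner_eq0.
  have := zclosedU (cY j) IHt; congr zclosed; apply/funext => x; apply/propext; split.
    by move=> [h1|[k k1 k2]]; [exists j => //; left|exists k => //; right].
  by move=> [k [<-|k1] k2]; [left|right; exists k].
have [|h1|h1] := irr _ _ (cY i) cZ.
- by move=> x /h[k [<-|k1] k2]; [left|right; exists k].
- by exists i => //; left.
- by have [k k1 k2] := IH h1; exists k => //; right.
Qed.

Lemma zirr_fin W (I : finType) (Y : I -> set X) : zirr W -> (forall i, zclosed (Y i)) ->
  (forall x, W x -> exists i, Y i x) -> exists i, forall x, W x -> Y i x.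
Proof.
move=> iW cY h; have [|i _ hi] := zirr_big (s := enum I) iW cY; last by exists i.
move=> x /h[i hi]; exists i => //.
have : i \in enum I by rewrite mem_enum.
by elim: (enum I) => // j s IH; rewrite inE => /orP[/eqP ->|/IH ?]; [left|right].
Qed.

(** Noetherian induction: a minimal closed set without a decomposition is nonempty and reducible,
    and its two proper closed parts decompose. *)
Lemma zirr_decomp W : zclosed W -> exists m (Y : 'I_m -> set X), [/\ forall i, zirr (Y i),
   forall x, W x <-> exists i, Y i x & forall i j, (forall x, Y i x -> Y j x) -> i = j].
Proof.
move=> cW.
pose rep m (V : set X) := exists Y : 'I_m -> set X, (forall i, zirr (Y i)) /\ forall x, V x <-> exists i, Y i x.
have hrep : exists m, rep m W.
  apply: contrapT => hn.
  have [||V [cV nV] Vmin] := @zmin [set V | zclosed V /\ ~ exists m, rep m V]%classic; first by exists W.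
    by move=> V [].
  apply: nV; case: (pselect (exists x, V x)) => [Vne|Ve]; last first.
    exists 0%N, (fun=> V); split; first by case.
    by move=> x; split => [hx|[[]] //]; case: Ve; exists x.
  case: (pselect (zirr V)) => [iV|nV].
    exists 1%N, (fun=> V); split => // x; split; first by exists ord0.
    by case.
  have /existsNP[Y /existsNP[Z /not_implyP[cY /not_implyP[cZ /not_implyP[hYZ /not_orP[nY nZ]]]]]] :
     ~ (forall Y Z, zclosed Y -> zclosed Z ->
  (forall x, V x -> Y x \/ Z x) -> (forall x, V x -> Y x) \/ (forall x, V x -> Z x)).
    by move=> h; apply: nV; split.
  have hsub (T : set X) : zclosed T -> ~ (forall x, V x -> T x) -> exists m, rep m (fun x => V x /\ T x).
    move=> cT nT; apply: contrapT => hnr; apply: nT => x Vx.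
    by have [] := Vmin (fun x => V x /\ T x) (conj (zclosedI cV cT) hnr) (fun x h => h.1) x Vx.
  have [m1 [Y1 [i1 h1]]] := hsub Y cY nY; have [m2 [Y2 [i2 h2]]] := hsub Z cZ nZ.
  exists (m1 + m2)%N, (fun i => match fintype.split i with inl j => Y1 j | inr j => Y2 j end); split.
    by move=> i; case: (fintype.split i).
  move=> x; split => [Vx|[i0]].
    have [Yx|Zx] := hYZ x Vx.
      have /h1[j hj] : V x /\ Y x by [].
      by exists (lshift m2 j); rewrite -[lshift _ _]/(unsplit (inl j)) unsplitK.
    have /h2[j hj] : V x /\ Z x by [].
    by exists (rshift m1 j); rewrite -[rshift _ _]/(unsplit (inr j)) unsplitK.
  case: (fintype.split i0) => j hj; first by have [] := (h1 x).2 (ex_intro _ j hj).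
  by have [] := (h2 x).2 (ex_intro _ j hj).
(* Taking the fewest pieces excludes inclusions, since a piece contained in another could be
   dropped. *)
have hex : exists m, `[< rep m W >] by have [m hm] := hrep; exists m; apply/asboolP.
case: (ex_minnP hex) => m /asboolP[Y [iY hY]] hmin; exists m, Y; split => // i j hij.
apply: contrapT => /eqP nij.
case: m Y iY hY hmin i j hij nij => [|m] Y iY hY hmin i j hij nij; first by case: i {hij nij}.
have : (m.+1 <= m)%N; last by rewrite ltnn.
apply: hmin; apply/asboolP; exists (fun k => Y (lift i k)); split => // x; rewrite hY; split.
  move=> [k hk]; case: (unliftP i k) => [k' ek|ek]; first by exists k'; rewrite -ek.
  case: (unliftP i j) => [j' ej|ej]; last by rewrite ej eqxx in nij.
  by exists j'; rewrite -ej; apply: hij; rewrite -ek.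
by move=> [k hk]; exists (lift i k).
Qed.

(** Artin's argument: subtracting a translate of the relation removes one character and keeps, with
    a nonzero factor, a coefficient that a point of [H] separates from it. Closure under addition is
    enough, as [H] will be a mere semigroup. *)
Lemma chi_independent (H : set X) (s : seq 'cV[int]_r) (c : 'cV[int]_r -> R[i]) :
  H 0 -> (forall h h', H h -> H h' -> H (h + h')) ->
  (forall g, g != 0 -> exists2 h, H h & ~ isint (dotv (zmx R g) h)) -> uniq s ->
  (forall h, H h -> \sum_(g <- s) c g * chi g h = 0) -> forall g, g \in s -> c g = 0.
Proof.
move=> H0 HD sep; elim: s c => [|g s IH] c //= /andP[gs us] hs.
have hc k : k \in s -> c k = 0.
  move=> ks; have gk : k - g != 0 by rewrite subr_eq0; apply: contraNneq gs => <-.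
  have [t Ht nt] := sep _ gk.
  have : c k * (chi k t - chi g t) = 0.
    apply: (IH (fun k => c k * (chi k t - chi g t))) => // h Hh.
    have h1 := hs _ (HD _ _ Hh Ht); have h2 := hs _ Hh.
    rewrite !big_cons in h1 h2.
    have -> : \sum_(j <- s) c j * (chi j t - chi g t) * chi j h =
      \sum_(j <- s) c j * chi j (h + t) - chi g t * \sum_(j <- s) c j * chi j h.
      rewrite mulr_sumr -sumrB; apply: eq_bigr => j _; rewrite chi_add; ring.
    move/eqP: h1; rewrite addrC addr_eq0 => /eqP ->.
    move/eqP: h2; rewrite addrC addr_eq0 => /eqP ->.
    by rewrite chi_add; ring.
  move=> /eqP; rewrite mulf_eq0 => /orP[/eqP //|/eqP hh].
  case: nt; apply: e2pii_eq1.
  rewrite zmxB dotvBl -e2pii_mulJ -/(chi k t) -/(chi g t).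
  move/eqP: hh; rewrite subr_eq0 => /eqP ->.
  by rewrite /chi e2pii_mulJ subrr e2pii0.
move=> k; rewrite inE => /orP[/eqP ->|]; last exact: hc.
have := hs 0 H0; rewrite big_cons big1_seq ?addr0 => [|j /andP[_ js]]; last by rewrite hc // mul0r.
by rewrite /chi dotv0r e2pii0 mulr1.
Qed.

End Trigonometric.

(** * Tilings by integer frequencies *)

Section Dual.
Variables (R : realType) (r : nat).
Local Notation e := (@e2pii R).
Implicit Types (A : 'M[int]_r) (D : seq 'cV[int]_r).

Definition complete A D := forall b g, b \in D -> exists2 b', b' \in D & Aimg A (g + b - b').

Definition residues A D := [/\ uniq D, (0 < size D)%N, complete A D &
  forall b b', b \in D -> b' \in D -> Aimg A (b - b') -> b = b'].

Lemma AimgD A g g' : Aimg A g -> Aimg A g' -> Aimg A (g + g').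
Proof. by move=> /AimgP[k ->] /AimgP[k' ->]; apply/AimgP; exists (k + k'); rewrite mulmxDr. Qed.

Lemma AimgN A g : Aimg A g -> Aimg A (- g).
Proof. by move=> /AimgP[k ->]; apply/AimgP; exists (- k); rewrite mulmxN. Qed.

Lemma AimgB A g g' : Aimg A g -> Aimg A g' -> Aimg A (g - g').
Proof. by move=> h h'; apply: AimgD => //; exact: AimgN. Qed.

Lemma Aimg0 A : Aimg A 0.
Proof. by apply/AimgP; exists 0; rewrite mulmx0. Qed.

Lemma dot_RinvT A (cA : contracting R A) (l g : 'cV[int]_r) : Aimg A^T l ->
  isint (dotv (zmx R l) (Rinv R A *m zmx R g)).
Proof.
move=> /AimgP[k ->]; rewrite zmxM zmxT dotv_mull trmxK mul_Rinv //.
exact: dotv_int.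
Qed.

Lemma Aimg_dual A (cA : contracting R A) (l : 'cV[int]_r) :
  (forall g : 'cV[int]_r, isint (dotv (zmx R l) (Rinv R A *m zmx R g))) -> Aimg A^T l.
Proof.
move=> h; have [|k hk] := @isintv_dot R r (Tinv R A *m zmx R l).
  by move=> g; rewrite dotvC -dot_Rinv.
apply/AimgP; exists k; apply: (@zmx_inj R); rewrite zmxM -hk zmxT AT_Tinv //.
Qed.

Lemma residues_perm A D (I : choiceType) (s : seq I) (f : I -> 'cV[int]_r) : residues A D ->
  (forall i, i \in s -> f i \in D) -> uniq s -> size s = size D ->
  {in s &, injective f} -> perm_eq (map f s) D.
Proof.
move=> [uD _ _ _] hf us hs inj.
have um : uniq (map f s) by rewrite map_inj_in_uniq.
apply: uniq_perm => //.
have hsub : {subset map f s <= D} by move=> _ /mapP[i hi ->]; exact: hf.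
by have [] := uniq_min_size um hsub _; rewrite ?size_map ?hs.
Qed.

(** Adding [g] permutes the residues, so the sum equals itself times the value of the character at
    [g]; that value can be chosen different from 1 unless the character is trivial. *)
Lemma char_sum A D (cA : contracting R A) l : residues A D ->
  \sum_(b <- D) e (dotv (zmx R l) (Rinv R A *m zmx R b)) = cr (size D)%:R * (Aimg A^T l)%:R.
Proof.
move=> rD; have [uD D0 cD mD] := rD.
case: (boolP (Aimg A^T l)) => hl.
  rewrite mulr1 cr_nat (eq_bigr (fun=> 1)) ?sum_const_seq ?mulr1 // => b _.
  by rewrite isint_e //; exact: dot_RinvT.
rewrite mulr0.
have [g hg] : exists g : 'cV[int]_r, ~ isint (dotv (zmx R l) (Rinv R A *m zmx R g)).
  by apply/existsNP => h; move/negP: hl; apply; exact: Aimg_dual.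
set S := \sum_(b <- D) _.
have hS : S = e (dotv (zmx R l) (Rinv R A *m zmx R g)) * S.
  have [f hf] : exists f : 'cV[int]_r -> 'cV[int]_r, forall b, b \in D -> f b \in D /\ Aimg A (g + b - f b).
    have H (b : 'cV[int]_r) : exists b', b \in D -> b' \in D /\ Aimg A (g + b - b').
      case: (boolP (b \in D)) => hb; last by exists 0.
      by have [b' h1 h2] := cD b g hb; exists b'.
    by have [f hf] := choice H; exists f.
  have hp : perm_eq (map f D) D.
    apply: residues_perm rD _ uD _ _ => //; first by move=> b /hf[].
    move=> b b' hb hb' hbb; apply: mD => //.
    have [_ h1] := hf b hb; have [_ h2] := hf b' hb'; have := AimgB h1 h2; rewrite hbb.
    by congr (Aimg A _); mxring.
  rewrite {1}/S -(perm_big _ hp) big_map mulr_sumr; apply: eq_big_seq => b hb.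
  have [_ /AimgP[k hk]] := hf b hb.
  have -> : f b = g + b - A *m k by rewrite -hk; mxring.
  rewrite zmxB zmxD mulmxBr mulmxDr zmxM Rinv_mul // dotvBr dotvDr e2piiD e2piiN.
  by rewrite (isint_e (dotv_int _ _ _)) cj1 mulr1 e2piiD.
move/eqP: hS; rewrite -subr_eq0 -{1}[S]mul1r -mulrBl mulf_eq0 => /orP[|/eqP //].
by rewrite subr_eq0 => /eqP h; case: hg; apply: e2pii_eq1.
Qed.

Lemma incongruent_sublist A (Q : seq 'cV[int]_r) : exists s : seq 'cV[int]_r, [/\ {subset s <= Q}, uniq s,
  forall l l', l \in s -> l' \in s -> Aimg A (l - l') -> l = l' &
  forall l, l \in Q -> exists2 l', l' \in s & Aimg A (l - l')].
Proof.
elim: Q => [|l Q [s [sQ us hs hc]]]; first by exists [::].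
case: (pselect (exists2 l', l' \in s & Aimg A (l - l'))) => h.
  exists s; split=> //; first by move=> x /sQ; rewrite inE orbC => ->.
  by move=> x; rewrite inE => /orP[/eqP ->|/hc].
exists (l :: s); split.
- by move=> x; rewrite !inE => /orP[->//|/sQ ->]; rewrite orbT.
- rewrite /= us andbT; apply/negP => ls; apply: h; exists l => //.
  by rewrite subrr Aimg0.
- move=> x y; rewrite !inE => /orP[/eqP ->|hx] /orP[/eqP ->|hy] hxy //.
  + by case: h; exists y => //; apply/AimgP.
  + by case: h; exists x => //; rewrite -opprB; apply: AimgN; apply/AimgP.
  + by apply: hs => //; apply/AimgP.
- move=> x; rewrite inE => /orP[/eqP ->|/hc[y hy hxy]].
    by exists l; rewrite ?mem_head // subrr Aimg0.
  by exists y => //; rewrite inE hy orbT.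
Qed.

(* The sum over a box is the sum over any transversal up to a constant, since
   character sums count each class of the dual group equally often. *)
Lemma dual_residues A D (cA : contracting R A) : residues A D ->
  exists L : seq 'cV[int]_r, [/\ size L = size D, uniq L, 0 \in L,
    forall l l', l \in L -> l' \in L -> Aimg A^T (l - l') -> l = l' &
    forall g, \sum_(l <- L) e (dotv (zmx R l) (Rinv R A *m zmx R g)) = cr (size D)%:R * (Aimg A g)%:R].
Proof.
move=> rD; have [uD D0 cD mD] := rD.
have [Q Q0 hQ] := box_avg cA.
have [s [sQ us hs hc]] := incongruent_sublist A^T Q.
have nD : (size D)%:R != 0 :> R[i] by rewrite pnatr_eq0 -lt0n.
have nQ : (size Q)%:R != 0 :> R[i] by rewrite pnatr_eq0 -lt0n.
(* Summing over the box first and over the residues second leaves only the residue divisible by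
   [A]. *)
have mult l : \sum_(l' <- Q) (Aimg A^T (l' - l))%:R = (size Q)%:R / (size D)%:R :> R[i].
  apply: (mulfI nD); rewrite mulrCA mulfV // mulr1.
  transitivity (\sum_(l' <- Q) \sum_(b <- D) e (dotv (zmx R (l' - l)) (Rinv R A *m zmx R b))).
    by rewrite mulr_sumr; apply: eq_bigr => l' _; rewrite (char_sum cA _ rD) cr_nat.
  rewrite exchange_big /=.
  transitivity (\sum_(b <- D) e (- dotv (zmx R l) (Rinv R A *m zmx R b)) * (cr (size Q)%:R * (Aimg A b)%:R)).
    apply: eq_bigr => b _; rewrite -hQ mulr_sumr; apply: eq_bigr => l' _.
    by rewrite -e2piiD zmxB dotvBl addrC.
  have [b0 hb0 hA0] : exists2 b0, b0 \in D & Aimg A b0.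
    case: (D) D0 cD => // b D' _ /(_ b (- b) (mem_head _ _))[b' hb'].
    by rewrite addNr sub0r => /AimgN; rewrite opprK => h; exists b'.
  rewrite (bigD1_seq b0) //= hA0 mulr1 big1_seq ?addr0; last first.
    move=> b /andP[bb0 hb]; case: (boolP (Aimg A b)) => h; last by rewrite !mulr0.
    by rewrite (mD b b0) ?eqxx // in bb0; exact: AimgB.
  rewrite cr_nat; have [k hk] := AimgP _ _ hA0.
  rewrite hk zmxM Rinv_mul // isint_e ?mul1r //.
  by apply: isintN; exact: dotv_int.
have sum g : \sum_(l <- s) e (dotv (zmx R l) (Rinv R A *m zmx R g)) = cr (size D)%:R * (Aimg A g)%:R.
  apply: (mulfI nQ); rewrite cr_nat mulrCA -cr_nat -hQ.
  transitivity ((size D)%:R * (\sum_(l <- s) \sum_(l' <- Q) (Aimg A^T (l' - l))%:R * e (dotv (zmx R l) (Rinv R A *m zmx R g)))).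
    rewrite !mulr_sumr; apply: eq_bigr => l _.
    by rewrite -mulr_suml mult cr_nat mulrA [_ * (_ / _)]mulrC divfK.
  congr (_ * _); rewrite exchange_big /=; apply: eq_big_seq => l' hl'.
  have [l hl hll] := hc l' hl'.
  rewrite (bigD1_seq l) //= hll mul1r big1_seq ?addr0; last first.
    move=> k /andP[kl hk]; case: (boolP (Aimg A^T (l' - k))) => h; last by rewrite mul0r.
    suff hkl : k = l by rewrite hkl eqxx in kl.
    by apply: hs => //; have := AimgB hll h; congr (Aimg _ _); mxring.
  have -> : dotv (zmx R l') (Rinv R A *m zmx R g) = dotv (zmx R l) (Rinv R A *m zmx R g) +
      dotv (zmx R (l' - l)) (Rinv R A *m zmx R g) by rewrite zmxB dotvBl addrC subrK.
  by rewrite e2piiD (isint_e (dot_RinvT cA _ hll)) mulr1.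
have ss : size s = size D.
  apply/eqP; rewrite -(eqr_nat R[i]); apply/eqP.
  have := sum 0; rewrite Aimg0 mulr1 cr_nat => <-.
  by rewrite zmx0 mulmx0 (eq_bigr (fun=> 1)) ?sum_const_seq ?mulr1 // => l _; rewrite dotv0r e2pii0.
case hs0 : s ss => [|l0 s'] ss; first by rewrite -ss in D0.
exists [seq l - l0 | l <- s]; split.
- by rewrite size_map hs0.
- by rewrite map_inj_uniq //; exact: addIr.
- by apply/mapP; exists l0; rewrite ?hs0 ?mem_head // subrr.
- move=> _ _ /mapP[l hl ->] /mapP[l' hl' ->] h; congr (_ - _); apply: hs => //.
  by move: h; congr (Aimg _ _); mxring.
- move=> g; rewrite big_map.
  transitivity (\sum_(l <- s) e (- dotv (zmx R l0) (Rinv R A *m zmx R g)) * e (dotv (zmx R l) (Rinv R A *m zmx R g))).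
    by apply: eq_bigr => l _; rewrite -e2piiD zmxB dotvBl addrC.
  rewrite -mulr_sumr sum; case: (boolP (Aimg A g)) => h; last by rewrite !mulr0.
  have [k hk] := AimgP _ _ h.
  rewrite {1}hk zmxM Rinv_mul // isint_e ?mul1r //.
  by apply: isintN; exact: dotv_int.
Qed.

End Dual.

Section Tile.
Variables (R : realType) (r : nat).
Local Notation e := (@e2pii R).
Local Notation X := 'cV[R]_r.
Variables (A : 'M[int]_r) (DD : seq (seq 'cV[int]_r)) (n0 : nat).
Hypothesis cA : contracting R A.
Hypothesis fD : digit_family A DD n0.
Hypothesis cD : forall D, D \in DD -> complete A D.
Let T := Tinv R A.
Let S := A^T.
Implicit Types (x y : X) (g : 'cV[int]_r).

Lemma fam_residues D : D \in DD -> residues A D.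
Proof.
move=> hD; split.
- exact: (fam_uniq fD).
- by rewrite (fam_card fD hD) (fam_pos fD).
- exact: cD.
- exact: (fam_mod fD).
Qed.

Lemma fam_pow_complete n E : E \in fam_pow A DD n -> complete (A ^+ n) E.
Proof.
elim: n E => [|n IH] E.
  rewrite inE => /eqP -> b g; rewrite inE => /eqP ->; exists 0; rewrite ?mem_head //.
  by apply/AimgP; exists g; rewrite mulTX0 addr0 subr0.
move=> /allpairsP[[D E'] /= [hD hE ->]] _ g /allpairsP[[b x] /= [hb hx ->]].
have [b' hb' /AimgP[k hk]] := cD hD g hb.
have [x' hx' /AimgP[l hl]] := IH E' hE x k hx.
exists (b' + A *m x'); first by apply/allpairsP; exists (b', x').
apply/AimgP; exists l; rewrite AXS -hl mulmxBr mulmxDr -hk; mxring.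
Qed.

Lemma fam_pow_residues n E : E \in fam_pow A DD n -> residues (A ^+ n) E.
Proof.
move=> hE; have f := fam_powP cA fD n; split.
- exact: (fam_uniq f).
- by rewrite (fam_card f hE) (fam_pos f).
- exact: fam_pow_complete.
- exact: (fam_mod f).
Qed.

Lemma fam_pow_cat m n E E' : E \in fam_pow A DD m -> E' \in fam_pow A DD n ->
  exists2 E2, E2 \in fam_pow A DD (m + n) &
    forall x b : 'cV[int]_r, x \in E -> b \in E' -> x + A ^+ m *m b \in E2.
Proof.
elim: m E => [|m IH] E.
  rewrite inE => /eqP -> hE'; exists E' => // x b; rewrite inE => /eqP -> hb.
  by rewrite mulTX0 add0r.
move=> /allpairsP[[D F] /= [hD hF ->]] hE'.
have [E2 h2 h2'] := IH F hF hE'.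
exists [seq b + A *m v | b <- D, v <- E2]; first by apply/allpairsP; exists (D, E2).
move=> _ b /allpairsP[[c x] /= [hc hx ->]] hb.
apply/allpairsP; exists (c, x + A ^+ m *m b); split => //=; first exact: h2'.
by rewrite AXS mulmxDr addrA.
Qed.

Lemma fam_pow_ne n : exists2 E, E \in fam_pow A DD n & exists b, b \in E.
Proof.
have f := fam_powP cA fD n; have := fam_size f; case h : (fam_pow A DD n) => [|E s] // _.
have hE : E \in fam_pow A DD n by rewrite h mem_head.
exists E; first by rewrite mem_head.
have := fam_pos f; rewrite -(fam_card f hE); case: (E) => // b ? _; exists b; exact: mem_head.
Qed.

(** Completeness supplies a successor for every frequency and digit: the operator is now
    stochastic. *)
Lemma Pop_one : Pop A DD (fun=> 1 : R) = fun=> 1.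
Proof.
apply/funext => g; rewrite /Pop -[RHS](@fam_sum_const R r A DD n0 fD).
congr (_ * _); apply: eq_big_seq => D hD; congr (_ * _); apply: eq_big_seq => b hb.
have [[b' hb' [k [_ ->]]] //|h0] := next_sum fD g (fun=> 0 : R) hD hb.
have [b' hb' hA] := cD hD g hb.
have := h0 (fun=> 1); rewrite (bigD1_seq b') ?(fam_uniq fD) //= {1}/nextf hA => /eqP.
rewrite paddr_eq0 ?ler01 ?oner_eq0 // sumr_ge0 // => c _.
by rewrite /nextf; case: ifP.
Qed.

Lemma iterPop_one m : iter m (Pop A DD) (fun=> 1 : R) = fun=> 1.
Proof. by elim: m => [|m IH] //; rewrite iterS IH Pop_one. Qed.

Lemma PopB (f h : 'cV[int]_r -> R) g : Pop A DD (fun k => f k - h k) g = Pop A DD f g - Pop A DD h g.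
Proof.
rewrite /Pop -mulrBr -sumrB; congr (_ * _); apply: eq_bigr => D _.
rewrite -mulrBr -sumrB; congr (_ * _); apply: eq_bigr => b _.
rewrite -sumrB; apply: eq_bigr => b' _; rewrite /nextf; case: ifP => // _.
by rewrite subr0.
Qed.

Lemma iterPopB m (f h : 'cV[int]_r -> R) g :
  iter m (Pop A DD) (fun k => f k - h k) g = iter m (Pop A DD) f g - iter m (Pop A DD) h g.
Proof.
elim: m g => [|m IH] g //=; rewrite -PopB; congr (Pop A DD _ g).
by apply/funext => k; exact: IH.
Qed.

(** Compare the cosine with the function equal to 1 at frequency 0 and to -1 elsewhere. *)
Lemma iterPop_cos m (y : X) g :
  1 - 2 * alive R A DD m g <= iter m (Pop A DD) (fun k => complex.Re (cr 1 * e (dotv (zmx R k) y))) g.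
Proof.
apply: (@le_trans _ _ (iter m (Pop A DD) (fun k => 1 - 2 * (k != 0)%:R) g)).
  by rewrite iterPopB iterPop_one iterPop_scale.
apply: (iterPop_le fD) => k; rewrite ReZ mul1r.
case: eqVneq => [->|_]; first by rewrite mulr0 subr0 zmx0 dotv0l e2pii0.
by rewrite mulr1 /=; have := cos_geN1 (2 * pi * dotv (zmx R k) y); lra.
Qed.

Let u01 := @mean_sqn_01 R r DD.

(** A trigonometric polynomial bounded by 1 that, for a large constant, is positive only near the
    lattice. *)
Definition bump (C : R) x : R := 1 - C * \sum_i (1 - cos (2 * pi * x i ord0)).

Lemma bump_le1 C x : 0 <= C -> bump C x <= 1.
Proof.
move=> C0; rewrite /bump lerBlDr lerDl mulr_ge0 // sumr_ge0 // => i _.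
Qed.

Lemma bump_near x (eta : R) : 0 < eta -> eta <= 2^-1 -> 0 < bump (1 - cos (2 * pi * eta))^-1 x ->
  exists k, nrm1 (x - zmx R k) <= r%:R * eta.
Proof.
move=> e0 e1 hb.
have c1 : 0 < 1 - cos (2 * pi * eta) by rewrite subr_gt0 cos_2pi_lt1.
have h i : exists n : int, `|x i ord0 - n%:~R| < eta.
  apply: (cos_near e0 e1); rewrite ltNge; apply/negP => hc; move: hb; rewrite ltNge => /negP; apply.
  rewrite /bump subr_le0 mulrC ler_pdivlMr // mul1r (bigD1 i) //=.
  rewrite -[leLHS]addr0; apply: lerD; first by rewrite lerB.
  by apply: sumr_ge0 => j _; rewrite subr_ge0 cos_le1.
have [f hf] := choice h; exists (\col_i f i).
rewrite /nrm1 mulr_natl -[r in leRHS]card_ord -sumr_const; apply: ler_sum => i _.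
by rewrite !mxE ltW.
Qed.

(** The weights at level n + 1 over a transversal [L] form a probability whose image on the torus
    concentrates at 0, by [iterPop_cos]. Each point close to an integer vector is moved by it to a
    translate of [x] whose q is nearly its weight. *)
Lemma tile_absorbing : (forall g, ~ immortal R A DD g) -> forall x (eps : R), 0 < eps ->
  exists2 F : seq 'cV[int]_r, uniq F & 1 - eps <= \sum_(k <- F) q T (mean_sqn DD) (x + zmx R k).
Proof.
move=> hno x eps eps0.
have hpos D : D \in DD -> (0 < size D)%N by move=> hD; rewrite (fam_card fD hD) (fam_pos fD).
have [c c0 hc] := q_family_near cA (fam_size fD) hpos.
pose ep := Num.min (eps / 2) 1.
have ep0 : 0 < ep by rewrite lt_min ltr01 divr_gt0.
have ep1 : ep <= 1 by rewrite ge_min lexx orbT.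
have epe : ep + ep <= eps.
  have : ep <= eps / 2 by rewrite ge_min lexx.
  lra.
pose eta : R := Num.min 2^-1 (ep / (c * (r%:R + 1))).
have r1 : 0 < r%:R + 1 :> R by rewrite ltr_wpDl.
have eta0 : 0 < eta by rewrite lt_min invr_gt0 divr_gt0 ?mulr_gt0 // andbT.
have eta1 : eta <= 2^-1 by rewrite ge_min lexx.
have etac : c * (r%:R * eta) <= ep.
  apply: (@le_trans _ _ (c * ((r%:R + 1) * (ep / (c * (r%:R + 1)))))); last first.
    by rewrite le_eqVlt; apply/orP; left; apply/eqP; field; rewrite !gt_eqF.
  rewrite ler_wpM2l ?(ltW c0) //; apply: ler_pM; rewrite ?(ltW eta0) //; last by rewrite ge_min lexx orbT.
  by rewrite lerDl.
pose C : R := (1 - cos (2 * pi * eta))^-1.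
have C0 : 0 < C by rewrite invr_gt0 subr_gt0 cos_2pi_lt1.
pose del (i : 'I_r) : 'cV[int]_r := \col_j (j == i)%:Z.
have hdel : 0 < ep / (2 * C * (r%:R + 1)) by rewrite divr_gt0 // !mulr_gt0.
have [n hn] := alive_uniform cA fD (enum 'I_r) del hno hdel.
have [cAn fDn] := contr_fam_pow cA fD n.
have [E hE _] := fam_pow_ne n.+1.
(* On a transversal, unlike on a box, the normalising factor of the transfer identity is 1. *)
have [L [sL uL _ mL hL]] := dual_residues cAn (fam_pow_residues hE).
have sLn : size L = (n0 ^ n.+1)%N by rewrite sL (fam_card fDn hE).
have L0 : (0 < size L)%N by rewrite sLn (fam_pos fDn).
pose w (l : 'cV[int]_r) : R := qn T (mean_sqn DD) n.+1 (x + zmx R l).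
pose y (l : 'cV[int]_r) : X := T ^+ n.+1 *m (x + zmx R l).
have w0 l : 0 <= w l by have /andP[] := qn01 T u01 n.+1 (x + zmx R l).
have trans z g : \sum_(l <- L) w l * complex.Re (z * e (dotv (zmx R g) (y l))) =
   iter n.+1 (Pop A DD) (fun k => complex.Re (z * e (dotv (zmx R k) x))) g.
  rewrite -(transfer_iter cA fD (Q := L)) //; last by move=> D b b' _ _ _; rewrite hL sL.
  by rewrite sLn divff ?mul1r // pnatr_eq0 -sLn -lt0n.
have w1 : \sum_(l <- L) w l = 1.
  have := trans (cr 1) 0; rewrite (iterPop0 cA fD) zmx0 dotv0l e2pii0 mulr1 /= => <-.
  by apply: eq_bigr => l _; rewrite !dotv0l mulr0 cos0 sin0 mulr0 subr0 !mulr1.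
have lower : 1 - ep <= \sum_(l <- L) w l * bump C (y l).
  have -> : \sum_(l <- L) w l * bump C (y l) = 1 - C * \sum_(i < r)
      (1 - iter n.+1 (Pop A DD) (fun k => complex.Re (cr 1 * e (dotv (zmx R k) x))) (del i)).
    have hcos i l : complex.Re (cr 1 * e (dotv (zmx R (del i)) (y l))) = cos (2 * pi * y l i ord0).
      rewrite ReZ mul1r /= /dotv (bigD1 i) //= big1 => [|j ji]; rewrite !mxE ?eqxx ?mul1r ?addr0 //.
      by rewrite (negPf ji) mul0r.
    transitivity (\sum_(l <- L) (w l - C * \sum_i (w l - w l * cos (2 * pi * y l i ord0)))).
      apply: eq_bigr => l _; rewrite /bump mulrBr mulr1 mulrCA mulr_sumr; congr (_ - _ * _).
      by apply: eq_bigr => i _; rewrite mulrBr mulr1.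
    rewrite sumrB w1 -mulr_sumr exchange_big; congr (1 - C * _); apply: eq_bigr => i _.
    rewrite sumrB w1 -trans; congr (1 - _); apply: eq_bigr => l _.
    by rewrite hcos.
  rewrite lerB //.
  apply: (@le_trans _ _ (C * \sum_(i < r) (2 * (ep / (2 * C * (r%:R + 1)))))).
    rewrite ler_wpM2l ?(ltW C0) //; apply: ler_sum => i _.
    have h1 := iterPop_cos n.+1 x (del i).
    have h2 : alive R A DD n.+1 (del i) <= ep / (2 * C * (r%:R + 1)) by apply: hn; rewrite mem_enum.
    lra.
  rewrite sumr_const card_ord -[_ *+ r]mulr_natl.
  have -> : C * (r%:R * (2 * (ep / (2 * C * (r%:R + 1))))) = ep * (r%:R / (r%:R + 1)).
    by field; rewrite !gt_eqF.
  by rewrite -[leRHS]mulr1 ler_wpM2l ?(ltW ep0) // ler_pdivrMr // mul1r lerDl.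
have [kap hkap] : exists kap : 'cV[int]_r -> 'cV[int]_r, forall l, 0 < bump C (y l) ->
    nrm1 (y l - zmx R (kap l)) <= r%:R * eta.
  have H l : exists k, 0 < bump C (y l) -> nrm1 (y l - zmx R k) <= r%:R * eta.
    case: (boolP (0 < bump C (y l))) => hb; last by exists 0.
    by have [k hk] := bump_near eta0 eta1 hb; exists k.
  by have [f hf] := choice H; exists f.
pose L' := [seq l <- L | 0 < bump C (y l)].
(* These are distinct because [L] is incongruent modulo S^(n+1); points where [bump] is not positive
   are dropped at no cost. *)
exists [seq l - S ^+ n.+1 *m kap l | l <- L'].
  rewrite map_inj_in_uniq ?filter_uniq // => l l'; rewrite !mem_filter => /andP[_ hl] /andP[_ hl'] hll.
  apply: mL => //; apply/AimgP; exists (kap l - kap l').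
  have -> : (A ^+ n.+1)^T = S ^+ n.+1 by rewrite trmxX.
  by rewrite -[l in LHS](subrK (S ^+ n.+1 *m kap l)) hll mulmxBr; mxring.
rewrite big_map big_filter.
apply: (@le_trans _ _ ((1 - ep) * \sum_(l <- L) w l * bump C (y l))).
  apply: (@le_trans _ _ ((1 - ep) * (1 - ep))).
    have : 0 <= ep * ep by rewrite mulr_ge0 // ltW.
    lra.
  by rewrite ler_wpM2l // subr_ge0.
rewrite mulr_sumr [leRHS]big_mkcond; apply: ler_sum => l _.
case: ifP => hb; last first.
  rewrite mulrA mulr_ge0_le0 //; first by rewrite mulr_ge0 // subr_ge0.
  by rewrite leNgt hb.
rewrite zmxB addrA (q_iter T u01 n.+1) -zmxN -mulmxN qn_int // -/(w l).
rewrite mulmxDr -/(y l) TinvX_mul // zmxN.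
apply: (@le_trans _ _ ((1 - ep) * w l)).
  rewrite mulrA -[leRHS]mulr1 ler_wpM2l ?bump_le1 ?(ltW C0) //.
  by rewrite mulr_ge0 // subr_ge0.
rewrite mulrC ler_wpM2l //; apply: le_trans (hc _).
by rewrite lerB // (le_trans _ etac) // ler_wpM2l ?(ltW c0) // hkap.
Qed.

End Tile.

(** * A harmonic trigonometric polynomial and its extremal set *)

Section InvariantSet.
Variables (R : realType) (r : nat).
Local Notation e := (@e2pii R).
Local Notation X := 'cV[R]_r.
Variables (A : 'M[int]_r) (DD : seq (seq 'cV[int]_r)) (n0 : nat).
Hypothesis cA : contracting R A.
Hypothesis fD : digit_family A DD n0.
Hypothesis cD : forall D, D \in DD -> complete A D.
Let T := Tinv R A.
Let S := A^T.
Implicit Types (g k : 'cV[int]_r).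

Lemma immortal_closed D b b' g k : D \in DD -> b \in D -> b' \in D ->
  immortal R A DD g -> g + b - b' = A *m k -> immortal R A DD k.
Proof.
move=> hD hb hb' hg hk.
have [b2 hb2 [k2 hk2 ik2]] := immortal_next fD hg hD hb.
have hbb : b2 = b'.
  apply: (fam_mod fD hD) => //; apply/AimgP; exists (k - k2).
  by rewrite mulmxBr -hk -hk2; mxring.
suff -> : k = k2 by [].
by apply: (contr_inj cA); rewrite /= -hk -hk2 hbb.
Qed.

Lemma PopD (f h : 'cV[int]_r -> R) g : Pop A DD (fun k => f k + h k) g = Pop A DD f g + Pop A DD h g.
Proof.
have -> : (fun k => f k + h k) = (fun k => f k - (-1) * h k).
  by apply/funext => k; rewrite mulN1r opprK.
by rewrite PopB Pop_scale mulN1r opprK.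
Qed.

Lemma Pop_sum (I : Type) (s : seq I) (c : I -> R) (h : I -> 'cV[int]_r -> R) g :
  Pop A DD (fun k => \sum_(i <- s) c i * h i k) g = \sum_(i <- s) c i * Pop A DD (h i) g.
Proof.
elim: s => [|i s IH].
  rewrite big_nil; have -> : (fun k => \sum_(i <- [::]) c i * h i k) = (fun k => 0 * 0).
    by apply/funext => k; rewrite big_nil mulr0.
  by rewrite (Pop_scale A DD 0 (fun=> 0)) mul0r.
rewrite big_cons -IH -Pop_scale -PopD; congr (Pop A DD _ g).
by apply/funext => k; rewrite big_cons.
Qed.

(** On a finite closed set of immortal frequencies the operator is a stochastic matrix. It fixes the
    constant vector, so 1 is an eigenvalue and there is also a left eigenvector. *)
Lemma stationary : (exists g, immortal R A DD g) -> exists (s : seq 'cV[int]_r) (c : 'cV[int]_r -> R),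
  [/\ uniq s, 0 \notin s, exists2 g, g \in s & c g != 0 &
      forall f, \sum_(g <- s) c g * Pop A DD f g = \sum_(g <- s) c g * f g].
Proof.
move=> [g0 ig0].
have [s [us g0s sI sC]] := finite_closed cA (DD := DD) (G := immortal R A DD) immortal_closed ig0.
pose m := size s.
pose gi (i : 'I_m) := tnth (in_tuple s) i.
have gis i : gi i \in s by exact: mem_tnth.
have ginj : injective gi by apply/tuple_uniqP.
pose M : 'M[R]_m := \matrix_(i, j) Pop A DD (fun k => (k == gi j)%:R) (gi i).
have PopE f i : Pop A DD f (gi i) = \sum_j M i j * f (gi j).
  transitivity (Pop A DD (fun k => \sum_j f (gi j) * (k == gi j)%:R) (gi i)); last first.
    by rewrite Pop_sum; apply: eq_bigr => j _; rewrite mxE mulrC.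
  have hf k : k \in s -> f k = \sum_j f (gi j) * (k == gi j)%:R.
    move=> /(@seq_tnthP _ s)[j ->]; rewrite (bigD1 j) //= eqxx mulr1 big1 ?addr0 // => l lj.
    by rewrite (inj_eq ginj) eq_sym (negPf lj) mulr0.
  have hC D b b' g k : D \in DD -> b \in D -> b' \in D -> [set` s]%classic g ->
     g + b - b' = A *m k -> [set` s]%classic k by exact: sC.
  apply/eqP; rewrite eq_le; apply/andP; split.
    by apply: (Pop_le fD hC _ (gis i)) => k /hf ->.
  by apply: (Pop_le fD hC _ (gis i)) => k /hf ->.
have [v v0 hv] : exists2 v : 'rV[R]_m, v != 0 & v *m (M - 1%:M) = 0.
  apply/det0P; apply: contraT => hdet.
  have uM : M - 1%:M \in unitmx by rewrite unitmxE unitfE.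
  have : (M - 1%:M) *m (const_mx 1 : 'cV[R]_m) = 0.
    apply/matrixP => i j; rewrite mulmxBl mul1mx !mxE.
    under eq_bigr => l _ do rewrite [const_mx _ _ _]mxE.
    by rewrite -(PopE (fun=> 1)) (Pop_one R fD cD) subrr.
  move/(congr1 (mulmx (invmx (M - 1%:M)))); rewrite mulmxA mulVmx // mul1mx mulmx0.
  have [i0 _] := seq_tnthP g0s.
  by move=> /matrixP /(_ i0 0); rewrite !mxE => /eqP; rewrite oner_eq0.
have hv' j : \sum_i v 0 i * M i j = v 0 j.
  move: hv; rewrite mulmxBr mulmx1 => /eqP; rewrite subr_eq0 => /eqP /matrixP /(_ 0 j).
  by rewrite mxE.
pose c k := \sum_i v 0 i * (k == gi i)%:R.
have cE i : c (gi i) = v 0 i.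
  rewrite /c (bigD1 i) //= eqxx mulr1 big1 ?addr0 // => j ji.
  by rewrite (inj_eq ginj) eq_sym (negPf ji) mulr0.
have sumE (f : 'cV[int]_r -> R) : \sum_(g <- s) c g * f g = \sum_i v 0 i * f (gi i).
  by rewrite big_tnth; apply: eq_bigr => i _; rewrite -cE.
exists s, c; split=> //.
- by apply/negP => /sI /immortal_neq0; rewrite eqxx => /(_ _ cA fD).
- have [i hi] : exists i, v 0 i != 0.
    apply/existsP; apply: contraT; rewrite negb_exists => /forallP h; case/negP: v0.
    by apply/eqP/rowP => i; rewrite mxE; apply/eqP; have := h i; rewrite negbK.
  by exists (gi i); rewrite ?cE.
- move=> f; rewrite !sumE.
  under eq_bigr => i _ do rewrite PopE mulr_sumr.
  rewrite exchange_big; apply: eq_bigr => j _ /=.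
  under eq_bigr => i _ do rewrite mulrA.
  by rewrite -mulr_suml hv'.
Qed.

(** The stationary coefficients [c] define a function [F] that is harmonic for the Ruelle operator.
    Where Re (z F) is maximal, the maximum principle makes it maximal at every preimage of positive
    weight. *)
Lemma invariant_set : (exists g, immortal R A DD g) -> exists Y : set X,
  [/\ zclosed Y, exists y, Y y, ~ Y 0 &
      forall y, Y (zmx R S *m y) -> mean_sqn DD y != 0 -> Y y].
Proof.
move=> /stationary[s [c [us s0 [g1 g1s cg1] hc]]].
pose F : X -> R[i] := fun x => \sum_(g <- s) cr (c g) * chi g x.
have trF : trig F by apply: trig_sum => g; exact: trig_chi.
have sep g : g != 0 -> exists2 h : X, setT h & ~ isint (dotv (zmx R g) h).
  move=> g0; have [i gi0] : exists i, g i ord0 != 0.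
    apply/existsP; apply: contraT; rewrite negb_exists => /forallP h; case/negP: g0.
    by apply/eqP/matrixP => i j; rewrite mxE (ord1 j); apply/eqP; have := h i; rewrite negbK.
  exists (\col_j ((j == i)%:R / (2 * (g i ord0)%:~R))) => // -[n].
  rewrite /dotv (bigD1 i) //= big1 => [|j ji]; rewrite !mxE ?eqxx ?(negPf ji) ?mul0r ?mulr0 // addr0.
  have g0' : (g i ord0)%:~R != 0 :> R by rewrite intr_eq0.
  move=> h; have : (n * 2)%:~R = 1%:~R :> R.
    by rewrite intrM -h /=; field.
  by move=> /eqP; rewrite eqr_int => /eqP; lia.
(* The rotation [z] is chosen so that 0 is not a maximum point. It exists because [F] is not
   constant, characters of distinct frequencies being independent. *)
have [z [y1 hy1]] : exists z y1, complex.Re (z * F 0) < complex.Re (z * F y1).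
  apply: contrapT => hno.
  have hF y : F y = F 0.
    apply/eqP; rewrite -subr_eq0; apply/eqP; apply: sqn_eq0; apply/eqP; rewrite eq_le sqn_ge0 andbT.
    rewrite leNgt; apply/negP => h; apply: hno; exists (cj (F y - F 0)), y.
    rewrite -subr_gt0; have := h; rewrite -[sqn _]/(complex.Re (cr (sqn (F y - F 0)))) sqnE.
    congr (0 < _); rewrite mulrC.
    by set w := cj _; rewrite mulrBr; case: (w * F y) => ? ?; case: (w * F 0).
  pose c' g := if g == 0 then - F 0 else cr (c g).
  have hz : forall g, g \in 0 :: s -> c' g = 0.
    apply: (chi_independent (H := setT)) => //=; first by rewrite s0.
    move=> h _; rewrite big_cons chi0 /c' eqxx mulr1.
    rewrite -(hF h) /F addrC; apply/eqP; rewrite subr_eq0; apply/eqP.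
    by apply: eq_big_seq => g hg; rewrite ifN //; apply: contraNneq s0 => <-.
  have := hz g1; rewrite inE g1s orbT /c' ifN; last by apply: contraNneq s0 => <-.
  by move=> /(_ isT); rewrite -cr0 => /(@cr_inj R) h; rewrite h eqxx in cg1.
have tzF := trigZ z trF.
have [y0 hy0] := trig_max tzF.
pose f y := complex.Re (z * F y).
exists [set y | f y = f y0]%classic; split.
- move=> y hy; apply: (@cr_inj R); apply/eqP; rewrite -subr_eq0; apply/eqP.
  have h0 := hy _ (trigB (trig_Re tzF) (trig_cst r (cr (f y0)))).
  by apply: h0 => w /= hw; rewrite -/(f w) hw subrr.
- by exists y0.
- by move=> h; have := hy0 y1; rewrite -/(f y1) -/(f y0) -h leNgt hy1.
move=> y hy Uy.
have [D hD [b hb]] : exists2 D, D \in DD & exists b, b \in D.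
  have := fam_size fD; case h : (DD) => [|D s'] // _.
  have hD : D \in DD by rewrite h mem_head.
  exists D; first by rewrite mem_head.
  have := fam_pos fD; rewrite -(fam_card fD hD); case: (D) => // b ? _; exists b; exact: mem_head.
have [L [sL uL L0 mL hL]] := dual_residues cA (fam_residues fD cD hD).
have sLn : size L = n0 by rewrite sL (fam_card fD hD).
have Lgt : (0 < size L)%N by rewrite sLn (fam_pos fD).
pose x := zmx R S *m y.
pose w l := mean_sqn DD (T *m (x + zmx R l)).
have w0 l : 0 <= w l by have /andP[] := mean_sqn_01 DD (T *m (x + zmx R l)).
have trans z' g : \sum_(l <- L) w l * complex.Re (z' * e (dotv (zmx R g) (T *m (x + zmx R l)))) =
   Pop A DD (fun k => complex.Re (z' * e (dotv (zmx R k) x))) g.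
  rewrite -(transfer_op cA fD (Q := L)) //; last by move=> D' b1 b2 _ _ _; rewrite hL sL.
  by rewrite sLn divff ?mul1r // pnatr_eq0 -sLn -lt0n.
have w1 : \sum_(l <- L) w l = 1.
  have := trans (cr 1) 0; rewrite (Pop0 cA fD) zmx0 dotv0l e2pii0 mulr1 /= => <-.
  by apply: eq_bigr => l _; rewrite !dotv0l mulr0 cos0 sin0 mulr0 subr0 !mulr1.
have fE y' : f y' = \sum_(g <- s) c g * complex.Re (z * e (dotv (zmx R g) y')).
  by rewrite /f /F mulr_sumr Re_sum; apply: eq_bigr => g _; rewrite mulrCA ReZ.
have harm : \sum_(l <- L) w l * f (T *m (x + zmx R l)) = f x.
  under eq_bigr => l _ do rewrite fE mulr_sumr.
  rewrite exchange_big /= fE -hc; apply: eq_bigr => g _.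
  by rewrite -trans mulr_sumr; apply: eq_bigr => l _; rewrite mulrCA.
have : \sum_(l <- L) w l * (f y0 - f (T *m (x + zmx R l))) = 0.
  under eq_bigr => l _ do rewrite mulrBr.
  by rewrite sumrB -mulr_suml w1 mul1r harm hy subrr.
move/eqP; rewrite psumr_eq0 => [/allP /(_ 0 L0)|l _]; last by rewrite mulr_ge0 // subr_ge0 hy0.
(* Since 0 belongs to [L], the point [y] itself is one of the preimages in the harmonic identity. *)
have hxy : T *m (x + zmx R 0) = y by rewrite zmx0 addr0 /x /S zmxT Tinv_AT.
by rewrite /= hxy mulf_eq0 /w hxy (negPf Uy) /= subr_eq0 => /eqP.
Qed.

End InvariantSet.

Definition is_subgrp d (G : set 'cV[int]_d) := G 0 /\ forall a b, G a -> G b -> G (a - b).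

Definition full_rank d (G : set 'cV[int]_d) := exists2 m : nat, (0 < m)%N & forall v : 'cV[int]_d, G (v *+ m).

Lemma subgrpD d (G : set 'cV[int]_d) a b : is_subgrp G -> G a -> G b -> G (a + b).
Proof. by move=> [G0 GB] ha hb; rewrite -[b]opprK -[- b]sub0r; exact: (GB _ _ ha (GB _ _ G0 hb)). Qed.

Lemma subgrp_sum d (G : set 'cV[int]_d) (I : Type) (s : seq I) (f : I -> 'cV[int]_d) :
  is_subgrp G -> (forall i, G (f i)) -> G (\sum_(i <- s) f i).
Proof.
move=> hG h; elim/big_ind: _ => //; first by case: hG.
by move=> x y; exact: subgrpD.
Qed.

Lemma subgrpZ d (G : set 'cV[int]_d) a (n : int) : is_subgrp G -> G a -> G (n *: a).
Proof.
move=> hG ha; have hn (k : nat) : G (k%:Z *: a).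
  elim: k => [|k IH]; first by rewrite scale0r; case: hG.
  by rewrite intS scalerDl scale1r; exact: subgrpD.
case: n => k; first exact: hn.
by rewrite NegzE scaleNr -sub0r; case: hG => G0 GB; apply: GB.
Qed.

Lemma isint_subgrp (R : realType) d (P : set 'cV[R]_d) :
  is_subgrp [set g : 'cV[int]_d | forall x, P x -> isint (dotv (zmx R g) x)]%classic.
Proof.
split; first by move=> x _; rewrite zmx0 dotv0l; exact: isint0.
by move=> a b ha hb x Px; rewrite zmxB dotvBl; apply: isintB; [exact: ha|exact: hb].
Qed.

(** * Irreducible components of invariant sets *)

Section Components.
Import fingroup perm.
Variables (R : realType) (r : nat).
Local Notation e := (@e2pii R).
Local Notation X := 'cV[R]_r.
Variables (A : 'M[int]_r) (DD : seq (seq 'cV[int]_r)) (n0 : nat).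
Hypothesis cA : contracting R A.
Hypothesis fD : digit_family A DD n0.
Hypothesis cD : forall D, D \in DD -> complete A D.
Let T := Tinv R A.
Let S := A^T.
Let Sn n : 'M[R]_r := zmx R (S ^+ n).
Let U n := mean_sqn (fam_pow A DD n) : X -> R.
Implicit Types (g k : 'cV[int]_r) (Y W Z : set X).

Definition invariant Y := forall y, Y (zmx R S *m y) -> mean_sqn DD y != 0 -> Y y.

Lemma preimage_ne x : exists k, mean_sqn DD (T *m (x + zmx R k)) != 0.
Proof.
have [D hD [b hb]] : exists2 D, D \in DD & exists b, b \in D.
  have := fam_size fD; case h : (DD) => [|D s'] // _.
  have hD : D \in DD by rewrite h mem_head.
  exists D; first by rewrite mem_head.
  have := fam_pos fD; rewrite -(fam_card fD hD); case: (D) => // b ? _; exists b; exact: mem_head.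
have [L [sL uL L0 mL hL]] := dual_residues cA (fam_residues fD cD hD).
have Lgt : (0 < size L)%N by rewrite sL (fam_card fD hD) (fam_pos fD).
have hyp D' (b1 b2 : 'cV[int]_r) : D' \in DD -> b1 \in D' -> b2 \in D' ->
    \sum_(l <- L) e (dotv (zmx R l) (Rinv R A *m zmx R (0 + b1 - b2))) = cr (size L)%:R * (Aimg A (0 + b1 - b2))%:R.
  by move=> _ _ _; rewrite hL sL.
have h := transfer_op cA fD Lgt (cr 1) x hyp; rewrite (Pop0 cA fD) zmx0 dotv0l e2pii0 mulr1 /= in h.
apply: contrapT => /forallNP hn; move/eqP: h.
rewrite big1 ?mulr0 1?eq_sym ?oner_eq0 // => l _.
have -> : mean_sqn DD (T *m (x + zmx R l)) = 0 by apply/eqP; apply: contrapT => /negP; exact: hn.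
by rewrite mul0r.
Qed.

Lemma Sn_int n k : Sn n *m zmx R k = zmx R (S ^+ n *m k).
Proof. by rewrite /Sn zmxM. Qed.

Lemma SnS n (y : X) : Sn n.+1 *m y = Sn n *m (zmx R S *m y).
Proof. by rewrite /Sn !zmxX mulTX. Qed.

Lemma Sn0 (y : X) : Sn 0 *m y = y.
Proof. by rewrite /Sn zmxX mulTX0. Qed.

Lemma SnD m n (y : X) : Sn (m + n) *m y = Sn m *m (Sn n *m y).
Proof. by rewrite /Sn !zmxX mulTXD. Qed.

(** By minimality [Y] equals its closed subset of points whose image under S stays in [Y]. That
    subset is again invariant, and it is nonempty since every point of [Y] has a preimage in [Y]
    modulo integers. *)
Lemma minimal_invariant : (exists g, immortal R A DD g) -> exists Y,
  [/\ zclosed Y, exists y, Y y, ~ Y 0, invariant Y &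
      (forall y, Y y -> Y (zmx R S *m y)) /\
      forall x, Y x -> exists2 y, Y y & exists k, zmx R S *m y = x + zmx R k].
Proof.
move=> /(invariant_set cA fD cD)[Y0 [c0 ne0 n0' i0]].
have [||Y [cY neY nY iY] Ymin] := @zmin R r [set Y | [/\ zclosed Y, exists y, Y y, ~ Y 0 & invariant Y]]%classic.
- by exists Y0.
- by move=> W [].
have back x : Y x -> exists2 y, Y y & exists k, zmx R S *m y = x + zmx R k.
  move=> Yx; have [k hk] := preimage_ne x.
  have hS : zmx R S *m (T *m (x + zmx R k)) = x + zmx R k by rewrite /S zmxT AT_Tinv.
  exists (T *m (x + zmx R k)); last by exists k.
  by apply: iY hk; rewrite hS; exact: zclosed_int.
exists Y; split=> //; split=> // y Yy.
have [||] := Ymin (fun y => Y y /\ Y (zmx R S *m y)) _ _ y Yy => //; last by move=> z [].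
split.
- by apply: zclosedI => //; exact: zclosed_comp.
- have [x Yx] := neY; have [z Yz [k hk]] := back x Yx.
  by exists z; split => //; rewrite hk; exact: zclosed_int.
- by move=> [].
- by move=> z [h1 h2] Uz; split => //; exact: iY.
Qed.

Lemma invariant_iter Y n y : invariant Y -> Y (Sn n *m y) -> U n y != 0 -> Y y.
Proof.
move=> iY; elim: n y => [|n IH] y; first by rewrite Sn0.
rewrite SnS /U mean_sqn_powS mulf_eq0 negb_or -zmxT => h /andP[h1 h2].
by apply: iY => //; exact: IH.
Qed.

(** Only a semigroup of translations: inclusion, not equality, is required. *)
Definition stab W : set X := [set t | forall y, W y -> W (y + t)]%classic.

Lemma mean_sqn_zclosed (EE : seq (seq 'cV[int]_r)) t :
  zclosed (fun x : X => mean_sqn EE (x + t) = 0).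
Proof.
have tm : trig (fun x : X => cr (mean_sqn EE x)).
  have -> : (fun x : X => cr (mean_sqn EE x)) =
    fun x => cr (size EE)%:R^-1 * \sum_(E <- EE) mean_e E x * cj (mean_e E x).
    by apply/funext => x; rewrite crM cr_sum; congr (_ * _); apply: eq_bigr => E _; rewrite sqnE.
  have te E : trig (mean_e E : X -> R[i]).
    apply: trigZ; apply: trig_sum => b; have := trig_chi1 R b; congr trig.
    by apply/funext => x; rewrite /chi dotvC.
  apply: trigZ; apply: trig_sum => E; apply: trigM => //; exact: trig_cj.
move=> x hx; apply: (@cr_inj R); apply: (hx _ (trig_shift t tm)) => w hw.
by rewrite hw.
Qed.

(** S permutes the components of the minimal set up to closure; [p] is the order of the permutation
    and [W] any component. For the last clause, irreducibility places a translate of [W] inside a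
    single component, which has to be [W]. *)
Lemma component : (exists g, immortal R A DD g) -> exists (p : nat) W,
  [/\ (0 < p)%N, zclosed W, exists y, W y, ~ W 0 & forall n, (p %| n)%N ->
  [/\ forall y, W y -> W (Sn n *m y),
      forall Z, zclosed Z -> (forall y, W y -> Z (Sn n *m y)) -> forall y, W y -> Z y &
      forall y t, W y -> isintv (Sn n *m t) -> U n (y + t) != 0 -> stab W t]].
Proof.
move=> /minimal_invariant[Y [cY [y0 Yy0] nY iY [SY back]]].
have [m [V [iV hV hirr]]] := zirr_decomp cY.
have cV i : zclosed (V i) by have [] := iV i.
have VY i x : V i x -> Y x by move=> h; apply/hV; exists i.
pose I i := zcl (fun x => exists2 y, V i y & x = zmx R S *m y).
(* [V j] is covered by the closed images of the components, so it lies in one of them; that image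
   lies in some component, and irredundancy makes both inclusions equalities. *)
have step j : exists i, forall x, I i x <-> V j x.
  have [||i hi] := @zirr_fin R r (V j) _ I (iV j).
  - by move=> i; exact: zcl_closed.
  - move=> x /VY /back[y /hV[i hy] [k hk]]; exists i.
    have -> : x = zmx R S *m y + zmx R (- k) by rewrite hk zmxN addrK.
    by apply: (@zclosed_int R r (I i)); [exact: zcl_closed|apply: zcl_sub; exists y].
  have [||j' hj'] := @zirr_fin R r (V i) _ (fun j x => V j (zmx R S *m x)) (iV i).
  - by move=> j'; exact: zclosed_comp.
  - by move=> x /VY /SY /hV.
  have hI x : I i x -> V j' x by apply: zcl_min => // _ [y hy ->]; exact: hj'.
  have jj : j = j' by apply: hirr => x /hi /hI.
  by exists i => x; split => [/hI|/hi //]; rewrite jj.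
have [nx hnx] := choice step.
have nxi : injective nx.
  by move=> j j' h; apply: hirr => x /hnx; rewrite h => /hnx.
pose s : {perm 'I_m} := perm nxi.
have dens n j : (forall y, V ((s ^+ n)%g j) y -> V j (Sn n *m y)) /\
   forall Z, zclosed Z -> (forall y, V ((s ^+ n)%g j) y -> Z (Sn n *m y)) -> forall y, V j y -> Z y.
  elim: n => [|n [IH1 IH2]].
    rewrite expg0 perm1; split => [y|Z cZ h y hy]; first by rewrite Sn0.
    by rewrite -[y]Sn0; exact: h.
  rewrite expgSr permM permE; split => [y hy|Z cZ h y].
    by rewrite SnS; apply: IH1; apply/hnx; apply: zcl_sub; exists y.
  apply: IH2 => // z /hnx; apply: (zcl_min (Y := fun z => Z (Sn n *m z))).
    exact: zclosed_comp.
  by move=> _ [w hw ->]; rewrite -SnS; exact: h.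
have [i0 hi0] := (hV y0).1 Yy0.
exists #[s]%g, (V i0); split => //.
- by have [_] := iV i0.
- by move=> /VY.
move=> n /dvdnP[l hl].
have sn : (s ^+ n = 1)%g by rewrite hl mulnC expgM expg_order expg1n.
split.
- by have [] := dens n i0; rewrite sn perm1.
- by have [] := dens n i0; rewrite sn perm1.
move=> y t Wy [k hk] Uy.
(* By invariance every translate x + t lies in some component, unless the weight vanishes there. The
   index [None] stands for this last closed set, which is excluded at [y]. *)
pose Q (o : option 'I_m) : set X := if o is Some j then fun x => V j (x + t) else fun x => U n (x + t) = 0.
have [||[j|] hj] := @zirr_fin R r (V i0) _ Q (iV i0).
- by case => [j|]; [exact: zclosed_shift|exact: mean_sqn_zclosed].
- move=> x Wx; case: (boolP (U n (x + t) == 0)) => [/eqP h|h]; first by exists None.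
  have /hV[j hj] : Y (x + t).
    apply: (@invariant_iter _ n) => //; rewrite mulmxDr hk; apply: zclosed_int => //.
    by apply/VY; apply: (dens n i0).1; rewrite sn perm1.
  by exists (Some j).
- have hij : i0 = j.
    apply: hirr => x; have [_] := dens n i0; rewrite sn perm1; apply => // z hz.
    have -> : Sn n *m z = Sn n *m (z + t) + zmx R (- k) by rewrite mulmxDr hk zmxN addrK.
    by apply: zclosed_int => //; apply: (dens n j).1; rewrite sn perm1; exact: hj.
  by move=> x /hj /=; rewrite hij.
- by have := hj y Wy; move/eqP; rewrite (negPf Uy).
Qed.

End Components.

(** * The frequencies that are trivial on the stabiliser *)

Section Annihilator.
Variables (R : realType) (r : nat).
Local Notation e := (@e2pii R).
Local Notation X := 'cV[R]_r.
Variables (A : 'M[int]_r) (DD : seq (seq 'cV[int]_r)) (n0 : nat).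
Hypothesis cA : contracting R A.
Hypothesis fD : digit_family A DD n0.
Hypothesis cD : forall D, D \in DD -> complete A D.
Let S := A^T.
Let Sn n : 'M[R]_r := zmx R (S ^+ n).
Let U n := mean_sqn (fam_pow A DD n) : X -> R.
Implicit Types (g : 'cV[int]_r) (W Z : set X).

Variables (p : nat) (W : set X).
Hypothesis p0 : (0 < p)%N.
Hypothesis cW : zclosed W.
Hypothesis neW : exists y, W y.
Hypothesis nW : ~ W 0.
Hypothesis W_iter : forall n, (p %| n)%N -> forall y, W y -> W (Sn n *m y).
Hypothesis W_dens : forall n, (p %| n)%N -> forall Z, zclosed Z ->
  (forall y, W y -> Z (Sn n *m y)) -> forall y, W y -> Z y.
Hypothesis W_stab : forall n, (p %| n)%N -> forall y t, W y -> isintv (Sn n *m t) ->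
  U n (y + t) != 0 -> stab W t.

Let H := stab W.
Definition annih : set 'cV[int]_r := [set g | forall h, H h -> isint (dotv (zmx R g) h)]%classic.

Lemma dot_Sn n g (x : X) : dotv (zmx R (A ^+ n *m g)) x = dotv (zmx R g) (Sn n *m x).
Proof. by rewrite dotv_mulr /Sn -zmxT -zmxM /S trmxX trmxK. Qed.

(** Fourier inversion on the finite set [E]: a single exponential is recovered from the means over
    [E] at the translates by dual points. *)
Lemma dual_inversion n E b (z : X) (L : seq 'cV[int]_r) : E \in fam_pow A DD n.+1 ->
  (forall g, \sum_(l <- L) e (dotv (zmx R l) (Rinv R (A ^+ n.+1) *m zmx R g)) =
     cr (size E)%:R * (Aimg (A ^+ n.+1) g)%:R) -> b \in E ->
  e (dotv (zmx R b) z) = \sum_(l <- L) e (- dotv (zmx R b) (Tinv R (A ^+ n.+1) *m zmx R l)) *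
     mean_e E (z + Tinv R (A ^+ n.+1) *m zmx R l).
Proof.
move=> hE hL hb; have [uE E0 _ mE] := fam_pow_residues cA fD cD hE.
have nE : (size E)%:R != 0 :> R by rewrite pnatr_eq0 -lt0n.
rewrite /mean_e; under eq_bigr => l _ do rewrite mulrCA mulr_sumr.
rewrite -mulr_sumr exchange_big /=.
transitivity (cr (size E)%:R^-1 * \sum_(b' <- E) e (dotv (zmx R b') z) * (cr (size E)%:R * (Aimg (A ^+ n.+1) (b' - b))%:R)).
  rewrite (bigD1_seq b) //= subrr Aimg0 mulr1 big1_seq ?addr0; last first.
    move=> c /andP[cb hc]; case: (boolP (Aimg _ _)) => h; last by rewrite !mulr0.
    by rewrite (mE c b) ?eqxx in cb.
  by rewrite mulrCA -crM mulVf // cr1 mulr1.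
congr (_ * _); apply: eq_bigr => b' _; rewrite -hL mulr_sumr; apply: eq_bigr => l _.
rewrite -!e2piiD; congr e2pii.
rewrite dot_Rinv zmxB dotvBr dotvDl (dotvC z) (dotvC (zmx R b)); ring.
Qed.

(** In the inversion formula at a point of [W], only translates with nonvanishing mean count. These
    belong to [H] by [W_stab], and there [b] and [b'] have equal phases. So the two exponentials
    agree on [W], hence on differences of its points. *)
Lemma annih_digits n E b b' : (p %| n.+1)%N -> E \in fam_pow A DD n.+1 -> b \in E -> b' \in E ->
  (forall t, H t -> isintv (Sn n.+1 *m t) -> isint (dotv (zmx R (b - b')) t)) ->
  annih (b - b') /\ forall y, W y -> isint (dotv (zmx R (b - b')) y).
Proof.
move=> hp hE hb hb' ht.
have [cAn fDn] := contr_fam_pow cA fD n.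
have [L [sL uL L0 mL hL]] := dual_residues cAn (fam_pow_residues cA fD cD hE).
have key z : W z -> isint (dotv (zmx R (b - b')) z).
  move=> Wz; apply: e2pii_eq1; rewrite zmxB dotvBl -e2pii_mulJ.
  suff -> : e (dotv (zmx R b) z) = e (dotv (zmx R b') z) by rewrite e2pii_mulJ subrr e2pii0.
  rewrite (dual_inversion z hE hL hb) (dual_inversion z hE hL hb'); apply: eq_bigr => l _.
  set t := Tinv _ _ *m _.
  have [->|hm] := eqVneq (mean_e E (z + t)) 0; first by rewrite !mulr0.
  congr (_ * _).
  have it : isintv (Sn n.+1 *m t).
    exists l; rewrite /Sn /S -trmxX zmxT /t AT_Tinv //.
  have Ut : U n.+1 (z + t) != 0.
    rewrite /U /mean_sqn mulf_neq0 ?invr_eq0 ?pnatr_eq0 -?lt0n ?(fam_size fDn) //.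
    rewrite psumr_eq0; last by move=> i _; exact: sqn_ge0.
    apply/negP => /allP /(_ E hE) /= /eqP /sqn_eq0 h; by rewrite h eqxx in hm.
  have := ht t (W_stab hp Wz it Ut) it; rewrite zmxB dotvBl => hi.
  have -> : - dotv (zmx R b) t = - dotv (zmx R b') t - (dotv (zmx R b) t - dotv (zmx R b') t) by ring.
  by rewrite e2piiD (isint_e (isintN hi)) mulr1.
split=> // h Hh; have [y Wy] := neW.
have -> : dotv (zmx R (b - b')) h = dotv (zmx R (b - b')) (y + h) - dotv (zmx R (b - b')) y.
  by rewrite dotvDr addrAC subrr add0r.
by apply: isintB; apply: key => //; exact: Hh.
Qed.

Lemma H0 : H 0.
Proof. by move=> y; rewrite addr0. Qed.

Lemma HD h h' : H h -> H h' -> H (h + h').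
Proof. by move=> hh hh' y Wy; rewrite addrA; apply: hh'; exact: hh. Qed.

Lemma H_iter n h : (p %| n)%N -> H h -> H (Sn n *m h).
Proof.
move=> hp hh; apply: (W_dens hp (Z := fun y => W (y + Sn n *m h))); first exact: zclosed_shift.
by move=> y Wy; rewrite -mulmxDr; apply: W_iter => //; exact: hh.
Qed.

Lemma annih_subgrp : is_subgrp annih. Proof. exact: isint_subgrp. Qed.

Lemma annih_iter n g : (p %| n)%N -> annih g -> annih (A ^+ n *m g).
Proof. by move=> hp hg h Hh; rewrite dot_Sn; apply: hg; exact: H_iter. Qed.

(** Were it trivial, characters would be independent on [H]. A polynomial vanishing on [W] vanishes
    on y + H, so all its coefficients are 0 and it vanishes at 0 as well, contrary to 0 lying
    outside the closed set [W]. *)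
Lemma annih_neq0 : exists2 g, annih g & g != 0.
Proof.
apply: contrapT => hn.
have sep g : g != 0 -> exists2 h, H h & ~ isint (dotv (zmx R g) h).
  move=> g0; apply: contrapT => h; apply: hn; exists g => // x Hx.
  by apply: contrapT => nx; apply: h; exists x.
have : ~ zcl W 0 by move=> /cW.
move=> /existsNP[f /not_implyP[[s hs] /not_implyP[fW f0]]]; apply: f0.
pose us := undup (map snd s); pose c g := \sum_(q <- s) q.1 * (q.2 == g)%:R.
have fE x : f x = \sum_(g <- us) c g * chi g x.
  rewrite hs /c; under [RHS]eq_bigr => g _ do rewrite mulr_suml.
  rewrite [RHS]exchange_big; apply: eq_big_seq => q hq /=.
  have qus : q.2 \in us by rewrite mem_undup map_f.
  rewrite (bigD1_seq q.2) ?undup_uniq //= eqxx mulr1 big1 ?addr0 // => g gq.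
  by rewrite eq_sym (negPf gq) mulr0 mul0r.
have [y Wy] := neW.
have hc g : g \in us -> c g * chi g y = 0.
  move=> gus; apply: (@chi_independent R r H us (fun g => c g * chi g y) H0 HD sep) => //.
    exact: undup_uniq.
  move=> h Hh; rewrite -[RHS](fW (y + h)) ?fE; last exact: Hh.
  by apply: eq_bigr => k _; rewrite chi_add mulrA.
rewrite fE big1_seq // => g /andP[_ /hc/eqP].
rewrite mulf_eq0 => /orP[/eqP ->|/eqP h]; first by rewrite mul0r.
by have := sqn_e (dotv (zmx R g) y); rewrite -/(chi g y) h sqn0 => /eqP; rewrite eq_sym oner_eq0.
Qed.

(** Pads two words by a common prefix and a common suffix, to reach a length divisible by [p]. *)
Lemma word_diff j m n E b b' : E \in fam_pow A DD m -> b \in E -> b' \in E ->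
  exists E' c c', [/\ E' \in fam_pow A DD (j + (m + n)), c \in E', c' \in E' & c - c' = A ^+ j *m (b - b')].
Proof.
move=> hE hb hb'.
have [E1 h1 [x hx]] := fam_pow_ne cA fD j; have [E3 h3 [v hv]] := fam_pow_ne cA fD n.
have [E2 h2 h2'] := fam_pow_cat hE h3; have [E4 h4 h4'] := fam_pow_cat h1 h2.
exists E4, (x + A ^+ j *m (b + A ^+ m *m v)), (x + A ^+ j *m (b' + A ^+ m *m v)).
split=> //; try by apply: h4' => //; exact: h2'.
by rewrite !mulmxDr mulmxN; mxring.
Qed.

Lemma digit_word D : D \in DD -> exists2 E, E \in fam_pow A DD 1 & {subset D <= E}.
Proof.
move=> hD; exists [seq b + A *m v | b <- D, v <- [:: 0]].
  by apply/allpairsP; exists (D, [:: 0]); rewrite mem_head.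
by move=> b hb; apply/allpairsP; exists (b, 0); rewrite mem_head mulmx0 addr0.
Qed.

(** The saturation of the annihilator under division by A^p, needed for quotients of carries to stay
    in the group. *)
Definition eventual : set 'cV[int]_r := [set g | exists k, annih (A ^+ (k * p) *m g)]%classic.

Lemma annih_mono k l g : (k <= l)%N -> annih (A ^+ (k * p) *m g) -> annih (A ^+ (l * p) *m g).
Proof.
by move=> /subnK <- h; rewrite mulnDl mulTXD; apply: annih_iter => //; rewrite dvdn_mull.
Qed.

Lemma eventual_subgrp : is_subgrp eventual.
Proof.
have [a0 aB] := annih_subgrp; split; first by exists 0%N; rewrite mulmx0.
move=> a b [k hk] [l hl]; exists (maxn k l); rewrite mulmxBr; apply: aB.
  by apply: annih_mono hk; rewrite leq_maxl.
by apply: annih_mono hl; rewrite leq_maxr.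
Qed.

Lemma eventual_iter g : eventual g -> eventual (A ^+ p *m g).
Proof.
move=> [k hk]; exists k; rewrite -mulTXD addnC mulTXD; exact: annih_iter.
Qed.

(** Completeness gives [b'] and the quotient; membership of the quotient follows from [annih_digits]
    for the difference of the digits moved [k * p] places up. *)
Lemma eventual_digits E b a : E \in fam_pow A DD p -> b \in E -> eventual a ->
  exists2 b', b' \in E & exists2 g, eventual g & b' - b - a = A ^+ p *m g.
Proof.
move=> hE hb [k hk].
have [b' hb' /AimgP[g hg]] := fam_pow_complete cD hE a hb.
exists b' => //; exists (- g); last by rewrite mulmxN -hg; mxring.
have [E' [c [c' [hE' hc hc' hcc]]]] := word_diff (k * p) 0 hE hb' hb.
rewrite addn0 in hE'.
have hn : (k * p + p = (k.+1 * p).-1.+1)%N by rewrite prednK ?muln_gt0 // mulSn addnC.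
have hA : A ^+ (k * p) *m (b' - b) = A ^+ (k * p) *m a - A ^+ (k * p + p) *m g.
  by rewrite mulTXD -hg -mulmxBr; congr (_ *m _); mxring.
have [] := annih_digits (n := (k.+1 * p).-1) (E := E') (b := c) (b' := c').
- by rewrite -hn dvdn_addl ?dvdn_mull.
- by rewrite -hn.
- done.
- done.
(* On such [t], the contribution of [a] is integral since it is annihilated, and that of [g] since
   S^(kp+p) t is an integer vector. *)
- move=> t Ht; rewrite -hn => it; rewrite hcc hA zmxB dotvBl; apply: isintB; first exact: hk.
  by rewrite dot_Sn; case: it => l ->; exact: dotv_int.
rewrite hcc => ha _; exists k.+1; rewrite mulmxN mulSn addnC.
have -> : - (A ^+ (k * p + p) *m g) = A ^+ (k * p) *m (b' - b) - A ^+ (k * p) *m a.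
  by rewrite hA; mxring.
by have [_ aB] := annih_subgrp; exact: aB.
Qed.

Hypothesis generating : forall K : set 'cV[int]_r, is_subgrp K ->
  (forall j D b b', D \in DD -> b \in D -> b' \in D -> K (A ^+ j *m (b - b'))) ->
  forall g, exists k0, forall k, (k0 <= k)%N -> K (A ^+ k *m g).

Let del (i : 'I_r) : 'cV[int]_r := \col_j (j == i)%:Z.

Lemma dot_del i (x : X) : dotv (zmx R (del i)) x = x i ord0.
Proof.
rewrite /dotv (bigD1 i) //= big1 => [|j ji]; rewrite !mxE ?eqxx ?mul1r ?addr0 //.
by rewrite (negPf ji) mul0r.
Qed.

Lemma ord_bound (P : 'I_r -> nat -> Prop) : (forall i m n, (m <= n)%N -> P i m -> P i n) ->
  (forall i, exists n, P i n) -> exists n, forall i, P i n.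
Proof.
move=> mono h; have [f hf] := choice h; exists (\max_i f i)%N => i.
by apply: mono (hf i); exact: leq_bigmax.
Qed.

Lemma int_mod_box m (k : 'cV[int]_r) : (0 < m)%N -> exists2 k0, k0 \in box r m & exists k1, k = k0 + k1 *+ m.
Proof.
move=> m0; have m0' : (m%:Z != 0)%R by rewrite eqz_nat -lt0n.
have hlt i : (`|(k i ord0 %% m%:Z)%Z|%N < m)%N.
  by rewrite -ltz_nat gez0_abs ?modz_ge0 // ltz_mod.
exists (\col_i (`|(k i ord0 %% m%:Z)%Z|%N : int)).
  apply/mapP; exists [ffun i => Ordinal (hlt i)]; first by rewrite mem_enum.
  by apply/matrixP => i j; rewrite !mxE ffunE.
exists (\col_i (k i ord0 %/ m%:Z)%Z); apply/matrixP => i j.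
rewrite mxE [in RHS]mulmxnE !mxE (ord1 j) gez0_abs ?modz_ge0 //.
rewrite {1}(divz_eq (k i ord0) m%:Z) addrC; congr (_ + _).
by rewrite -mulr_natr natz.
Qed.

Lemma isintv_Sn n m (x : X) : (n <= m)%N -> isintv (Sn n *m x) -> isintv (Sn m *m x).
Proof. by move=> /subnK <- [k hk]; rewrite SnD hk; exists (S ^+ (m - n) *m k); rewrite zmxM. Qed.

Lemma torsion_bound m n2 : (0 < m)%N -> (forall v, annih (A ^+ n2 *m (v *+ m))) ->
  exists n1, forall t, H t -> (exists n, isintv (Sn n *m t)) -> isintv (Sn n1 *m t).
Proof.
move=> m0 hm.
have m0' : m%:R != 0 :> R by rewrite pnatr_eq0 -lt0n.
pose tor (x : X) := exists n, isintv (Sn n *m x).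
have [n1 hn1] : exists n1, forall k0, k0 \in box r m -> tor (m%:R^-1 *: zmx R k0) -> isintv (Sn n1 *m (m%:R^-1 *: zmx R k0)).
  elim: (box r m) => [|k0 s [n1 IH]]; first by exists 0%N.
  case: (pselect (tor (m%:R^-1 *: zmx R k0))) => [[n3 h2]|h2].
    exists (maxn n1 n3) => k; rewrite inE => /orP[/eqP -> _|hk tk].
      by apply: isintv_Sn h2; rewrite leq_maxr.
    by apply: isintv_Sn (IH k hk tk); rewrite leq_maxl.
  by exists n1 => k; rewrite inE => /orP[/eqP -> //|]; exact: IH.
exists (n1 + n2)%N => t Ht [n tn]; rewrite SnD; set u := Sn n2 *m t.
have [k hk] : isintv (m%:R *: u).
  apply: isintv_dot => a; rewrite dotvZr -dotvZl.
  have -> : m%:R *: zmx R a = zmx R (a *+ m) by rewrite -[a *+ m]scaler_nat zmxZ; congr (_ *: _); rewrite natz.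
  by rewrite /u -dot_Sn; exact: hm.
have [k0 hk0 [k1 hk1]] := int_mod_box k m0.
have ht : u = m%:R^-1 *: zmx R k0 + zmx R k1.
  apply: (scalerI m0'); rewrite hk hk1 zmxD scalerDr scalerA mulfV // scale1r; congr (_ + _).
  by rewrite -[k1 *+ m]scaler_nat zmxZ natz -pmulrn.
have [l hl] : isintv (Sn n1 *m (m%:R^-1 *: zmx R k0)).
  apply: hn1 => //; exists n; have -> : m%:R^-1 *: zmx R k0 = u + zmx R (- k1) by rewrite ht zmxN addrK.
  case: tn => l hl; exists (S ^+ n2 *m l + S ^+ n *m (- k1)).
  by rewrite mulmxDr /u -SnD addnC SnD hl !Sn_int zmxD.
by rewrite ht mulmxDr hl Sn_int -zmxD; exists (l + S ^+ n1 *m k1).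
Qed.

(** Full rank bounds the torsion of [H] uniformly. Then high powers of [A] applied to digit
    differences are integral on all of [W]; as digits generate, so are high powers applied to every
    vector. By density [W] consists of integer vectors, and periodicity puts 0 into it. *)
Lemma eventual_not_full : ~ full_rank eventual.
Proof.
move=> [m m0 hm].
have [k0 hk0] : exists k0, forall i, annih (A ^+ (k0 * p) *m (del i *+ m)).
  apply: ord_bound => [i a b hab|i]; first exact: annih_mono.
  exact: hm.
have hA v : annih (A ^+ (k0 * p) *m (v *+ m)).
  have -> : v *+ m = \sum_i v i ord0 *: (del i *+ m).
    apply/matrixP => i j; rewrite (ord1 j) mulmxnE summxE (bigD1 i) //= big1 ?addr0.
      by rewrite !mxE mulmxnE mxE eqxx mulrnAr mulr1.
    by move=> l li; rewrite !mxE mulmxnE mxE eq_sym (negPf li) mul0rn mulr0.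
  rewrite mulmx_sumr; apply: subgrp_sum annih_subgrp _ => i.
  by rewrite -scalemxAr; apply: subgrpZ annih_subgrp _.
have [n1 hn1] := torsion_bound m0 hA.
(* A multiple of [p], as required by the density of the image of [W]. *)
pose n2 := (n1 * p)%N.
have n12 : (n1 <= n2)%N by rewrite leq_pmulr.
have key j D b b' y : D \in DD -> b \in D -> b' \in D -> W y -> isint (dotv (zmx R (A ^+ (n2 + j) *m (b - b'))) y).
  move=> hD hb hb' Wy; have [E hE DE] := digit_word hD.
  pose total := ((n2 + j).+1 * p)%N.
  have ht : (n2 + j + (1 + (total - (n2 + j).+1)) = total.-1.+1)%N.
    by rewrite addnA addn1 subnKC ?prednK ?muln_gt0 // leq_pmulr.
  have [E' [c [c' [hE' hc hc' hcc]]]] := word_diff (n2 + j) (total - (n2 + j).+1) hE (DE _ hb) (DE _ hb').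
  rewrite ht in hE'.
  have [] := annih_digits (n := total.-1) _ hE' hc hc'; last by rewrite hcc => _; apply.
  - by rewrite prednK ?muln_gt0 // dvdn_mull.
  - move=> t Ht it; have := hn1 t Ht (ex_intro (fun n => isintv (Sn n *m t)) _ it) => i1.
    have [l hl] : isintv (Sn (n2 + j) *m t) by apply: isintv_Sn i1; rewrite (leq_trans n12) ?leq_addr.
    by rewrite hcc dot_Sn hl; exact: dotv_int.
have [||k1 hk1] := ord_bound (P := fun i k => forall k', (k <= k')%N -> forall y, W y ->
    isint (dotv (zmx R (A ^+ n2 *m (A ^+ k' *m del i))) y)).
- by move=> i a b hab h k' hk'; apply: h; exact: leq_trans hk'.
- move=> i; apply: (generating (K := fun g => forall y, W y -> isint (dotv (zmx R (A ^+ n2 *m g)) y))).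
    split; first by move=> y _; rewrite mulmx0 zmx0 dotv0l; exact: isint0.
    by move=> a b ha hb y Wy; rewrite mulmxBr zmxB dotvBl; apply: isintB; [exact: ha|exact: hb].
  by move=> j D b b' hD hb hb' y Wy; rewrite -mulTXD; exact: (key j D b b' y hD hb hb' Wy).
have Wint y : W y -> isintv y.
  have hp : (p %| n2 + k1 * p)%N by rewrite dvdn_add ?dvdn_mull.
  apply: (W_dens hp (@zclosed_lattice R r)) => z Wz; apply: isintvP => i.
  rewrite -dot_del -dot_Sn mulTXD; apply: hk1 => //.
  by rewrite leq_pmulr.
have [y Wy] := neW; have [k hk] := Wint y Wy.
apply: nW; have := zclosed_int (- k) cW Wy; rewrite zmxN -hk subrr.
by [].
Qed.

End Annihilator.

(** The digit differences generate the whole lattice up to division by powers of [A]. *)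
Definition generates r (A : 'M[int]_r) (DD : seq (seq 'cV[int]_r)) :=
  forall K : set 'cV[int]_r, is_subgrp K ->
  (forall j D b b', D \in DD -> b \in D -> b' \in D -> K (A ^+ j *m (b - b'))) ->
  forall g, exists k0, forall k, (k0 <= k)%N -> K (A ^+ k *m g).

Definition carries r (A : 'M[int]_r) (D : seq 'cV[int]_r) (G : set 'cV[int]_r) :=
  forall b a, b \in D -> G a ->
  exists2 b', b' \in D & exists2 g, G g & b' - b - a = A *m g.

Lemma tile_alternative (R : realType) r (A : 'M[int]_r) (DD : seq (seq 'cV[int]_r)) n0 :
  contracting R A -> digit_family A DD n0 -> (forall D, D \in DD -> complete A D) -> generates A DD ->
  (forall (x : 'cV[R]_r) (eps : R), 0 < eps -> exists2 F : seq 'cV[int]_r, uniq F &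
     1 - eps <= \sum_(k <- F) q (Tinv R A) (mean_sqn DD) (x + zmx R k)) \/
  exists p (G : set 'cV[int]_r), [/\ (0 < p)%N, is_subgrp G, exists2 g, G g & g != 0, ~ full_rank G &
    (forall g, G g -> G (A ^+ p *m g)) /\ forall E, E \in fam_pow A DD p -> carries (A ^+ p) E G].
Proof.
move=> cA fD cD gD.
case: (pselect (exists g, immortal R A DD g)) => [im|no]; last first.
  by left; apply: tile_absorbing cA fD cD _ => g ig; apply: no; exists g.
right; have [p [W [p0 cW neW nW hW]]] := component cA fD cD im.
have Wi n (hn : (p %| n)%N) : _ := let: And3 h _ _ := hW n hn in h.
have Wd n (hn : (p %| n)%N) : _ := let: And3 _ h _ := hW n hn in h.
have Ws n (hn : (p %| n)%N) : _ := let: And3 _ _ h := hW n hn in h.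
exists p, (eventual A p W); split => //.
- exact: eventual_subgrp Wi Wd.
- have [g hg g0] := annih_neq0 cW neW nW.
  by exists g => //; exists 0%N; rewrite mul0n mulTX0.
- exact: (eventual_not_full cA fD cD p0 cW neW nW Wi Wd Ws gD).
- split; first by move=> g; apply: eventual_iter Wi Wd _.
  by move=> E hE b a hb ha; exact: (eventual_digits cA fD cD p0 neW Ws hE hb ha).
Qed.

Lemma words_cat_mem (X : eqType) (B : seq X) m n w : w \in words B (m + n) ->
  exists u v, [/\ u \in words B m, v \in words B n & w = u ++ v].
Proof.
elim: m w => [|m IH] w hw; first by exists [::], w; rewrite mem_head.
move: hw => /allpairsP[[x z] /= [hx hz ->]]; have [u [v [hu hv ->]]] := IH z hz.
by exists (x :: u), v; rewrite /words prodw_consP hx.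
Qed.

Lemma words_rcons_mem (X : eqType) (B : seq X) n w b :
  (rcons w b \in words B n.+1) = (w \in words B n) && (b \in B).
Proof.
rewrite /words; elim: n w => [|n IH] [|x w].
- by rewrite prodw_consP mem_head andbC.
- have -> : (x :: w \in prodw (nseq 0 B)) = false by [].
  by apply/negbTE/negP => /prodwP /=; rewrite size_rcons.
- have -> : ([::] \in prodw (nseq n.+1 B)) = false by apply/negbTE/negP => /prodwP.
  by apply/negbTE/negP => /prodwP.
- by rewrite rcons_cons prodw_consP IH prodw_consP andbA.
Qed.

(** * Powers of the matrix *)

Section PowerReduction.
Variables (R : realType) (d : nat).
Local Notation e := (@e2pii R).
Implicit Types (A : 'M[int]_d) (B L : seq 'cV[int]_d).

Definition has_spectrum A B := exists Lam : set 'cV[R]_d, countable Lam /\ parseval A B Lam.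

Definition power_digits A B p := map (digit_isum A) (words B p).

Definition carry_group A B p (G : set 'cV[int]_d) :=
  [/\ (0 < p)%N, is_subgrp G, exists2 g, G g & g != 0, forall g, G g -> G (A ^+ p *m g) &
      carries (A ^+ p) (power_digits A B p) G].

(** On a difference of digits divisible by [A] all characters of integer frequency are 1, so the
    orthogonality sum cannot vanish. *)
Lemma hadamard_family A B L : contracting R A -> hadamard R A B L -> digit_family A [:: B] (size B).
Proof.
move=> cA [uB B0 sL hL]; split=> //; try by move=> D; rewrite inE => /eqP ->.
move=> D; rewrite inE => /eqP -> b b' hb hb' hi; have [k hk] := AimgP _ _ hi.
apply/eqP; apply: contraT => nbb; have := hL b b' hb hb'.
rewrite (negPf nbb) mulr0 cr0 hk zmxM Rinv_mul // (eq_bigr (fun=> 1)); last first.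
  by move=> l _; rewrite isint_e //; exact: dotv_int.
rewrite sum_const_seq mulr1 sL => /eqP; rewrite pnatr_eq0 => /eqP h.
by rewrite h in B0.
Qed.

Lemma hadamard_shift A B L : hadamard R A B L -> exists2 L', hadamard R A B L' & 0 \in L'.
Proof.
move=> [uB B0 sL hL].
case: L sL hL => [|l0 L] sL hL; first by rewrite -sL in B0.
exists [seq l - l0 | l <- l0 :: L]; last by rewrite /= subrr mem_head.
split=> //; first by rewrite size_map.
move=> b b' hb hb'; rewrite big_map.
under eq_bigr => l _ do rewrite (zmxB R l l0) dotvBl e2piiD.
rewrite -mulr_suml hL //; case: eqVneq => [->|_]; last by rewrite mulr0 mul0r.
by rewrite subrr zmx0 mulmx0 dotv0r oppr0 e2pii0 mulr1.
Qed.

Lemma spectrum_mortal A B L : contracting R A -> hadamard R A B L ->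
  (forall g, ~ immortal R A [:: B] g) -> has_spectrum A B.
Proof.
move=> cA hBL hno; have [L' hL' L0] := hadamard_shift hBL.
have [eps eps0 he] := equi_positive cA (hadamard_family cA hBL) hno.
have H y : exists k : 'cV[int]_d, eps <= qB A B (y + zmx R k) /\ (eps <= qB A B y -> k = 0).
  case: (boolP (eps <= qB A B y)) => hy; first by exists 0; rewrite zmx0 addr0.
  by have [k hk] := he y; exists k.
have [k hk] := choice H.
exists (tree_set A L' k); split; first exact: tree_set_countable.
by apply: (tree_parseval cA hL' eps0 _ _ L0) => y; have [] := hk y.
Qed.

(** An injective correspondence of a finite set with itself is onto. This inverts carries. *)
Lemma digit_injection B (P : 'cV[int]_d -> 'cV[int]_d -> Prop) : uniq B ->
  (forall b, b \in B -> exists2 b', b' \in B & P b b') ->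
  (forall b c b', b \in B -> c \in B -> P b b' -> P c b' -> b = c) ->
  forall b', b' \in B -> exists2 b, b \in B & P b b'.
Proof.
move=> uB hP inj b' hb'.
have H b : exists b', b \in B -> b' \in B /\ P b b'.
  case: (boolP (b \in B)) => hb; last by exists 0.
  by have [c h1 h2] := hP b hb; exists c.
have [f hf] := choice H.
have um : uniq (map f B).
  rewrite map_inj_in_uniq // => b c hb hc hbc.
  have [_ h1] := hf b hb; have [_ h2] := hf c hc; apply: (inj _ _ (f b)) => //.
  by rewrite hbc.
have hs : {subset map f B <= B} by move=> _ /mapP[b hb ->]; case: (hf b hb).
have [|_ heq] := uniq_min_size um hs; first by rewrite size_map.
have : b' \in map f B by rewrite heq.
by move=> /mapP[b hb ->]; exists b => //; have [] := hf b hb.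
Qed.

(** Immortal frequencies can be carried by definition. The task is to pass to the group they
    generate together with their images under [A]. *)
Lemma immortal_carry A B n0 : contracting R A -> digit_family A [:: B] n0 ->
  (exists g, immortal R A [:: B] g) -> exists G, carry_group A B 1 G.
Proof.
move=> cA fB [g0 ig0].
have uB : uniq B by apply: (fam_uniq fB); rewrite mem_head.
have mB := fam_mod fB (mem_head B [::]).
pose inv (K : set 'cV[int]_d) := [/\ is_subgrp K, forall g, immortal R A [:: B] g -> K g & forall g, K g -> K (A *m g)].
pose G : set 'cV[int]_d := [set g | forall K, inv K -> K g]%classic.
have gG : is_subgrp G.
  split; first by move=> K [[K0 _] _ _].
  by move=> a b ha hb K hK; have [[_ KB] _ _] := hK; apply: KB; [exact: ha|exact: hb].
have AG g : G g -> G (A *m g) by move=> hg K hK; have [_ _ h] := hK; apply: h; exact: hg.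
have [G0 GB] := gG.
pose P (b a b' : 'cV[int]_d) := exists2 g, G g & b' - b - a = A *m g.
(* The elements that can be carried form an A-stable group: differences work because carrying by one
   element permutes [B], and multiples of [A] are carried by leaving the digit unchanged. *)
pose K : set 'cV[int]_d := [set a | G a /\ forall b, b \in B -> exists2 b', b' \in B & P b a b']%classic.
have GK a : G a -> K a.
  move=> ha; apply: ha; split.
  - split; first by split=> // b hb; exists b => //; exists 0 => //; rewrite mulmx0 subrr subr0.
    move=> {}a b [Ga ha] [Gb hb]; split; first exact: GB.
    move=> c hc; have [c1 hc1 [g1 hg1 e1]] := ha c hc.
    have [c2 hc2 [g2 hg2 e2]] : exists2 c2, c2 \in B & P c2 b c1.
      apply: (digit_injection (P := fun x y => P x b y)) => //.
      move=> x y z hx hy [g hg eg] [g' hg' eg']; apply: mB => //; apply/AimgP; exists (g' - g).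
      by rewrite mulmxBr -eg -eg'; mxring.
    exists c2 => //; exists (g1 - g2); first exact: GB.
    by rewrite mulmxBr -e1 -e2; mxring.
  - move=> g ig; have Gg : G g by move=> K' [_ h _]; exact: h.
    split=> // b hb; have [b' hb' [k hk ik]] := immortal_next fB ig (mem_head _ _) hb.
    exists b' => //; exists (- k); last by rewrite mulmxN -hk; mxring.
    by rewrite -sub0r; apply: GB => // K' [_ h _]; exact: h.
  - move=> g [Gg _]; split; first exact: AG.
    move=> b hb; exists b => //; exists (- g); first by rewrite -sub0r; exact: GB.
    by rewrite mulmxN subrr sub0r.
exists G; split=> //.
- by exists g0; [move=> K' [_ h _]; exact: h|exact: (immortal_neq0 cA fB ig0)].
have memB b : (b \in power_digits A B 1) = (b \in B).
  apply/mapP/idP => [[w]|hb].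
    move=> /allpairsP[[x v] /= [hx]]; rewrite inE => /eqP -> -> ->.
    by rewrite /= mulTX0 addr0.
  by exists [:: b]; rewrite ?prodw_consP ?hb //= mulTX0 addr0.
move=> b a; rewrite memB => hb ha; have [b' hb' [g hg e']] := (GK a ha).2 b hb.
by exists b'; [rewrite memB|exists g; rewrite ?expr1].
Qed.

Lemma digit_isum_cat A u v : digit_isum A (u ++ v) = A ^+ size v *m digit_isum A u + digit_isum A v.
Proof.
elim: u => [|b u IH] /=; first by rewrite mulmx0 add0r.
by rewrite IH size_cat addnC mulTXD mulmxDr addrA.
Qed.

Lemma digit_isum_rcons A w b : digit_isum A (rcons w b) = A *m digit_isum A w + b.
Proof. by rewrite -cats1 digit_isum_cat /= mulTX0 addr0 expr1. Qed.

Section Fixed.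
Variables (A : 'M[int]_d) (B L : seq 'cV[int]_d).
Hypothesis cA : contracting R A.
Hypothesis hBL : hadamard R A B L.
Let uB : uniq B. Proof. by case: hBL. Qed.
Let B0 : (0 < size B)%N. Proof. by case: hBL. Qed.

(** Dual lists compose like the tree without corrections: S^p l' is invisible on the first p digits
    and resolves the next one. *)
Lemma hadamard_words p : exists Lp : seq 'cV[int]_d, size Lp = (size B ^ p)%N /\
  forall w w', w \in words B p -> w' \in words B p ->
  \sum_(l <- Lp) e (dotv (zmx R l) (digit_sum R A w - digit_sum R A w')) =
  cr ((size B ^ p)%:R * (w == w')%:R).
Proof.
have [_ _ sL hL] := hBL.
elim: p => [|p [Lp [sLp IH]]].
  exists [:: 0]; split=> // w w'; rewrite !inE => /eqP -> /eqP ->.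
  by rewrite big_seq1 zmx0 dotv0l e2pii0 eqxx mul1r.
exists [seq l + A^T ^+ p *m l' | l' <- L, l <- Lp]; split.
  by rewrite size_allpairs sLp sL expnS.
move=> w w'; case/lastP: w => [|w b]; first by move/words_size.
case/lastP: w' => [|w' b']; first by move=> _ /words_size.
rewrite !words_rcons_mem => /andP[hw hb] /andP[hw' hb'].
have sw := words_size hw; have sw' := words_size hw'.
rewrite big_allpairs_dep /=.
pose x := digit_sum R A w - digit_sum R A w'; pose y := Rinv R A ^+ p.+1 *m zmx R (b - b').
transitivity (\sum_(l' <- L) \sum_(l <- Lp) (e (dotv (zmx R l') (Rinv R A *m zmx R (b - b'))) * e (dotv (zmx R l) y)) *
    e (dotv (zmx R l) x)).
  apply: eq_bigr => l' _; apply: eq_bigr => l _; rewrite -!e2piiD.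
  rewrite !digit_sum_rcons sw sw'.
  have -> : digit_sum R A w + Rinv R A ^+ p.+1 *m zmx R b - (digit_sum R A w' + Rinv R A ^+ p.+1 *m zmx R b') = x + y.
    by rewrite /x /y zmxB mulmxBr; mxring.
  rewrite (zmxD R l) dotvDl dotvDr.
  have -> : dotv (zmx R (A^T ^+ p *m l')) (x + y) = dotv (zmx R (A^T ^+ p *m l')) x +
     dotv (zmx R l') (Rinv R A *m zmx R (b - b')).
    by rewrite dotvDr /y mulTX (zmxTX_dot cA).
  have hint : isint (dotv (zmx R (A^T ^+ p *m l')) x).
    rewrite /x dotvBr; by apply: isintB; [exact: (zmx_dot_digit_sum cA l' hw)|exact: (zmx_dot_digit_sum cA l' hw')].
  move: hint; set h := dotv _ x; set t1 := dotv _ _; set t2 := dotv _ _; set t3 := dotv _ _ => hint.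
  have -> : t1 + t2 + (h + t3) = h + (t3 + t2 + t1) by ring.
  by rewrite e2piiD (isint_e hint) mul1r.
have [bb|nb] := eqVneq b b'; last first.
  have -> : (rcons w b == rcons w' b') = false.
    by apply/negP => /eqP/rcons_inj[_ h]; rewrite h eqxx in nb.
  rewrite mulr0 exchange_big /= big1 // => l _.
  under eq_bigr => l' _ do rewrite -mulrA.
  by rewrite -mulr_suml hL // (negPf nb) mulr0 mul0r.
rewrite /y bb subrr zmx0 !mulmx0.
have -> : (rcons w b' == rcons w' b') = (w == w').
  by apply/eqP/eqP => [/rcons_inj[]|->].
under eq_bigr => l' _.
  under eq_bigr => l _ do rewrite !dotv0r e2pii0 !mul1r.
  rewrite IH //; over.
by rewrite sum_const_seq sL -cr_nat -crM mulrA -natrM -expnS.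
Qed.

Lemma isum_Rinv p w w' : w \in words B p -> w' \in words B p ->
  Rinv R (A ^+ p) *m zmx R (digit_isum A w - digit_isum A w') = digit_sum R A w - digit_sum R A w'.
Proof.
move=> /words_size sw /words_size sw'; rewrite zmxB -!digit_isumE // sw sw' mulmxBr !mulmxA.
rewrite /Rinv mulVmx ?mul1mx //; apply: zmx_unitX; by case: cA.
Qed.

Lemma isum_inj p : {in words B p &, injective (digit_isum A)}.
Proof.
move=> w w' hw hw' hww; apply/eqP; apply: contraT => nww.
have [Lp [sLp h]] := hadamard_words p.
have := h w w' hw hw'; rewrite -(isum_Rinv hw hw') hww subrr zmx0 mulmx0 (negPf nww) mulr0.
under eq_bigr => l _ do rewrite dotv0r e2pii0.
rewrite sum_const_seq mulr1 sLp => /eqP; rewrite pnatr_eq0 expn_eq0 => /andP[/eqP h0 _].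
by have := B0; rewrite h0.
Qed.

Lemma hadamard_pow p : exists Lp, hadamard R (A ^+ p) (power_digits A B p) Lp.
Proof.
have [Lp [sLp h]] := hadamard_words p; exists Lp; split.
- by rewrite map_inj_in_uniq ?words_uniq //; exact: isum_inj.
- by rewrite size_map size_words expn_gt0 B0.
- by rewrite size_map size_words.
- move=> _ _ /mapP[w hw ->] /mapP[w' hw' ->].
  rewrite size_map size_words (isum_Rinv hw hw') h //; congr (cr (_ * _%:R)).
  by congr nat_of_bool; apply/eqP/eqP => [->|/(isum_inj hw hw') ->].
Qed.

Variable p : nat.
Hypothesis p0 : (0 < p)%N.
Let Bp := power_digits A B p.

Fixpoint blocks n (w : seq 'cV[int]_d) : seq 'cV[int]_d :=
  if n is m.+1 then digit_isum A (take p w) :: blocks m (drop p w) else [::].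

Lemma big_blocks (V : nmodType) n (F : seq 'cV[int]_d -> V) :
  \sum_(W <- words Bp n) F W = \sum_(w <- words B (n * p)) F (blocks n w).
Proof.
elim: n F => [|n IH] F; first by rewrite !big_words0.
rewrite big_wordsS mulSn big_words_cat big_map; apply: eq_big_seq => u hu.
rewrite IH; apply: eq_bigr => v _ /=.
by rewrite take_size_cat ?drop_size_cat // (words_size hu).
Qed.

Lemma digit_sum_blocks n w : size w = (n * p)%N -> digit_sum R (A ^+ p) (blocks n w) = digit_sum R A w.
Proof.
elim: n w => [|n IH] w; first by rewrite mul0n => /size0nil ->.
move=> hs; have hst : size (take p w) = p by rewrite size_takel // hs mulSn leq_addr.
rewrite /= IH; last by rewrite size_drop hs mulSn addKn.
rewrite -[in RHS](cat_take_drop p w) digit_sum_cat hst mulmxDr; congr (_ + _).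
  rewrite -digit_isumE // hst mulmxA /Rinv mulVmx ?mul1mx //; apply: zmx_unitX; by case: cA.
by rewrite RinvX //; case: cA.
Qed.

(** Inverse of the block map on words of length [p], well determined there by [isum_inj]; elsewhere
    a default is returned. *)
Definition unblock (b : 'cV[int]_d) := nth [::] (words B p) (index b Bp).

Lemma unblockK u : u \in words B p -> unblock (digit_isum A u) = u.
Proof.
move=> hu; have hb : digit_isum A u \in Bp by exact: map_f.
have hn : unblock (digit_isum A u) \in words B p by rewrite mem_nth // -(size_map (digit_isum A)) index_mem.
apply: (isum_inj hn hu); rewrite -[RHS](nth_index 0 hb) (nth_map [::]) //.
by rewrite -(size_map (digit_isum A)) index_mem.
Qed.

Lemma unblocks n w : w \in words B (n * p) -> flatten (map unblock (blocks n w)) = w.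
Proof.
elim: n w => [|n IH] w; first by rewrite mul0n inE => /eqP ->.
rewrite mulSn => /words_cat_mem[u [v [hu hv ->]]].
have su := words_size hu.
by rewrite /= take_size_cat ?drop_size_cat // unblockK // IH.
Qed.

Lemma coef_blocks n c (x : 'cV[R]_d) : coef A B (n * p) c x =
  coef (A ^+ p) Bp n (fun W => c (flatten (map unblock W))) x.
Proof.
rewrite /coef size_map size_words natrX -exprM mulnC big_blocks mulnC; congr (_ * _).
apply: eq_big_seq => w hw; rewrite unblocks // digit_sum_blocks //.
exact: words_size hw.
Qed.

Lemma nrm2_blocks n c : nrm2 B (n * p) c = nrm2 Bp n (fun W => c (flatten (map unblock W))) :> R.
Proof.
rewrite /nrm2 size_map size_words natrX -exprM mulnC big_blocks mulnC; congr (_ * _).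
by apply: eq_big_seq => w hw; rewrite unblocks.
Qed.

Lemma qB_blocks (x : 'cV[R]_d) : qB (A ^+ p) Bp x = qB A B x.
Proof.
have Bp0 : (0 < size Bp)%N by rewrite size_map size_words expn_gt0 B0.
have h n : qn (Tinv R (A ^+ p)) (mean_sqn [:: Bp]) n x = qn (Tinv R A) (mean_sqn [:: B]) (n * p) x.
  by rewrite -!sqn_coef1 // coef_blocks.
apply/eqP; rewrite eq_le; apply/andP; split; apply: q_lb => n.
  apply: le_trans (q_le_qn _ (mean_sqn_01 _) n x) _; rewrite h; apply: qn_le; first exact: mean_sqn_01.
  by rewrite leq_pmulr.
by rewrite h; apply: q_le_qn; exact: mean_sqn_01.
Qed.

(** A function of n letters of [B] is also a function of n p letters, that is of n blocks, and [qB]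
    is the same for both systems. *)
Lemma parseval_pow (Lam : set 'cV[R]_d) : parseval (A ^+ p) Bp Lam -> parseval A B Lam.
Proof.
move=> hp n c.
have hn : (n * p = n + (n * p - n))%N by rewrite subnKC // leq_pmulr.
pose c' w := c (take n w).
have e1 x : sqn (coef A B n c x) * qB A B (Tinv R A ^+ n *m x) =
    sqn (coef (A ^+ p) Bp n (fun W => c' (flatten (map unblock W))) x) *
      qB (A ^+ p) Bp (Tinv R (A ^+ p) ^+ n *m x).
  rewrite (coef_qB A B n (n * p - n)) -hn coef_blocks qB_blocks TinvX; last by case: cA.
  by rewrite -exprM mulnC.
have e2 : nrm2 B n c = nrm2 Bp n (fun W => c' (flatten (map unblock W))) :> R.
  by rewrite -(nrm2_take B0 n (n * p - n)) -hn nrm2_blocks.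
have [h1 h2] := hp n (fun W => c' (flatten (map unblock W))); rewrite e2; split.
  by move=> F uF FL; under eq_bigr => x _ do rewrite e1; exact: h1.
move=> eps e0; have [F [uF FL hF]] := h2 eps e0; exists F; split=> //.
by under eq_bigr => x _ do rewrite e1.
Qed.

End Fixed.

End PowerReduction.

(** [v] is the orthogonal projection of [c] onto the span of the [phi x]; expand the norm of
    [c - v], which is nonnegative. *)
Lemma bessel (R : realType) (X : eqType) (K : eqType) (s : seq X) (F : seq K)
    (phi : K -> X -> R[i]) (c : X -> R[i]) (k : R) : 0 < k -> uniq F ->
  (forall x y, x \in F -> y \in F ->
    \sum_(z <- s) phi x z * cj (phi y z) = cr (k * (x == y)%:R)) ->
  \sum_(x <- F) sqn (\sum_(z <- s) c z * phi x z) <= k * \sum_(z <- s) sqn (c z).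
Proof.
move=> k0 uF h; pose a x := \sum_(z <- s) c z * phi x z.
pose v z := cr k^-1 * \sum_(x <- F) a x * cj (phi x z).
have kn : k != 0 by rewrite gt_eqF.
have hv : \sum_(z <- s) sqn (v z) = k^-1 * \sum_(x <- F) sqn (a x).
  under eq_bigr => z _ do rewrite sqnM sqn_real.
  rewrite -mulr_sumr (fin_parseval (phi := fun x z => cj (phi x z)) (k := k) a uF).
    by rewrite mulrA; congr (_ * _); field.
  move=> x y hx hy; under eq_bigr => z _ do rewrite cjK mulrC.
  by rewrite h // eq_sym.
have hcv : \sum_(z <- s) complex.Re (c z * cj (v z)) = k^-1 * \sum_(x <- F) sqn (a x).
  rewrite -Re_sum; transitivity (complex.Re (cr (k^-1 * \sum_(x <- F) sqn (a x)))); last by [].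
  congr complex.Re; rewrite crM cr_sum.
  under eq_bigr => z _ do rewrite /v cjM cj_cr mulrCA.
  rewrite -mulr_sumr; congr (_ * _).
  under eq_bigr => z _ do rewrite cj_sum mulr_sumr.
  rewrite exchange_big /=; apply: eq_bigr => x _; rewrite sqnE [X in X * _]/a mulr_suml.
  by apply: eq_bigr => z _; rewrite cjM cjK mulrCA mulrC.
have e z : sqn (c z - v z) = sqn (c z) + sqn (v z) - 2 * complex.Re (c z * cj (v z)).
  by case: (c z) => ? ?; case: (v z) => ? ?; rewrite /sqn /=; ring.
have : 0 <= \sum_(z <- s) sqn (c z - v z) by apply: sumr_ge0 => z _; exact: sqn_ge0.
under eq_bigr => z _ do rewrite e.
rewrite sumrB big_split /= -mulr_sumr hv hcv.
set Sc := \sum_(z <- s) sqn (c z); set Sa := \sum_(x <- F) _ => h0.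
rewrite -ler_pdivrMl //; lra.
Qed.

Lemma nrm1_lt1 (R : realType) d (z : 'cV[int]_d) : nrm1 (zmx R z) < 1 -> z = 0.
Proof.
move=> h1; apply/matrixP => i j; rewrite ord1 mxE; have := le_lt_trans (nrm1_entry (zmx R z) i) h1.
have -> : z i 0 = z i ord0 by congr (z i _); apply/val_inj.
rewrite mxE -intr_norm -[1]/(1%:~R) ltr_int; move: (z i ord0) => a; clear; lia.
Qed.

(** * Block triangular systems *)

Section DigitSums.
Variables (R : realType) (d : nat) (A : 'M[int]_d).
Hypothesis cA : contracting R A.
Local Notation e := (@e2pii R).

Lemma digit_sum_bound (B : seq 'cV[int]_d) : exists2 C : R, 0 <= C &
  forall w, {subset w <= B} -> nrm1 (digit_sum R A w) <= C.
Proof.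
have [t [N [t0 t1 ND Nn Nt]]] := adapted_norm cA.
have N0 x : 0 <= N x by apply: le_trans (Nn x); exact: nrm1_ge0.
pose M := \sum_(b <- B) N (zmx R b).
have M0 : 0 <= M by apply: sumr_ge0.
have t1' : 0 < 1 - t by rewrite subr_gt0.
(* Solves C = t M + N 0 + t C, so the bound survives one more letter; the term [N 0] takes care of
   the empty word. *)
pose C := (t * M + N 0) / (1 - t).
have C0 : 0 <= C by rewrite divr_ge0 ?(ltW t1') // addr_ge0 // mulr_ge0.
exists C => // w hw; apply: le_trans (Nn _) _.
elim: w hw => [|b w IH] hw /=.
  rewrite /C ler_pdivlMr // mulrBr mulr1 (@le_trans _ _ (N 0)) //.
    by rewrite gerBl mulr_ge0.
  by rewrite lerDr mulr_ge0.
apply: le_trans (Nt _) _; apply: (@le_trans _ _ (t * (M + C))).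
  rewrite ler_wpM2l //; apply: le_trans (ND _ _) _; apply: lerD.
    have hb : b \in B by apply: hw; rewrite mem_head.
    by rewrite /M (big_rem b) //= lerDl sumr_ge0.
  by apply: IH => x hx; apply: hw; rewrite inE hx orbT.
have hC : C = (t * M + N 0) + t * C by rewrite /C; field; rewrite gt_eqF.
by rewrite [leRHS]hC mulrDr lerD2r lerDl.
Qed.

Lemma zmxT_digit_sum (z : 'cV[int]_d) w : isint (dotv (zmx R (A^T ^+ size w *m z)) (digit_sum R A w)).
Proof.
rewrite zmxM dotv_mull zmxX zmxT trmxX trmxK -zmxX digit_isumE //.
exact: dotv_int.
Qed.

End DigitSums.

Section ProdWords.
Variable X : eqType.

Lemma prodw_mem (Ds : seq (seq X)) w x : w \in prodw Ds -> x \in w -> exists2 D, D \in Ds & x \in D.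
Proof.
elim: Ds w => [|D Ds IH] w; first by rewrite inE => /eqP ->.
move=> /allpairsP[[y v] /= [hy hv ->]]; rewrite inE => /orP[/eqP ->|hx].
  by exists D => //; rewrite mem_head.
by have [E hE hxE] := IH v hv hx; exists E => //; rewrite inE hE orbT.
Qed.

Lemma prodw_rcons_mem (Ds : seq (seq X)) D w b :
  rcons w b \in prodw (rcons Ds D) -> w \in prodw Ds /\ b \in D.
Proof.
elim: Ds w => [|E Ds IH] w h.
  have hw := prodwP h; move: hw h; rewrite size_rcons => -[/size0nil ->] h.
  by split; [rewrite mem_head|]; have [D' ] := prodw_mem h (mem_head _ _); rewrite inE => /eqP ->.
case: w h => [|x w]; first by move=> /prodwP /=; rewrite size_rcons.
rewrite !rcons_cons !prodw_consP => /andP[-> h]; have [h1 h2] := IH w h; split=> //.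
Qed.

End ProdWords.

Lemma words_mem (X : eqType) (B : seq X) n w : w \in words B n -> {subset w <= B}.
Proof.
by move=> hw x /(prodw_mem hw)[D]; rewrite mem_nseq => /andP[_ /eqP ->].
Qed.

Lemma size_prodw_map (X Y : eqType) (Dg : X -> seq Y) D w : (forall x, x \in w -> size (Dg x) = D) ->
  size (prodw (map Dg w)) = (D ^ size w)%N.
Proof.
elim: w => [|x w IH] h //=; rewrite size_allpairs IH; last by move=> y hy; apply: h; rewrite inE hy orbT.
by rewrite h ?mem_head // expnS.
Qed.

Section Fibers.
Variables (R : realType) (k : nat) (Y : eqType) (A : 'M[int]_k) (B1 : seq Y) (Dg : Y -> seq 'cV[int]_k) (D : nat).
Local Notation e := (@e2pii R).
Hypothesis cA : contracting R A.
Hypothesis fD : digit_family A (map Dg B1) D.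
Hypothesis cD : forall E, E \in map Dg B1 -> complete A E.
Let T := Tinv R A.
Implicit Types (w : seq Y) (u : seq 'cV[int]_k).

Let Dg_mem b : b \in B1 -> Dg b \in map Dg B1. Proof. exact: map_f. Qed.
Let Dg_size b : b \in B1 -> size (Dg b) = D. Proof. by move=> hb; apply: (fam_card fD); exact: map_f. Qed.

Lemma fiber_size w : {subset w <= B1} -> size (prodw (map Dg w)) = (D ^ size w)%N.
Proof. by move=> hw; apply: size_prodw_map => x /hw; exact: Dg_size. Qed.

Lemma fiber_word_size w u : u \in prodw (map Dg w) -> size u = size w.
Proof. by move/prodwP; rewrite size_map. Qed.

(** The first alphabet is a residue system, so its sum vanishes unless A^T divides the frequency;
    the quotient is handed to the remaining letters. *)
Lemma fiber_char_sum w g : {subset w <= B1} ->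
  \sum_(u <- prodw (map Dg w)) e (dotv (zmx R g) (digit_sum R A u)) =
  cr (D%:R ^+ size w * (Aimg (A^T ^+ size w) g)%:R).
Proof.
elim: w g => [|b w IH] g hw.
  rewrite big_seq1 dotv0r e2pii0 mul1r.
  suff -> : Aimg (A^T ^+ 0) g by [].
  by apply/AimgP; exists g; rewrite mulTX0.
have hb : b \in B1 by apply: hw; rewrite mem_head.
have hw' : {subset w <= B1} by move=> x hx; apply: hw; rewrite inE hx orbT.
rewrite [prodw _]/= big_prodw_cons /=.
transitivity ((\sum_(x <- Dg b) e (dotv (zmx R g) (Rinv R A *m zmx R x))) *
    \sum_(u <- prodw (map Dg w)) e (dotv (T *m zmx R g) (digit_sum R A u))).
  rewrite mulr_suml; apply: eq_bigr => x _; rewrite mulr_sumr; apply: eq_bigr => u _.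
  by rewrite -e2piiD mulmxDr dotvDr [dotv _ (Rinv R A *m digit_sum R A u)]dot_Rinv.
rewrite (char_sum cA _ (fam_residues fD cD (Dg_mem hb))) Dg_size //.
case: (boolP (Aimg A^T g)) => hg; last first.
  rewrite mulr0 mul0r; suff -> : Aimg (A^T ^+ (size w).+1) g = false by rewrite mulr0.
  apply/negbTE; apply: contra hg => /AimgP[l ->]; apply/AimgP; exists (A^T ^+ size w *m l).
  by rewrite mulTXl.
have [l hl] := AimgP _ _ hg.
rewrite mulr1 hl zmxM zmxT Tinv_AT // IH // -crM exprS -mulrA; congr (cr (_ * (_ * _%:R))).
congr nat_of_bool; apply/idP/idP => /AimgP[j hj]; apply/AimgP; exists j.
  by rewrite mulTXl -hj.
apply: (@zmx_inj R); move: hj; rewrite mulTXl => /(congr1 (fun z => Tinv R A *m zmx R z)).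
by rewrite !zmxM !zmxT !Tinv_AT // -?zmxT -?zmxM.
Qed.

End Fibers.

(** * Product spectra for block triangular systems *)

Section Product.
Variables (R : realType) (k d1 : nat).
Local Notation e := (@e2pii R).
Variables (A : 'M[int]_(k + d1)) (A2 P : 'M[int]_k) (A1 : 'M[int]_d1).
Variables (B : seq 'cV[int]_(k + d1)) (B1 : seq 'cV[int]_d1).
Variables (off : 'cV[int]_d1 -> 'cV[int]_k) (Dg : 'cV[int]_d1 -> seq 'cV[int]_k) (D : nat).
Hypotheses (cA : contracting R A) (cA1 : contracting R A1) (cA2 : contracting R A2).
Hypothesis uP : zmx R P \in unitmx.
Hypothesis Rinv_low : forall x : 'cV[R]_(k + d1), dsubmx (Rinv R A *m x) = Rinv R A1 *m dsubmx x.
Hypothesis Rinv_up : forall u : 'cV[R]_k,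
  Rinv R A *m col_mx (zmx R P *m u) 0 = col_mx (zmx R P *m (Rinv R A2 *m u)) 0.
(** A digit is a quotient digit [b1] with a fibre digit [x], written in the basis [P] of the fibre
    lattice and shifted by an offset. *)
Let mk b1 x : 'cV[int]_(k + d1) := col_mx (off b1 + P *m x) b1.
Hypothesis hB : perm_eq B [seq mk b1 x | b1 <- B1, x <- Dg b1].
Hypothesis fD : digit_family A2 (map Dg B1) D.
Hypothesis cD : forall E, E \in map Dg B1 -> complete A2 E.
Let T := Tinv R A.
Let T2 := Tinv R A2.
Let U := mean_sqn (map Dg B1) : 'cV[R]_k -> R.
Implicit Types (x y : 'cV[R]_k) (w u : seq 'cV[int]_d1) (v : seq 'cV[int]_k).

Let D0 : 0 < D%:R :> R. Proof. by rewrite ltr0n (fam_pos fD). Qed.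
Let Dn0 n : 0 < D%:R ^+ n :> R. Proof. by rewrite exprn_gt0. Qed.
Let B10 : (0 < size B1)%N. Proof. by have := fam_size fD; rewrite size_map. Qed.
Let N10 : 0 < (size B1)%:R :> R. Proof. by rewrite ltr0n. Qed.

Definition mkw w v := [seq mk p.1 p.2 | p <- zip w v].
(** The coordinate dual to [P]: integer frequencies of the fibre system correspond to the points
    [pk] of integer vectors. *)
Definition pk x : 'cV[R]_k := (invmx (zmx R P))^T *m x.

Lemma dot_pk x y : dotv (pk x) (zmx R P *m y) = dotv x y.
Proof. by rewrite /pk dotv_mull trmxK mulmxA mulVmx // mul1mx. Qed.

Lemma pk_inj : injective pk.
Proof.
move=> x y h; have := congr1 (fun z => (zmx R P)^T *m z) h.
by rewrite /pk !mulmxA -trmx_mul mulVmx // trmx1 !mul1mx.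
Qed.

Lemma big_fibers (V : nmodType) n (F : seq 'cV[int]_(k + d1) -> V) :
  \sum_(w <- words B n) F w = \sum_(w <- words B1 n) \sum_(v <- prodw (map Dg w)) F (mkw w v).
Proof.
elim: n F => [|n IH] F; first by rewrite (big_words0 B) (big_words0 B1) big_seq1.
rewrite !big_wordsS (perm_big _ hB) big_allpairs_dep; apply: eq_bigr => b1 _.
under eq_bigr => x _ do rewrite IH.
rewrite exchange_big; apply: eq_bigr => w _.
by rewrite [map Dg _]/= big_prodw_cons.
Qed.

Lemma size_fibers : (size B)%:R = D%:R * (size B1)%:R :> R.
Proof.
rewrite (perm_size hB) size_allpairs_dep sumnE big_map big_seq.
rewrite (eq_bigr (fun=> D)) => [|b1 hb1]; last by apply: (fam_card fD); exact: map_f.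
by rewrite -big_seq big_const_seq count_predT iter_addn_0 natrM.
Qed.

Let Bn n : (size B)%:R ^- n = (size B1)%:R ^- n * D%:R ^- n :> R.
Proof. by rewrite size_fibers exprMn invfM mulrC. Qed.

Lemma B_gt0 : (0 < size B)%N.
Proof. by rewrite -(ltr0n R) size_fibers mulr_gt0. Qed.

Lemma mkw_words n w v : w \in words B1 n -> v \in prodw (map Dg w) -> mkw w v \in words B n.
Proof.
elim: n w v => [|n IH] [|b1 w] [|x v].
- by [].
- by move=> _ /prodwP.
- by move=> /words_size.
- by move=> /words_size.
- by move=> /words_size.
- by move=> /words_size.
- by move=> _ /prodwP.
rewrite /words [nseq _ _]/= prodw_consP [map _ _]/= prodw_consP => /andP[h1 h2] /andP[h3 h4].
rewrite /mkw /= prodw_consP (perm_mem hB) -/(mkw w v) IH // andbT.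
by apply/allpairsPdep; exists b1, x.
Qed.

Let base w : 'cV[R]_(k + d1) := digit_sum R A (map (mk^~ 0) w).

Lemma digit_sum_mk w v : size v = size w ->
  digit_sum R A (mkw w v) = base w + col_mx (zmx R P *m digit_sum R A2 v) 0.
Proof.
elim: w v => [|b w IH] [|x v] //=; first by rewrite /base /= mulmx0 col_mx0 addr0.
move=> [hs]; rewrite /base /= -/(mkw w v) IH //.
rewrite -Rinv_up -mulmxDr -/(base w); congr (_ *m _).
rewrite !zmx_col mulmx0 addr0 zmxD zmxM mulmxDr.
by rewrite -[X in col_mx _ X + _]addr0 -add_col_mx -[X in col_mx (_ + _) X]addr0 -add_col_mx addrACA.
Qed.

Lemma dsub_digit_sum w v : size v = size w ->
  dsubmx (digit_sum R A (mkw w v)) = digit_sum R A1 w.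
Proof.
elim: w v => [|b w IH] [|x v] //=; first by rewrite linear0.
by move=> [hs]; rewrite Rinv_low linearD /= -/(mkw w v) IH // zmx_col col_mxKd.
Qed.

Definition tail m n x w := cr (D%:R ^+ n)^-1 * \sum_(v <- prodw (map Dg w))
  e (- dotv (T ^+ m *m col_mx (pk x) 0) (digit_sum R A (mkw w v))).

Definition slice n (c : seq 'cV[int]_(k + d1) -> R[i]) x w := cr (D%:R ^+ n)^-1 *
  \sum_(v <- prodw (map Dg w)) c (mkw w v) * e (- dotv (col_mx (pk x) 0) (digit_sum R A (mkw w v))).

Let ds2 (v : seq 'cV[int]_k) : 'cV[R]_k := digit_sum R A2 v.

Lemma dot_Tpk m x w v : size v = size w ->
  dotv (T ^+ m *m col_mx (pk x) 0) (digit_sum R A (mkw w v)) =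
  dotv (T ^+ m *m col_mx (pk x) 0) (base w) + dotv (T2 ^+ m *m x) (ds2 v).
Proof.
move=> hs; rewrite digit_sum_mk // dotvDr; congr (_ + _).
rewrite -!dot_RinvX; have -> y : Rinv R A ^+ m *m col_mx (zmx R P *m y) 0 = col_mx (zmx R P *m (Rinv R A2 ^+ m *m y)) 0.
  elim: m y => [|m IH] y; first by rewrite !mulTX0.
  by rewrite !mulTXl IH Rinv_up.
by rewrite dotv_col dot_pk dotv0l addr0.
Qed.

Lemma sqn_phase (I : eqType) (s : seq I) (f : I -> R[i]) (t : R) (g h : I -> R) :
  (forall i, i \in s -> g i = t + h i) ->
  sqn (\sum_(i <- s) f i * e (- g i)) = sqn (\sum_(i <- s) f i * e (- h i)).
Proof.
move=> hg; transitivity (sqn (e (- t) * \sum_(i <- s) f i * e (- h i))).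
  congr sqn; rewrite mulr_sumr !big_seq; apply: eq_bigr => i hi.
  by rewrite hg // opprD e2piiD mulrCA.
by rewrite sqnM sqn_e mul1r.
Qed.

Lemma sqn_slice n c x w : sqn (slice n c x w) =
  (D%:R ^+ n)^-1 ^+ 2 * sqn (\sum_(v <- prodw (map Dg w)) c (mkw w v) * e (- dotv x (ds2 v))).
Proof.
rewrite /slice sqnM sqn_real; congr (_ * _); apply: sqn_phase => v /fiber_word_size hv.
have := dot_Tpk 0 x hv; rewrite !mulTX0; exact.
Qed.

Lemma sqn_tail m n x w : sqn (tail m n x w) =
  (D%:R ^+ n)^-1 ^+ 2 * sqn (\sum_(v <- prodw (map Dg w)) e (- dotv (T2 ^+ m *m x) (ds2 v))).
Proof.
rewrite /tail sqnM sqn_real; congr (_ * _).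
under eq_bigr => v _ do rewrite -[e _]mul1r; under [in RHS]eq_bigr => v _ do rewrite -[e _]mul1r.
by apply: (sqn_phase (fun=> 1)) => v /fiber_word_size hv; exact: dot_Tpk.
Qed.

Lemma coef_slice n c x (l : 'cV[R]_d1) : coef A B n c (col_mx (pk x) l) = coef A1 B1 n (slice n c x) l.
Proof.
rewrite /coef Bn crM big_fibers -mulrA; congr (_ * _).
rewrite mulr_sumr; apply: eq_bigr => w _; rewrite /slice -mulrA; congr (_ * _).
rewrite mulr_suml !big_seq; apply: eq_bigr => v /fiber_word_size hv.
rewrite -mulrA -e2piiD -opprD; congr (_ * e (- _)).
by rewrite -(dsub_digit_sum hv) -{1}[digit_sum R A _]vsubmxK -[in RHS](vsubmxK (digit_sum R A _))
  !dotv_col col_mxKd dotv0l addr0.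
Qed.

Lemma slice_cat m n c x u w : {subset u <= B1} -> size u = m ->
  slice (m + n) (fun z => c (take m z)) x (u ++ w) = slice m c x u * tail m n x w.
Proof.
move=> hu su; rewrite /slice /tail map_cat big_prodw_cat exprD invfM crM -!mulrA; congr (_ * _).
rewrite mulrCA; congr (_ * _); rewrite mulr_suml big_seq [RHS]big_seq; apply: eq_bigr => v /fiber_word_size hv.
rewrite mulr_sumr; apply: eq_bigr => v' _.
have -> : mkw (u ++ w) (v ++ v') = mkw u v ++ mkw w v' by rewrite /mkw zip_cat // map_cat.
have sm : size (mkw u v) = m by rewrite size_map size_zip hv minnn.
rewrite take_cat sm ltnn subnn take0 cats0 digit_sum_cat sm dotvDr opprD e2piiD mulrA.
by rewrite dot_RinvX.
Qed.

(** The product for the family is the mean over quotient words of the squared Fourier transforms of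
    their fibres. *)
Lemma fiber_qn n y : qn T2 U n y = ((size B1)%:R ^+ n)^-1 * \sum_(w <- words B1 n)
  (D%:R ^+ n)^-1 ^+ 2 * sqn (\sum_(v <- prodw (map Dg w)) e (- dotv y (ds2 v))).
Proof.
elim: n y => [|n IH] y.
  by rewrite big_words0 /= big_seq1 dotv0r oppr0 e2pii0 sqn1 !expr0 invr1 expr1n !mulr1.
rewrite /= {}IH big_wordsS.
have -> : (size B1)%:R ^- n.+1 = (size B1)%:R ^- n * (size B1)%:R^-1 :> R by rewrite exprSr invfM.
rewrite -[RHS]mulrA.
transitivity ((size B1)%:R ^- n * ((size B1)%:R^-1 * \sum_(b1 <- B1) \sum_(w <- words B1 n)
   sqn (mean_e (Dg b1) (T2 *m y)) * ((D%:R ^+ n)^-1 ^+ 2 * sqn (\sum_(v <- prodw (map Dg w)) e (- dotv (T2 *m y) (ds2 v)))))).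
  under [in RHS]eq_bigr => b1 _ do rewrite -mulr_sumr.
  by rewrite -mulr_suml /U /mean_sqn size_map big_map; ring.
congr (_ * (_ * _)); rewrite !big_seq; apply: eq_bigr => b1 hb1; apply: eq_bigr => w _.
rewrite [map Dg _]/= big_prodw_cons -[mean_e _ _]cjK sqn_cj mean_eN /mean_e (fam_card fD (map_f Dg hb1)).
rewrite [X in _ = _ * sqn X](_ : _ = (\sum_(x <- Dg b1) e (dotv (- (T2 *m y)) (zmx R x))) *
   \sum_(v <- prodw (map Dg w)) e (- dotv (T2 *m y) (ds2 v))).
  rewrite !sqnM sqn_real; move: (sqn _) (sqn _) => a b.
  by rewrite (exprSr D%:R n) invfM exprMn; ring.
rewrite mulr_suml; apply: eq_bigr => x _; rewrite mulr_sumr; apply: eq_bigr => v _.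
by rewrite /ds2 /= dot_Rinv dotvDr opprD e2piiD dotvNl.
Qed.

(** Slices do not keep their norm when more letters are read; the loss is exactly a partial product
    of the fibre weight, which tiling later compensates. *)
Lemma nrm2_slice_take m n c x : nrm2 B1 (m + n) (slice (m + n) (fun z => c (take m z)) x) =
  nrm2 B1 m (slice m c x) * qn T2 U n (T2 ^+ m *m x).
Proof.
rewrite fiber_qn /nrm2 big_words_cat exprD invfM -!mulrA; congr (_ * _); rewrite [RHS]mulrCA; congr (_ * _).
rewrite mulr_suml big_seq [RHS]big_seq; apply: eq_bigr => u hu; rewrite mulr_sumr; apply: eq_bigr => w _.
by rewrite (slice_cat n c x w (words_mem hu) (words_size hu)) sqnM sqn_tail.
Qed.

Lemma slice_shift n c x z w : w \in words B1 n ->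
  sqn (slice n c (x + zmx R (A2^T ^+ n *m z)) w) = sqn (slice n c x w).
Proof.
move=> hw; rewrite !sqn_slice; congr (_ * sqn _); rewrite !big_seq; apply: eq_bigr => v /fiber_word_size hv.
congr (_ * _); rewrite dotvDl opprD e2piiD.
have hi : isint (dotv (zmx R (A2^T ^+ n *m z)) (ds2 v)) by rewrite -(words_size hw) -hv; exact: zmxT_digit_sum.
by rewrite (isint_e (isintN hi)) mulr1.
Qed.

Lemma incongruent_large (s : seq 'cV[int]_k) : exists n0, forall n, (n0 <= n)%N ->
  forall l l', l \in s -> l' \in s -> Aimg (A2^T ^+ n) (l - l') -> l = l'.
Proof.
have [K [rho [K0 r0 r1 hT]]] := Tinv_contr cA2.
pose C := \sum_(l <- s) \sum_(l' <- s) nrm1 (zmx R (l - l')).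
have C0 : 0 <= C by apply: sumr_ge0 => ? _; apply: sumr_ge0 => ? _; exact: nrm1_ge0.
have hC l l' : l \in s -> l' \in s -> nrm1 (zmx R (l - l')) <= C.
  move=> h h'; rewrite /C (big_rem l h) /= (big_rem l' h') /= -addrA lerDl addr_ge0 ?sumr_ge0 // => *;
    rewrite ?sumr_ge0 // => *; exact: nrm1_ge0.
have e0 : 0 < (2 * (K * C + 1))^-1 by rewrite invr_gt0 mulr_gt0 // ltr_wpDl // mulr_ge0.
have [n0 hn0] := pow_small r0 r1 e0; exists n0 => n /hn0 hn l l' hl hl' /AimgP[z hz].
apply/eqP; rewrite -subr_eq0 hz; apply/eqP; suff -> : z = 0 by rewrite mulmx0.
have h1 : nrm1 (zmx R z) < 1.
  rewrite -(TinvX_mul cA2 n z) -hz; apply: le_lt_trans (hT _ _) _.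
  apply: (@le_lt_trans _ _ (K * (2 * (K * C + 1))^-1 * C)).
    by apply: ler_pM; rewrite ?nrm1_ge0 ?mulr_ge0 ?exprn_ge0 ?hC // ler_wpM2l.
  have hKC : 0 <= K * C by rewrite mulr_ge0.
  by rewrite mulrAC ltr_pdivrMr ?mul1r; lra.
exact: nrm1_lt1 h1.
Qed.

Let fiber_parseval_const n w : w \in words B1 n -> size (prodw (map Dg w)) = (D ^ n)%N.
Proof. by move=> hw; rewrite (fiber_size fD (words_mem hw)) (words_size hw). Qed.

Lemma slice_bessel n c (Ks : seq 'cV[int]_k) : uniq Ks ->
  (forall l l', l \in Ks -> l' \in Ks -> Aimg (A2^T ^+ n) (l - l') -> l = l') ->
  \sum_(l <- Ks) nrm2 B1 n (slice n c (zmx R l)) <= nrm2 B n c.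
Proof.
move=> uK hK; rewrite /nrm2 -mulr_sumr Bn -[leRHS]mulrA ler_wpM2l ?invr_ge0 ?exprn_ge0 ?(ltW N10) //.
rewrite exchange_big big_fibers mulr_sumr big_seq [leRHS]big_seq; apply: ler_sum => w hw.
under eq_bigr => l _ do rewrite sqn_slice.
rewrite -mulr_sumr expr2 -mulrA ler_wpM2l ?invr_ge0 ?(ltW (Dn0 _)) //.
rewrite ler_pdivrMl //; apply: bessel => // l l' hl hl'.
under eq_bigr => v _ do rewrite e2pii_mulJ opprK addrC -dotvBl -zmxB.
rewrite (fiber_char_sum cA2 fD cD _ (words_mem hw)) (words_size hw); congr (cr (_ * _%:R)); congr nat_of_bool.
case: eqP => [->|ne]; first by rewrite subrr Aimg0.
by apply/negbTE/negP => h; apply: ne; apply/esym; exact: hK.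
Qed.

Lemma fiber_isum_inj w v v' : {subset w <= B1} -> v \in prodw (map Dg w) -> v' \in prodw (map Dg w) ->
  Aimg (A2 ^+ size w) (digit_isum A2 v - digit_isum A2 v') -> v = v'.
Proof.
elim/last_ind: w v v' => [|w b IH] v v' hw; first by rewrite !inE => /eqP -> /eqP ->.
rewrite map_rcons; case: (lastP v) => [|{}v x] hv; first by move: (prodwP hv) => /=; rewrite size_rcons.
case: (lastP v') => [|{}v' x'] hv'; first by move: (prodwP hv') => /=; rewrite size_rcons.
have [h1 h2] := prodw_rcons_mem hv; have [h3 h4] := prodw_rcons_mem hv'.
rewrite !digit_isum_rcons size_rcons => /AimgP[j hj].
have hb : b \in B1 by apply: hw; rewrite mem_rcons mem_head.
have ex : A2 *m (A2 ^+ size w *m j - (digit_isum A2 v - digit_isum A2 v')) = x - x'.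
  by rewrite mulmxBr -mulTXl -hj mulmxBr; apply/matrixP => ? ?; rewrite !mxE; ring.
have xx : x = x'.
  by apply: (fam_mod fD (map_f Dg hb) h2 h4); rewrite -ex; apply/AimgP; eexists.
rewrite xx (IH v v') //; first by move=> y hy; apply: hw; rewrite mem_rcons inE hy orbT.
apply/AimgP; exists j; apply/eqP; rewrite -subr_eq0; apply/eqP.
apply: (contr_inj cA2); rewrite mulmx0 -opprB mulmxN ex xx subrr oppr0.
by [].
Qed.

(** The frequencies in [L2] are dual to every fibre at once, because all fibres of length n are
    residue systems for the same matrix A2^n. *)
Lemma slice_basis n : exists L2 : seq 'cV[int]_k, [/\ uniq L2,
  forall l l', l \in L2 -> l' \in L2 -> Aimg (A2^T ^+ n) (l - l') -> l = l' &
  forall c, \sum_(l <- L2) nrm2 B1 n (slice n c (zmx R l)) = nrm2 B n c].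
Proof.
have [L2 [uL hL hs]] : exists L2 : seq 'cV[int]_k, [/\ uniq L2,
    forall l l', l \in L2 -> l' \in L2 -> Aimg (A2^T ^+ n) (l - l') -> l = l' &
    forall w v v', w \in words B1 n -> v \in prodw (map Dg w) -> v' \in prodw (map Dg w) ->
      \sum_(l <- L2) e (dotv (zmx R l) (ds2 v - ds2 v')) = cr (D%:R ^+ n * (v == v')%:R)].
  case: n => [|n].
    exists [:: 0]; split=> // [l l'|w v v' /words_size/size0nil ->]; first by rewrite !inE => /eqP -> /eqP ->.
    by rewrite !inE => /eqP -> /eqP ->; rewrite big_seq1 subrr dotv0r e2pii0 eqxx mulr1.
  have [E hE _] := fam_pow_ne cA2 fD n.+1.
  have cn := contractingX n cA2.
  have [L2 [sL uL _ hL hs]] := dual_residues cn (fam_pow_residues cA2 fD cD hE).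
  exists L2; split=> // [l l' hl hl' h|w v v' hw hv hv']; first by apply: hL => //; rewrite trmxX.
  have sv : size v = n.+1 by rewrite (fiber_word_size hv) (words_size hw).
  have sv' : size v' = n.+1 by rewrite (fiber_word_size hv') (words_size hw).
  have := hs (digit_isum A2 v - digit_isum A2 v').
  rewrite zmxB -!(digit_isumE _ cA2) sv sv' -mulmxBr (Rinv_mul cn) -/(ds2 v) -/(ds2 v') => ->.
  rewrite (fam_card (fam_powP cA2 fD n.+1) hE) -[(Aimg _ _)%:R]cr_nat -crM natrX; congr (cr (_ * _%:R)); congr nat_of_bool.
  case: eqP => [->|ne]; first by rewrite subrr Aimg0.
  by apply/negbTE/negP => h; apply: ne; apply: (fiber_isum_inj (words_mem hw) hv hv'); rewrite (words_size hw).
exists L2; split=> // c; rewrite /nrm2 -mulr_sumr Bn -[RHS]mulrA; congr (_ * _).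
rewrite exchange_big big_fibers mulr_sumr big_seq [RHS]big_seq; apply: eq_bigr => w hw.
under eq_bigr => l _ do rewrite sqn_slice.
rewrite -mulr_sumr.
rewrite (fin_parseval (phi := fun v l => e (- dotv (zmx R l) (ds2 v))) (k := D%:R ^+ n) (fun v => c (mkw w v))).
- by rewrite mulrA; congr (_ * _); field; rewrite gt_eqF.
- by apply: prodw_uniq => E /mapP[b hb ->]; apply: (fam_uniq fD); apply: map_f; exact: (words_mem hw).
move=> v v' hv hv'; under eq_bigr => l _ do rewrite e2pii_mulJ opprK addrC -dotvBr.
by rewrite (hs w) // eq_sym.
Qed.

(** After m contractions the frequency is close to 0, while digit sums stay bounded, so all phases
    are close to 1, uniformly in the word. *)
Lemma tail_near x (eps : R) : 0 < eps -> exists m0, forall m, (m0 <= m)%N -> forall n w,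
  {subset w <= B1} -> w \in words B1 n -> sqn (1 - tail m n x w) <= eps.
Proof.
move=> eps0; have [K [rho [K0 r0 r1 hT]]] := Tinv_contr cA; have [C C0 hC] := digit_sum_bound cA B.
pose px : 'cV[R]_(k + d1) := col_mx (pk x) 0; pose M : R := 2 * pi * K * nrm1 px * C.
have M0 : 0 <= M by rewrite !mulr_ge0 ?pi_ge0 // nrm1_ge0.
have e1 : 0 < Num.min 1 (eps / (M ^+ 2 + 1)).
  by rewrite lt_min ltr01 divr_gt0 // ltr_wpDl // sqr_ge0.
have [m0 hm0] := pow_small r0 r1 e1; exists m0 => m /hm0 hm n w hw hwn.
have key v : v \in prodw (map Dg w) ->
    sqn (1 - e (- dotv (T ^+ m *m col_mx (pk x) 0) (digit_sum R A (mkw w v)))) <= eps.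
  move=> hv; apply: le_trans (sqn_1Be_le _) _.
  have h1 : `|2 * pi * - dotv (T ^+ m *m col_mx (pk x) 0) (digit_sum R A (mkw w v))| <= M * rho ^+ m.
    rewrite normrM normrN ger0_norm ?mulr_ge0 ?pi_ge0 // /M -!mulrA !ler_wpM2l ?pi_ge0 //.
    apply: le_trans (dotv_le _ _) _; rewrite [X in _ <= X](_ : _ = (K * rho ^+ m * nrm1 px) * C); last by ring.
    apply: ler_pM; rewrite ?nrm1_ge0 ?hT //; apply: hC; apply: words_mem (mkw_words hwn hv).
  rewrite -real_normK ?num_real //; apply: (@le_trans _ _ ((M * rho ^+ m) ^+ 2)).
    have hMr : 0 <= M * rho ^+ m by rewrite mulr_ge0 // exprn_ge0.
    by rewrite -[leRHS](@real_normK _ (M * rho ^+ m)) ?num_real // lerXn2r ?nnegrE // (ger0_norm hMr).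
  move: hm; rewrite le_min => /andP[hm1 hm2]; rewrite exprMn.
  have hs : (rho ^+ m) ^+ 2 <= eps / (M ^+ 2 + 1).
    apply: le_trans hm2; rewrite expr2 -[leRHS]mulr1 ler_wpM2l ?exprn_ge0 //.
  apply: (@le_trans _ _ ((M ^+ 2 + 1) * (rho ^+ m) ^+ 2)); first by rewrite ler_wpM2r ?sqr_ge0 // lerDl.
  by rewrite mulrC -ler_pdivlMr // ltr_wpDl // sqr_ge0.
have sw := fiber_parseval_const hwn.
have -> : 1 - tail m n x w = cr (D%:R ^+ n)^-1 * \sum_(v <- prodw (map Dg w))
    (1 - e (- dotv (T ^+ m *m col_mx (pk x) 0) (digit_sum R A (mkw w v)))).
  rewrite sumrB mulrBr -/(tail m n x w); congr (_ - _).
  by rewrite sum_const_seq mulr1 sw natrX -!cr_nat -crX -crM mulVf ?gt_eqF // cr1.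
rewrite sqnM sqn_real exprVn ler_pdivrMl ?exprn_gt0 //; apply: le_trans (sqn_sum_le _ _) _.
rewrite sw natrX expr2 -mulrA ler_wpM2l ?(ltW (Dn0 _)) //.
rewrite -natrX -sw -sum_const_seq !big_seq; exact: ler_sum.
Qed.

(** For a fixed fibre frequency, the slices of deeper levels are nearly determined by the first m
    quotient letters, so [parseval_limit] applies to the quotient. The limit norm is the slice norm
    times the fibre weight at the frequency. *)
Lemma kappa_lower Lam1 (l : 'cV[int]_k) n c (eps : R) : parseval A1 B1 Lam1 -> 0 < eps ->
  exists F, [/\ uniq F, ([set` F] `<=` Lam1)%classic &
    nrm2 B1 n (slice n c (zmx R l)) * q T2 U (T2 ^+ n *m zmx R l) - eps <=
    \sum_(x <- F) sqn (coef A B n c (col_mx (pk (zmx R l)) x)) * qB A B (T ^+ n *m col_mx (pk (zmx R l)) x)].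
Proof.
move=> hp eps0; set x := zmx R l.
pose c' (z : seq 'cV[int]_(k + d1)) := c (take n z).
pose C := \sum_(z <- words B n) sqn (c z).
have C0 : 0 <= C by apply: sumr_ge0 => z _; exact: sqn_ge0.
have hc m w v : (n <= m)%N -> w \in words B1 m -> v \in prodw (map Dg w) -> sqn (c' (mkw w v)) <= C.
  move=> nm hw hv; have := mkw_words hw hv; rewrite -(subnKC nm) => /words_cat_mem[u [u' [hu hu' e1]]].
  rewrite /c' e1 take_size_cat ?(words_size hu) // /C (big_rem u hu) /= lerDl.
  by apply: sumr_ge0 => z _; exact: sqn_ge0.
have hs m w : (n <= m)%N -> w \in words B1 m -> sqn (slice m c' x w) <= C.
  move=> nm hw; rewrite /slice sqnM sqn_real exprVn ler_pdivrMl ?exprn_gt0 //.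
  apply: le_trans (sqn_sum_le _ _) _; have sw := fiber_parseval_const hw.
  rewrite sw natrX expr2 -mulrA ler_wpM2l ?(ltW (Dn0 _)) // -natrX -sw -sum_const_seq !big_seq.
  by apply: ler_sum => v hv; rewrite sqnM sqn_e mulr1 (hc m).
(* The losses through [eta], [delta] and the near equality at eps / 8 amount to at most 3/4 of
   [eps]; replacing weights by 1 - e2 costs at most another 1/8. *)
pose eta : R := Num.min 2^-1 (eps / (4 * (C + 1))).
have C1 : 0 < 4 * (C + 1) by rewrite mulr_gt0 // ltr_wpDl.
have eta0 : 0 < eta by rewrite lt_min invr_gt0 ltr0n /= divr_gt0.
have eta1 : eta < 1 by rewrite gt_min; apply/orP; left; lra.
have etaC : eta * (4 * (C + 1)) <= eps by rewrite -ler_pdivlMr // /eta ge_min lexx orbT.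
pose delta := eta * eps / 4.
have del0 : 0 < delta by rewrite /delta divr_gt0 // mulr_gt0.
have [m0 hm0] := tail_near x (divr_gt0 del0 (ltr_wpDl C0 ltr01)).
pose m := (n + m0)%N; pose cs M := slice M c' x.
have hclose j w : w \in words B1 (m + j) -> sqn (cs (m + j)%N w - cs m (take m w)) <= delta.
  move=> /words_cat_mem[u [v [hu hv ->]]].
  have -> : cs (m + j)%N (u ++ v) = cs m u * tail m j x v.
    rewrite /cs -(slice_cat j c' x v (words_mem hu) (words_size hu)).
    by rewrite /slice; congr (_ * _); apply: eq_bigr => z _; rewrite /c' take_takel // leq_addr.
  rewrite take_size_cat ?(words_size hu) //.
  rewrite -{2}[cs m u]mulr1 -mulrBr sqnM -opprB sqnN mulrC.
  apply: (@le_trans _ _ (delta / (C + 1) * (C + 1))); last by rewrite divfK // gt_eqF // ltr_wpDl.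
  apply: ler_pM; rewrite ?sqn_ge0 //; first by apply: (hm0 m _ j v (words_mem hv)) => //; rewrite leq_addl.
  by apply: le_trans (hs _ _ _ hu) _; rewrite ?leq_addr // lerDl.
have [F [uF FL hF]] := parseval_limit B10 hp eta0 eta1 hclose (divr_gt0 eps0 (ltr0Sn _ 7)).
exists F; split=> //.
pose v0 := nrm2 B1 m (cs m).
have v0E : v0 = nrm2 B1 n (slice n c x) * qn T2 U m0 (T2 ^+ n *m x) by exact: nrm2_slice_take.
have v00 : 0 <= v0 by apply: nrm2_ge0.
have v0C : v0 <= C by apply: (nrm2_le B10) => w hw; apply: hs => //; rewrite leq_addr.
have q0 : nrm2 B1 n (slice n c x) * q T2 U (T2 ^+ n *m x) <= v0.
  by rewrite v0E ler_wpM2l ?nrm2_ge0 //; apply: q_le_qn; exact: mean_sqn_01.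
apply: le_trans (lerD q0 (lexx _)) _.
have C8 : 0 < 8 * (C + 1) by rewrite mulr_gt0 // ltr_wpDl.
pose e2 := Num.min 1 (eps / (8 * (C + 1))).
have e20 : 0 < e2 by rewrite lt_min ltr01 divr_gt0.
have e21 : e2 <= 1 by rewrite ge_min lexx.
have e2C : e2 * (8 * (C + 1)) <= eps by rewrite -ler_pdivlMr // /e2 ge_min lexx orbT.
have [j hj] := qB_lim cA B_gt0 (map (col_mx (pk x)) F) e20.
have hj' z : z \in F -> 1 - e2 <= qB A B (T ^+ (m + j) *m col_mx (pk x) z).
  by move=> hz; apply: hj; rewrite ?leq_addl //; exact: map_f.
have {hj} := hF j; rewrite -/v0; set S := \sum_(z <- F) _ => hS.
apply: (@le_trans _ _ ((1 - e2) * S)).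
  have S0 : 0 <= S by apply: sumr_ge0 => z _; exact: sqn_ge0.
  move: hS; have -> : eta^-1 * delta = eps / 4 by rewrite /delta -mulrA mulKf // gt_eqF.
  move=> hS.
  have h1 : v0 - 3 / 4 * eps <= S.
    apply: le_trans hS; have := mulr_ge0 (ltW eta0) C0; have := ler_wpM2l (ltW eta0) v0C.
    have := mulr_ge0 (ltW eta0) (ltW eps0); lra.
  have e22 : 0 <= 1 - e2 by rewrite subr_ge0.
  apply: le_trans (ler_wpM2l e22 h1).
  have := mulr_ge0 (ltW e20) (ltW eps0); have := ler_wpM2l (ltW e20) v0C; lra.
rewrite /S mulr_sumr !big_seq; apply: ler_sum => z hz.
rewrite (coef_qB A B n (m0 + j)) addnA -/m (coef_slice _ _ x) mulrC ler_wpM2l ?sqn_ge0 //.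
exact: hj'.
Qed.

(** Bessel: at a deep level the fibre frequencies are incongruent, so slices obey Bessel, and the
    quotient does so for each slice. Completeness: each frequency of [slice_basis] is spread over
    its translates, whose slices have equal norm, and tiling makes their weights add up to nearly
    1. *)
Lemma parseval_product Lam1 : parseval A1 B1 Lam1 ->
  (forall x (eps : R), 0 < eps -> exists2 F : seq 'cV[int]_k, uniq F &
     1 - eps <= \sum_(z <- F) q T2 U (x + zmx R z)) ->
  parseval A B [set x : 'cV[R]_(k + d1) | (exists l : 'cV[int]_k, usubmx x = pk (zmx R l)) /\ Lam1 (dsubmx x)]%classic.
Proof.
move=> hp tile n c; have Nc0 : 0 <= nrm2 B n c :> R by apply: nrm2_ge0; exact: B_gt0.
have colI : injective (fun p : 'cV[int]_k * 'cV[R]_d1 => col_mx (pk (zmx R p.1)) p.2).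
  by move=> [a b] [a' b'] /= /eq_col_mx[/pk_inj/zmx_inj -> ->].
split.
  move=> F uF hF.
  have [f hf] : exists f : 'cV[R]_(k + d1) -> 'cV[int]_k, forall x : 'cV[R]_(k + d1), x \in F -> usubmx x = pk (zmx R (f x)).
    have /choice[f hf] : forall x : 'cV[R]_(k + d1), exists l : 'cV[int]_k, x \in F -> usubmx x = pk (zmx R l).
      move=> x; case: (boolP (x \in F)) => [hx|_]; last by exists 0.
      by have [[l hl] _] := hF x hx; exists l.
    by exists f.
  pose Ks := undup (map f F); pose Ls := undup (map dsubmx F).
  have Ls1 : ([set` Ls] `<=` Lam1)%classic.
    by move=> z /=; rewrite mem_undup => /mapP[x hx ->]; have [] := hF x hx.
  have [m1 hm1] := incongruent_large Ks.
  apply/ler_addgt0Pr => eps eps0.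
  (* The cap 1/2 gives the crude bound S <= 2 nrm2, which then turns the relative loss e2 into an
     absolute loss of at most [eps]. *)
  pose e2 := Num.min 2^-1 (eps / (2 * (nrm2 B n c + 1))).
  have N1 : 0 < 2 * (nrm2 B n c + 1) :> R by rewrite mulr_gt0 // ltr_wpDl.
  have e20 : 0 < e2 by rewrite lt_min invr_gt0 ltr0n divr_gt0.
  have e21 : e2 <= 2^-1 by rewrite ge_min lexx.
  have e2C : e2 * (2 * (nrm2 B n c + 1)) <= eps by rewrite -ler_pdivlMr // /e2 ge_min lexx orbT.
  have [m2 hm2] := qB_lim cA1 B10 Ls e20.
  pose m := (m1 + m2)%N; pose M := (n + m)%N; pose c' z := c (take n z).
  pose G (p : 'cV[int]_k * 'cV[R]_d1) := sqn (coef A B M c' (col_mx (pk (zmx R p.1)) p.2)).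
  have h1 : \sum_(x <- F) sqn (coef A B n c x) * qB A B (Tinv R A ^+ n *m x) <=
      \sum_(l <- Ks) \sum_(z <- Ls) G (l, z).
    rewrite -big_allpairs /=.
    apply: (@le_trans _ _ (\sum_(p <- map (fun y0 : 'cV[R]_(k + d1) => (f y0, dsubmx y0)) F) G p)).
      rewrite big_map !big_seq; apply: ler_sum => y0 hx; rewrite /G /= -hf // vsubmxK.
      rewrite (coef_qB A B n m) -[leRHS]mulr1 ler_wpM2l ?sqn_ge0 //.
      by have /andP[] := qB01 A B (Tinv R A ^+ M *m y0).
    apply: cr_ge0_sum.
    - rewrite map_inj_in_uniq // => x y hx hy [h1 h2].
      by rewrite -(vsubmxK x) -(vsubmxK y) hf // hf // h1 h2.
    - by apply: allpairs_uniq; rewrite ?undup_uniq // => -[a b] [a' b'].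
    - move=> _ /mapP[x hx ->]; apply/allpairsP; exists (f x, dsubmx x); split=> //=.
        by rewrite mem_undup map_f.
      by rewrite mem_undup map_f.
    by move=> p; exact: sqn_ge0.
  have h2 : (1 - e2) * \sum_(l <- Ks) \sum_(z <- Ls) G (l, z) <= nrm2 B n c.
    rewrite -(nrm2_take B_gt0 n m c) -/M -/c'.
    apply: le_trans (slice_bessel c' (undup_uniq (map f F)) (hm1 M _)); last by rewrite /M /m addnCA leq_addr.
    rewrite mulr_sumr; apply: ler_sum => l _.
    have [hb _] := hp M (slice M c' (zmx R l)); apply: le_trans (hb Ls (undup_uniq _) Ls1).
    rewrite mulr_sumr !big_seq; apply: ler_sum => z hz; rewrite /G /= coef_slice mulrC ler_wpM2l ?sqn_ge0 //.
    by apply: hm2 => //; rewrite /M /m addnA leq_addl.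
  apply: le_trans h1 _; move: h2; set S := \sum_(l <- Ks) _ => h2.
  have : S * 2^-1 <= nrm2 B n c.
    have S0 : 0 <= S by apply: sumr_ge0 => ? _; apply: sumr_ge0 => ? _; exact: sqn_ge0.
    apply: le_trans h2; rewrite mulrC ler_wpM2r //; lra.
  move=> h3; have : e2 * S <= e2 * (2 * nrm2 B n c) by rewrite ler_wpM2l ?(ltW e20) //; lra.
  lra.
move=> eps eps0.
have [L2 [uL hL hs]] := slice_basis n.
pose e1 := eps / (2 * (nrm2 B n c + 1)).
have N1 : 0 < 2 * (nrm2 B n c + 1) :> R by rewrite mulr_gt0 // ltr_wpDl.
have e10 : 0 < e1 by rewrite divr_gt0.
have e1E : e1 * (2 * (nrm2 B n c + 1)) = eps by rewrite divfK // gt_eqF.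
(* Tiling is applied at T2^n l: the translate l + S2^n z, with S2 = A2^T, has the point T2^n l + z
   as its image. *)
have /choice[J hJ] : forall l : 'cV[int]_k, exists F : seq 'cV[int]_k, uniq F /\
    1 - e1 <= \sum_(z <- F) q T2 U (T2 ^+ n *m zmx R l + zmx R z).
  by move=> l; have [F uF hF] := tile (T2 ^+ n *m zmx R l) e1 e10; exists F.
pose Ks := [seq l + A2^T ^+ n *m z | l <- L2, z <- J l].
have uK : uniq Ks.
  apply: allpairs_uniq_dep => // [l _|]; first by have [] := hJ l.
  move=> [l z] [l' z'] /allpairsPdep[a [b [ha hb [-> ->]]]] /allpairsPdep[a' [b' [ha' hb' [-> ->]]]] /= h.
  have e3 : a - a' = A2^T ^+ n *m (b' - b).
    have -> : a = a' + A2^T ^+ n *m b' - A2^T ^+ n *m b by rewrite -h addrK.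
    by rewrite mulmxBr addrAC [a' + _]addrC addrK.
  have aa : a = a' by apply: hL => //; apply/AimgP; exists (b' - b).
  have bb : b = b'.
    apply: (@zmx_inj R); rewrite -(TinvX_mul cA2 n b) -(TinvX_mul cA2 n b').
    by move: h; rewrite aa => /addrI ->.
  by rewrite aa bb.
pose e2 := eps / (2 * (size Ks).+1%:R).
have e20 : 0 < e2 by rewrite divr_gt0 // mulr_gt0 ?ltr0n.
have /choice[FF hFF] := fun l : 'cV[int]_k => kappa_lower l n c hp e20.
exists [seq col_mx (pk (zmx R l)) z | l <- Ks, z <- FF l]; split.
- apply: allpairs_uniq_dep => // [l _|]; first by have [] := hFF l.
  move=> [l z] [l' z'] _ _ /= h.
  by have [-> ->] := colI (l, z) (l', z') h.
- move=> _ /= /allpairsPdep[l [z [hl hz ->]]] /=; rewrite col_mxKu col_mxKd; split; first by exists l.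
  by have [_ h _] := hFF l; apply: h.
rewrite big_allpairs_dep /=.
apply: (@le_trans _ _ (\sum_(l <- Ks) (nrm2 B1 n (slice n c (zmx R l)) * q T2 U (T2 ^+ n *m zmx R l) - e2))); last first.
  by apply: ler_sum => l _; have [] := hFF l.
rewrite sumrB sum_const_seq.
have h1 : (1 - e1) * nrm2 B n c <= \sum_(l <- Ks) nrm2 B1 n (slice n c (zmx R l)) * q T2 U (T2 ^+ n *m zmx R l).
  rewrite big_allpairs_dep /= -hs mulr_sumr; apply: ler_sum => l _.
  have hz z : nrm2 B1 n (slice n c (zmx R (l + A2^T ^+ n *m z))) = nrm2 B1 n (slice n c (zmx R l)).
    rewrite /nrm2 !big_seq; congr (_ * _); apply: eq_bigr => w hw.
    by rewrite zmxD slice_shift.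
  under eq_bigr => z _ do rewrite hz zmxD mulmxDr (TinvX_mul cA2).
  rewrite -mulr_sumr mulrC ler_wpM2l //; first by apply: nrm2_ge0.
  by have [] := hJ l.
have h2 : (size Ks)%:R * e2 <= eps / 2.
  by rewrite /e2 mulrA ler_pdivrMr ?mulr_gt0 ?ltr0n // -[(size Ks).+1%:R]natr1; lra.
have : e1 * nrm2 B n c <= eps / 2 by rewrite -e1E; lra.
lra.
Qed.

End Product.

(** * Integer bases and conjugation *)

Section IntegerMatrices.

Definition indep d k (M : 'M[int]_(d, k)) := forall v : 'cV[int]_k, M *m v = 0 -> v = 0.

(** Rank at least [k], witnessed by independent columns. *)
Definition has_rank d (G : set 'cV[int]_d) k :=
  exists2 M : 'M[int]_(d, k), forall j, G (col j M) & indep M.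

(** In the Smith normal form, independence makes all [k] diagonal entries nonzero, so the square
    factor [Q] is invertible up to an integer. *)
Lemma smith_indep d k (M : 'M[int]_(d, k)) : indep M -> (k <= d)%N /\
  exists (V W : 'M[int]_d) (Q N : 'M[int]_k) (m : nat),
  [/\ V *m W = 1%:M, W *m V = 1%:M, (0 < m)%N, M = V *m pid_mx k *m Q & Q *m N = (m%:Z)%:M].
Proof.
move=> iM; have [V uV [Rr uR [s _ e]]] := int_Smith_normal_form M.
have hs (j : 'I_k) : (j < d)%N /\ s`_j != 0.
  case: (boolP ((j < d)%N && (s`_j != 0))) => [/andP //|h].
  have : invmx Rr *m delta_mx j 0 = 0 :> 'cV[int]_k.
    apply: iM; rewrite e -!mulmxA mulKVmx //.
    rewrite [X in V *m X](_ : _ = 0) ?mulmx0 //.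
    apply/colP => i; rewrite mxE [RHS]mxE big1 // => l _; rewrite !mxE eqxx andbT.
    case: eqP => [il|]; last by rewrite mulr0n mul0r.
    case: eqP => [lj|]; last by rewrite mulr0.
    rewrite mulr1n mulr1; apply/eqP; move: h; rewrite -lj -il ltn_ord /= negbK => /eqP ->.
    by [].
  move=> /(congr1 (fun X => Rr *m X)); rewrite mulKVmx // mulmx0 => /colP/(_ j).
  by rewrite !mxE !eqxx.
split.
  case: k M iM Rr uR e hs => // k M iM Rr uR e hs.
  by have [] := hs ord_max.
(* Squares make the common multiple positive whatever the signs of the diagonal entries. *)
pose m : int := \prod_(j < k) s`_j ^+ 2.
pose t (j : 'I_k) : int := s`_j * \prod_(i < k | i != j) s`_i ^+ 2.
have m0 : 0 < m by apply: prodr_gt0 => j _; rewrite exprn_even_gt0 //; have [_ ->] := hs j.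
exists V, (invmx V), (diag_mx (\row_j s`_j) *m Rr), (invmx Rr *m diag_mx (\row_j t j)), `|m|%N.
split; rewrite ?mulmxV ?mulVmx //; first by rewrite absz_gt0 gt_eqF.
- rewrite {1}e mulmxA; congr (_ *m _); rewrite -mulmxA; congr (_ *m _).
  apply/matrixP => i j; rewrite mul_mx_diag !mxE.
  case: eqP => [ij|]; last by rewrite mulr0n mul0r.
  by rewrite ij ltn_ord /= mul1r mulr1n.
rewrite -mulmxA mulKVmx // mulmx_diag gez0_abs ?(ltW m0) // -diag_const_mx; congr diag_mx.
apply/rowP => j; rewrite !mxE /t /m [in RHS](bigD1 j) //=; ring.
Qed.

Lemma mulmx_cols d k (M : 'M[int]_(d, k)) (v : 'cV[int]_k) :
  M *m v = \sum_j v j 0 *: col j M.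
Proof.
apply/colP => i; rewrite !mxE summxE; apply: eq_bigr => j _.
by rewrite !mxE mulrC.
Qed.

Lemma subgrp_cols d k (G : set 'cV[int]_d) (M : 'M[int]_(d, k)) v :
  is_subgrp G -> (forall j, G (col j M)) -> G (M *m v).
Proof. by move=> hG hM; rewrite mulmx_cols; apply: subgrp_sum => // j; exact: subgrpZ. Qed.

Lemma scalar_mul k (m : nat) n (v : 'M[int]_(k, n)) : (m%:Z)%:M *m v = v *+ m.
Proof. by rewrite mul_scalar_mx -scaler_nat; congr (_ *: _); rewrite natz. Qed.

Lemma rank_full k (G : set 'cV[int]_k) : is_subgrp G -> has_rank G k -> full_rank G.
Proof.
move=> hG [M hM iM]; have [_ [V [W [Q [N [m [VW WV m0 eM QN]]]]]]] := smith_indep iM.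
exists m => // v; have -> : v *+ m = M *m (N *m (W *m v)).
  by rewrite eM pid_mx_1 mulmx1 -!mulmxA (mulmxA Q N) QN scalar_mul -!scaler_nat -scalemxAr mulmxA VW mul1mx.
exact: subgrp_cols.
Qed.

(** The group is generated by the vectors m e_i together with its elements in the box of side m. The
    Smith form of this generating matrix leaves [k] columns. *)
Lemma subgrp_basis k (G : set 'cV[int]_k) : is_subgrp G -> full_rank G ->
  exists P X : 'M[int]_k, exists2 m : nat, (0 < m)%N &
   P *m X = (m%:Z)%:M /\ forall g, G g <-> exists z, g = P *m z.
Proof.
move=> hG [m m0 hm].
pose gs := [seq (delta_mx i 0 : 'cV[int]_k) *+ m | i : 'I_k] ++ [seq b <- box k m | `[< G b >]].
have hgs g : g \in gs -> G g.
  by rewrite mem_cat mem_filter => /orP[/mapP[i _ ->]|/andP[/asboolP]].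
pose n := size gs; pose M : 'M[int]_(k, n) := \matrix_(i, j) (nth 0 gs j : 'cV[int]_k) i 0.
have colM j : col j M = nth 0 gs j by apply/colP => i; rewrite !mxE.
have GM v : G (M *m v) by apply: subgrp_cols => // j; rewrite colM; apply: hgs; exact: mem_nth.
have gM g : g \in gs -> exists v, g = M *m v.
  move=> hg; have hi : (index g gs < n)%N by rewrite index_mem.
  exists (delta_mx (Ordinal hi) 0); rewrite -colE colM /= nth_index //.
have DM (v v' : 'cV[int]_k) : (exists z, v = M *m z) -> (exists z, v' = M *m z) -> exists z, v + v' = M *m z.
  by move=> [z ->] [z' ->]; exists (z + z'); rewrite mulmxDr.
have mM (v : 'cV[int]_k) : exists z, v *+ m = M *m z.
  have -> : v *+ m = \sum_i v i 0 *: ((delta_mx i 0 : 'cV[int]_k) *+ m).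
    apply/colP => i; rewrite mulmxnE summxE (bigD1 i) //= big1 ?addr0.
      by rewrite mxE mulmxnE mxE !eqxx mulr_natr.
    by move=> j ji; rewrite mxE mulmxnE mxE eq_sym (negPf ji) mul0rn mulr0.
  elim/big_ind: _; [by exists 0; rewrite mulmx0|exact: DM|].
  move=> i _; have [|z ->] := gM ((delta_mx i 0 : 'cV[int]_k) *+ m).
    by rewrite /gs mem_cat; apply/orP; left; apply/mapP; exists i; rewrite ?mem_enum.
  by exists (v i 0 *: z); rewrite -scalemxAr.
have GE g : G g -> exists z, g = M *m z.
  move=> Gg; have [k0 hk0 [k1 e]] := int_mod_box g m0; rewrite e; apply: DM => //; apply: gM.
  rewrite /gs mem_cat mem_filter hk0 andbT; apply/orP; right; apply/asboolP.
  by have -> : k0 = g - k1 *+ m; [rewrite e addrK|apply: hG.2].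
have [V uV [Rr uR [s _ e]]] := int_Smith_normal_form M; move: e.
set D := (\matrix_(i, j) _); move=> e.
have hD : D *m (pid_mx k : 'M[int]_(n, k)) *m (pid_mx k : 'M[int]_(k, n)) = D.
  rewrite -mulmxA mul_pid_mx; apply/matrixP => i j; rewrite mxE (bigD1 j) //= big1 ?addr0 => [|l lj].
    rewrite !mxE eqxx; case: (eqVneq (i : nat) j) => [ij|]; last by rewrite mulr0n mul0r.
    rewrite minnn (_ : (j < _)%N) ?mulr1 //.
    by rewrite minnn -ij ltn_ord.
  by rewrite [X in _ * X]mxE (negPf (_ : (l : nat) != j)) // mulr0.
pose P := V *m D *m (pid_mx k : 'M[int]_(n, k)).
have PM g : (exists z, g = M *m z) <-> exists z, g = P *m z.
  split=> [[z ->]|[z ->]].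
    exists ((pid_mx k : 'M[int]_(k, n)) *m (Rr *m z)).
    by rewrite /P e !mulmxA -(mulmxA _ _ (pid_mx k)) -(mulmxA V) -[in LHS]hD !mulmxA.
  by exists (invmx Rr *m (pid_mx k *m z)); rewrite /P e -!mulmxA mulKVmx.
have /choice[X hX] : forall i : 'I_k, exists z, (delta_mx i 0 : 'cV[int]_k) *+ m = P *m z.
  by move=> i; apply/PM; exact: mM.
exists P, (\matrix_(i, j) X j i 0), m => //; split.
  apply/matrixP => i j; have /colP/(_ i) := hX j.
  rewrite mulmxnE !mxE eqxx andbT natz -mulr_natr natz => h.
  rewrite -[RHS]mulr_natl; move: h; rewrite ?natz => ->.
  by apply: eq_bigr => l _; rewrite mxE.
move=> g; rewrite -PM; split; first exact: GE.
by move=> [z ->].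
Qed.
End IntegerMatrices.

Section Intertwining.
Variable R : realType.

Lemma intertwineX (S : pzRingType) d d' (M : 'M[S]_d) (M' : 'M[S]_d') (X : 'M[S]_(d, d')) j :
  M *m X = X *m M' -> M ^+ j *m X = X *m M' ^+ j.
Proof.
move=> h; elim: j => [|j IH]; first by rewrite !expr0 mul1mx mulmx1.
by rewrite !exprS -!mulmxE -mulmxA IH !mulmxA h.
Qed.

Lemma contracting_factor d d' (A : 'M[int]_d) (A' : 'M[int]_d') (X : 'M[R]_(d', d)) (Y : 'M[R]_(d, d')) :
  contracting R A -> zmx R A' \in unitmx ->
  (forall j, Rinv R A' ^+ j = X *m Rinv R A ^+ j *m Y) -> contracting R A'.
Proof.
move=> [_ [K [rho [K0 r0 r1 hb]]]] uA' h; split=> //.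
pose SX := \sum_i \sum_j `|X i j|; pose SY := \sum_j \sum_i `|Y i j|.
have SX0 : 0 <= SX by apply: sumr_ge0 => i _; apply: sumr_ge0.
have SY0 : 0 <= SY by apply: sumr_ge0 => i _; apply: sumr_ge0.
exists (SX * K * SY), rho; split=> //; first by rewrite !mulr_ge0.
move=> j i l; rewrite h !mxE.
have hX : \sum_b `|X i b| <= SX.
  by rewrite /SX (bigD1 i) //= lerDl sumr_ge0 // => ? _; rewrite sumr_ge0.
have hY : \sum_a `|Y a l| <= SY.
  by rewrite /SY (bigD1 l) //= lerDl sumr_ge0 // => ? _; rewrite sumr_ge0.
have Kr0 : 0 <= K * rho ^+ j by rewrite mulr_ge0 ?exprn_ge0.
apply: (@le_trans _ _ (\sum_a (SX * (K * rho ^+ j)) * `|Y a l|)).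
  apply: le_trans (ler_norm_sum _ _ _) _; apply: ler_sum => a _.
  rewrite normrM ler_wpM2r // mxE; apply: le_trans (ler_norm_sum _ _ _) _.
  apply: (@le_trans _ _ (\sum_b `|X i b| * (K * rho ^+ j))).
    by apply: ler_sum => b _; rewrite normrM ler_wpM2l.
  by rewrite -mulr_suml ler_wpM2r.
rewrite -mulr_sumr; apply: (@le_trans _ _ (SX * (K * rho ^+ j) * SY)).
  by rewrite ler_wpM2l // mulr_ge0.
by rewrite [leLHS](_ : _ = SX * K * SY * rho ^+ j) //; ring.
Qed.

Lemma conj_Rinv d (A A' V : 'M[int]_d) : contracting R A -> zmx R V \in unitmx -> A *m V = V *m A' ->
  zmx R A' \in unitmx /\ Rinv R A *m zmx R V = zmx R V *m Rinv R A'.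
Proof.
move=> [uA _] uV h; have hr : zmx R A *m zmx R V = zmx R V *m zmx R A' by rewrite -!zmxM h.
have uA' : zmx R A' \in unitmx.
  have : zmx R V *m zmx R A' \in unitmx by rewrite -hr unitmx_mul uA.
  by rewrite unitmx_mul => /andP[].
split=> //; apply: (can_inj (mulKmx uA)); rewrite mulKVmx // mulmxA hr -mulmxA mulmxV //.
by rewrite mulmx1.
Qed.

Lemma conj_contracting d (A A' V : 'M[int]_d) : contracting R A -> zmx R V \in unitmx ->
  A *m V = V *m A' -> contracting R A'.
Proof.
move=> cA uV h; have [uA' hr] := conj_Rinv cA uV h.
apply: (contracting_factor (X := invmx (zmx R V)) (Y := zmx R V) cA uA') => j.
by rewrite -mulmxA (intertwineX j hr) mulKmx.
Qed.

Section Block.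
Variables (k d1 : nat) (R2 : 'M[int]_k) (C : 'M[int]_(k, d1)) (R1 : 'M[int]_d1).
Let A := block_mx R2 C 0 R1.
Hypothesis cA : contracting R A.

Let zA : zmx R A = block_mx (zmx R R2) (zmx R C) 0 (zmx R R1).
Proof. by rewrite /zmx map_block_mx map_mx0. Qed.

Lemma block_units : zmx R R2 \in unitmx /\ zmx R R1 \in unitmx.
Proof.
have [uA _] := cA; move: uA; rewrite zA !unitmxE det_ublock unitrM => /andP[-> ->].
by [].
Qed.

Lemma Rinv_block_up n (u : 'M[R]_(k, n)) : Rinv R A *m col_mx u 0 = col_mx (Rinv R R2 *m u) 0.
Proof.
have [u2 _] := block_units; have [uA _] := cA.
apply: (can_inj (mulKmx uA)); rewrite mulKVmx // zA mul_block_col !mulmx0 mul0mx !addr0.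
by rewrite mulKVmx.
Qed.

Lemma Rinv_block_low n (x : 'M[R]_(k + d1, n)) : dsubmx (Rinv R A *m x) = Rinv R R1 *m dsubmx x.
Proof.
have [_ u1] := block_units; have [uA _] := cA.
rewrite -{2}(mulKVmx uA x) -/(Rinv R A); set y := Rinv R A *m x.
rewrite zA -{2}(vsubmxK y) mul_block_col col_mxKd mul0mx add0r.
by rewrite mulKmx.
Qed.

Lemma block_contracting : contracting R R2 /\ contracting R R1.
Proof.
have [u2 u1] := block_units; split.
  apply: (contracting_factor (X := row_mx 1%:M 0) (Y := col_mx 1%:M 0) cA u2) => j.
  have h : Rinv R A *m col_mx 1%:M 0 = col_mx 1%:M 0 *m Rinv R R2.
    by rewrite Rinv_block_up mulmx1 mul_col_mx mul1mx mul0mx.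
  by rewrite -mulmxA (intertwineX j h) mulmxA mul_row_col mul1mx mul0mx addr0 mul1mx.
apply: (contracting_factor (X := row_mx 0 1%:M) (Y := col_mx 0 1%:M) cA u1) => j.
have h : Rinv R R1 *m row_mx 0 1%:M = row_mx 0 1%:M *m Rinv R A.
  rewrite -[in RHS](submxK (Rinv R A)) mul_row_block !mul0mx !add0r !mul1mx.
  have := Rinv_block_low 1%:M; rewrite mulmx1 -[X in Rinv R R1 *m X]/(dsubmx 1%:M).
  rewrite -(hsubmxK (dsubmx (Rinv R A))) => ->.
  by rewrite scalar_mx_block block_mxEv col_mxKd.
by rewrite -(intertwineX j h) -mulmxA mul_row_col mul0mx add0r mulmx1 mulmx1.
Qed.

End Block.
End Intertwining.

Lemma residues_size (R : realType) k (A : 'M[int]_k) (D D' : seq 'cV[int]_k) :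
  contracting R A -> residues A D -> residues A D' -> size D = size D'.
Proof.
move=> cA; suff h E E' : residues A E -> residues A E' -> (size E <= size E')%N.
  by move=> h1 h2; apply/eqP; rewrite eqn_leq !h.
move=> [uE E0 _ mE] [_ E0' cE' _].
have [x0 hx0] : exists x0, x0 \in E' by case: E' E0' {cE'} => // x s _; exists x; rewrite mem_head.
have /choice[f hf] : forall b, exists b', b' \in E' /\ Aimg A (b - b').
  move=> b; have [b' hb' h] := cE' x0 (b - x0) hx0; exists b'; split=> //.
  by move: h; rewrite subrK.
rewrite -(size_map f); apply: uniq_leq_size.
  rewrite map_inj_in_uniq // => b b' hb hb' e; apply: mE => //.
  have [_ h1] := hf b; have [_ h2] := hf b'; move: h2; rewrite -e => h2.
  have -> : b - b' = (b - f b) - (b' - f b) by rewrite opprB addrA subrK.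
  exact: AimgB.
by move=> _ /mapP[b _ ->]; have [] := hf b.
Qed.

Lemma words_map (X Y : Type) (f : X -> Y) (B : seq X) n :
  words (map f B) n = map (map f) (words B n).
Proof.
elim: n => [|n IH] //; rewrite /words /= -!/(words _ _) IH.
by rewrite map_allpairs allpairs_mapl allpairs_mapr.
Qed.

Section Conjugation.
Variables (R : realType) (d : nat) (A A' V W : 'M[int]_d) (B' : seq 'cV[int]_d).
Local Notation e := (@e2pii R).
Hypothesis cA : contracting R A.
Hypothesis VW : V *m W = 1%:M.
Hypothesis WV : W *m V = 1%:M.
Hypothesis AV : A *m V = V *m A'.
Let Vr := zmx R V.
Let B := map (mulmx V) B'.

Let uV : Vr \in unitmx.
Proof. have h : Vr *m zmx R W = 1%:M by rewrite -zmxM VW zmx1.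
by case: (mulmx1_unit h). Qed.

Let RV : Rinv R A *m Vr = Vr *m Rinv R A'. Proof. by have [] := conj_Rinv cA uV AV. Qed.

Let TV (x : 'cV[R]_d) : Vr^T *m (Tinv R A *m x) = Tinv R A' *m (Vr^T *m x).
Proof. by rewrite !mulmxA -!trmx_mul RV. Qed.

Let TVX n (x : 'cV[R]_d) : Vr^T *m (Tinv R A ^+ n *m x) = Tinv R A' ^+ n *m (Vr^T *m x).
Proof. by elim: n => [|n IH]; rewrite ?mulTX0 // !mulTXl TV IH. Qed.

Lemma conj_digit_sum w : digit_sum R A (map (mulmx V) w) = Vr *m digit_sum R A' w.
Proof.
elim: w => [|b w IH] /=; first by rewrite mulmx0.
by rewrite IH zmxM -mulmxDr !mulmxA RV.
Qed.

Lemma conj_digit_isum w : digit_isum A (map (mulmx V) w) = V *m digit_isum A' w.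
Proof.
elim: w => [|b w IH] /=; first by rewrite mulmx0.
by rewrite IH size_map mulmxDr !mulmxA (intertwineX _ AV).
Qed.

Lemma conj_coef n c (x : 'cV[R]_d) :
  coef A B n c x = coef A' B' n (fun w => c (map (mulmx V) w)) (Vr^T *m x).
Proof.
rewrite /coef /B words_map big_map size_map; congr (_ * _); apply: eq_bigr => w _.
by rewrite conj_digit_sum dotv_mulr.
Qed.

Lemma conj_nrm2 n c : nrm2 B n c = nrm2 B' n (fun w => c (map (mulmx V) w)) :> R.
Proof. by rewrite /nrm2 /B words_map big_map size_map. Qed.

Lemma conj_qB (x : 'cV[R]_d) : qB A B x = qB A' B' (Vr^T *m x).
Proof.
suff h n y : qn (Tinv R A) (mean_sqn [:: B]) n y = qn (Tinv R A') (mean_sqn [:: B']) n (Vr^T *m y).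
  by rewrite /qB /q (_ : _ ^~ x = (qn (Tinv R A') (mean_sqn [:: B']) ^~ (Vr^T *m x))) //; apply: funext => n.
elim: n y => [|n IH] y //=; rewrite IH TV; congr (_ * _).
rewrite !mean_sqn1 /mean_e /B big_map size_map; congr (sqn (_ * _)).
by apply: eq_bigr => b _; rewrite zmxM dotv_mulr TV.
Qed.

Lemma spectrum_conj : has_spectrum R A' B' -> has_spectrum R A B.
Proof.
move=> [Lam [cL hL]]; pose f (x : 'cV[R]_d) := (invmx Vr)^T *m x.
have fK : cancel f (mulmx Vr^T) by move=> x; rewrite /f mulmxA -trmx_mul mulVmx // trmx1 mul1mx.
have Kf : cancel (mulmx Vr^T) f by move=> x; rewrite /f mulmxA -trmx_mul mulmxV // trmx1 mul1mx.
exists [set x | Lam (Vr^T *m x)]%classic; split.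
  have /subset_card_le h : ([set x | Lam (Vr^T *m x)] `<=` [set f y | y in Lam])%classic.
    by move=> x hx; exists (Vr^T *m x) => //; exact: Kf.
  exact: card_le_trans h (card_le_trans (card_image_le _ _) cL).
move=> n c; have [h1 h2] := hL n (fun w => c (map (mulmx V) w)); split.
  move=> F uF hF; rewrite conj_nrm2; apply: le_trans (h1 (map (mulmx Vr^T) F) _ _).
  - rewrite big_map; apply: ler_sum => x _; rewrite conj_coef conj_qB TVX.
    by [].
  - by rewrite map_inj_uniq //; exact: can_inj Kf.
  by move=> _ /mapP[x hx ->]; exact: hF.
move=> eps eps0; have [F [uF hF hs]] := h2 eps eps0; exists (map f F); split.
- by rewrite map_inj_uniq //; exact: can_inj fK.
- by move=> _ /mapP[x hx ->] /=; rewrite fK; exact: hF.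
rewrite conj_nrm2; apply: le_trans hs _; rewrite big_map; apply: ler_sum => x _.
by rewrite conj_coef conj_qB TVX fK.
Qed.

Lemma conj_hadamard L : hadamard R A B L -> hadamard R A' B' (map (mulmx V^T) L).
Proof.
move=> [uB B0 sL hL]; have inj : injective (mulmx V : 'cV[int]_d -> _).
  by move=> x y /(congr1 (mulmx W)); rewrite !mulmxA WV !mul1mx.
split; rewrite ?size_map //; first by move: uB; rewrite map_inj_uniq.
- by move: B0; rewrite size_map.
- by move: sL; rewrite size_map.
move=> b b' hb hb'; have := hL _ _ (map_f (mulmx V) hb) (map_f (mulmx V) hb').
rewrite size_map (inj_eq inj) => <-; rewrite big_map; apply: eq_bigr => l _.
by rewrite zmxM zmxT dotv_mull trmxK mulmxA -RV -mulmxA -zmxM mulmxBr.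
Qed.

Lemma conj_power_digits p : power_digits A B p = map (mulmx V) (power_digits A' B' p).
Proof.
rewrite /power_digits /B words_map -!map_comp; apply: eq_map => w /=.
exact: conj_digit_isum.
Qed.

Lemma conj_carry p G : carry_group A' B' p G -> carry_group A B p [set V *m g | g in G]%classic.
Proof.
move=> [p0 [G0 GB] [g Gg g0] AG hc]; split=> //.
- split; first by exists 0; rewrite ?mulmx0.
  by move=> _ _ [a ha <-] [b hb <-]; exists (a - b); [exact: GB|rewrite mulmxBr].
- exists (V *m g); first by exists g.
  by apply: contra_neq g0 => /(congr1 (mulmx W)); rewrite mulmxA WV mul1mx mulmx0.
- by move=> _ [a ha <-]; exists (A' ^+ p *m a); [exact: AG|rewrite !mulmxA (intertwineX _ AV)].
move=> b a; rewrite conj_power_digits => /mapP[b1 hb1 ->] [a1 ha1 <-].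
have [b' hb' [k hk e']] := hc b1 a1 hb1 ha1; exists (V *m b'); first exact: map_f.
by exists (V *m k); [exists k|rewrite -!mulmxBr e' !mulmxA (intertwineX _ AV)].
Qed.

End Conjugation.

Lemma factor_mx d k n (M : 'M[int]_(d, n)) (P : 'M[int]_(d, k)) :
  (forall z : 'cV[int]_n, exists z', M *m z = P *m z') -> exists N, M = P *m N.
Proof.
move=> h; have /choice[X hX] : forall j : 'I_n, exists z, col j M = P *m z.
  by move=> j; have [z hz] := h (delta_mx j 0); exists z; rewrite colE.
exists (\matrix_(i, j) X j i 0); apply/matrixP => i j; have /colP/(_ i) := hX j.
by rewrite !mxE => ->; apply: eq_bigr => l _; rewrite mxE.
Qed.

Lemma power_digits1 d (A : 'M[int]_d) B b : (b \in power_digits A B 1) = (b \in B).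
Proof.
apply/mapP/idP => [[w]|hb].
  by move=> /allpairsP[[x v] /= [hx]]; rewrite inE => /eqP -> -> ->; rewrite /= mulTX0 addr0.
by exists [:: b]; rewrite ?prodw_consP ?hb //= mulTX0 addr0.
Qed.

(** An infinitely divisible [g] equals A^n z with z the contraction of [g]; for large n this integer
    vector has norm below 1. *)
Lemma divisible_eq0 (R : realType) k (A : 'M[int]_k) : contracting R A ->
  (forall g, Aimg A g) -> forall g : 'cV[int]_k, g = 0.
Proof.
move=> cA h g; have [K [rho [K0 r0 r1 hT]]] := Rinv_contr cA.
have M0 : 0 <= K * nrm1 (zmx R g) by rewrite mulr_ge0 // nrm1_ge0.
have e0 : 0 < (2 * (K * nrm1 (zmx R g) + 1))^-1 by rewrite invr_gt0 mulr_gt0 // ltr_wpDl.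
have [n hn] := pow_small r0 r1 e0.
have [z hz] : exists z, g = A ^+ n *m z.
  elim: n {hn} => [|n [z hz]]; first by exists g; rewrite mulTX0.
  by have [y hy] := AimgP _ _ (h z); exists y; rewrite mulTX -hy.
have hz' : zmx R z = Rinv R A ^+ n *m zmx R g.
  rewrite hz zmxM zmxX {hz hn}; elim: n => [|n IH]; first by rewrite !mulTX0.
  by rewrite (mulTX (Rinv R A)) (mulTXl (zmx R A)) Rinv_mul.
suff z0 : z = 0 by rewrite hz z0 mulmx0.
apply: (@nrm1_lt1 R); rewrite hz'; apply: le_lt_trans (hT _ _) _.
apply: (@le_lt_trans _ _ (K * nrm1 (zmx R g) * (2 * (K * nrm1 (zmx R g) + 1))^-1)).
  by rewrite mulrAC ler_wpM2l // hn.
by rewrite ltr_pdivrMr ?mul1r; lra.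
Qed.

(** * The induction on the dimension *)

Section BlockStep.
Variables (R : realType) (k d1 : nat) (A2 : 'M[int]_k) (C : 'M[int]_(k, d1)) (A1 : 'M[int]_d1).
Local Notation e := (@e2pii R).
Let A := block_mx A2 C 0 A1.
Variables (B L : seq 'cV[int]_(k + d1)) (Gam : set 'cV[int]_k).
Let emb (H : set 'cV[int]_k) : set 'cV[int]_(k + d1) := [set x | exists2 g, H g & x = col_mx g 0]%classic.
Hypothesis k0 : (0 < k)%N.
Hypothesis cA : contracting R A.
Hypothesis hBL : hadamard R A B L.
Hypothesis gGam : is_subgrp Gam.
Hypothesis fGam : full_rank Gam.
Hypothesis cGam : carries A B (emb Gam).
Hypothesis minimal : forall p H, carry_group A B p (emb H) -> full_rank H.
Hypothesis quotient_spectrum : forall B1 L1, contracting R A1 -> hadamard R A1 B1 L1 -> has_spectrum R A1 B1.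

Let uB : uniq B. Proof. by have [] := hBL. Qed.
Let fB : digit_family A [:: B] (size B). Proof. exact: hadamard_family cA hBL. Qed.
Let cA2 : contracting R A2. Proof. by have [] := block_contracting cA. Qed.
Let cA1 : contracting R A1. Proof. by have [] := block_contracting cA. Qed.
Let B1 := undup (map dsubmx B) : seq 'cV[int]_d1.
(** The fibre of [B] over a quotient digit, read in the first k coordinates. *)
Let F (b1 : 'cV[int]_d1) : seq 'cV[int]_k := [seq usubmx b | b <- B & dsubmx b == b1].

Lemma block_emb n (g : 'cV[int]_k) : A ^+ n *m col_mx g 0 = col_mx (A2 ^+ n *m g) 0.
Proof.
elim: n g => [|n IH] g; first by rewrite !mulTX0.
by rewrite !mulTX /A mul_block_col !mulmx0 mul0mx !addr0 IH.
Qed.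

Let A_emb (g : 'cV[int]_k) : A *m col_mx g 0 = col_mx (A2 *m g) 0.
Proof. by have := block_emb 1 g; rewrite !expr1. Qed.

Let subE (x x' : 'cV[int]_k) (b1 : 'cV[int]_d1) : col_mx x b1 - col_mx x' b1 = col_mx (x - x') 0.
Proof. by rewrite opp_col_mx add_col_mx subrr. Qed.

Let memF x b1 : (x \in F b1) = (col_mx x b1 \in B).
Proof.
apply/mapP/idP => [[b]|h]; first by rewrite mem_filter => /andP[/eqP <- hb ->]; rewrite vsubmxK.
by exists (col_mx x b1); rewrite ?mem_filter ?col_mxKd ?eqxx ?h ?col_mxKu.
Qed.

Let memB1 x b1 : x \in F b1 -> b1 \in B1.
Proof. by rewrite memF mem_undup => h; apply/mapP; exists (col_mx x b1); rewrite ?col_mxKd. Qed.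

Let F_ne b1 : b1 \in B1 -> exists x, x \in F b1.
Proof.
rewrite mem_undup => /mapP[b hb ->]; exists (usubmx b).
by rewrite memF vsubmxK.
Qed.

Let uF b1 : uniq (F b1).
Proof.
rewrite map_inj_in_uniq ?filter_uniq // => b b'; rewrite !mem_filter => /andP[/eqP h _] /andP[/eqP h' _] e1.
by rewrite -(vsubmxK b) -(vsubmxK b') e1 h h'.
Qed.

Let modF b1 x x' : x \in F b1 -> x' \in F b1 -> Aimg A2 (x - x') -> x = x'.
Proof.
rewrite !memF => h h' /AimgP[z hz].
have : col_mx x b1 = col_mx x' b1.
  apply: (fam_mod fB (mem_head _ _) h h'); apply/AimgP; exists (col_mx z 0).
  by rewrite A_emb subE hz.
by move=> /eq_col_mx[].
Qed.

Let B_ne : exists b, b \in B.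
Proof.
by have [_ B0 _ _] := hBL; case: (B) B0 => // b s _; exists b; rewrite mem_head.
Qed.

Let Gam_step x b1 a : x \in F b1 -> Gam a -> exists2 x', x' \in F b1 & exists2 g, Gam g & x' - x - a = A2 *m g.
Proof.
rewrite memF => hx ha; have [b' hb' [_ [g hg ->] e']] := cGam hx (ex_intro2 _ _ a ha erefl).
move: e' hb'; rewrite A_emb -(vsubmxK b') !(opp_col_mx, add_col_mx) => /eq_col_mx[e1 e2] hb'.
have e3 : dsubmx b' = b1 by apply/eqP; rewrite -subr_eq0 -e2 oppr0 addr0.
by exists (usubmx b'); [rewrite memF -e3|exists g].
Qed.

(** Carrying A2 x from a digit leads to a congruent digit, hence to the same one; the carry is then
    -x. *)
Let Gam_sat x : Gam (A2 *m x) -> Gam x.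
Proof.
move=> hx; have [b hb] := B_ne; have hb' : usubmx b \in F (dsubmx b) by rewrite memF vsubmxK.
have [x' hx' [g hg e1]] := Gam_step hb' hx.
have e2 : x' = usubmx b.
  apply: (modF hx' hb'); apply/AimgP; exists (x + g).
  by rewrite mulmxDr -e1 [RHS]addrC subrK.
have -> : x = - g.
  apply: (contr_inj cA2); rewrite mulmxN -e1 e2 subrr sub0r opprK.
  by [].
by rewrite -sub0r; apply: gGam.2 => //; exact: gGam.1.
Qed.

(** Pigeonhole modulo m: two iterates of [v] are congruent, so their difference lies in [Gam], and
    saturation strips the common power of [A2]. *)
Let Gam_surj v : exists x, exists2 g, Gam g & v = A2 *m x + g.
Proof.
have [m m0 hm] := fGam.
have /choice[f hf] : forall n, exists p : 'cV[int]_k * 'cV[int]_k, p.1 \in box k m /\ A2 ^+ n *m v = p.1 + p.2 *+ m.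
  by move=> n; have [a ha [b hb]] := int_mod_box (A2 ^+ n *m v) m0; exists (a, b).
pose s := map (fun n => (f n).1) (iota 0 (size (box k m)).+1).
have : ~~ uniq s.
  apply/negP => us; have : {subset s <= box k m} by move=> _ /mapP[n _ ->]; have [] := hf n.
  by move=> /(uniq_leq_size us); rewrite size_map size_iota ltnn.
move=> /(uniqPn 0)[i [j [ij hj]]]; rewrite size_map size_iota in hj.
rewrite !(nth_map 0%N) ?size_iota ?(ltn_trans ij hj) // !nth_iota ?(ltn_trans ij hj) // !add0n => e1.
have [_ hi] := hf i; have [_ hj'] := hf j.
have h1 : Gam (A2 ^+ i *m (v - A2 ^+ (j - i) *m v)).
  rewrite mulmxBr -mulTXD subnKC ?(ltnW ij) // hi hj' e1 opprD addrACA subrr add0r -mulrnBl.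
  exact: hm.
have {}h1 : Gam (v - A2 ^+ (j - i) *m v).
  elim: {ij e1 hi} i (v - _) h1 => [|i IH] u; first by rewrite mulTX0.
  by rewrite mulTXl => /Gam_sat; exact: IH.
exists (A2 ^+ (j - i).-1 *m v), (v - A2 ^+ (j - i) *m v) => //.
by rewrite -mulTXl prednK ?subn_gt0 // addrC subrK.
Qed.

Let F_complete b1 : complete A2 (F b1).
Proof.
move=> x v hx; have [y [a ha hv]] := Gam_surj v.
have [x' hx' [g hg e1]] := Gam_step hx ha; exists x' => //; apply/AimgP; exists (y - g).
by rewrite mulmxBr -e1 hv; mxring.
Qed.

Let F_residues b1 : b1 \in B1 -> residues A2 (F b1).
Proof.
move=> hb; split=> //; last by move=> x x'; exact: modF.
by have [x hx] := F_ne hb; case: (F b1) hx.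
Qed.

Let D := size (F (dsubmx (head 0 B))).

Let B1_ne : dsubmx (head 0 B) \in B1.
Proof.
have [b hb] := B_ne; rewrite mem_undup; apply: map_f.
by case: (B) hb => // b' s _; rewrite mem_head.
Qed.

Let F_size b1 : b1 \in B1 -> size (F b1) = D.
Proof. by move=> hb; apply: (residues_size cA2); exact: F_residues. Qed.

Let B_perm : perm_eq B [seq col_mx x b1 | b1 <- B1, x <- F b1].
Proof.
apply: uniq_perm => //.
  apply: allpairs_uniq_dep => //; [exact: undup_uniq|].
  by move=> [b1 x] [b2 x'] _ _ /= /eq_col_mx[-> ->].
move=> b; apply/idP/allpairsPdep => [hb|[b1 [x [h1 h2 ->]]]]; last by rewrite -memF.
exists (dsubmx b), (usubmx b); rewrite memF vsubmxK; split=> //.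
by rewrite mem_undup map_f.
Qed.

Let D0 : (0 < D)%N. Proof. by have [] := F_residues B1_ne. Qed.

Let size_B : size B = (D * size B1)%N.
Proof.
rewrite (perm_size B_perm) size_allpairs_dep sumnE big_map big_seq.
rewrite (eq_bigr (fun=> D)) => [|b1 hb1]; last exact: F_size.
by rewrite -big_seq big_const_seq count_predT iter_addn_0.
Qed.

(* Summing the orthogonality relations over two fibres keeps only the
   frequencies whose upper part is trivial on them. *)
Lemma quotient_hadamard : exists L1, hadamard R A1 B1 L1.
Proof.
(* For a frequency whose upper part is divisible by A2^T, the quotient [kap] moves it to the lower
   block through [C]. This yields the frequency of the quotient triple. *)
pose kap (l : 'cV[int]_(k + d1)) := Adiv A2^T (usubmx l).
pose Lf := [seq l <- L | Aimg A2^T (usubmx l)].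
pose L1 := [seq dsubmx l - C^T *m kap l | l <- Lf].
have [_ _ _ hL] := hBL.
have Dr0 : D%:R != 0 :> R by rewrite pnatr_eq0 -lt0n.
have key b1 b2 : b1 \in B1 -> b2 \in B1 ->
    \sum_(l <- L1) e (dotv (zmx R l) (Rinv R A1 *m zmx R (b1 - b2))) = cr ((size B1)%:R * (b1 == b2)%:R).
  move=> hb1 hb2; pose y := Rinv R A *m zmx R (col_mx (0 : 'cV[int]_k) (b1 - b2)).
  have dy : dsubmx y = Rinv R A1 *m zmx R (b1 - b2).
    by rewrite /y (Rinv_block_low cA) zmx_col col_mxKd.
  have uy : zmx R A2 *m usubmx y + zmx R C *m dsubmx y = 0.
    have : zmx R A *m y = zmx R (col_mx (0 : 'cV[int]_k) (b1 - b2)) by exact: mul_Rinv.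
    rewrite -{1}(vsubmxK y) /zmx map_block_mx map_col_mx mul_block_col => /eq_col_mx[-> _].
    by rewrite map_mx0.
  have h1 : \sum_(x <- F b1) \sum_(x' <- F b2) \sum_(l <- L)
      e (dotv (zmx R l) (Rinv R A *m zmx R (col_mx x b1 - col_mx x' b2))) =
      cr ((size B)%:R * D%:R * (b1 == b2)%:R).
    transitivity (\sum_(x <- F b1) \sum_(x' <- F b2) @cr R ((size B)%:R * (b1 == b2)%:R * (x == x')%:R)).
      rewrite big_seq [RHS]big_seq; apply: eq_bigr => x hx; rewrite big_seq [RHS]big_seq; apply: eq_bigr => x' hx'.
      have hb12 : (b1 == b2)%:R * (x == x')%:R = ((b1 == b2) && (x == x'))%:R :> R by rewrite -natrM mulnb.
      rewrite hL -?memF // -mulrA hb12; congr (cr (_ * _%:R)); congr nat_of_bool.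
      apply/eqP/andP => [/eq_col_mx[-> ->]|[/eqP -> /eqP ->]] //.
    case: eqVneq => [<-|_] /=; rewrite ?mulr0n ?mulr1n; last first.
      by rewrite big1 ?mulr0 ?cr0 // => x _; rewrite big1 // => x' _; rewrite ?mulr0 mul0r cr0.
    rewrite mulr1 big_seq (eq_bigr (fun=> cr (size B)%:R)) => [|x hx].
      by rewrite -big_seq sum_const_seq F_size // -cr_nat -crM mulrC mulr1.
    rewrite (bigD1_seq x) //= eqxx mulr1 big1 ?addr0 // => x' hx'.
    by rewrite eq_sym (negPf hx') mulr0 cr0.
  have h2 : \sum_(x <- F b1) \sum_(x' <- F b2) \sum_(l <- L)
      e (dotv (zmx R l) (Rinv R A *m zmx R (col_mx x b1 - col_mx x' b2))) =
      cr (D%:R * D%:R) * \sum_(l <- L1) e (dotv (zmx R l) (Rinv R A1 *m zmx R (b1 - b2))).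
    transitivity (\sum_(l <- L) e (dotv (zmx R l) y) *
      ((\sum_(x <- F b1) e (dotv (zmx R (usubmx l)) (Rinv R A2 *m zmx R x))) *
       cj (\sum_(x <- F b2) e (dotv (zmx R (usubmx l)) (Rinv R A2 *m zmx R x))))).
      under eq_bigr => x _ do rewrite exchange_big.
      rewrite exchange_big; apply: eq_bigr => l _; rewrite cj_sum mulr_suml mulr_sumr.
      apply: eq_bigr => x _; rewrite !mulr_sumr; apply: eq_bigr => x' _.
      rewrite e2pii_mulJ -e2piiD -dotvBr -mulmxBr -zmxB; congr e.
      have -> : col_mx x b1 - col_mx x' b2 = col_mx (x - x') 0 + col_mx 0 (b1 - b2).
        by rewrite opp_col_mx !add_col_mx addr0 add0r.
      rewrite (zmxD R (col_mx (x - x') 0)) mulmxDr dotvDr addrC; congr (_ + _).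
      rewrite zmx_col zmx0 (Rinv_block_up cA) -{1}(vsubmxK l) zmx_col dotv_col dotv0r addr0.
      by [].
    rewrite /L1 big_map mulr_sumr /Lf big_filter [RHS]big_mkcond /=; apply: eq_bigr => l _.
    rewrite !(char_sum cA2 _ (F_residues _)) // !F_size //.
    case: ifP => hl; last by rewrite !mulr0 mul0r mulr0.
    rewrite !mulr1 cj_cr -crM mulrC; congr (_ * e _).
    rewrite -dy -{1}(vsubmxK l) -{1}(vsubmxK y) zmx_col dotv_col zmxB dotvBl addrC; congr (_ + _).
    rewrite {1}(AdivE hl) -/(kap l) !zmxM !zmxT !dotv_mull !trmxK.
    by apply/eqP; rewrite -subr_eq0 opprK -dotvDr uy dotv0r.
  have := h1; rewrite h2 size_B natrM => h3.
  apply: (mulfI (_ : cr (D%:R * D%:R) != 0)).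
    by apply/eqP => /(@cr_inj R _ 0)/eqP; rewrite mulf_eq0 orbb (negPf Dr0).
  by rewrite h3 -crM; congr cr; ring.
exists L1; split=> //.
- exact: undup_uniq.
- by case: (B1) B1_ne.
have := key _ _ B1_ne B1_ne; rewrite subrr zmx0 mulmx0 eqxx mulr1.
under eq_bigr => l _ do rewrite dotv0r e2pii0.
by rewrite sum_const_seq mulr1 -cr_nat => /(@cr_inj R)/eqP; rewrite eqr_nat => /eqP.
Qed.

Let gens (K : set 'cV[int]_k) := forall j b1 x x', x \in F b1 -> x' \in F b1 -> K (A2 ^+ j *m (x - x')).
(** The smallest A2-stable group containing the differences of digits in a common fibre; [G1] is its
    saturation under division by [A2]. *)
Let G0 : set 'cV[int]_k := [set g | forall K, is_subgrp K -> gens K -> K g]%classic.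
Let G1 : set 'cV[int]_k := [set g | exists j, G0 (A2 ^+ j *m g)]%classic.

Let G0_subgrp : is_subgrp G0.
Proof.
split; first by move=> K [].
by move=> a b ha hb K hK hg; apply: hK.2; [exact: ha|exact: hb].
Qed.

Let G0_gens : gens G0. Proof. by move=> j b1 x x' hx hx' K _ hg; exact: (hg j b1). Qed.

Let G0_iter n g : G0 g -> G0 (A2 ^+ n *m g).
Proof.
move=> hg K hK hgen.
apply: (hg [set u | K (A2 ^+ n *m u)]%classic).
  split; first by rewrite /= mulmx0; exact: hK.1.
  by move=> a b /= ha hb; rewrite mulmxBr; exact: hK.2.
by move=> j b1 x x' hx hx' /=; rewrite -mulTXD; exact: (hgen _ b1).
Qed.

Let G1_subgrp : is_subgrp G1.
Proof.
split; first by exists 0%N; rewrite mulmx0; exact: G0_subgrp.1.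
move=> a b [i hi] [j hj]; exists (i + j)%N; rewrite mulmxBr; apply: G0_subgrp.2.
  by rewrite addnC mulTXD; exact: G0_iter.
by rewrite mulTXD; exact: G0_iter.
Qed.

Let G0_G1 g : G0 g -> G1 g. Proof. by exists 0%N; rewrite mulTX0. Qed.

Let G1_A2 g : G1 g -> G1 (A2 *m g).
Proof. by move=> [j hj]; exists j; rewrite -mulTX mulTXl; have := G0_iter 1 hj; rewrite expr1. Qed.

Let G1_sat g : G1 (A2 *m g) -> G1 g.
Proof. by move=> [j]; rewrite -mulTX => hj; exists j.+1. Qed.

Let F_sub b1 x x' : x \in F b1 -> x' \in F b1 -> G1 (x - x').
Proof. by move=> hx hx'; apply: G0_G1; have := G0_gens 0 hx hx'; rewrite mulTX0. Qed.

(** If [G1] were trivial, each fibre would be a single digit and completeness would make [A2]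
    surjective on a nonzero lattice. *)
Let G1_ne : exists2 g, G1 g & g != 0.
Proof.
apply: contrapT => hno; have G10 g : G1 g -> g = 0.
  by move=> hg; apply: contrapT => /eqP g0; apply: hno; exists g.
have [x hx] := F_ne B1_ne.
have h g : Aimg A2 g.
  have [x' hx' h] := F_complete g hx; move: h.
  by rewrite -addrA (G10 _ (F_sub hx hx')) addr0.
have /colP/(_ (Ordinal k0)) := divisible_eq0 cA2 h (const_mx 1).
by rewrite !mxE.
Qed.

Let emb_subgrp H : is_subgrp H -> is_subgrp (emb H).
Proof.
move=> [H0 HB]; split; first by exists 0; rewrite ?col_mx0.
move=> _ _ [a ha ->] [b hb ->]; exists (a - b); first exact: HB.
by rewrite opp_col_mx add_col_mx subrr.
Qed.

Let emb_ne H : (exists2 g, H g & g != 0) -> exists2 g, emb H g & g != 0.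
Proof.
move=> [g hg g0]; exists (col_mx g 0); first by exists g.
by rewrite col_mx_eq0 negb_and g0.
Qed.

(** Completeness supplies the new digit. A2 times the carry is made of a fibre difference and an
    element of [G1], so saturation puts the carry in [G1]; minimality then makes [G1] of full
    rank. *)
Let G1_carry : carry_group A B 1 (emb G1).
Proof.
split=> //; [exact: emb_subgrp|exact: emb_ne| |].
  by move=> _ [g hg ->]; exists (A2 *m g); [exact: G1_A2|rewrite block_emb expr1].
move=> b a0; rewrite power_digits1 => hb [a ha ->].
have hx : usubmx b \in F (dsubmx b) by rewrite memF vsubmxK.
have [x' hx' /AimgP[g hg]] := F_complete a hx.
exists (col_mx x' (dsubmx b)); first by rewrite power_digits1 -memF.
have e1 : x' - usubmx b - a = A2 *m (- g) by rewrite mulmxN -hg; mxring.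
exists (col_mx (- g) 0).
  exists (- g) => //; apply: G1_sat; rewrite -e1; apply: G1_subgrp.2 => //; exact: F_sub hx' hx.
have e2 : col_mx x' (dsubmx b) - b = col_mx (x' - usubmx b) 0 by rewrite -(subE _ _ (dsubmx b)) vsubmxK.
by rewrite block_emb expr1 -e1 e2 opp_col_mx add_col_mx subrr.
Qed.

Let G1_full : full_rank G1. Proof. exact: minimal G1_carry. Qed.

Section Basis.
Variables (P X A3 : 'M[int]_k) (m : nat).
Hypothesis m0 : (0 < m)%N.
Hypothesis PX : P *m X = (m%:Z)%:M.
Hypothesis G1E : forall g, G1 g <-> exists z, g = P *m z.
Hypothesis A2P : A2 *m P = P *m A3.
(** A base point of the fibre; the default 0 occurs only for empty fibres, that is off [B1]. *)
Let off b1 : 'cV[int]_k := head 0 (F b1).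
Let Dg b1 : seq 'cV[int]_k := [seq Adiv P (x - off b1) | x <- F b1].

Lemma basis_unit : zmx R P \in unitmx.
Proof.
have m0' : (m%:R : R) != 0 by rewrite pnatr_eq0 -lt0n.
have h : zmx R P *m (m%:R^-1 *: zmx R X) = 1%:M.
  rewrite -scalemxAr -zmxM PX /zmx map_scalar_mx /= -[_%:~R]/(m%:R : R).
  by rewrite scale_scalar_mx mulVf.
by case: (mulmx1_unit h).
Qed.

Let P_inj (z z' : 'cV[int]_k) : P *m z = P *m z' -> z = z'.
Proof.
move=> h; apply: (@zmx_inj R); apply: (can_inj (mulKmx basis_unit)).
by rewrite -!zmxM h.
Qed.

Let A3X n (z : 'cV[int]_k) : P *m (A3 ^+ n *m z) = A2 ^+ n *m (P *m z).
Proof. by rewrite !mulmxA (intertwineX n A2P). Qed.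

Let off_mem b1 : b1 \in B1 -> off b1 \in F b1.
Proof. by move=> /F_ne[x]; rewrite /off; case: (F b1) => // y s _; rewrite mem_head. Qed.

Let DgE b1 x : x \in F b1 -> x = off b1 + P *m Adiv P (x - off b1).
Proof.
move=> hx; have h : Aimg P (x - off b1).
  by apply/AimgP/G1E; exact: F_sub hx (off_mem (memB1 hx)).
by rewrite -(AdivE h) [RHS]addrC subrK.
Qed.

Let Dg_mem b1 z : z \in Dg b1 -> off b1 + P *m z \in F b1.
Proof. by move=> /mapP[x hx ->]; rewrite -DgE. Qed.

Let Dg_mod b1 z z' : z \in Dg b1 -> z' \in Dg b1 -> Aimg A3 (z - z') -> z = z'.
Proof.
move=> hz hz' /AimgP[y hy]; apply: P_inj; apply: (addrI (off b1)).
apply: modF (Dg_mem hz) (Dg_mem hz') _; apply/AimgP; exists (P *m y).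
by have := A3X 1 y; rewrite !expr1 => <-; rewrite -hy mulmxBr; mxring.
Qed.

Lemma basis_family : digit_family A3 (map Dg B1) D.
Proof.
split=> //.
- by rewrite size_map; case: (B1) B1_ne.
- by move=> _ /mapP[b1 hb ->]; rewrite size_map F_size.
- move=> _ /mapP[b1 hb ->]; rewrite map_inj_in_uniq // => x x' hx hx' h.
  by rewrite (DgE hx) h -DgE.
by move=> _ /mapP[b1 hb ->]; exact: Dg_mod.
Qed.

Lemma basis_complete E : E \in map Dg B1 -> complete A3 E.
Proof.
move=> /mapP[b1 hb ->] z g hz.
have [x' hx' /AimgP[y hy]] := F_complete (P *m g) (Dg_mem hz).
exists (Adiv P (x' - off b1)); first exact: map_f.
have e1 : P *m (g + z - Adiv P (x' - off b1)) = A2 *m y.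
  by rewrite -hy {2}(DgE hx') mulmxBr mulmxDr; mxring.
have [v hv] : exists v, y = P *m v.
  by apply/G1E; apply: G1_sat; rewrite -e1; apply/G1E; eexists.
apply/AimgP; exists v; apply: P_inj; rewrite e1 hv.
by have := A3X 1 v; rewrite !expr1.
Qed.

(** Holds by the choice of [P]: in this basis the saturation of the group of fibre differences is
    the entire lattice. *)
Lemma basis_generates : generates A3 (map Dg B1).
Proof.
move=> K gK hK g.
pose K' : set 'cV[int]_k := [set x | exists2 z, K z & x = P *m z]%classic.
have gK' : is_subgrp K'.
  split; first by exists 0; rewrite ?mulmx0 //; exact: gK.1.
  by move=> _ _ [a ha ->] [b hb ->]; exists (a - b); [exact: gK.2|rewrite mulmxBr].
have hK' : gens K'.
  move=> j b1 x x' hx hx'; exists (A3 ^+ j *m (Adiv P (x - off b1) - Adiv P (x' - off b1))).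
    by apply: (hK j (Dg b1)); apply: map_f => //; exact: memB1 hx.
  rewrite A3X; congr (_ *m _).
    by rewrite mulmxBr {1}(DgE hx) {1}(DgE hx'); mxring.
have [j hj] : G1 (P *m g) by apply/G1E; exists g.
exists j => i ji; have := G0_iter (i - j) hj; rewrite -mulTXD subnK // => /(_ K' gK' hK')[z hz e1].
by have -> : A3 ^+ i *m g = z by apply: P_inj; rewrite A3X.
Qed.

Lemma basis_perm : perm_eq B [seq col_mx (off b1 + P *m z) b1 | b1 <- B1, z <- Dg b1].
Proof.
suff -> : [seq col_mx (off b1 + P *m z) b1 | b1 <- B1, z <- Dg b1] =
  [seq col_mx x b1 | b1 <- B1, x <- F b1] by exact: B_perm.
rewrite /Dg allpairs_mapr; congr flatten; apply: eq_map => b1; apply/eq_in_map => x hx.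
by rewrite -DgE.
Qed.

(** Words of [B] over a fixed quotient word form a translate of a set of the family power, with the
    same offset [c] for all of them. Carries in the fibre system thus lift to [B]. *)
Lemma basis_words n w : w \in words B n -> exists E e1 c,
  [/\ E \in fam_pow A3 (map Dg B1) n, e1 \in E, digit_isum A w = c + col_mx (P *m e1) 0 &
   forall e2, e2 \in E -> exists2 w', w' \in words B n & digit_isum A w' = c + col_mx (P *m e2) 0].
Proof.
elim: n w => [|n IH] w.
  move=> /words_size/size0nil ->; exists [:: 0], 0, 0; split=> //=; rewrite ?mem_head //.
    by rewrite mulmx0 col_mx0 addr0.
  by move=> e2; rewrite inE => /eqP ->; exists [::] => //=; rewrite mulmx0 col_mx0 addr0.
case: (lastP w) => [/words_size //|{}w b]; rewrite words_rcons_mem => /andP[hw hb].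
have [E [e1 [c [hE he1 ew hc]]]] := IH w hw.
have hx : usubmx b \in F (dsubmx b) by rewrite memF vsubmxK.
pose z := Adiv P (usubmx b - off (dsubmx b)).
have hz : z \in Dg (dsubmx b) by exact: map_f.
exists [seq x + A3 *m y | x <- Dg (dsubmx b), y <- E], (z + A3 *m e1),
  (A *m c + col_mx (off (dsubmx b)) (dsubmx b)).
have comb w' y x : digit_isum A w' = c + col_mx (P *m y) 0 ->
    digit_isum A (rcons w' (col_mx (off (dsubmx b) + P *m x) (dsubmx b))) =
    A *m c + col_mx (off (dsubmx b)) (dsubmx b) + col_mx (P *m (x + A3 *m y)) 0.
  move=> hw'; rewrite digit_isum_rcons hw' mulmxDr A_emb -!addrA; congr (_ + _).
  rewrite !add_col_mx addr0 add0r mulmxDr; congr col_mx.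
  have := A3X 1 y; rewrite !expr1 => ->; mxring.
split.
- apply/allpairsP; exists (Dg (dsubmx b), E); split=> //.
  by apply: map_f; exact: memB1 hx.
- by apply/allpairsP; exists (z, e1).
- by rewrite -(comb w e1 z ew) -DgE // vsubmxK.
move=> _ /allpairsP[[x y] /= [hx' hy ->]]; have [w' hw' ew'] := hc y hy.
exists (rcons w' (col_mx (off (dsubmx b) + P *m x) (dsubmx b))); last exact: comb.
by rewrite words_rcons_mem hw' -memF Dg_mem.
Qed.

Lemma basis_carry p (H : set 'cV[int]_k) : (0 < p)%N -> is_subgrp H -> (exists2 g, H g & g != 0) ->
  (forall g, H g -> H (A3 ^+ p *m g)) -> (forall E, E \in fam_pow A3 (map Dg B1) p -> carries (A3 ^+ p) E H) ->
  carry_group A B p (emb [set P *m g | g in H]%classic).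
Proof.
move=> p0 gH [g0 hg0 ng0] AH hc; split=> //.
- apply: emb_subgrp; split; first by exists 0; [exact: gH.1|rewrite mulmx0].
  by move=> _ _ [a ha <-] [b hb <-]; exists (a - b); [exact: gH.2|rewrite mulmxBr].
- apply: emb_ne; exists (P *m g0); first by exists g0.
  by apply: contra_neq ng0 => h; apply: P_inj; rewrite mulmx0.
- move=> _ [_ [g hg <-] ->]; rewrite block_emb; exists (A2 ^+ p *m (P *m g)) => //.
  by exists (A3 ^+ p *m g); [exact: AH|exact: A3X].
move=> _ _ /mapP[w hw ->] [_ [g hg <-] ->].
have [E [e1 [c [hE he1 ew hc']]]] := basis_words hw.
have [e2 he2 [y hy e3]] := hc E hE e1 g he1 hg; have [w' hw' ew'] := hc' e2 he2.
exists (digit_isum A w'); first exact: map_f.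
exists (col_mx (A2 ^+ 0 *m (P *m y)) 0).
  by exists (A2 ^+ 0 *m (P *m y)) => //; exists y; rewrite ?mulTX0.
rewrite mulTX0 block_emb -A3X -e3 ew' ew !mulmxBr.
rewrite opprD addrACA subrr add0r !(opp_col_mx, add_col_mx) !(subr0, subrr).
by [].
Qed.

(** If tiling failed, the group of lower rank from the fibre system would lift to a carrying group
    for a power of [A], against minimality. *)
Lemma basis_spectrum : has_spectrum R A B.
Proof.
have uP := basis_unit; have cA3 : contracting R A3 := conj_contracting cA2 uP A2P.
have [tile|[p [H [p0 gH neH nH [AH hc]]]]] := tile_alternative cA3 basis_family basis_complete basis_generates.
  have [L1 hL1] := quotient_hadamard.
  have [Lam1 [cLam hLam]] := quotient_spectrum cA1 hL1.
  have [_ hr] := conj_Rinv cA2 uP A2P.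
  exists [set x : 'cV[R]_(k + d1) | (exists l : 'cV[int]_k, usubmx x = pk P (zmx R l)) /\ Lam1 (dsubmx x)]%classic.
  split.
    have /subset_card_le h : ([set x : 'cV[R]_(k + d1) | (exists l : 'cV[int]_k, usubmx x = pk P (zmx R l)) /\ Lam1 (dsubmx x)] `<=`
        [set col_mx (pk P (zmx R p.1)) p.2 | p in ([set: 'cV[int]_k] `*` Lam1)])%classic.
      by move=> x [[l hl] hx]; exists (l, dsubmx x) => //=; rewrite -hl vsubmxK.
    apply: card_le_trans h (card_le_trans (card_image_le _ _) _).
    by apply: countableX => //; exact: countableP.
  apply: (parseval_product (A2 := A3) cA cA1 cA3 uP _ _ basis_perm basis_family basis_complete hLam tile).
    by move=> x; exact: Rinv_block_low.
  by move=> u; rewrite (Rinv_block_up cA) mulmxA hr -mulmxA.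
have [q q0 hq] := minimal (basis_carry p0 gH neH AH hc); exfalso; apply: nH.
exists q => // v; have [g hg e1] := hq (P *m v).
suff <- : g = v *+ q by [].
by apply: P_inj; rewrite e1 -!scaler_nat scalemxAr.
Qed.

End Basis.

Lemma block_spectrum : has_spectrum R A B.
Proof.
have [P [X [m m0 [PX hP]]]] := subgrp_basis G1_subgrp G1_full.
have [A3 hA3] : exists N, A2 *m P = P *m N.
  apply: factor_mx => z; apply/hP; rewrite -mulmxA; apply: G1_A2; apply/hP; by exists z.
exact: (basis_spectrum m0 PX hP hA3).
Qed.

End BlockStep.

Section PowerDigits.
Variables (d : nat) (A : 'M[int]_d) (B : seq 'cV[int]_d).

Lemma words_cat (X : eqType) (C : seq X) m n u v :
  u \in words C m -> v \in words C n -> u ++ v \in words C (m + n).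
Proof.
elim: m u => [|m IH] [|x u]; first by [].
- by move=> /words_size.
- by move=> /words_size.
by rewrite addSn /words /= -!/(words _ _) !prodw_consP => /andP[-> hu] hv; exact: IH.
Qed.

Lemma power_digitsD m n x : reflect
  (exists u v, [/\ u \in power_digits A B m, v \in power_digits A B n & x = A ^+ n *m u + v])
  (x \in power_digits A B (m + n)).
Proof.
apply: (iffP mapP) => [[w /words_cat_mem[u [v [hu hv ->]]] ->]|[_ [_ [/mapP[u hu ->] /mapP[v hv ->] ->]]]].
  exists (digit_isum A u), (digit_isum A v); split; try exact: map_f.
  by rewrite digit_isum_cat (words_size hv).
by exists (u ++ v); [exact: words_cat|rewrite digit_isum_cat (words_size hv)].
Qed.
End PowerDigits.

Lemma power_digits_mul d (A : 'M[int]_d) B p q :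
  power_digits (A ^+ p) (power_digits A B p) q =i power_digits A B (q * p).
Proof.
elim: q => [|q IH] x; first by [].
have e : A ^+ (q * p) = A ^+ p ^+ q by rewrite mulnC exprM.
rewrite mulSn; apply/(power_digitsD _ _ 1 q)/(power_digitsD _ _ p (q * p)) => -[u [v [hu hv ->]]]; exists u, v.
  by rewrite -IH e; split=> //; move: hu; rewrite power_digits1.
by rewrite IH e power_digits1.
Qed.

Lemma carry_group_pow d (A : 'M[int]_d) B p q G : (0 < p)%N ->
  carry_group (A ^+ p) (power_digits A B p) q G -> carry_group A B (q * p) G.
Proof.
move=> p0 [q0 gG neG AG hc]; have e : A ^+ (q * p) = A ^+ p ^+ q by rewrite mulnC exprM.
split=> //; rewrite ?muln_gt0 ?q0 ?p0 // e // => b a.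
by rewrite -power_digits_mul => hb ha; have [b' hb' h] := hc b a hb ha; exists b'; rewrite -?power_digits_mul.
Qed.

Lemma indep_col d (g : 'cV[int]_d) : g != 0 -> indep g.
Proof.
move=> g0 v; rewrite mulmx_cols big_ord1 => /eqP; rewrite scalemx_eq0 => /orP[/eqP h|].
  by apply/colP => i; rewrite ord1 h mxE.
by rewrite (_ : col 0 g = g) ?(negPf g0) //; apply/colP => i; rewrite mxE.
Qed.

Lemma rank1 d (G : set 'cV[int]_d) : (exists2 g, G g & g != 0) -> has_rank G 1.
Proof.
move=> [g hg g0]; exists g => [j|]; last exact: indep_col.
by rewrite (_ : col j g = g) //; apply/colP => i; rewrite !mxE (ord1 j).
Qed.

(** Strong induction on the dimension. An immortal frequency yields a carrying group, and one of
    least rank over all powers puts a power of [A] in block form. *)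
Theorem hadamard_spectrum (R : realType) d (A : 'M[int]_d) B L :
  contracting R A -> hadamard R A B L -> has_spectrum R A B.
Proof.
elim/ltn_ind: d A B L => d IH A B L cA hBL.
have [him|hno] := pselect (exists g, immortal R A [:: B] g); last first.
  by apply: (spectrum_mortal cA hBL) => g hg; apply: hno; exists g.
have [G0 hG0] := immortal_carry cA (hadamard_family cA hBL) him.
(* The least such [k] is the minimal rank: some carrying group has no k + 1 independent vectors, and
   all have [k]. The value d qualifies since Z^d contains no d + 1 independent vectors. *)
pose Pk k := `[< exists p G, carry_group A B p G /\ ~ has_rank G k.+1 >].
have ex : exists k, Pk k.
  exists d; apply/asboolP; exists 1%N, G0; split=> // -[M _ /smith_indep[]].
  by rewrite ltnn.
case: (ex_minnP ex) => k /asboolP[p [G [hG nG]]] min {ex}.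
have rk q H : carry_group A B q H -> has_rank H k.
  move=> hH; case: k nG min => [|k] nG min.
    by exists 0 => [[]|v _] //; apply/colP => -[].
  apply: contrapT => nH; have := min k; rewrite ltnn.
  by move=> h; suff : false by []; apply: h; apply/asboolP; exists q, H.
have k0 : (0 < k)%N.
  by case: k nG {min rk} => // nG; exfalso; apply: nG; apply: rank1; have [] := hG.
have [p0 gG _ AG cG] := hG.
have [M hM iM] := rk p G hG.
have [kd [V [W [Q [N [m [VW WV m0 eM QN]]]]]]] := smith_indep iM.
have [d1 ed] : exists d1, d = (k + d1)%N by exists (d - k)%N; rewrite subnKC.
subst d.
have cAp : contracting R (A ^+ p) by case: (p) p0 => // p' _; exact: contractingX.
have [Lp hLp] := hadamard_pow cA hBL p.
suff [Lam [cL hL]] : has_spectrum R (A ^+ p) (power_digits A B p).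
  by exists Lam; split=> //; exact: (parseval_pow cA hBL p0 hL).
pose A' := W *m A ^+ p *m V; pose B' := map (mulmx W) (power_digits A B p).
have AV : A ^+ p *m V = V *m A' by rewrite /A' !mulmxA VW mul1mx.
have eB : power_digits A B p = map (mulmx V) B'.
  rewrite -map_comp -[LHS]map_id; apply: eq_map => x /=.
  by rewrite mulmxA VW mul1mx.
rewrite eB; apply: (spectrum_conj cAp VW AV).
have uV : zmx R V \in unitmx.
  have h : zmx R V *m zmx R W = 1%:M by rewrite -zmxM VW zmx1.
  by case: (mulmx1_unit h).
have cA' : contracting R A' := conj_contracting cAp uV AV.
have hB' : hadamard R A' B' (map (mulmx V^T) Lp).
  by apply: (conj_hadamard cAp VW WV AV); rewrite -eB.
(* [V] straightens the k independent vectors into the first coordinates; an element of [G] with a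
   nonzero lower part would be independent of them. *)
have hlow g : G g -> dsubmx (W *m g) = 0.
  move=> Gg; apply: contrapT => /eqP ng; apply: nG.
  have -> : k.+1 = (k + 1)%N by rewrite addn1.
  exists (row_mx M g).
    move=> j; case: (split_ordP j) => i ->; first by rewrite colKl.
    by rewrite colKr (_ : col i g = g) //; apply/colP => l; rewrite mxE (ord1 i).
  move=> v; rewrite -(vsubmxK v) mul_row_col; set v1 := usubmx v; set t := dsubmx v => h.
  have t0 : t = 0.
    apply: (indep_col ng); have := congr1 (fun X => dsubmx (W *m X)) h.
    have hWM : dsubmx (W *m M) = 0.
      by rewrite eM -!mulmxA (mulmxA W V) WV mul1mx pid_mx_col mul_col_mx col_mxKd mul0mx.
    by rewrite mulmx0 linear0 mulmxDr linearD /= !mulmxA -(mul_dsub_mx (W *m M)) -(mul_dsub_mx (W *m g)) hWM mul0mx add0r.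
  move: h; rewrite t0 mulmx0 addr0 => /iM ->.
  by rewrite col_mx0.
have eg g : G g -> W *m g = col_mx (usubmx (W *m g)) 0.
  by move=> Gg; rewrite -{1}(vsubmxK (W *m g)) hlow.
pose Gam : set 'cV[int]_k := [set x | G (V *m col_mx x 0)]%classic.
have gGam : is_subgrp Gam.
  split; first by rewrite /Gam /= col_mx0 mulmx0; exact: gG.1.
  move=> a b ha hb; rewrite /Gam /=.
  have -> : col_mx (a - b) 0 = col_mx a 0 - col_mx b 0 :> 'cV[int]_(k + d1).
    by rewrite opp_col_mx add_col_mx subrr.
  by rewrite mulmxBr; exact: gG.2.
have GamW g : G g -> Gam (usubmx (W *m g)).
  by move=> Gg; rewrite /Gam /= -eg // mulmxA VW mul1mx.
have gamM (v : 'cV[int]_k) : G (V *m col_mx (v *+ m) 0).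
  have -> : V *m col_mx (v *+ m) 0 = M *m (N *m v).
    by rewrite eM -!mulmxA (mulmxA Q) QN scalar_mul pid_mx_col mul_col_mx mul1mx mul0mx.
  exact: subgrp_cols.
have fGam : full_rank Gam by exists m.
(* Stability of [G] under the power of [A] forces this block to kill multiples of every vector. *)
have low0 : dlsubmx A' = 0.
  have h (x : 'cV[int]_k) : dlsubmx A' *m x = 0.
    have hx : G (V *m col_mx (x *+ m) 0) by exact: gamM.
    have := hlow _ (AG _ hx); rewrite (mulmxA (A ^+ p)) AV -(mulmxA V) (mulmxA W) WV mul1mx.
    rewrite -{1}(submxK A') mul_block_col !mulmx0 !addr0 col_mxKd.
    rewrite -scaler_nat -scalemxAr => /eqP; rewrite scalemx_eq0 => /orP[|/eqP //].
    by rewrite pnatr_eq0 => /eqP h; rewrite h in m0.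
  apply/matrixP => i j; have /colP/(_ i) := h (delta_mx j 0); rewrite -colE mxE => ->.
  by rewrite !mxE.
have [A2 [C [A1 eA]]] : exists A2 C A1, A' = block_mx A2 C 0 A1.
  by exists (ulsubmx A'), (ursubmx A'), (drsubmx A'); rewrite -low0 submxK.
clearbody A'; subst A'.
apply: (block_spectrum (Gam := Gam) k0 cA' hB') => //.
- move=> _ _ /mapP[b hb ->] [x hx ->].
  have [b' hb' [g Gg e1]] := cG b _ hb hx.
  exists (W *m b'); first exact: map_f.
  exists (W *m g); first by exists (usubmx (W *m g)); [exact: GamW|exact: eg].
  have := congr1 (mulmx W) e1; rewrite !mulmxBr !mulmxA WV mul1mx => ->.
  have -> : A ^+ p = V *m block_mx A2 C 0 A1 *m W by rewrite -AV -mulmxA VW mulmx1.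
  by rewrite !mulmxA WV mul1mx.
- move=> q H hH; have gH : is_subgrp H.
    have [_ [h0 hB] _ _ _] := hH; split.
      by have [g hg /eqP] := h0; rewrite eq_sym col_mx_eq0 => /andP[/eqP <- _].
    move=> a b ha hb; have [g hg] := hB _ _ (ex_intro2 _ _ a ha erefl) (ex_intro2 _ _ b hb erefl).
    by rewrite opp_col_mx add_col_mx => /eq_col_mx[-> _].
  (* A carrying group of the block system transports back to one of [A], for the product of the
     exponents, so it has rank at least [k], which is full rank in the first block. *)
  have := conj_carry WV AV hH; rewrite -eB => /(carry_group_pow p0)/rk[M' hM' iM'].
  apply: (rank_full gH); exists (usubmx (W *m M')).
    move=> j; have [x [y hy ey] ex] := hM' j.
    rewrite (_ : col j _ = y) //.
    have -> : col j (usubmx (W *m M')) = usubmx (W *m col j M') by rewrite !colE -!mul_usub_mx mulmxA.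
    by rewrite -ex mulmxA WV mul1mx ey col_mxKu.
  move=> v hv; apply: iM'; have e1 : W *m (M' *m v) = 0.
    rewrite -[LHS]vsubmxK mulmxA -(mul_usub_mx (W *m M')) -(mul_dsub_mx (W *m M')) hv (_ : dsubmx (W *m M') = 0) ?mul0mx ?col_mx0 //.
    apply/matrixP => i j; have [x [y hy ey] ex] := hM' j.
    have : dsubmx (W *m col j M') = 0 by rewrite -ex mulmxA WV mul1mx ey col_mxKd.
    rewrite colE mulmxA -mul_dsub_mx -colE => /colP/(_ i); rewrite !mxE => ->.
    by [].
  by rewrite -[LHS]mul1mx -VW -mulmxA e1 mulmx0.
move=> B1 L1; apply: IH; by rewrite -{1}[d1]add0n ltn_add2r.
Qed.

(** * From Hadamard triples to contractions *)

Section Expansive.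
Import ComplexField.Normc.
Variables (R : realType) (n : nat) (A : 'M[int]_n.+1).
Hypothesis eA : expansive R A.
Let f := real_complex R.
Let M : 'M[R[i]]_n.+1 := zmx R[i] A.
Let N := invmx M.

Let ME : M = map_mx f (zmx R A).
Proof. by apply/matrixP => i j; rewrite !mxE; exact: esym (rmorph_int (real_complex R) _). Qed.

Let uM : M \in unitmx.
Proof.
apply: contraT => nM; have : eigenvalue M 0.
  rewrite /eigenvalue /eigenspace raddf0 subr0 kermx_eq0 row_free_unit.
  by [].
by move=> /eA; rewrite normr0 ltr10.
Qed.

Lemma expansive_unit : zmx R A \in unitmx.
Proof. by have := uM; rewrite ME map_unitmx. Qed.

Let NE j : N ^+ j = map_mx f (Rinv R A ^+ j).
Proof.
elim: j => [|j IH]; first by rewrite !expr0 map_mx1.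
by rewrite !exprS IH -!mulmxE map_mxM /N ME -map_invmx.
Qed.

Let bounded_orbit (rho : R) (X : 'M[R[i]]_n.+1) := exists2 K : R, 0 <= K &
  forall j i l, normc ((N ^+ j *m X) i l) <= K * rho ^+ j.

Let normc_ge0 (z : R[i]) : 0 <= normc z.
Proof. by case: z => a b; rewrite sqrtr_ge0. Qed.

(** With Y = (M - z) X one has N X = z^-1 (X - N Y), a recursion for the orbit of X with ratio at
    most [rho0] and a forcing term of rate [rho]. The strict gap between the rates keeps the
    constant finite. *)
Let orbit_step (rho0 rho : R) z X : 0 <= rho0 -> rho0 < rho -> rho < 1 -> z != 0 -> normc z^-1 <= rho0 ->
  bounded_orbit rho ((M - z%:M) *m X) -> bounded_orbit rho X.
Proof.
move=> r0 r01 r1 z0 hz [K K0 hK]; set Y := (M - z%:M) *m X.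
have rr : 0 < rho - rho0 by rewrite subr_gt0.
have rho_ge0 : 0 <= rho by lra.
have NX : N *m X = z^-1 *: (X - N *m Y).
  rewrite /Y mulmxBl mulmxBr mulmxA mulVmx // mul1mx mul_scalar_mx -scalemxAr opprB addrCA subrr addr0.
  by rewrite scalerA mulVf // scale1r.
pose S := \sum_i \sum_l normc (X i l).
have S0 : 0 <= S by apply: sumr_ge0 => i _; apply: sumr_ge0.
have hS i l : normc (X i l) <= S.
  rewrite /S (bigD1 i) //= (bigD1 l) //= -addrA lerDl addr_ge0 ?sumr_ge0 // => i' _.
  exact: sumr_ge0.
pose K' := S + K / (rho - rho0).
have K'0 : 0 <= K' by rewrite addr_ge0 // divr_ge0 // ltW.
have hKK : K <= (rho - rho0) * K'.
  by rewrite /K' mulrDr mulrCA mulfV ?gt_eqF // mulr1 lerDr mulr_ge0 // ltW.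
exists K' => //; elim=> [|j IH] i l.
  rewrite expr0 mul1mx expr0 mulr1 /K'; apply: le_trans (hS i l) _.
  by rewrite lerDl divr_ge0 // ltW.
have -> : N ^+ j.+1 *m X = z^-1 *: (N ^+ j *m X - N ^+ j.+1 *m Y).
  by rewrite {1}exprSr -mulmxE -mulmxA NX -scalemxAr mulmxBr exprSr -mulmxE mulmxA.
rewrite !mxE normcM; apply: (@le_trans _ _ (rho0 * (K' * rho ^+ j + K * rho ^+ j.+1))).
  apply: ler_pM => //; apply: le_trans (le_normcD _ _) _; rewrite normcN; apply: lerD.
    by have := IH i l; rewrite mxE.
  by have := hK j.+1 i l; rewrite mxE.
rewrite exprS; set t := rho ^+ j; have t0 : 0 <= t by rewrite exprn_ge0.
have -> : rho0 * (K' * t + K * (rho * t)) = (rho0 * K' + rho0 * rho * K) * t by ring.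
rewrite mulrA ler_wpM2r // (@le_trans _ _ (rho0 * K' + K)) //; last by lra.
rewrite lerD2l -[leRHS]mul1r ler_wpM2r //.
have h1 : rho0 * rho <= 1 * 1 by apply: ler_pM; lra.
lra.
Qed.

(** By Cayley-Hamilton the product of all M - z is 0, whose orbit is trivially bounded. Removing the
    factors one at a time with [orbit_step] ends at the identity, without any Jordan form. *)
Lemma expansive_contracting : contracting R A.
Proof.
split; first exact: expansive_unit.
have [r hr] := closed_field_poly_normal (char_poly M).
rewrite (eqP (char_poly_monic M)) scale1r in hr.
have hroot z : z \in r -> 1 < normc z.
  move=> hz; have : 1 < `|z|.
    apply: eA; rewrite eigenvalue_root_char hr root_prod_XsubC.
    by [].
  by rewrite normc_def -[1]/(1%:C) ltcR; case: (z).
have [rho0 [r00 r01 hrho]] : exists rho0 : R, [/\ 0 <= rho0, rho0 < 1 & forall z, z \in r -> normc z^-1 <= rho0].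
  elim: r hroot {hr} => [|z r IH] hroot; first by exists 0.
  have [|t [t0 t1 ht]] := IH; first by move=> x hx; apply: hroot; rewrite inE hx orbT.
  have hz := hroot z (mem_head _ _).
  exists (Num.max t (normc z)^-1); split; first by rewrite le_max t0.
    by rewrite gt_max t1 invf_lt1 // (lt_trans ltr01).
  move=> x; rewrite inE => /orP[/eqP ->|/ht hx]; first by rewrite normcV le_max lexx orbT.
  by rewrite le_max hx.
pose rho := (rho0 + 1) / 2.
have rr : rho0 < rho by rewrite /rho; lra.
have rr1 : rho < 1 by rewrite /rho; lra.
have hprod : \prod_(z <- r) (M - z%:M) = 0.
  rewrite -[RHS](Cayley_Hamilton M) hr rmorph_prod; apply: eq_bigr => z _.
  by rewrite rmorphB /= horner_mx_X horner_mx_C.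
have [K K0 hK] : bounded_orbit rho 1%:M.
  have : bounded_orbit rho (\prod_(z <- r) (M - z%:M)).
    rewrite hprod; exists 0 => // j i l; rewrite mulmx0 mxE mul0r.
    by rewrite normc0.
  elim: r hrho hroot {hr hprod} => [|z r IH] hrho hroot; first by rewrite big_nil.
  rewrite big_cons -mulmxE => h; apply: IH.
  - by move=> x hx; apply: hrho; rewrite inE hx orbT.
  - by move=> x hx; apply: hroot; rewrite inE hx orbT.
  apply: (orbit_step r00 rr rr1 _ (hrho z (mem_head _ _)) h).
  by apply: contraTneq (hroot z (mem_head _ _)) => ->; rewrite normc0 ltr10.
exists K, rho; split=> //; first by rewrite /rho; lra.
move=> j i l; have := hK j i l; rewrite mulmx1 NE mxE /=.
by rewrite expr0n /= addr0 sqrtr_sqr.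
Qed.

End Expansive.

Lemma unitary_columns (C : numClosedFieldType) m n (M : 'M[C]_(m, n)) : m = n ->
  M \is unitarymx -> forall i j, \sum_l M l i * (M l j)^* = (i == j)%:R.
Proof.
move=> e; subst m => /unitarymxP /mulmx1C h i j; have /matrixP/(_ j i) := h.
rewrite !mxE eq_sym => <-; apply: eq_bigr => l _; rewrite !mxE mulrC.
by [].
Qed.

Lemma hadamard_triple_hadamard (R : realType) d (A : 'M[int]_d) (B L : {fset 'cV[int]_d}) :
  hadamard_triple R A B L -> (0 < #|` B|)%N -> hadamard R A B L.
Proof.
move=> [_ sBL uH] B0; split=> //; first exact: fset_uniq.
move=> b b' hb hb'.
have hi (x : 'cV[int]_d) : x \in B -> (index x B < #|` B|)%N by rewrite index_mem.
have N0 : 0 < #|` B|%:R :> R by rewrite ltr0n.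
have := unitary_columns (esym sBL) uH (Ordinal (hi b hb)) (Ordinal (hi b' hb')).
rewrite -val_eqE /=.
have -> : (index b B == index b' B) = (b == b').
  apply/eqP/eqP => [h|-> //]; by rewrite -(nth_index 0 hb) h nth_index.
move=> h; rewrite crM -cr_nat in h *; rewrite -h (big_nth 0) big_mkord mulr_sumr.
apply: eq_bigr => l _; rewrite !mxE /= !nth_index //.
set s := (Num.sqrt _)^-1%:C.
have conjE (z : R[i]) : Num.conj z = cj z by [].
rewrite conjE cjM -[s]/(cr _) cj_cr mulrACA -crM -invfM -expr2 sqr_sqrtr ?ltW //.
have hN : cr #|` B|%:R * cr #|` B|%:R^-1 = 1 :> R[i] by rewrite -crM mulfV ?gt_eqF // cr1.
rewrite [RHS]mulrA hN mul1r e2pii_mulJ -dotvBl -mulmxBr -zmxB dotvC.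
by [].
Qed.

(** * Quadrature for the self-affine measure *)

Section BoundedLipschitz.
Variables (R : realType) (d : nat).
Local Notation e := (@e2pii R).
Local Notation X := 'cV[R]_d.
Implicit Types (x y : X) (h : X -> R).

(** The test functions: stable under products and affine substitutions, integrable for every
    probability, and rich enough to approximate indicators of open sets. *)
Definition blip h := exists2 C : R, 0 <= C &
  (forall x, `|h x| <= C) /\ forall x y, `|h x - h y| <= C * nrm1 (x - y).

Lemma blip_cst a : blip (fun=> a).
Proof.
exists `|a| => //; split=> // x y; rewrite subrr normr0 mulr_ge0 //.
exact: nrm1_ge0.
Qed.

Lemma blipD h h' : blip h -> blip h' -> blip (fun x => h x + h' x).
Proof.
move=> [C C0 [b l]] [C' C0' [b' l']]; exists (C + C'); [exact: addr_ge0|split=> [x|x y]].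
  by apply: le_trans (ler_normD _ _) _; exact: lerD.
by rewrite mulrDl opprD addrACA; apply: le_trans (ler_normD _ _) _; exact: lerD.
Qed.

Lemma blipM h h' : blip h -> blip h' -> blip (fun x => h x * h' x).
Proof.
move=> [C C0 [b l]] [C' C0' [b' l']].
have M0 : 0 <= C * C' by exact: mulr_ge0.
exists (2 * (C * C')); [exact: mulr_ge0|split=> [x|x y]].
  by rewrite normrM (@le_trans _ _ (C * C')) //; [exact: ler_pM|lra].
have -> : h x * h' x - h y * h' y = h x * (h' x - h' y) + (h x - h y) * h' y by ring.
apply: le_trans (ler_normD _ _) _; rewrite !normrM.
have -> : 2 * (C * C') * nrm1 (x - y) = C * (C' * nrm1 (x - y)) + C * nrm1 (x - y) * C' by ring.
by apply: lerD; apply: ler_pM.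
Qed.

Lemma blipZ a h : blip h -> blip (fun x => a * h x).
Proof. by move=> bh; apply: blipM => //; exact: blip_cst. Qed.

Lemma blipB h h' : blip h -> blip h' -> blip (fun x => h x - h' x).
Proof.
move=> bh bh'; have := blipD bh (blipZ (-1) bh').
by under eq_fun do rewrite mulN1r.
Qed.

Lemma blip_sum (I : Type) (s : seq I) (h : I -> X -> R) :
  (forall i, blip (h i)) -> blip (fun x => \sum_(i <- s) h i x).
Proof.
move=> bh; elim: s => [|i s IH].
  by under eq_fun do rewrite big_nil; exact: blip_cst.
by under eq_fun do rewrite big_cons; exact: blipD.
Qed.

Lemma nrm1_mulmx (M : 'M[R]_d) : exists2 C : R, 0 <= C & forall x, nrm1 (M *m x) <= C * nrm1 x.
Proof.
exists (d%:R * \sum_i \sum_j `|M i j|).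
  by rewrite mulr_ge0 // sumr_ge0 // => i _; rewrite sumr_ge0.
move=> x; apply: nrm1_mul => i j; rewrite (bigD1 i) //= (bigD1 j) //= -addrA lerDl addr_ge0 // sumr_ge0 // => *.
exact: sumr_ge0.
Qed.

Lemma blip_affine (M : 'M[R]_d) v h : blip h -> blip (fun x => h (v + M *m x)).
Proof.
move=> [C C0 [b l]]; have [K K0 hK] := nrm1_mulmx M.
exists (C * (K + 1)); first by rewrite mulr_ge0 // addr_ge0.
split=> [x|x y]; first by apply: le_trans (b _) _; rewrite ler_peMr // lerDr.
apply: le_trans (l _ _) _; rewrite opprD addrACA subrr add0r -mulmxBr -mulrA ler_wpM2l //.
by apply: le_trans (hK _) _; rewrite ler_wpM2r ?nrm1_ge0 // lerDl.
Qed.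

Lemma sqn_e_sub (s t : R) : sqn (e s - e t) <= (2 * pi * (s - t)) ^+ 2.
Proof.
have -> : e s - e t = e s * (1 - e (t - s)).
  by rewrite mulrBr mulr1 -e2piiD [s + _]addrC subrK.
rewrite sqnM sqn_e mul1r; apply: le_trans (sqn_1Be_le _) _.
by rewrite -sqrrN -mulrN opprB.
Qed.

Lemma abs_le_sqr (a b : R) : 0 <= b -> a ^+ 2 <= b ^+ 2 -> `|a| <= b.
Proof. by move=> b0; rewrite -(real_normK (num_real a)) ler_pXn2r ?nnegrE. Qed.

Lemma blip_sqn_lip (f : X -> R[i]) (C : R) : 0 <= C -> (forall x, sqn (f x) <= C ^+ 2) ->
  (forall x y, sqn (f x - f y) <= (C * nrm1 (x - y)) ^+ 2) ->
  blip (fun x => complex.Re (f x)) /\ blip (fun x => complex.Im (f x)).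
Proof.
move=> C0 b l; have CN x y : 0 <= C * nrm1 (x - y) by rewrite mulr_ge0 // nrm1_ge0.
split; exists C => //; split=> [x|x y].
- by apply: abs_le_sqr => //; apply: le_trans (Re_sqr_le _) (b x).
- by apply: abs_le_sqr => //; apply: le_trans (l x y); have := Re_sqr_le (f x - f y); case: (f x) (f y) => ? ? [].
- by apply: abs_le_sqr => //; apply: le_trans (b x); rewrite /sqn lerDr sqr_ge0.
apply: abs_le_sqr => //; apply: le_trans (l x y); case: (f x) (f y) => ? ? [? ?] /=.
by rewrite /sqn /= lerDr sqr_ge0.
Qed.

Lemma blip_e y : blip (fun x => complex.Re (e (dotv y x))) /\ blip (fun x => complex.Im (e (dotv y x))).
Proof.
have hp : 0 <= 2 * pi * nrm1 y + 1 :> R by rewrite addr_ge0 // !mulr_ge0 ?pi_ge0 ?nrm1_ge0.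
apply: (blip_sqn_lip hp) => [x|x x'].
  by rewrite sqn_e expr_ge1 // lerDr !mulr_ge0 ?pi_ge0 ?nrm1_ge0.
apply: le_trans (sqn_e_sub _ _) _; rewrite -dotvBr -(real_normK (num_real (2 * pi * _))).
apply: lerXn2r; rewrite ?nnegrE ?mulr_ge0 ?nrm1_ge0 //.
rewrite normrM ger0_norm ?mulr_ge0 ?pi_ge0 //.
apply: (@le_trans _ _ (2 * pi * (nrm1 y * nrm1 (x - x')))).
  by rewrite ler_wpM2l ?mulr_ge0 ?pi_ge0 // dotv_le.
by rewrite mulrA ler_wpM2r ?nrm1_ge0 // lerDl.
Qed.

Lemma open_nrm1 (U : set X) : open U <-> forall x, U x -> exists2 r : R, 0 < r & forall y, nrm1 (x - y) < r -> U y.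
Proof.
split=> [oU x Ux|hU].
  have /nbhs_ballP[r /= r0 hr] := open_nbhs_nbhs (conj oU Ux); exists r => // y hy.
  apply: hr; split=> // i j; rewrite ord1 /ball /=; apply: le_lt_trans hy.
  by have := nrm1_entry (x - y) i; rewrite !mxE.
rewrite openE => x /hU[r r0 hr]; apply/nbhs_ballP.
exists (r / d.+1%:R) => /=; first by rewrite divr_gt0 // ltr0n.
move=> y hy; apply: hr; apply: (@le_lt_trans _ _ (\sum_(i < d) r / d.+1%:R)).
  apply: ler_sum => i _; rewrite !mxE; apply: ltW.
  exact: (hy.2 i ord0).
rewrite sumr_const card_ord -[_ *+ _]mulr_natr mulrAC ltr_pdivrMr ?ltr0n //.
by rewrite ltr_pM2l // ltr_nat.
Qed.

Lemma lip_measurable h (C : R) : 0 <= C -> (forall x y, `|h x - h y| <= C * nrm1 (x - y)) ->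
  measurable_fun setT (h : Rd R d -> R).
Proof.
move=> C0 l; apply: (measurability _ (RGenOInfty.measurableE R)) => _ [_ [a ->] <-].
rewrite setTI; apply: sub_sigma_algebra; apply/open_nrm1 => x /=.
rewrite in_itv /= andbT => ax.
have C1 : 0 < C + 1 by rewrite ltr_wpDl.
exists ((h x - a) / (C + 1)); first by rewrite divr_gt0 // subr_gt0.
move=> y; rewrite in_itv /= andbT ltr_pdivlMr // => hy.
have := l x y; rewrite ler_norml => /andP[_ h1].
have : C * nrm1 (x - y) <= nrm1 (x - y) * (C + 1) by rewrite mulrC ler_wpM2l ?nrm1_ge0 // lerDl.
lra.
Qed.

Lemma blip_measurable h : blip h -> measurable_fun setT (h : Rd R d -> R).
Proof. by move=> [C C0 [_ l]]; exact: lip_measurable C0 l. Qed.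

Lemma affine_measurable (M : 'M[R]_d) v : measurable_fun setT ((fun x => v + M *m x) : Rd R d -> Rd R d).
Proof.
have [K K0 hK] := nrm1_mulmx M.
apply: (@measurability _ _ (Rd R d) (Rd R d) _ _ (@open X)) => // _ [U /open_nrm1 oU <-].
rewrite setTI; apply: sub_sigma_algebra; apply/open_nrm1 => x /= /oU[r r0 hr].
have K1 : 0 < K + 1 by rewrite ltr_wpDl.
exists (r / (K + 1)); first by rewrite divr_gt0.
move=> y; rewrite ltr_pdivlMr // => hy; apply: hr.
rewrite opprD addrACA subrr add0r -mulmxBr; apply: le_lt_trans (hK _) (le_lt_trans _ hy).
by rewrite mulrC ler_wpM2l ?nrm1_ge0 // lerDl.
Qed.

Section Average.
Variable mu : probability (Rd R d) R.

Definition avg h : R := \int[mu]_(x in (setT : set (Rd R d))) h x.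

Lemma blip_integrable h : blip h -> mu.-integrable setT (EFin \o (h : Rd R d -> R)).
Proof.
move=> bh; have [C C0 [b _]] := bh.
have muT : (mu setT < +oo)%E by rewrite probability_setT ltry.
apply: measurable_bounded_integrable => //.
  exact: blip_measurable.
exists C; split; first exact: num_real.
by move=> M CM x _; apply: le_trans (b x) (ltW CM).
Qed.

Lemma avg_cst a : avg (fun=> a) = a.
Proof.
transitivity (a * fine (mu [set: Rd R d]%classic)); first exact: Rintegral_cst.
by rewrite probability_setT mulr1.
Qed.

Lemma avgD h h' : blip h -> blip h' -> avg (fun x => h x + h' x) = avg h + avg h'.
Proof. by move=> bh bh'; rewrite /avg RintegralD //; exact: blip_integrable. Qed.

Lemma avgB h h' : blip h -> blip h' -> avg (fun x => h x - h' x) = avg h - avg h'.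
Proof. by move=> bh bh'; rewrite /avg RintegralB //; exact: blip_integrable. Qed.

Lemma avgZ a h : blip h -> avg (fun x => a * h x) = a * avg h.
Proof. by move=> bh; rewrite /avg RintegralZl //; exact: blip_integrable. Qed.

Lemma eq_avg h h' : h =1 h' -> avg h = avg h'.
Proof. by move=> /funext ->. Qed.

Lemma avg_sum (I : Type) (s : seq I) (h : I -> X -> R) : (forall i, blip (h i)) ->
  avg (fun x => \sum_(i <- s) h i x) = \sum_(i <- s) avg (h i).
Proof.
move=> bh; elim: s => [|i s IH].
  by rewrite big_nil -[RHS](avg_cst 0); apply: eq_avg => x; rewrite big_nil.
rewrite big_cons -IH -avgD //; last exact: blip_sum.
by apply: eq_avg => x; rewrite big_cons.
Qed.

Lemma le_avg h h' : blip h -> blip h' -> (forall x, h x <= h' x) -> avg h <= avg h'.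
Proof. by move=> bh bh' hh; apply: le_Rintegral => //; exact: blip_integrable. Qed.

Lemma norm_avg_le h h' : blip h -> blip h' -> (forall x, `|h x| <= h' x) -> `|avg h| <= avg h'.
Proof.
move=> bh bh' hh; rewrite ler_norml; apply/andP; split.
  rewrite -[avg h']mul1r -mulNr -avgZ //; apply: le_avg => // [|x]; first exact: blipZ.
  by have := hh x; rewrite ler_norml mulN1r => /andP[].
by apply: le_avg => // x; have := hh x; rewrite ler_norml => /andP[].
Qed.

Lemma avgE h : blip h -> (avg h)%:E = (\int[mu]_(x in (setT : set (Rd R d))) (h x)%:E)%E.
Proof. by move=> bh; rewrite /avg /Rintegral fineK //; apply: integrable_fin_num => //; exact: blip_integrable. Qed.

Section SelfAffine.
Variables (A : 'M[int]_d) (B : {fset 'cV[int]_d}).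
Hypothesis cA : contracting R A.
Hypothesis hmu : self_affine_measure A B mu.
Let N : R := #|` B|%:R.

Lemma digits_nonempty : (0 < #|` B|)%N.
Proof.
rewrite lt0n; apply/eqP => B0; have := hmu measurableT.
rewrite probability_setT (_ : \sum_(b <- B) _ = 0)%E.
  by rewrite mule0 => /eqP; rewrite eqe oner_eq0.
by rewrite (size0nil B0) big_nil.
Qed.

Let tauE b x : tau A b x = Rinv R A *m zmx R b + Rinv R A *m x.
Proof. by rewrite /tau mulmxDr addrC. Qed.

Let tau_measurable b : measurable_fun setT (tau A b : Rd R d -> Rd R d).
Proof.
rewrite (_ : tau A b = (fun x : Rd R d => Rinv R A *m zmx R b + Rinv R A *m x)); last exact: funext (tauE b).
exact: affine_measurable.
Qed.

Let blip_tau b h : blip h -> blip (fun x => h (tau A b x)).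
Proof.
move=> bh; have := blip_affine (Rinv R A) (Rinv R A *m zmx R b) bh.
by under eq_fun do rewrite -tauE.
Qed.

Let image_measure (i : nat) : {measure set (Rd R d) -> \bar R} :=
  measure_function_pushforward__canonical__measure_function_Measure mu (tau_measurable (nth 0 B i)).

Let avg_self_ge0 h : blip h -> (forall x, 0 <= h x) ->
  avg h = N^-1 * \sum_(b <- B) avg (fun x => h (tau A b x)).
Proof.
move=> bh h0; have N0 : 0 < N by rewrite ltr0n digits_nonempty.
have mh : measurable_fun setT (EFin \o (h : Rd R d -> R)) by apply/measurable_EFinP; exact: blip_measurable.
apply: EFin_inj; rewrite avgE //.
have Nn : 0 <= N^-1 by rewrite invr_ge0 ltW.
rewrite (eq_measure_integral (mscale (NngNum Nn) (msum image_measure #|` B|))); last first.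
  move=> E mE _; rewrite /= /mscale /= /msum hmu //; congr (_ * _)%E.
  by rewrite (big_nth 0) big_mkord.
rewrite ge0_integral_mscale //=; last by move=> x _; rewrite lee_fin.
rewrite ge0_integral_measure_sum //; last by move=> x _; rewrite lee_fin.
rewrite EFinM -sumEFin (big_nth 0) big_mkord; congr (_ * _)%E; apply: eq_bigr => i _.
rewrite (ge0_integral_pushforward (tau_measurable _)) //; last by move=> x _; rewrite lee_fin.
by rewrite preimage_setT avgE //; exact: blip_tau.
Qed.

Lemma avg_self h : blip h -> avg h = N^-1 * \sum_(b <- B) avg (fun x => h (tau A b x)).
Proof.
move=> bh; have [C C0 [b _]] := bh.
have N0 : 0 < N by rewrite ltr0n digits_nonempty.
have bC := blip_cst C.
have h0 x : 0 <= h x + C by have := b x; rewrite ler_norml => /andP[]; lra.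
(* Self-affinity was transferred for nonnegative integrands, where the integral against a sum of
   measures splits; adding the constant [C] reduces to that case. *)
have := avg_self_ge0 (blipD bh bC) h0; rewrite avgD // avg_cst.
under eq_bigr => i _ do rewrite (avgD (blip_tau i bh) bC) avg_cst.
rewrite big_split /= sum_const_seq mulrDr mulrA mulVf ?gt_eqF // mul1r => /addIr.
by [].
Qed.

Lemma avg_words M h : blip h -> avg h = (N ^+ M)^-1 *
  \sum_(w <- words B M) avg (fun x => h (digit_sum R A w + Rinv R A ^+ M *m x)).
Proof.
move=> bh; elim: M => [|M IH].
  rewrite big_words0 expr0 invr1 mul1r; apply: eq_avg => x.
  by rewrite mulTX0 add0r.
rewrite IH big_words_rcons exprSr invfM -mulrA; congr (_ * _).
rewrite exchange_big mulr_sumr !big_seq; apply: eq_bigr => w hw.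
rewrite (avg_self (blip_affine _ _ bh)); congr (_ * _); apply: eq_bigr => b _; apply: eq_avg => x.
by rewrite tauE digit_sum_rcons (words_size hw) mulmxDr -!mulTX addrA.
Qed.

End SelfAffine.
End Average.
End BoundedLipschitz.

(** Dominated convergence, with the square of [f] as dominating function. *)
Lemma square_limit dd (T : measurableType dd) (R : realType) (mu : {measure set T -> \bar R})
    (f : T -> R) (f_ : nat -> T -> R) :
  measurable_fun setT f -> (forall n, measurable_fun setT (f_ n)) ->
  (forall n x, 0 <= f_ n x <= f x) -> (forall x, (f_ ^~ x @ \oo --> f x)%classic) ->
  (\int[mu]_x (f x ^+ 2)%:E < +oo)%E ->
  forall eps : R, 0 < eps -> exists n, (\int[mu]_x ((f x - f_ n x) ^+ 2)%:E <= eps%:E)%E.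
Proof.
move=> mf mf_ hb hl hi eps eps0.
have mF n : measurable_fun setT (fun x => ((f x - f_ n x) ^+ 2)%:E).
  by apply/measurable_EFinP; apply: measurable_funX; exact: measurable_funB.
have mG : measurable_fun setT (fun x => (f x ^+ 2)%:E).
  by apply/measurable_EFinP; exact: measurable_funX.
have ig : mu.-integrable setT (fun x => (f x ^+ 2)%:E).
  apply/integrableP; split=> //; under eq_integral do rewrite gee0_abs ?lee_fin ?sqr_ge0 //.
  exact: hi.
have hlim x : ((fun n => ((f x - f_ n x) ^+ 2)%:E) @ \oo --> 0%:E)%classic.
  apply/fine_cvgP; split; first exact: nearW.
  rewrite (_ : 0 = (f x - f x) * (f x - f x)); last by rewrite subrr mulr0.
  by apply: cvgM; (apply: cvgB; [exact: cvg_cst|exact: hl]).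
have hdom x n : setT x -> (`|((f x - f_ n x) ^+ 2)%:E| <= (f x ^+ 2)%:E)%E.
  move=> _; rewrite gee0_abs ?lee_fin ?sqr_ge0 //; have /andP[h1 h2] := hb n x.
  by rewrite ler_pXn2r // ?nnegrE ?subr_ge0 ?lerBlDr ?lerDl // (le_trans h1).
have [_ _] := dominated_convergence measurableT mF (measurable_cst 0%E) (aeW mu (fun x _ => hlim x)) ig (aeW mu hdom).
rewrite integral0 => /fine_cvgP[hfin /cvgrPdist_le /(_ eps eps0) hd].
have [n _ /(_ n (leqnn n))[h1 h2]] := filterI hfin hd; exists n.
move: h1 h2 => /= h1 h2; rewrite -(fineK h1) lee_fin; move: h2; rewrite sub0r normrN.
by apply: le_trans; exact: ler_norm.
Qed.

Section Quadrature.
Variables (R : realType) (d : nat).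
Local Notation e := (@e2pii R).
Local Notation X := 'cV[R]_d.
Variable mu : probability (Rd R d) R.

Lemma nrm1_lip (x y : X) : `|nrm1 x - nrm1 y| <= nrm1 (x - y).
Proof.
rewrite ler_norml; apply/andP; split.
  have := nrm1D (y - x) x; rewrite subrK -opprB nrm1N; lra.
have := nrm1D (x - y) y; rewrite subrK; lra.
Qed.

Lemma blip_cap (c : R) : 0 <= c -> blip (fun x : X => Num.min 1 (c * nrm1 x)).
Proof.
move=> c0; exists (c + 1); [exact: addr_ge0|split=> [x|x y]].
  have h0 : 0 <= c * nrm1 x by rewrite mulr_ge0 // nrm1_ge0.
  rewrite ger0_norm ?le_min ?ler01 //; apply: (@le_trans _ _ 1); last by rewrite lerDr.
  by rewrite ge_min lexx.
have h : `|Num.min 1 (c * nrm1 x) - Num.min 1 (c * nrm1 y)| <= `|c * nrm1 x - c * nrm1 y|.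
  rewrite /Num.min; case: ifP => h1; case: ifP => h2; rewrite ?subrr ?normr0 ?normr_ge0 //.
    rewrite [leRHS]ger0_norm ?ger0_norm; lra.
  rewrite distrC [leRHS]distrC ![X in _ <= X]ger0_norm ?ger0_norm; lra.
apply: le_trans h _; rewrite -mulrBr normrM ger0_norm //.
apply: (@le_trans _ _ (c * nrm1 (x - y))); first by rewrite ler_wpM2l // nrm1_lip.
by rewrite ler_wpM2r ?nrm1_ge0 // lerDl.
Qed.

Lemma cap_tail (eps : R) : 0 < eps ->
  exists2 c : R, 0 < c & avg mu (fun x : X => Num.min 1 (c * nrm1 x)) <= eps.
Proof.
move=> eps0; pose c n : R := n.+1%:R^-1.
have c0 n : 0 <= c n by rewrite invr_ge0.
pose f_ n (x : Rd R d) : R := 1 - Num.min 1 (c n * nrm1 (x : X)).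
have m_ n : measurable_fun setT (f_ n) by apply: blip_measurable; apply: blipB; [exact: blip_cst|exact: blip_cap].
have b_ n x : 0 <= f_ n x <= 1.
  have h0 : 0 <= c n * nrm1 (x : X) by rewrite mulr_ge0 // nrm1_ge0.
  by rewrite /f_ subr_ge0 ge_min lexx /= gerBl le_min ler01.
have l_ x : (f_ ^~ x @ \oo --> (1 : R))%classic.
  apply/cvgrPdist_le => t t0.
  have [n0 hn0] : exists n0 : nat, nrm1 (x : X) / t <= n0%:R.
    by exists (Num.truncn (nrm1 (x : X) / t)).+1; rewrite ltW // truncnS_gt.
  exists n0 => // n /= hn; rewrite /f_ opprB addrCA subrr addr0.
  have h0 : 0 <= c n * nrm1 (x : X) by rewrite mulr_ge0 // nrm1_ge0.
  rewrite ger0_norm ?le_min ?ler01 // ge_min; apply/orP; right.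
  rewrite /c ler_pdivrMl ?ltr0n //; rewrite ler_pdivrMr // in hn0.
  by apply: le_trans hn0 _; rewrite ler_pM2r // ler_nat (leq_trans hn).
have i1 : (\int[mu]_(x in (setT : set (Rd R d))) ((1 : R) ^+ 2)%:E < +oo)%E.
  rewrite expr1n integral_cst // mul1e; apply: (@le_lt_trans _ _ 1%E); last exact: ltry.
  exact: probability_le1.
have e2 : 0 < eps ^+ 2 by rewrite exprn_gt0.
have [n hn] := square_limit (measurable_cst (1 : R)) m_ b_ l_ i1 e2.
exists (c n); first by rewrite invr_gt0.
pose g (x : X) := Num.min 1 (c n * nrm1 x).
have bg : blip g by exact: blip_cap.
have hg : avg mu (fun x => g x * g x) <= eps ^+ 2.
  rewrite -lee_fin avgE; last exact: blipM.
  apply: le_trans hn; under [in leRHS]eq_integral => x _ do rewrite /f_ opprB addrCA subrr addr0 expr2.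
  by [].
have h2 : avg mu g <= avg mu (fun x => 2^-1 * (eps + eps^-1 * (g x * g x))).
  apply: le_avg => //; first by apply: blipZ; apply: blipD; [exact: blip_cst|apply: blipZ; exact: blipM].
  (* The inequality g <= (eps + g^2 / eps) / 2 converts the bound on the mean square into one on the
     mean. *)
  move=> x; rewrite -subr_ge0.
  have -> : 2^-1 * (eps + eps^-1 * (g x * g x)) - g x = 2^-1 * eps^-1 * (eps - g x) ^+ 2.
    by field; rewrite gt_eqF.
  by rewrite mulr_ge0 ?sqr_ge0 // mulr_ge0 // invr_ge0 ltW.
apply: le_trans h2 _; rewrite avgZ; last by apply: blipD; [exact: blip_cst|apply: blipZ; exact: blipM].
rewrite avgD; [|exact: blip_cst|by apply: blipZ; exact: blipM].
rewrite avg_cst avgZ; last exact: blipM.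
rewrite ler_pdivrMl // mulr_natl mulr2n lerD2l ler_pdivrMl //.
Qed.

Variables (A : 'M[int]_d) (B : {fset 'cV[int]_d}).
Hypothesis cA : contracting R A.
Hypothesis hmu : self_affine_measure A B mu.
Let N : R := #|` B|%:R.
Let N0 : 0 < N. Proof. by rewrite ltr0n (digits_nonempty hmu). Qed.

(** Self-affinity writes the integral as a mean over words of integrals over small copies. On each
    copy [h] varies by at most 2 C min(1, c |x|), uniformly in the word, and [cap_tail] bounds the
    mean of this. *)
Lemma quadrature (h : X -> R) (eps : R) : blip h -> 0 < eps -> exists M0, forall M, (M0 <= M)%N ->
  `|avg mu h - (N ^+ M)^-1 * \sum_(w <- words B M) h (digit_sum R A w)| <= eps.
Proof.
move=> bh eps0; have [C C0 [b l]] := bh.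
have [K [rho [K0 r0 r1 hK]]] := Rinv_contr cA.
have C1 : 0 < 2 * C + 1 by rewrite ltr_wpDl // mulr_ge0.
have [c c0 hc] := cap_tail (divr_gt0 eps0 C1).
have K1 : 0 < K + 1 by rewrite ltr_wpDl.
have [M0 hM0] := pow_small r0 r1 (divr_gt0 c0 K1); exists M0 => M /hM0 hM.
have NM : 0 < N ^+ M by rewrite exprn_gt0.
rewrite (avg_words hmu M bh) -mulrBr -sumrB normrM ger0_norm ?invr_ge0 ?(ltW NM) //.
rewrite ler_pdivrMl //; apply: le_trans (ler_norm_sum _ _ _) _.
have -> : N ^+ M * eps = \sum_(w <- words B M) eps by rewrite sum_const_seq size_words natrX.
apply: ler_sum => w _; set v := digit_sum R A w.
have bv := blip_affine (Rinv R A ^+ M) v bh.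
have -> : avg mu (fun x => h (v + Rinv R A ^+ M *m x)) - h v =
    avg mu (fun x => h (v + Rinv R A ^+ M *m x) - h v).
  by rewrite avgB ?avg_cst //; exact: blip_cst.
have bcap := blip_cap (ltW c0).
apply: (@le_trans _ _ (avg mu (fun x => 2 * C * Num.min 1 (c * nrm1 x)))); last first.
  rewrite avgZ //; apply: (@le_trans _ _ (2 * C * (eps / (2 * C + 1)))).
    by rewrite ler_wpM2l // mulr_ge0.
  by rewrite mulrA ler_pdivrMr //; lra.
apply: norm_avg_le; [|exact: blipZ|].
  by apply: blipB => //; exact: blip_cst.
move=> x; have h1 : `|h (v + Rinv R A ^+ M *m x) - h v| <= 2 * C.
  by apply: le_trans (ler_normB _ _) _; have := b (v + Rinv R A ^+ M *m x); have := b v; lra.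
have h2 : `|h (v + Rinv R A ^+ M *m x) - h v| <= C * (c * nrm1 x).
  apply: le_trans (l _ _) _; rewrite [v + _]addrC addrK ler_wpM2l //.
  apply: le_trans (hK _ _) _; rewrite ler_wpM2r ?nrm1_ge0 //.
  move: hM; rewrite ler_pdivlMr // => hM.
  have : 0 <= rho ^+ M by rewrite exprn_ge0.
  lra.
rewrite /Num.min; case: ifP => _; first by rewrite mulr1.
apply: le_trans h2 _; rewrite ler_wpM2r ?mulr_ge0 ?nrm1_ge0 ?(ltW c0) //; lra.
Qed.

End Quadrature.

Lemma sqr_near (R : realType) (b eps : R) : 0 < eps ->
  exists2 t : R, 0 < t & forall a, `|b - a| <= t -> a ^+ 2 <= b ^+ 2 + eps.
Proof.
move=> eps0; have b1 : 0 < 2 * `|b| + 1 by rewrite ltr_wpDl // mulr_ge0.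
exists (Num.min 1 (eps / (2 * `|b| + 1))); first by rewrite lt_min ltr01 divr_gt0.
move=> a; rewrite le_min ler_pdivlMr // => /andP[h1 h2].
have -> : a ^+ 2 = b ^+ 2 + (a - b) * (2 * b + (a - b)) by ring.
rewrite lerD2l; apply: le_trans (ler_norm _) _; rewrite normrM distrC; apply: le_trans h2.
rewrite ler_wpM2l //; apply: le_trans (ler_normD _ _) _; rewrite normrM ger0_norm //.
by rewrite distrC lerD2l.
Qed.

Section Spectrum.
Variables (R : realType) (d : nat).
Local Notation e := (@e2pii R).
Local Notation X := 'cV[R]_d.
Variable mu : probability (Rd R d) R.
Variables (A : 'M[int]_d) (B : {fset 'cV[int]_d}) (Lam : set X).
Hypothesis cA : contracting R A.
Hypothesis hmu : self_affine_measure A B mu.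
Hypothesis hp : parseval A B Lam.
Let N : R := #|` B|%:R.
Let B0 : (0 < size B)%N. Proof. exact: digits_nonempty hmu. Qed.
Let N0 : 0 < N. Proof. by rewrite ltr0n. Qed.
Let NM M : 0 < N ^+ M. Proof. by rewrite exprn_gt0. Qed.
Implicit Types (x y lam : X).

(** Bessel's inequality for the exponential at [y] and the two frequencies [x], [y]: the term of [y]
    alone nearly exhausts the norm 1. *)
Lemma spectrum_gap x y (eps : R) : Lam x -> Lam y -> x != y -> 0 < eps ->
  exists n, qn (Tinv R A) (mean_sqn [:: B : seq _]) n (x - y) <= eps.
Proof.
move=> Lx Ly xy eps0; pose del : R := Num.min 2^-1 (eps / 2).
have d0 : 0 < del by rewrite lt_min invr_gt0 ltr0n divr_gt0.
have d1 : del <= 2^-1 by rewrite ge_min lexx.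
have d2 : del <= eps / 2 by rewrite ge_min lexx orbT.
have [n hn] := qB_lim cA B0 [:: x; y] d0; exists n.
have hx : 1 - del <= qB A B (Tinv R A ^+ n *m x) by apply: hn => //; rewrite mem_head.
have hy : 1 - del <= qB A B (Tinv R A ^+ n *m y) by apply: hn => //; rewrite !inE eqxx orbT.
pose c (w : seq 'cV[int]_d) := e (dotv y (digit_sum R A w)).
have [h _] := hp n c; have {h} := h [:: x; y].
have -> : nrm2 B n c = 1.
  rewrite /nrm2; under eq_bigr do rewrite sqn_e.
  by rewrite sum_const_seq size_words natrX mulr1 mulVf // gt_eqF.
have cE z : coef A B n c z = coef A B n (fun=> 1) (z - y).
  rewrite /coef; congr (_ * _); apply: eq_bigr => w _.
  by rewrite /c -e2piiD mul1r dotvBl opprB.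
rewrite big_cons big_seq1 !cE !sqn_coef1 // subrr.
have -> : qn (Tinv R A) (mean_sqn [:: B : seq _]) n 0 = 1.
  rewrite -(sqn_coef1 A (B : seq _)) /coef; under eq_bigr do rewrite dotv0l oppr0 e2pii0 mul1r.
  rewrite sum_const_seq mulr1 size_words natrX -cr_nat -crX -crM mulVf ?gt_eqF //.
  by rewrite sqn_real expr1n.
move=> h; have {h} : qn (Tinv R A) (mean_sqn [:: B : seq _]) n (x - y) * qB A B (Tinv R A ^+ n *m x) +
    1 * qB A B (Tinv R A ^+ n *m y) <= 1.
  apply: h; first by rewrite /= inE xy.
  by move=> z /=; rewrite !inE => /orP[] /eqP ->.
set q1 := qn _ _ _ _; have q10 : 0 <= q1 by have /andP[] := qn01 (Tinv R A) (@mean_sqn_01 R d [:: B : seq _]) n (x - y).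
have : q1 * (1 - del) <= q1 * qB A B (Tinv R A ^+ n *m x) by rewrite ler_wpM2l.
have : q1 * del <= q1 * 2^-1 by rewrite ler_wpM2l.
lra.
Qed.

Lemma spectrum_orthogonal x y : Lam x -> Lam y -> x != y ->
  avg mu (fun z => complex.Re (e (dotv (x - y) z))) = 0 /\
  avg mu (fun z => complex.Im (e (dotv (x - y) z))) = 0.
Proof.
move=> Lx Ly xy; have [bre bim] := blip_e (x - y).
have yx : y != x by rewrite eq_sym.
(* [p] stands for the real or the imaginary part, treated alike. The quadrature sum is [p] of a
   coefficient of the constant function, which is small by [spectrum_gap]. *)
have key (p : R[i] -> R) : (forall z, p z ^+ 2 <= sqn z) -> (forall t z, p (cr t * z) = t * p z) ->
    (forall s : seq (seq 'cV[int]_d), forall f, p (\sum_(w <- s) f w) = \sum_(w <- s) p (f w)) ->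
    blip (fun z => p (e (dotv (x - y) z))) -> avg mu (fun z => p (e (dotv (x - y) z))) = 0.
  move=> p2 pZ ps bp; apply/eqP; rewrite -normr_le0; apply/ler_addgt0Pl => eps eps0.
  have e2 : 0 < eps / 2 by rewrite divr_gt0.
  have [n hn] := spectrum_gap Ly Lx yx (exprn_gt0 2 e2).
  have [M hM] := quadrature cA hmu bp e2.
  have := hM (maxn n M) (leq_maxr _ _); set S := \sum_(w <- _) _ => h1.
  have h2 : `|(N ^+ maxn n M)^-1 * S| <= eps / 2.
    apply: abs_le_sqr; first exact: ltW.
    apply: le_trans (le_trans (qn_le (Tinv R A) (@mean_sqn_01 R d [:: B : seq _]) _ (leq_maxl n M)) hn).
    rewrite -(sqn_coef1 A (B : seq _)); apply: le_trans (p2 _); rewrite /coef pZ ps -/N.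
    rewrite (eq_bigr (fun w => p (e (dotv (x - y) (digit_sum R A w))))) // => w _.
    by rewrite mul1r -dotvNl opprB.
  rewrite addr0; have := ler_normD (avg mu (fun z => p (e (dotv (x - y) z))) - (N ^+ maxn n M)^-1 * S) ((N ^+ maxn n M)^-1 * S).
  rewrite subrK; lra.
split; apply: key => //; first exact: Re_sqr_le.
- exact: ReZ.
- by move=> s f; exact: Re_sum.
- by move=> z; rewrite /sqn lerDr sqr_ge0.
- exact: ImZ.
by move=> s f; exact: Im_sum.
Qed.

Variable g : X -> R.
Hypothesis bg : blip g.

Definition fourier_coef lam : R[i] :=
  avg mu (fun x => g x * complex.Re (e (dotv lam x))) +i* - avg mu (fun x => g x * complex.Im (e (dotv lam x))).

Let b_re lam : blip (fun x => g x * complex.Re (e (dotv lam x))).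
Proof. by apply: blipM => //; have [] := blip_e lam. Qed.
Let b_im lam : blip (fun x => g x * complex.Im (e (dotv lam x))).
Proof. by apply: blipM => //; have [] := blip_e lam. Qed.

Lemma fourier_coef_near lam (eps : R) : 0 < eps -> exists M0, forall M, (M0 <= M)%N ->
  sqn (coef A B M (fun w => cr (g (digit_sum R A w))) lam) <= sqn (fourier_coef lam) + eps.
Proof.
move=> eps0; have e2 : 0 < eps / 2 by rewrite divr_gt0.
have [t t0 ht] := sqr_near (avg mu (fun x => g x * complex.Re (e (dotv lam x)))) e2.
have [s s0 hs] := sqr_near (avg mu (fun x => g x * complex.Im (e (dotv lam x)))) e2.
have [M1 h1] := quadrature cA hmu (b_re lam) t0; have [M2 h2] := quadrature cA hmu (b_im lam) s0.
exists (maxn M1 M2) => M; rewrite geq_max => /andP[hM1 hM2].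
have := hs _ (h2 M hM2); have := ht _ (h1 M hM1); rewrite -/N.
set a : R := (N ^+ M)^-1 * \sum_(w <- words B M) g (digit_sum R A w) * complex.Re (e (dotv lam (digit_sum R A w))).
set b : R := (N ^+ M)^-1 * \sum_(w <- words B M) g (digit_sum R A w) * complex.Im (e (dotv lam (digit_sum R A w))).
move=> ha hb; have -> : sqn (coef A B M (fun w => cr (g (digit_sum R A w))) lam) = a ^+ 2 + b ^+ 2.
  rewrite /sqn /coef ReZ ImZ Re_sum Im_sum -/N -[in RHS](sqrrN b) -mulrN -sumrN.
  congr ((_ * _) ^+ 2 + (_ * _) ^+ 2); apply: eq_bigr => w _.
    by rewrite ReZ e2piiN; case: (e _).
  by rewrite ImZ e2piiN; case: (e _) => ? ? /=; rewrite mulrN.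
rewrite /fourier_coef /sqn /= sqrrN; lra.
Qed.

Lemma fourier_coefs_near (F : seq X) (eps : R) : 0 < eps -> exists M0, forall M, (M0 <= M)%N ->
  \sum_(lam <- F) sqn (coef A B M (fun w => cr (g (digit_sum R A w))) lam) <=
  \sum_(lam <- F) sqn (fourier_coef lam) + eps.
Proof.
elim: F eps => [|lam F IH] eps eps0; first by exists 0%N => M _; rewrite !big_nil add0r ltW.
have e2 : 0 < eps / 2 by rewrite divr_gt0.
have [M1 h1] := fourier_coef_near lam e2; have [M2 h2] := IH _ e2.
exists (maxn M1 M2) => M; rewrite geq_max => /andP[/h1 hM1 /h2 hM2]; rewrite !big_cons; lra.
Qed.

(** [g] on digit sums is nearly determined by the first m letters, as [g] is Lipschitz and tails
    contract. So [parseval_limit] applies, and quadrature turns word norms and word coefficients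
    into integrals. *)
Lemma fourier_complete (eps : R) : 0 < eps -> exists F : seq X, [/\ uniq F, ([set` F] `<=` Lam)%classic &
  avg mu (fun x => g x * g x) - eps <= \sum_(lam <- F) sqn (fourier_coef lam)].
Proof.
move=> eps0; have [C C0 [b l]] := bg.
have C2 : 0 < 8 * (C ^+ 2 + 1) by rewrite mulr_gt0 // ltr_wpDl // sqr_ge0.
(* Four losses of at most eps / 8 (the factor 1 - eta, the near equality, del / eta, the quadrature
   of g^2) and eps / 2 for the coefficients. *)
pose eta : R := Num.min 2^-1 (eps / (8 * (C ^+ 2 + 1))).
have eta0 : 0 < eta by rewrite lt_min invr_gt0 ltr0n /= divr_gt0.
have eta1 : eta < 1 by rewrite gt_min; apply/orP; left; lra.
have etaC : eta * (8 * (C ^+ 2 + 1)) <= eps by rewrite -ler_pdivlMr // /eta ge_min lexx orbT.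
pose del := eta * (eps / 8).
have e8 : 0 < eps / 8 by rewrite divr_gt0.
have del0 : 0 < del by rewrite mulr_gt0.
have [K [rho [K0 r0 r1 hK]]] := Rinv_contr cA; have [C' C'0 hC'] := digit_sum_bound cA B.
have M0' : 0 <= C * K * C' by rewrite !mulr_ge0.
have e1 : 0 < Num.min 1 (del / ((C * K * C') ^+ 2 + 1)).
  by rewrite lt_min ltr01 divr_gt0 // ltr_wpDl // sqr_ge0.
have [m1 hm1] := pow_small r0 r1 e1.
have [m2 hm2] := quadrature cA hmu (blipM bg bg) e8.
pose m := maxn m1 m2; pose c (M : nat) (w : seq 'cV[int]_d) : R[i] := cr (g (digit_sum R A w)).
have hclose j w : w \in words B (m + j) -> sqn (c (m + j)%N w - c m (take m w)) <= del.
  move=> /words_cat_mem[u [v [hu hv ->]]]; rewrite take_size_cat ?(words_size hu) //.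
  rewrite /c -crB sqn_real digit_sum_cat (words_size hu).
  have h1 : `|g (digit_sum R A u + Rinv R A ^+ m *m digit_sum R A v) - g (digit_sum R A u)| <= C * K * C' * rho ^+ m.
    apply: le_trans (l _ _) _; rewrite [digit_sum R A u + _]addrC addrK -!mulrA ler_wpM2l //.
    apply: le_trans (hK _ _) _; rewrite -mulrA [C' * _]mulrC !ler_wpM2l ?exprn_ge0 //.
    by apply: hC'; exact: words_mem hv.
  rewrite -(real_normK (num_real (_ - _))); apply: (@le_trans _ _ ((C * K * C' * rho ^+ m) ^+ 2)).
    by apply: lerXn2r => //; rewrite nnegrE // mulr_ge0 // exprn_ge0.
  have := hm1 m (leq_maxl _ _); rewrite le_min ler_pdivlMr ?ltr_wpDl ?sqr_ge0 // => /andP[p1 p2].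
  rewrite exprMn; set P := (C * K * C') ^+ 2 in p2 *; set r := rho ^+ m in p1 p2 *.
  have P0 : 0 <= P by exact: sqr_ge0.
  have r00 : 0 <= r by rewrite exprn_ge0.
  have : r ^+ 2 <= r by rewrite expr2 -[leRHS]mulr1 ler_wpM2l.
  have := ler_wpM2l P0 (_ : r ^+ 2 <= r) => h2 h3; have := h2 h3; lra.
have [F [uF FL hF]] := parseval_limit B0 hp eta0 eta1 hclose e8; exists F; split=> //.
have n2 : nrm2 B m (c m) = (N ^+ m)^-1 * \sum_(w <- words B m) g (digit_sum R A w) * g (digit_sum R A w).
  by rewrite /nrm2; congr (_ * _); apply: eq_bigr => w _; rewrite sqn_real expr2.
have := hm2 m (leq_maxr _ _); rewrite -/N -n2 ler_norml => /andP[_ hq].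
have e2 : 0 < eps / 2 by rewrite divr_gt0.
have [j hj] := fourier_coefs_near F e2.
have := hj (m + j)%N (leq_addl _ _); have := hF j; rewrite /c -/(c m).
set S := \sum_(lam <- F) _ => hS hS'.
have nC : nrm2 B m (c m) <= C ^+ 2.
  apply: (nrm2_le B0) => w _; rewrite sqn_real -(real_normK (num_real _)).
  by apply: lerXn2r => //; rewrite nnegrE.
have n0 : 0 <= nrm2 B m (c m) by exact: nrm2_ge0.
move: hS; have -> : eta^-1 * del = eps / 8 by rewrite /del mulKf // gt_eqF.
move=> hS; have := ler_wpM2l (ltW eta0) nC; have := mulr_ge0 (ltW eta0) (ltW eps0).
have := mulr_ge0 (ltW eta0) n0; lra.
Qed.

Lemma sqn_residual (F : seq X) (z : X -> R[i]) (a : R) x :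
  sqn (cr a - \sum_(lam <- F) z lam * e (dotv lam x)) = a * a -
   2 * (\sum_(lam <- F) (complex.Re (z lam) * (a * complex.Re (e (dotv lam x))) -
      complex.Im (z lam) * (a * complex.Im (e (dotv lam x))))) +
   \sum_(lam <- F) \sum_(y <- F) (complex.Re (z lam * cj (z y)) * complex.Re (e (dotv (lam - y) x)) -
      complex.Im (z lam * cj (z y)) * complex.Im (e (dotv (lam - y) x))).
Proof.
set S := \sum_(lam <- F) z lam * e (dotv lam x).
have -> : sqn (cr a - S) = a * a - 2 * (a * complex.Re S) + sqn S.
  by case: S => p q; rewrite /sqn /=; ring.
congr (_ - 2 * _ + _).
  rewrite /S Re_sum mulr_sumr; apply: eq_bigr => lam _.
  by case: (z lam) (e _) => ? ? [? ?] /=; ring.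
rewrite -[sqn S]/(complex.Re (cr (sqn S))) sqnE /S cj_sum mulr_suml Re_sum; apply: eq_bigr => lam _.
rewrite mulr_sumr Re_sum; apply: eq_bigr => y _.
rewrite cjM mulrACA e2pii_mulJ -dotvBl; case: (z lam * _) (e _) => ? ? [? ?] /=.
by [].
Qed.

Lemma blip_residual (F : seq X) (z : X -> R[i]) :
  blip (fun x => sqn (cr (g x) - \sum_(lam <- F) z lam * e (dotv lam x))).
Proof.
rewrite (funext (fun x => sqn_residual F z (g x) x)).
apply: blipD; first (apply: blipB; first exact: blipM).
  by apply: blipZ; apply: blip_sum => lam; apply: blipB; apply: blipZ.
apply: blip_sum => lam; apply: blip_sum => y; have [? ?] := blip_e (lam - y).
by apply: blipB; apply: blipZ.
Qed.

(** Pythagoras: by orthogonality the double sum reduces to its diagonal. Near equality in Parseval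
    thus becomes smallness of the residual. *)
Lemma residual_avg (F : seq X) : uniq F -> ([set` F] `<=` Lam)%classic ->
  avg mu (fun x => sqn (cr (g x) - \sum_(lam <- F) fourier_coef lam * e (dotv lam x))) =
  avg mu (fun x => g x * g x) - \sum_(lam <- F) sqn (fourier_coef lam).
Proof.
move=> uF FL; rewrite (eq_avg mu (fun x => sqn_residual F fourier_coef (g x) x)).
have bs1 : blip (fun x => \sum_(lam <- F) (complex.Re (fourier_coef lam) * (g x * complex.Re (e (dotv lam x))) -
      complex.Im (fourier_coef lam) * (g x * complex.Im (e (dotv lam x))))).
  by apply: blip_sum => lam; apply: blipB; apply: blipZ.
have bi lam y : blip (fun x => complex.Re (fourier_coef lam * cj (fourier_coef y)) * complex.Re (e (dotv (lam - y) x)) -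
      complex.Im (fourier_coef lam * cj (fourier_coef y)) * complex.Im (e (dotv (lam - y) x))).
  by have [? ?] := blip_e (lam - y); apply: blipB; apply: blipZ.
have bs2 : blip (fun x => \sum_(lam <- F) \sum_(y <- F)
     (complex.Re (fourier_coef lam * cj (fourier_coef y)) * complex.Re (e (dotv (lam - y) x)) -
      complex.Im (fourier_coef lam * cj (fourier_coef y)) * complex.Im (e (dotv (lam - y) x)))).
  by apply: blip_sum => lam; exact: blip_sum.
rewrite avgD //; last by apply: blipB; [exact: blipM|exact: blipZ].
rewrite avgB; [|exact: blipM|exact: blipZ].
rewrite avgZ // avg_sum; last by move=> lam; apply: blipB; apply: blipZ.
rewrite avg_sum; last by move=> lam; exact: blip_sum.
have -> : \sum_(lam <- F) avg mu (fun x => complex.Re (fourier_coef lam) * (g x * complex.Re (e (dotv lam x))) -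
      complex.Im (fourier_coef lam) * (g x * complex.Im (e (dotv lam x)))) = \sum_(lam <- F) sqn (fourier_coef lam).
  apply: eq_bigr => lam _; rewrite avgB; [|exact: blipZ|exact: blipZ]; rewrite !avgZ // /sqn /=; ring.
have -> : \sum_(lam <- F) avg mu (fun x => \sum_(y <- F)
     (complex.Re (fourier_coef lam * cj (fourier_coef y)) * complex.Re (e (dotv (lam - y) x)) -
      complex.Im (fourier_coef lam * cj (fourier_coef y)) * complex.Im (e (dotv (lam - y) x)))) =
   \sum_(lam <- F) sqn (fourier_coef lam); last by ring.
rewrite !big_seq; apply: eq_bigr => lam hl; rewrite avg_sum //.
rewrite (bigD1_seq lam hl uF) -[LHS]/(_ + _) [X in _ + X]big_seq_cond [X in _ + X]big1 ?addr0.
  rewrite (eq_avg mu (h' := fun=> sqn (fourier_coef lam))) ?avg_cst // => x.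
  by rewrite subrr dotv0l e2pii0; case: (fourier_coef lam) => p q; rewrite /sqn /=; ring.
move=> y /andP[hy ly]; have [br bi'] := blip_e (lam - y).
have yl : lam != y by rewrite eq_sym.
have [hr him] := spectrum_orthogonal (FL _ hl) (FL _ hy) yl.
by rewrite avgB ?avgZ ?hr ?him ?mulr0 ?subrr //; exact: blipZ.
Qed.

End Spectrum.

(** * Density in L^2 *)

Section InfConvolution.
Variables (R : realType) (d : nat).
Local Notation X := 'cV[R]_d.

(* The largest c-Lipschitz function (for nrm1) below f. *)
Definition infconv (f : X -> R) (c : R) (x : X) : R := inf [set t | exists y, t = f y + c * nrm1 (x - y)]%classic.

Variable f : X -> R.
Hypothesis f01 : forall x, 0 <= f x <= 1.
Variable c : R.
Hypothesis c0 : 0 <= c.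

Let f0 x : 0 <= f x. Proof. by have /andP[] := f01 x. Qed.

Let lb x : lbound [set t | exists y, t = f y + c * nrm1 (x - y)]%classic 0.
Proof. by move=> _ [y ->]; rewrite addr_ge0 // mulr_ge0 // nrm1_ge0. Qed.

Lemma infconv_le x y : infconv f c x <= f y + c * nrm1 (x - y).
Proof. by apply: ge_inf; [exists 0; exact: lb|exists y]. Qed.

Lemma le_infconv x t : (forall y, t <= f y + c * nrm1 (x - y)) -> t <= infconv f c x.
Proof. by move=> h; apply: lb_le_inf => [|_ [y ->]]; [exists (f x + c * nrm1 (x - x)); exists x|]. Qed.

Lemma infconv_bounds x : 0 <= infconv f c x <= f x.
Proof.
rewrite le_infconv => [|y]; last by apply: lb; exists y.
by apply: le_trans (infconv_le x x) _; rewrite subrr /nrm1 big1 ?mulr0 ?addr0 // => i _; rewrite mxE normr0.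
Qed.

Lemma blip_infconv : blip (infconv f c).
Proof.
have h x y : infconv f c x - infconv f c y <= c * nrm1 (x - y).
  rewrite lerBlDr -lerBlDl; apply: le_infconv => z; rewrite lerBlDl.
  apply: le_trans (infconv_le x z) _; rewrite addrCA lerD2l -mulrDr ler_wpM2l //.
  by have := nrm1D (x - y) (y - z); rewrite addrA subrK.
have c1 : 0 <= c + 1 by rewrite addr_ge0.
exists (c + 1) => //; split=> [x|x y].
  have /andP[h1 h2] := infconv_bounds x; rewrite ger0_norm //.
  by have /andP[_ h3] := f01 x; apply: le_trans h2 (le_trans h3 _); rewrite lerDr.
apply: (@le_trans _ _ (c * nrm1 (x - y))); last by rewrite ler_wpM2r ?nrm1_ge0 // lerDl.
rewrite ler_norml h andbT lerNl opprB; apply: le_trans (h y x) _.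
by rewrite -opprB nrm1N.
Qed.

End InfConvolution.

(** * From bounded Lipschitz functions to square integrable ones *)

Section Density.
Variables (R : realType) (d : nat).
Local Notation e := (@e2pii R).
Local Notation X := 'cV[R]_d.
Variable mu : probability (Rd R d) R.
Variables (A : 'M[int]_d) (B : {fset 'cV[int]_d}) (Lam : set X).
Hypothesis cA : contracting R A.
Hypothesis hmu : self_affine_measure A B mu.
Hypothesis hp : parseval A B Lam.
Implicit Types (f g : X -> R[i]) (h : X -> R).

Definition cmeasurable f :=
  measurable_fun setT ((fun x => complex.Re (f x)) : Rd R d -> R) /\
  measurable_fun setT ((fun x => complex.Im (f x)) : Rd R d -> R).

Definition nu2 f : \bar R := (\int[mu]_(x in (setT : set (Rd R d))) (sqn (f x))%:E)%E.

Definition exp_sum (s : seq (X * R[i])) (x : X) : R[i] := \sum_(p <- s) p.2 * e (dotv p.1 x).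

Definition spectral_seq (s : seq (X * R[i])) := forall p, p \in s -> Lam p.1.

Definition approximable f := forall eps : R, 0 < eps ->
  exists2 s, spectral_seq s & (nu2 (fun x => (f x - exp_sum s x)%R) <= eps%:E)%E.

Lemma cmeasurableD f g : cmeasurable f -> cmeasurable g -> cmeasurable (fun x => f x + g x).
Proof.
move=> [f1 f2] [g1 g2]; split.
  rewrite (_ : (fun x => _) = fun x => complex.Re (f x) + complex.Re (g x)); first exact: measurable_funD.
  by apply: funext => x; case: (f x) (g x) => ? ? [].
rewrite (_ : (fun x => _) = fun x => complex.Im (f x) + complex.Im (g x)); first exact: measurable_funD.
by apply: funext => x; case: (f x) (g x) => ? ? [].
Qed.

Lemma cmeasurableM f g : cmeasurable f -> cmeasurable g -> cmeasurable (fun x => f x * g x).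
Proof.
move=> [f1 f2] [g1 g2]; split.
  rewrite (_ : (fun x => _) = fun x => complex.Re (f x) * complex.Re (g x) - complex.Im (f x) * complex.Im (g x)).
    by apply: measurable_funB; exact: measurable_funM.
  by apply: funext => x; case: (f x) (g x) => ? ? [].
rewrite (_ : (fun x => _) = fun x => complex.Re (f x) * complex.Im (g x) + complex.Im (f x) * complex.Re (g x)).
  by apply: measurable_funD; exact: measurable_funM.
by apply: funext => x; case: (f x) (g x) => ? ? [].
Qed.

Lemma cmeasurable_cst z : cmeasurable (fun=> z).
Proof. by split; exact: measurable_cst. Qed.

Lemma cmeasurableB f g : cmeasurable f -> cmeasurable g -> cmeasurable (fun x => f x - g x).
Proof.
move=> mf mg; under eq_fun do rewrite -mulN1r; apply: cmeasurableD => //.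
by apply: cmeasurableM => //; exact: cmeasurable_cst.
Qed.

Lemma cmeasurable_real h : measurable_fun setT (h : Rd R d -> R) -> cmeasurable (fun x => cr (h x)).
Proof. by move=> mh; split => //; exact: measurable_cst. Qed.

Lemma cmeasurable_e y : cmeasurable (fun x => e (dotv y x)).
Proof. by have [b1 b2] := blip_e y; split; exact: blip_measurable. Qed.

Lemma cmeasurable_exp_sum s : cmeasurable (exp_sum s).
Proof.
elim: s => [|p s IH]; rewrite /exp_sum; first by under eq_fun do rewrite big_nil; exact: cmeasurable_cst.
under eq_fun do rewrite big_cons; apply: cmeasurableD => //; apply: cmeasurableM; first exact: cmeasurable_cst.
exact: cmeasurable_e.
Qed.

Lemma measurable_sqn f : cmeasurable f -> measurable_fun setT ((fun x => (sqn (f x))%:E) : Rd R d -> \bar R).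
Proof.
move=> [f1 f2]; apply/measurable_EFinP; rewrite /sqn.
by apply: measurable_funD; exact: measurable_funX.
Qed.

Lemma nu2_ge0 f : (0 <= nu2 f)%E.
Proof. by apply: integral_ge0 => x _; rewrite lee_fin sqn_ge0. Qed.

Lemma eq_nu2 f g : f =1 g -> nu2 f = nu2 g.
Proof. by move=> /funext ->. Qed.

Lemma nu2_le f g : cmeasurable f -> cmeasurable g -> (forall x, sqn (f x) <= sqn (g x)) -> (nu2 f <= nu2 g)%E.
Proof.
move=> mf mg fg; apply: ge0_le_integral => //; try exact: measurable_sqn.
- by move=> x _; rewrite lee_fin sqn_ge0.
by move=> x _; rewrite lee_fin.
Qed.

Lemma nu2D f g (a b : R) : cmeasurable f -> cmeasurable g -> (nu2 f <= a%:E)%E -> (nu2 g <= b%:E)%E ->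
  (nu2 (fun x => (f x + g x)%R) <= (2 * (a + b))%:E)%E.
Proof.
move=> mf mg fa gb.
have mF := measurable_sqn mf; have mG := measurable_sqn mg.
have h1 : (nu2 (fun x => (f x + g x)%R) <= \int[mu]_(x in (setT : set (Rd R d))) (2%:E * ((sqn (f x))%:E + (sqn (g x))%:E)))%E.
  apply: ge0_le_integral => //.
  - by move=> x _; rewrite lee_fin sqn_ge0.
  - by apply: measurable_sqn; exact: cmeasurableD.
  - by apply: measurable_funeM; exact: emeasurable_funD.
  by move=> x _; rewrite -EFinD -EFinM lee_fin sqn_le_norms.
apply: le_trans h1 _; rewrite ge0_integralZl_EFin //.
- rewrite ge0_integralD //; last 2 first.
  + by move=> x _; rewrite lee_fin sqn_ge0.
  + by move=> x _; rewrite lee_fin sqn_ge0.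
  apply: (@le_trans _ _ (2%:E * (a%:E + b%:E))%E) => //.
  by apply: lee_wpmul2l; [rewrite lee_fin|exact: leeD].
- by move=> x _; rewrite adde_ge0 // lee_fin sqn_ge0.
exact: emeasurable_funD.
Qed.

Lemma nu2Z z f : cmeasurable f -> nu2 (fun x => (z * f x)%R) = ((sqn z)%:E * nu2 f)%E.
Proof.
move=> mf; rewrite /nu2; under eq_integral do rewrite sqnM EFinM.
rewrite ge0_integralZl_EFin //; last exact: sqn_ge0.
  by move=> x _; rewrite lee_fin sqn_ge0.
exact: measurable_sqn.
Qed.

Lemma approximable_limit f : cmeasurable f ->
  (forall eps : R, 0 < eps -> exists g, [/\ cmeasurable g, approximable g & (nu2 (fun x => (f x - g x)%R) <= eps%:E)%E]) ->
  approximable f.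
Proof.
move=> mf h eps eps0; have e4 : 0 < eps / 4 by rewrite divr_gt0.
have [g [mg ag fg]] := h _ e4; have [s sp gs] := ag _ e4; exists s => //.
rewrite (_ : (fun x => _) = fun x => (f x - g x) + (g x - exp_sum s x)).
  rewrite (_ : eps = 2 * (eps / 4 + eps / 4)); last by field.
  by apply: nu2D => //; apply: cmeasurableB => //; exact: cmeasurable_exp_sum.
by apply: funext => x; rewrite addrA subrK.
Qed.

Lemma exp_sum_cat s t x : exp_sum (s ++ t) x = exp_sum s x + exp_sum t x.
Proof. by rewrite /exp_sum big_cat. Qed.

Lemma approximableD f g : cmeasurable f -> cmeasurable g -> approximable f -> approximable g ->
  approximable (fun x => f x + g x).
Proof.
move=> mf mg af ag eps eps0; have e4 : 0 < eps / 4 by rewrite divr_gt0.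
have [s sp fs] := af _ e4; have [t tp gt] := ag _ e4; exists (s ++ t).
  by move=> p; rewrite mem_cat => /orP[/sp|/tp].
rewrite (_ : (fun x => _) = fun x => (f x - exp_sum s x) + (g x - exp_sum t x)).
  rewrite (_ : eps = 2 * (eps / 4 + eps / 4)); last by field.
  by apply: nu2D => //; apply: cmeasurableB => //; exact: cmeasurable_exp_sum.
by apply: funext => x; rewrite exp_sum_cat opprD addrACA.
Qed.

Lemma approximableZ z f : cmeasurable f -> approximable f -> approximable (fun x => z * f x).
Proof.
move=> mf af eps eps0; have z1 : 0 < sqn z + 1 by rewrite ltr_wpDl // sqn_ge0.
have e4 : 0 < eps / (sqn z + 1) by rewrite divr_gt0.
have [s sp fs] := af _ e4; exists [seq (p.1, z * p.2) | p <- s].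
  by move=> _ /mapP[p /sp ps ->].
rewrite (_ : (fun x => _) = fun x => z * (f x - exp_sum s x)).
  rewrite nu2Z; last by apply: cmeasurableB => //; exact: cmeasurable_exp_sum.
  apply: (@le_trans _ _ ((sqn z)%:E * (eps / (sqn z + 1))%:E)%E); first by apply: lee_wpmul2l; rewrite ?lee_fin ?sqn_ge0.
  rewrite -EFinM lee_fin mulrA ler_pdivrMr // mulrC ler_wpM2l //; first exact: ltW.
  by rewrite lerDl.
apply: funext => x; rewrite mulrBr /exp_sum big_map mulr_sumr; congr (_ - _).
by apply: eq_bigr => p _; rewrite mulrA.
Qed.

Lemma approximable_sum (I : Type) (s : seq I) (f : I -> X -> R[i]) : (forall i, cmeasurable (f i)) ->
  (forall i, approximable (f i)) -> approximable (fun x => \sum_(i <- s) f i x).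
Proof.
move=> mf af; suff [] : cmeasurable (fun x => \sum_(i <- s) f i x) /\ approximable (fun x => \sum_(i <- s) f i x) by [].
elim: s => [|i s [IH1 IH2]].
  under eq_fun do rewrite big_nil; split; first exact: cmeasurable_cst.
  move=> eps eps0; exists [::] => //; rewrite (eq_nu2 (g := fun=> 0)); last by move=> x; rewrite /exp_sum big_nil subrr.
  by rewrite /nu2 integral0_eq ?lee_fin ?ltW // => x _; rewrite sqn0.
by under eq_fun do rewrite big_cons; split; [exact: cmeasurableD|exact: approximableD].
Qed.

Lemma approximable_blip h : blip h -> approximable (fun x => cr (h x)).
Proof.
move=> bh eps eps0; have [F [uF FL hF]] := fourier_complete cA hmu hp bh eps0.
exists [seq (lam, fourier_coef mu h lam) | lam <- F].
  by move=> _ /mapP[lam hl ->]; exact: FL.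
rewrite (eq_nu2 (g := fun x => cr (h x) - \sum_(lam <- F) fourier_coef mu h lam * e (dotv lam x))).
  rewrite /nu2 -avgE; last exact: blip_residual.
  rewrite (residual_avg cA hmu hp bh uF FL) lee_fin; lra.
by move=> x; rewrite /exp_sum big_map.
Qed.

Lemma approximable_monotone h (h_ : nat -> X -> R) :
  measurable_fun setT (h : Rd R d -> R) -> (forall n, measurable_fun setT (h_ n : Rd R d -> R)) ->
  (forall n x, 0 <= h_ n x <= h x) -> (forall x, (h_ ^~ x @ \oo --> h x)%classic) ->
  (nu2 (fun x => cr (h x)) < +oo)%E -> (forall n, approximable (fun x => cr (h_ n x))) ->
  approximable (fun x => cr (h x)).
Proof.
move=> mh mh_ hb hl hf ha; apply: approximable_limit; first exact: cmeasurable_real.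
move=> eps eps0; have hf' : (\int[mu]_(x in (setT : set (Rd R d))) (h x ^+ 2)%:E < +oo)%E.
  by apply: le_lt_trans hf; under [leRHS]eq_integral do rewrite sqn_real.
have [n hn] := square_limit mh mh_ hb hl hf' eps0.
exists (fun x => cr (h_ n x)); split; [exact: cmeasurable_real|exact: ha|].
apply: le_trans hn; rewrite le_eqVlt; apply/orP; left; apply/eqP.
by apply: eq_integral => x _; rewrite -crB sqn_real.
Qed.

Lemma nu2_indic_lty (E : set (Rd R d)) : measurable E -> (nu2 (fun x => cr (\1_E x)) < +oo)%E.
Proof.
move=> mE; apply: (@le_lt_trans _ _ (nu2 (fun=> 1))).
  apply: nu2_le; [by apply: cmeasurable_real; exact: measurable_indic|exact: cmeasurable_cst|].
  by move=> x; rewrite sqn_real sqn1 indicE; case: (_ \in _); rewrite ?expr1n // expr0n.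
rewrite /nu2; under eq_integral do rewrite sqn1.
by rewrite integral_cst // mul1e (le_lt_trans (probability_le1 _ _)) ?ltry.
Qed.

(** The n-Lipschitz regularisations of the indicator increase to it: at a point with a ball of
    radius r inside [U] they equal 1 as soon as n r >= 1. *)
Lemma approximable_open (U : set X) : open U -> approximable (fun x => cr (\1_U x)).
Proof.
move=> oU; have mU : measurable (U : set (Rd R d)) by exact: sub_sigma_algebra.
have b01 x : 0 <= (\1_U x : R) <= 1 by rewrite indicE; case: (_ \in _); rewrite ?lexx ?ler01.
have bi n : blip (infconv (\1_U : X -> R) n%:R) by apply: blip_infconv.
apply: (@approximable_monotone _ (fun n => infconv (\1_U : X -> R) n%:R)).
- exact: measurable_indic.
- by move=> n; exact: blip_measurable.
- by move=> n x; exact: infconv_bounds.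
- move=> x; have [Ux|Ux] := pselect (U x); last first.
    rewrite (_ : (fun n => _) = fun=> \1_U x); first exact: cvg_cst.
    apply: funext => n; have := infconv_bounds b01 (ler0n R n) x.
    by rewrite indicE memNset // => h; apply/eqP; rewrite eq_le andbC.
  have [r r0 hr] := (open_nrm1 U).1 oU x Ux.
  apply/cvgrPdist_le => t t0; exists (Num.truncn r^-1).+1 => // n /= hn.
  suff -> : infconv (\1_U : X -> R) n%:R x = \1_U x by rewrite subrr normr0 ltW.
  apply/eqP; rewrite eq_le; have /andP[_ ->] /= := infconv_bounds b01 (ler0n R n) x.
  apply: le_infconv => // y; rewrite indicE mem_set //.
  have [hy|hy] := ltP (nrm1 (x - y)) r.
    by rewrite indicE mem_set ?lerDl ?mulr_ge0 ?nrm1_ge0 //; exact: hr.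
  apply: (@le_trans _ _ (n%:R * nrm1 (x - y))); last by rewrite lerDr; have /andP[] := b01 y.
  apply: (@le_trans _ _ (n%:R * r)); last by rewrite ler_wpM2l.
  rewrite -ler_pdivrMr // mul1r; apply: le_trans (ltW (truncnS_gt r^-1)) _.
  by rewrite ler_nat.
- exact: nu2_indic_lty.
by move=> n; exact: approximable_blip.
Qed.

(** Dynkin's pi-lambda argument, starting from the open sets, which are stable under intersection
    and generate the Borel sets. *)
Lemma approximable_indic (E : set (Rd R d)) : measurable E -> approximable (fun x => cr (\1_E x)).
Proof.
apply: (@dynkin_induction _ (Rd R d) (@open X) (fun E => approximable (fun x => cr (\1_E x)))).
- by [].
- exact: openI.
- by apply: approximable_open; exact: openT.
- exact: approximable_open.
- move=> S mS aS; rewrite (_ : (fun x => _) = fun x => 1 + (-1) * cr (\1_S x)).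
    apply: approximableD; [exact: cmeasurable_cst| | |].
    + apply: cmeasurableM; first exact: cmeasurable_cst.
      by apply: cmeasurable_real; exact: measurable_indic.
    + by apply: approximable_blip; exact: blip_cst.
    by apply: approximableZ => //; apply: cmeasurable_real; exact: measurable_indic.
  apply: funext => x; rewrite mulN1r -cr1 -crB indicE in_setC indicE.
  by case: (_ \in _); rewrite ?subrr ?subr0.
move=> F mF tF aF; pose G n := (\bigcup_(i < n) F i)%classic.
have mG n : measurable (G n) by apply: bigcup_measurable.
have GS n x : \1_(G n.+1) x = \1_(G n) x + \1_(F n) x :> R.
  have h : (G n `&` F n = set0)%classic.
    rewrite /G bigcup_mkord; apply: (@trivIset_bigsetUI _ predT F _ n n isT (leqnn n)).
    by move=> i j _ _; exact: tF.
  have -> : G n.+1 = (G n `|` F n)%classic by rewrite /G !bigcup_mkord big_ord_recr.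
  rewrite !indicE in_setU; case: (boolP (x \in G n)) => h1; case: (boolP (x \in F n)) => h2; rewrite ?addr0 ?add0r //.
  by move: h1 h2; rewrite !inE => h1 h2; have : (G n `&` F n)%classic x by []; rewrite h.
apply: (@approximable_monotone _ (fun n => \1_(G n) : X -> R)).
- by apply: measurable_indic; exact: bigcup_measurable.
- by move=> n; exact: measurable_indic.
- move=> n x; rewrite !indicE; case: (boolP (x \in G n)); rewrite ?lexx ?ler0n //=.
  by rewrite inE => -[i _ Fi]; rewrite mem_set ?ler01 ?lexx //; exists i.
- move=> x; have [[i _ Fi]|Ux] := pselect ((\bigcup_k F k)%classic x).
    apply/cvgrPdist_le => t t0; exists i.+1 => // n /= hn.
    by rewrite !indicE !mem_set ?subrr ?normr0 ?ltW //; exists i.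
  rewrite (_ : (fun n => _) = fun=> \1_(\bigcup_k F k) x); first exact: cvg_cst.
  apply: funext => n; rewrite !indicE !memNset // => -[i _ Fi].
  by apply: Ux; exists i.
- by apply: nu2_indic_lty; exact: bigcup_measurable.
elim=> [|n IH].
  rewrite (_ : (fun x => _) = fun=> cr 0); first by apply: approximable_blip; exact: blip_cst.
  by apply: funext => x; rewrite indicE memNset // => -[].
rewrite (_ : (fun x => _) = fun x => cr (\1_(G n) x) + cr (\1_(F n) x)).
  by apply: approximableD => //; apply: cmeasurable_real; exact: measurable_indic.
by apply: funext => x; rewrite GS crD.
Qed.

Import HBNNSimple.

Lemma approximable_ge0 h : measurable_fun setT (h : Rd R d -> R) -> (forall x, 0 <= h x) ->
  (nu2 (fun x => cr (h x)) < +oo)%E -> approximable (fun x => cr (h x)).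
Proof.
move=> mh h0 hf; have mE : measurable_fun setT (EFin \o (h : Rd R d -> R)) by apply/measurable_EFinP.
have h0' (x : Rd R d) : setT x -> (0 <= (EFin \o h) x)%E by move=> _; rewrite lee_fin.
refine (@approximable_monotone h (fun n => (nnsfun_approx measurableT mE n : Rd R d -> R)) mh _ _ _ hf _).
- by move=> n; exact: measurable_funPT.
- move=> n x; apply/andP; split; first exact: fun_ge0.
  by rewrite nnsfun_approxE -lee_fin; exact: (le_approx n h0').
- by move=> x; have /fine_cvgP[_] := cvg_nnsfun_approx measurableT mE h0' (x := x) I.
move=> n; set g := nnsfun_approx _ _ _.
rewrite (_ : (fun x => _) = fun x => \sum_(i < #|` fset_set (range g)|)
   cr ((fset_set (range g))`_i) * cr (\1_(g @^-1` [set (fset_set (range g))`_i]) x)).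
  apply: approximable_sum => i.
    apply: cmeasurableM; first exact: cmeasurable_cst.
    by apply: cmeasurable_real; apply: measurable_indic.
  apply: approximableZ; first by apply: cmeasurable_real; apply: measurable_indic.
  by apply: approximable_indic.
by apply: funext => x; rewrite fimfunEord cr_sum; apply: eq_bigr => i _; rewrite crM.
Qed.

Lemma approximable_L2 f : cmeasurable f -> (nu2 f < +oo)%E -> approximable f.
Proof.
have key h : measurable_fun setT (h : Rd R d -> R) -> (nu2 (fun x => cr (h x)) < +oo)%E -> approximable (fun x => cr (h x)).
  move=> mh hf; have mN : measurable_fun setT ((fun x => - h x) : Rd R d -> R) by exact: measurable_funN.
  have mp (k : X -> R) : measurable_fun setT (k : Rd R d -> R) ->
      measurable_fun setT ((fun x => Num.max (k x) 0) : Rd R d -> R) by move=> mk; exact: measurable_maxr.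
  have ap (k : X -> R) : measurable_fun setT (k : Rd R d -> R) -> (forall x, k x ^+ 2 = h x ^+ 2) ->
      approximable (fun x => cr (Num.max (k x) 0)).
    move=> mk kh; apply: approximable_ge0; [exact: mp|by move=> x; rewrite le_max lexx orbT|].
    apply: le_lt_trans hf; apply: nu2_le; [by apply: cmeasurable_real; exact: mp|exact: cmeasurable_real|].
    by move=> x; rewrite !sqn_real -kh /Num.max; case: ifP; rewrite ?lexx // expr0n sqr_ge0.
  rewrite (_ : (fun x => _) = fun x => cr (Num.max (h x) 0) + (-1) * cr (Num.max (- h x) 0)).
    apply: approximableD.
    - by apply: cmeasurable_real; exact: mp.
    - by apply: cmeasurableM; [exact: cmeasurable_cst|apply: cmeasurable_real; exact: mp].
    - exact: ap.
    apply: approximableZ; first by apply: cmeasurable_real; exact: mp.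
    by apply: ap => // x; rewrite sqrrN.
  apply: funext => x; rewrite mulN1r -crB; congr cr; rewrite /Num.max; case: ifP => h1; case: ifP => h2; lra.
move=> [m1 m2] hf; rewrite (_ : f = fun x => cr (complex.Re (f x)) + 'i * cr (complex.Im (f x))).
  apply: approximableD.
  - exact: cmeasurable_real.
  - by apply: cmeasurableM; [exact: cmeasurable_cst|exact: cmeasurable_real].
  - apply: key => //; apply: le_lt_trans hf; apply: nu2_le; [exact: (cmeasurable_real m1)|by split|].
    by move=> x; rewrite sqn_real Re_sqr_le.
  apply: approximableZ; first exact: cmeasurable_real.
  apply: key => //; apply: le_lt_trans hf; apply: nu2_le; [exact: (cmeasurable_real m2)|by split|].
  by move=> x; rewrite sqn_real /sqn lerDr sqr_ge0.
by apply: funext => x; case: (f x) => p q; apply/eqP; rewrite eq_complex /=; apply/andP; split; apply/eqP; ring.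
Qed.

End Density.

Section SpectralBasis.
Variables (R : realType) (d : nat).
Local Notation e := (@e2pii R).
Local Notation X := 'cV[R]_d.
Variable mu : probability (Rd R d) R.

Lemma l2normE (f : Rd R d -> R[i]) : l2norm mu f = (nu2 mu f `^ 2^-1)%E.
Proof.
rewrite /l2norm Lnorm.unlock /nu2; congr (_ `^ _)%E; apply: eq_integral => x _ /=.
case: (f x) => a b; rewrite /ComplexField.Normc.normc /sqn /= ger0_norm ?sqrtr_ge0 //.
by rewrite powR_mulrn ?sqrtr_ge0 // sqr_sqrtr // addr_ge0 ?sqr_ge0.
Qed.

Lemma nu2_lty (f : Rd R d -> R[i]) : (l2norm mu f < +oo)%E -> (nu2 mu f < +oo)%E.
Proof. by rewrite l2normE => /lty_poweRy; apply; rewrite invr_neq0. Qed.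

Lemma l2norm_lt (f : Rd R d -> R[i]) (eps : R) : 0 < eps ->
  (nu2 mu f <= ((eps / 2) ^+ 2)%:E)%E -> (l2norm mu f < eps%:E)%E.
Proof.
move=> eps0 h; have e2 : 0 <= eps / 2 by rewrite divr_ge0 // ltW.
apply: (@le_lt_trans _ _ (eps / 2)%:E); last by rewrite lte_fin; lra.
rewrite l2normE poweR12_sqrt ?nu2_ge0 //; have := nu2_ge0 mu f; move: h; case: (nu2 mu f) => [r| |] //=.
rewrite !lee_fin => h r0; rewrite -[leRHS]ger0_norm // -sqrtr_sqr; exact: ler_wsqrtr.
Qed.

(** Lists may repeat a frequency, whereas the basis property asks for one coefficient per frequency
    of a finite set; repeated terms are grouped. *)
Lemma exp_sum_fset (s : seq (X * R[i])) x : let F := [fset p.1 | p in s]%fset in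
  exp_sum s x = \sum_(lam <- F) (\sum_(p <- s | p.1 == lam) p.2) * e (dotv lam x).
Proof.
move=> F; rewrite /exp_sum; under [RHS]eq_bigr do rewrite mulr_suml.
rewrite (exchange_big_dep predT) //= !big_seq; apply: eq_bigr => p ps.
rewrite big_mkcond (bigD1_seq p.1) ?fset_uniq //=; last by apply/imfsetP; exists p.
by rewrite eqxx big1 ?addr0 // => lam; rewrite eq_sym => /negPf ->.
Qed.

Variables (A : 'M[int]_d) (B : {fset 'cV[int]_d}) (Lam : set X).
Hypothesis cA : contracting R A.
Hypothesis hmu : self_affine_measure A B mu.
Hypothesis hp : parseval A B Lam.

Lemma exp_orthonormal x y : Lam x -> Lam y ->
  inner_product mu (fun z : Rd R d => e (dotv x z)) (fun z => e (dotv y z)) = (x == y)%:R.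
Proof.
move=> Lx Ly; rewrite /inner_product /cintegral.
have E z : e (dotv x z) * (e (dotv y z))^* = e (dotv (x - y) z) by rewrite dotvBl -e2pii_mulJ.
have -> : (\int[mu]_z complex.Re (e (dotv x z) * (e (dotv y z))^*) = avg mu (fun z => complex.Re (e (dotv (x - y) z))))%R.
  by congr Rintegral; apply: funext => z; rewrite E.
have -> : (\int[mu]_z complex.Im (e (dotv x z) * (e (dotv y z))^*) = avg mu (fun z => complex.Im (e (dotv (x - y) z))))%R.
  by congr Rintegral; apply: funext => z; rewrite E.
have [<-|xy] := eqVneq x y; last first.
  by have [-> ->] := spectrum_orthogonal cA hmu hp Lx Ly xy.
rewrite subrr (eq_avg mu (h' := fun=> 1)) ?(eq_avg mu (h := fun z => complex.Im _) (h' := fun=> 0)) ?avg_cst // => z.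
  by rewrite dotv0l e2pii0.
by rewrite dotv0l e2pii0.
Qed.

Lemma exp_orthonormal_basis : orthonormal_basis mu Lam (fun (lam : X) (x : Rd R d) => e (dotv lam x)).
Proof.
split=> [lam _|x y Lx Ly|f [m1 m2 hf] eps eps0]; last 2 first.
- exact: exp_orthonormal.
- have e2 : 0 < (eps / 2) ^+ 2 by rewrite exprn_gt0 // divr_gt0.
  have [s sp hs] := approximable_L2 cA hmu hp (conj m1 m2) (nu2_lty hf) e2.
  exists [fset p.1 | p in s]%fset, (fun lam => \sum_(p <- s | p.1 == lam) p.2); split.
    by move=> _ /= /imfsetP[p /= /sp ps ->].
  apply: l2norm_lt => //; apply: le_trans hs; rewrite le_eqVlt; apply/orP; left; apply/eqP.
  by apply: eq_nu2 => x; rewrite exp_sum_fset.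
have [m1 m2] := cmeasurable_e lam; split=> //.
rewrite l2normE; apply: poweR_lty; apply: (@le_lt_trans _ _ (nu2 mu (fun=> 1))).
  rewrite le_eqVlt; apply/orP; left; apply/eqP.
  by apply: eq_integral => x _; rewrite sqn_e sqn1.
rewrite /nu2; under eq_integral do rewrite sqn1.
by rewrite integral_cst // mul1e (le_lt_trans (probability_le1 _ _)) ?ltry.
Qed.

End SpectralBasis.

Theorem theorem1p3 (R : realType) (d : nat) (hd : (0 < d)%N) (A : 'M[int]_d)
    (B L : {fset 'cV[int]_d}) (hABL : hadamard_triple R A B L)
    (mu : probability (Rd R d) R) (hmu : self_affine_measure A B mu) :
  spectral_measure mu.
Proof.
(* Square matrices form a ring with characteristic polynomials in successor dimension, as
   [expansive_contracting] requires. *)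
case: d hd A B L hABL mu hmu => // n _ A B L hABL mu hmu.
have cA : contracting R A by have [eA _ _] := hABL; exact: expansive_contracting.
have [Lam [cL pL]] := hadamard_spectrum cA (hadamard_triple_hadamard hABL (digits_nonempty hmu)).
by exists Lam; split=> //; exact: exp_orthonormal_basis cA hmu pL.
Qed.
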